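(* Let $d\in\{1,2\}$ and let $v_0\in\mathscr{A}^0(\mathbb{T}^d)\cap\mathscr{H}^2(\mathbb{T}^d)$ be real-valued with $\int_{\mathbb{T}^d}v_0\,dx=0$ and such that the value $$\delta(|v_0|_0)=2-e^{|v_0|_0}-7|v_0|_0e^{|v_0|_0}-6|v_0|_0^2e^{|v_0|_0}-|v_0|_0^3e^{|v_0|_0}$$ satisfies $\delta(|v_0|_0)>0$. Then there exists a global weak solution $v$ (in the sense defined in the context, on $[0,T]$ for every $T>0$) of $$\partial_t v=\Delta^2e^{-v},\qquad v(0,x)=v_0(x),$$ such that, for every $T>0$, $$v\in L^\infty([0,T]\times\mathbb{T}^d)\cap L^{4/3}(0,T;W^{3,\infty}(\mathbb{T}^d))\cap\mathcal{M}(0,T;W^{4,\infty}(\mathbb{T}^d))\cap L^2(0,T;\mathscr{H}^2(\mathbb{T}^d)),\qquad v\in C([0,T];L^2(\mathbb{T}^d)),$$ $$\|v(t)\|_{L^\infty}\le|v_0|_0\,e^{-\delta(|v_0|_0)t}\quad\text{for all }t\in[0,T],$$ and which also satisfies, for every $T>0$, $$v\in C([0,T];\mathscr{H}^2(\mathbb{T}^d))\cap L^2(0,T;\mathscr{H}^4(\mathbb{T}^d)).$$ Furthermore, there are positive constants $c_i=c_i(v_0)$, $i=1,\dots,4$, such that for every $T>0$ and every $t\in[0,T]$, $$\|v(t)\|_{\mathscr{H}^2}+c_1\int_0^T\|v(s)\|_{\mathscr{H}^4}^2\,ds\le c_2,$$ $$\|v(t)\|_{\mathscr{H}^r}\le c_3e^{-c_4t}\quad\text{for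 all }0\le r<2.$$
   Context: $\mathbb{T}^d=[-\pi,\pi]^d$ is the $d$-dimensional torus (periodic boundary conditions). Fourier coefficients: $\widehat u(k)=(2\pi)^{-d}\int_{\mathbb{T}^d}u(x)e^{-ix\cdot k}\,dx$, $k\in\mathbb{Z}^d$. For $\alpha\ge0$: $\mathscr{A}^\alpha(\mathbb{T}^d)=\{u\in L^1(\mathbb{T}^d):|u|_\alpha:=\sum_{k\in\mathbb{Z}^d}|k|^\alpha|\widehat u(k)|<\infty\}$ and $\mathscr{H}^\alpha(\mathbb{T}^d)=\{u\in L^2(\mathbb{T}^d):\|u\|_{\mathscr{H}^\alpha}^2:=\sum_{k\in\mathbb{Z}^d}|k|^{2\alpha}|\widehat u(k)|^2<\infty\}$ (with $|0|^0=1$). $W^{n,p}(\mathbb{T}^d)$ is the usual Sobolev space, and $\mathcal{M}(0,T;X)$ is the space of Radon measures on $[0,T]$ with values in the Banach space $X$. Weak solution: $v\in L^\infty(0,T;L^\infty(\mathbb{T}^d))$ is a weak solution on $[0,T]$ of $\partial_tv=\Delta^2e^{-v}$ with initial data $v_0$ if $$\int_{\mathbb{T}^d}\varphi(0,x)v_0(x)\,dx+\int_0^T\int_{\mathbb{T}^d}\big(\partial_t\varphi(t,x)\,v(t,x)+\Delta^2\varphi(t,x)\,e^{-v(t,x)}\big)\,dx\,dt=0$$ for all $\varphi\in W^{1,1}(0,T;L^1(\mathbb{T}^d))\cap L^1(0,T;W^{4,1}(\mathbb{T}^d))$ with $\varphi(T,\cdot)=0$. *)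

(* Defs.v *)
From HB Require Import structures.
From mathcomp Require Import all_boot all_order all_algebra.
From mathcomp Require Import all_classical all_reals all_analysis.
From mathcomp Require Import complex.

Set Implicit Arguments.
Unset Strict Implicit.
Unset Printing Implicit Defensive.

Import Order.TTheory GRing.Theory Num.Theory.
Import numFieldNormedType.Exports.

Local Open Scope classical_set_scope.
Local Open Scope ring_scope.

(* 'rV[R]_d carries the product sigma-algebra, generated by the coordinates *)
Section row_vector_measurable.
Context (R : realType) (d : nat).

Let coors (i : 'I_d) (x : 'rV[R]_d) : R := x ord0 i.

Let rv_set0 : g_sigma_preimage coors set0.
Proof. exact: sigma_algebra0. Qed.

Let rv_setC A : g_sigma_preimage coors A -> g_sigma_preimage coors (~` A).
Proof. exact: sigma_algebraC. Qed.

Let rv_bigcup (F : (set 'rV[R]_d)^nat) :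
  (forall i, g_sigma_preimage coors (F i)) ->
  g_sigma_preimage coors (\bigcup_i (F i)).
Proof. exact: sigma_algebra_bigcup. Qed.

Fact rv_display : measure_display. Proof. exact: default_measure_display. Qed.

HB.instance Definition _ := @isMeasurable.Build rv_display 'rV[R]_d
  (g_sigma_preimage coors) rv_set0 rv_setC rv_bigcup.

End row_vector_measurable.

Section torus_measure.
Context (R : realType).

Lemma measurable_fun_rowP d1 (T1 : measurableType d1) d (f : T1 -> 'rV[R]_d) :
  (forall i, measurable_fun [set: T1] (fun t => f t ord0 i)) ->
  measurable_fun [set: T1] f.
Proof.
move=> mf.
suff S : g_sigma_preimage (fun i => (fun x : 'rV[R]_d => x ord0 i) \o f)
    `<=` measurable.
  by move=> _ A mA; apply: S; rewrite g_sigma_preimage_comp; exists A.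
apply: smallest_sub; first exact: sigma_algebra_measurable.
case: d => [|d] in f mf *; first by rewrite big_ord0.
rewrite -bigcup_mkord_ord; apply: bigcup_sub => i Ii.
by move=> A [B mB <-]; exact: mf.
Qed.

Lemma measurable_coord d (i : 'I_d) :
  measurable_fun [set: 'rV[R]_d] (fun x : 'rV[R]_d => x ord0 i).
Proof.
move=> _ Y mY; rewrite setTI; apply: sub_sigma_algebra => /=.
rewrite -bigcup_seq/=; exists i => /=; first by rewrite mem_index_enum.
by exists Y => //; rewrite setTI.
Qed.

Definition row_cons d (p : R * 'rV[R]_d) : 'rV[R]_d.+1 :=
  row_mx (const_mx p.1 : 'rV[R]_1) p.2.

Lemma measurable_row_cons d : measurable_fun [set: R * 'rV[R]_d] (@row_cons d).
Proof.
apply: measurable_fun_rowP => i; rewrite /row_cons.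
have [j ->|j ->] := split_ordP (i : 'I_(1 + d)).
  rewrite (_ : (fun _ => _) = fst)//.
  by apply/funext => p; rewrite (row_mxEl (const_mx p.1 : 'rV[R]_1)) mxE.
rewrite (_ : (fun _ => _) = (fun x : 'rV[R]_d => x ord0 j) \o snd); last first.
  by apply/funext => p; rewrite (row_mxEr (const_mx p.1 : 'rV[R]_1)).
apply: measurableT_comp => //.
exact: measurable_coord.
Qed.

Definition circle_measure :=
  mrestr (@lebesgue_measure R) (measurable_itv `[- pi, pi]).
HB.instance Definition _ := Measure.on circle_measure.

Lemma circle_measure_fin : fin_num_fun circle_measure.
Proof.
apply: lty_fin_num_fun; rewrite /= /circle_measure /mrestr setTI.
by rewrite lebesgue_measure_itv; case: ifPn => //= _; rewrite -EFinB ltry.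
Qed.
HB.instance Definition _ :=
  Measure_isFinite.Build _ _ _ circle_measure circle_measure_fin.

Section step.
Context d (mu : {finite_measure set 'rV[R]_d -> \bar R}).

Definition torus_step : set 'rV[R]_d.+1 -> \bar R :=
  pushforward (circle_measure \x mu)%E (@row_cons d).



Let mf := @measurable_row_cons d.

Let torus_step0 : torus_step set0 = 0%E.
Proof. by rewrite /torus_step /pushforward preimage_set0 measure0. Qed.

Let torus_step_ge0 A : (0 <= torus_step A)%E.
Proof. exact: measure_ge0. Qed.

Let torus_step_sigma_additive : semi_sigma_additive torus_step.
Proof.
move: mf => mf'; exact: measure_semi_sigma_additive.
Qed.

HB.instance Definition _ := isMeasure.Build _ _ _ torus_step
  torus_step0 torus_step_ge0 torus_step_sigma_additive.

Let torus_step_fin : fin_num_fun torus_step.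
Proof.
apply: lty_fin_num_fun.
rewrite /= /torus_step /pushforward preimage_setT -setXTT product_measure1E//.
rewrite lte_mul_pinfty ?measure_ge0// ?fin_num_measure//.
by rewrite ltey_eq fin_num_measure.
Qed.

HB.instance Definition _ :=
  Measure_isFinite.Build _ _ _ torus_step torus_step_fin.
End step.

(* Lebesgue measure restricted to the cell [-pi, pi]^d *)
Fixpoint torus_measure d : {finite_measure set 'rV[R]_d -> \bar R} :=
  match d with
  | 0 => \d_(0 : 'rV[R]_0)
  | n.+1 => torus_step (torus_measure n)
  end.
End torus_measure.

Section function_spaces.
Context (R : realType) (d : nat).

(* Functions on the torus are functions on R^d considered only up to
   torus_measure-null sets; hence only their values on the cell matter. *)
Local Notation fn := ('rV[R]_d -> R).
Local Notation mu := (torus_measure R d).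

Definition dotk (x : 'rV[R]_d) (k : 'rV[int]_d) : R :=
  \sum_i x ord0 i * (k ord0 i)%:~R.

Definition normk (k : 'rV[int]_d) : R :=
  Num.sqrt (\sum_i (k ord0 i)%:~R ^+ 2).

Definition fourier (u : fn) (k : 'rV[int]_d) : R[i] :=
  Complex ((2 * pi) ^- d * \int[mu]_x (u x * cos (dotk x k)))
          (- ((2 * pi) ^- d * \int[mu]_x (u x * sin (dotk x k)))).

(* powR gives 0 `^ 0 = 1 and 0 `^ a = 0 for a != 0 *)
Definition wiener_norm (alpha : R) (u : fn) : \bar R :=
  (\esum_(k in [set: 'rV[int]_d])
    (normk k `^ alpha * ComplexField.Normc.normc (fourier u k))%:E)%E.

Definition wiener (alpha : R) : set fn :=
  [set u | u \in Lfun mu 1%:E /\ (wiener_norm alpha u < +oo)%E].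

Definition h_norm (alpha : R) (u : fn) : \bar R :=
  ((\esum_(k in [set: 'rV[int]_d])
    (normk k `^ (2 * alpha) *
     ComplexField.Normc.normc (fourier u k) ^+ 2)%:E) `^ 2^-1)%E.

Record fspace := FSpace { fcarrier : set fn ; fnorm : fn -> \bar R }.

Definition Lp_space (p : \bar R) : fspace :=
  FSpace [set u | u \in Lfun mu p] (fun u => 'N[mu]_p [EFin \o u])%E.

(* h_norm alpha vanishes on constants when alpha > 0, so the L^2 norm is added
   to obtain the Banach space topology; on mean-zero functions this norm is
   equivalent to h_norm alpha. *)
Definition Hspace (alpha : R) : fspace :=
  FSpace [set u | u \in Lfun mu 2%:E /\ (h_norm alpha u < +oo)%E]
         (fun u => 'N[mu]_2%:E [EFin \o u] + h_norm alpha u)%E.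

Definition partial (i : 'I_d) (f : fn) : fn :=
  fun x => 'D_(delta_mx ord0 i) f x.

Definition smooth_periodic (eta : fn) : Prop :=
  (forall s : seq 'I_d, let g := foldr partial eta s in
     continuous g /\ forall x i, derivable g x (delta_mx ord0 i)) /\
  (forall x i, eta (x + (2 * pi) *: delta_mx ord0 i) = eta x).

Definition mpartial (a : 'I_d -> nat) (f : fn) : fn :=
  foldr (fun i => iter (a i) (partial i)) f (enum 'I_d).

Definition weak_partial (a : 'I_d -> nat) (u w : fn) : Prop :=
  forall eta, smooth_periodic eta ->
    \int[mu]_x (w x * eta x) =
    (-1) ^+ (\sum_i a i)%N * \int[mu]_x (u x * mpartial a eta x).

Definition laplacian (f : fn) : fn :=
  fun x => \sum_i partial i (partial i f) x.

Definition weak_bilaplacian (u w : fn) : Prop :=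
  forall eta, smooth_periodic eta ->
    \int[mu]_x (w x * eta x) = \int[mu]_x (u x * laplacian (laplacian eta) x).

(* Weak derivatives are a.e. unique, so the infimum below is over a single
   value, or over the empty set when some weak derivative is missing. *)
Definition sobolev_norm (n : nat) (p : \bar R) (u : fn) : \bar R :=
  ereal_inf [set s | exists g : {ffun 'I_d -> 'I_n.+1} -> fn,
    (forall a : {ffun 'I_d -> 'I_n.+1}, (\sum_i a i <= n)%N ->
       g a \in Lfun mu p /\ weak_partial (fun i => a i) u (g a)) /\
    s = (\sum_(a : {ffun 'I_d -> 'I_n.+1} | (\sum_i a i <= n)%N)
           'N[mu]_p [EFin \o g a])%E].

Definition Wspace (n : nat) (p : \bar R) : fspace :=
  FSpace [set u | u \in Lfun mu p /\ (sobolev_norm n p u < +oo)%E]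
         (sobolev_norm n p).

End function_spaces.

Section bochner_spaces.
Context (R : realType) (d : nat).
Local Notation fn := ('rV[R]_d -> R).
Local Notation mu := (torus_measure R d).

Definition time_measure (T : R) :=
  mrestr (@lebesgue_measure R) (measurable_itv `[0, T]).
HB.instance Definition _ T := Measure.on (time_measure T).

Record step := Step {
  step_size : nat ;
  step_set : 'I_step_size -> set (measurableTypeR R) ;
  step_val : 'I_step_size -> fn }.

Definition step_in (X : fspace R d) (s : step) : Prop :=
  forall i, measurable (@step_set s i) /\ fcarrier X (step_val i).

Definition step_fun (s : step) (t : R) : fn :=
  fun x => \sum_i \1_(@step_set s i) t * step_val i x.

Definition step_int (T : R) (s : step) : fn :=
  fun x => \sum_i fine (time_measure T (@step_set s i)) * step_val i x.

Definition strongly_measurable (T : R) (X : fspace R d) (f : R -> fn) : Prop :=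
  {ae time_measure T, forall t, fcarrier X (f t)} /\
  exists s : nat -> step, (forall n, step_in X (s n)) /\
    {ae time_measure T, forall t,
      fnorm X (f t \- step_fun (s n) t) @[n --> \oo] --> 0%E}.

Definition bochner_Lp (T : R) (p : \bar R) (X : fspace R d) (f : R -> fn) :
    Prop :=
  strongly_measurable T X f /\
  ('N[time_measure T]_p [fnorm X \o f] < +oo)%E.

Definition is_bochner_int (T : R) (X : fspace R d) (f : R -> fn) (I : fn) :
    Prop :=
  [/\ strongly_measurable T X f, fcarrier X I &
   exists s : nat -> step, [/\ forall n, step_in X (s n),
     (\int[time_measure T]_t fnorm X (f t \- step_fun (s n) t)%R)%E
       @[n --> \oo] --> 0%E &
     fnorm X (I \- step_int T (s n)) @[n --> \oo] --> 0%E]].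

Definition continuous_into (T : R) (X : fspace R d) (f : R -> fn) : Prop :=
  forall t, 0 <= t <= T -> fcarrier X (f t) /\
    fnorm X (f s \- f t) @[s --> within `[0, T] (nbhs t)] --> 0%E.

(* sigma-additive X-valued Borel measures of bounded variation on [0, T]; their
   variation is a finite Borel measure on [0, T], so regularity is automatic *)
Definition radon_measure (T : R) (X : fspace R d)
    (m : set (measurableTypeR R) -> fn) : Prop :=
  [/\ forall E : set (measurableTypeR R), measurable E -> E `<=` `[0, T] ->
        fcarrier X (m E),
      forall F : (set (measurableTypeR R))^nat,
        (forall n, measurable (F n)) -> (forall n, F n `<=` `[0, T]) ->
        trivIset setT F ->
        fnorm X (m (\bigcup_n F n) \- (fun x => \sum_(i < n) m (F i) x))
          @[n --> \oo] --> 0%E &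
      exists M : R, forall F : (set (measurableTypeR R))^nat,
        (forall n, measurable (F n)) -> (forall n, F n `<=` `[0, T]) ->
        trivIset setT F ->
        forall n, (\sum_(i < n) fnorm X (m (F i)) <= M%:E)%E].

(* M(0, T; X): f is identified with the measure E |-> \int_E f(t) dt, the
   integral being taken in L^1 of the torus *)
Definition measure_into (T : R) (X : fspace R d) (f : R -> fn) : Prop :=
  exists2 m, radon_measure T X m &
    forall E : set (measurableTypeR R), measurable E -> E `<=` `[0, T] ->
      is_bochner_int T (Lp_space d 1%:E) (fun t x => \1_E t * f t x) (m E).

Definition time_bump (T : R) (eta : R -> R) : Prop :=
  (forall n t, derivable (derive1n n eta) t 1) /\
  exists a b, [/\ 0 < a, b < T & forall t, eta t != 0 -> a <= t <= b].

Definition weak_time_derivative (T : R) (X : fspace R d) (f g : R -> fn) :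
    Prop :=
  forall eta, time_bump T eta -> exists I,
    is_bochner_int T X (fun t x => derive1 eta t * f t x) I /\
    is_bochner_int T X (fun t x => - (eta t * g t x)) I.

(* phi ranges over W^{1,1}(0,T; L^1) /\ L^1(0,T; W^{4,1}) with phi(T) = 0; phi
   is the continuous representative, so that phi(0) and phi(T) make sense *)
Definition test_function (T : R) (phi dt_phi bilap_phi : R -> fn) : Prop :=
  [/\ bochner_Lp T 1%:E (Lp_space d 1%:E) phi,
      bochner_Lp T 1%:E (Lp_space d 1%:E) dt_phi /\
        weak_time_derivative T (Lp_space d 1%:E) phi dt_phi,
      continuous_into T (Lp_space d 1%:E) phi,
      bochner_Lp T 1%:E (Wspace d 4 1%:E) phi /\
        {ae time_measure T, forall t, bilap_phi t \in Lfun mu 1%:E /\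
          weak_bilaplacian (phi t) (bilap_phi t)} &
      {ae mu, forall x, phi T x = 0}].

Definition weak_solution (T : R) (v0 : fn) (v : R -> fn) : Prop :=
  bochner_Lp T +oo%E (Lp_space d +oo%E) v /\
  forall phi dt_phi bilap_phi, test_function T phi dt_phi bilap_phi ->
    \int[mu]_x (phi 0 x * v0 x) +
    \int[time_measure T]_t \int[mu]_x
      (dt_phi t x * v t x + bilap_phi t x * expR (- v t x)) = 0.

End bochner_spaces.

Definition crystal_delta {R : realType} (a : R) : R :=
  2 - expR a - 7 * a * expR a - 6 * a ^+ 2 * expR a - a ^+ 3 * expR a.

(* Main.v *)
Require Import Defs.
From HB Require Import structures.
From mathcomp Require Import all_boot all_order all_algebra.
From mathcomp Require Import all_classical all_reals all_analysis.
From mathcomp Require Import measurable_realfun ess_sup_inf complex ring lra zify.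

Set Implicit Arguments.
Unset Strict Implicit.
Unset Printing Implicit Defensive.

Import Order.TTheory GRing.Theory Num.Theory.
Import numFieldNormedType.Exports.

Local Open Scope classical_set_scope.
Local Open Scope ring_scope.

(** In Fourier variables the equation reads a_k' = |k|^4 F_k(a), where F_k(a) is the k-th
    coefficient of e^(-v). Writing e^(-v) = 1 - v + (e^(-v) - 1 + v) gives a linear damping
    - |k|^4 a_k and a remainder whose |k|^4-weighted l^1 norm is at most growth(|v_0|_0) times
    that of a, because |k_1 + ... + k_n|^4 <= n^3 (|k_1|^4 + ... + |k_n|^4). As
    crystal_delta = 1 - growth is positive, |v|_0 decays exponentially and bounds the time
    integral of |v|_4; the same convolution estimate in l^2 controls the H^2 and H^4 norms.

    Both estimates hold for an explicit Euler scheme on finitely many modes whose time step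
    resolves the stiffest mode, and pass to the limit coefficientwise: the coefficients are
    uniformly Lipschitz in time, and for d <= 2 the H^2 bound gives l^1 tails that are uniform
    in time, so that the coefficients of e^(-v) converge too.

    A test function is paired with each mode, which gives an absolutely continuous function of
    time and hence an integration by parts against a_k. Summing over modes, the uniform l^1
    tails of v and e^(-v) give the weak formulation; the initial datum and e^(-v) are
    identified with their Fourier series through the uniqueness of Fourier coefficients
    in L^1. *)

(** * Weighted sequences on the lattice *)

(** Test functions are only integrable in time with values in L^1 and W^(4,1), so v and e^(-v) must
    be limits of their partial Fourier sums uniformly in time and space. This is why the bounds are
    turned into l^1 tails independent of time. For continuity into H^2 a bound on the norm does not
    give such tails; they come from an energy inequality for each single mode, whose right-hand side
    is free of t and summable in k.

    The scheme is explicit because a step is then a convex combination on each mode and the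
    estimates hold exactly. The exponential is that of the full partial sum; only the resulting
    coefficients are truncated.

    Decay rests on the zero mean: the coefficient at k = 0 stays 0 and |k| >= 1 elsewhere, so the
    dissipation |v|_4 dominates |v|_0 and 1 - growth becomes the rate. The l^2 estimate acts on
    squared norms, which leaves half that rate for the H^2 norm. *)

Section seqs.
Context {R : realType}.
Context {I : countType}.
Implicit Types (f g : I -> R) (X Y e : R) (s : seq I).

(** For nonnegative [f] this says that the l^1 norm is at most [X]. Quantifying over finite
    duplicate-free lists keeps infinite sums out of the estimates, and a bound of this kind survives
    coefficientwise limits. *)
Definition ball1 f X := forall s, uniq s -> \sum_(k <- s) f k <= X.

Lemma ball1_ge0 f X : ball1 f X -> 0 <= X.
Proof. by move=> /(_ [::] isT); rewrite big_nil. Qed.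

Lemma ball1_le f g X : (forall k, f k <= g k) -> ball1 g X -> ball1 f X.
Proof. by move=> fg gX s us; apply: le_trans (gX s us); apply: ler_sum. Qed.

Lemma ball1_leX f X Y : X <= Y -> ball1 f X -> ball1 f Y.
Proof. by move=> XY gX s us; apply: le_trans (gX s us) _. Qed.

Lemma ball1D f g X Y : ball1 f X -> ball1 g Y -> ball1 (fun k => f k + g k) (X + Y).
Proof. by move=> fX gY s us; rewrite big_split lerD ?fX ?gY. Qed.

Lemma ball1Z f X c : 0 <= c -> ball1 f X -> ball1 (fun k => c * f k) (c * X).
Proof. by move=> c0 fX s us; rewrite -mulr_sumr ler_wpM2l ?fX. Qed.

Lemma ball1_term f X k : ball1 f X -> f k <= X.
Proof. by move=> /(_ [:: k] isT); rewrite big_seq1. Qed.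

Lemma ball1_sub f s1 s2 : (forall k, 0 <= f k) -> uniq s1 -> uniq s2 ->
  {subset s1 <= s2} -> \sum_(k <- s1) f k <= \sum_(k <- s2) f k.
Proof.
move=> f0 u1 u2 s12.
have -> : \sum_(k <- s1) f k = \sum_(k <- s2 | k \in s1) f k.
  rewrite -[RHS]big_filter; apply: perm_big; apply: uniq_perm => //.
    by rewrite filter_uniq.
  by move=> k; rewrite mem_filter andb_idr//; exact: s12.
by rewrite [leRHS](bigID (mem s1))/= lerDl sumr_ge0.
Qed.

Lemma ball1_split f s1 s2 : (forall k, 0 <= f k) -> uniq s1 ->
  \sum_(k <- s1) f k <= \sum_(k <- s2) f k +
    \sum_(k <- [seq k <- s1 | k \notin s2]) f k.
Proof.
move=> f0 u1; rewrite (bigID (mem s2))/= [X in _ <= _ + X]big_filter lerD2r.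
rewrite -big_filter.
(* [s2] may contain repetitions. Since [f] is nonnegative, removing them only lowers the sum. *)
have [t us2] : {t : seq I | uniq t /\ {subset t <= s2} /\
    \sum_(k <- t) f k <= \sum_(k <- s2) f k /\ {subset s2 <= t}}.
  exists (undup s2); split; first exact: undup_uniq.
  split; first by move=> k; rewrite mem_undup.
  split; last by move=> k; rewrite mem_undup.
  elim: s2 => [|k t IH]//=; case: ifP => kt; rewrite !big_cons.
    by rewrite ler_wpDl.
  by rewrite lerD2l.
case: us2 => ut [_ [tle st]]; apply: le_trans tle.
apply: ball1_sub => //; first by rewrite filter_uniq.
by move=> k; rewrite mem_filter => /andP[/st].
Qed.

(* What the l^1 and l^2 balls have in common, so that both norms are estimated at once. *)
Record seqnorm (B : (I -> R) -> R -> Prop) : Prop := Seqnorm {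
  sn_ge0 : forall f X, B f X -> 0 <= X ;
  sn_le : forall f g X, (forall k, 0 <= f k <= g k) -> B g X -> B f X ;
  sn_leX : forall f X Y, X <= Y -> B f X -> B f Y ;
  snD : forall f g X Y, (forall k, 0 <= f k) -> (forall k, 0 <= g k) ->
    B f X -> B g Y -> B (fun k => f k + g k) (X + Y) ;
  snZ : forall f X c, 0 <= c -> B f X -> B (fun k => c * f k) (c * X) ;
  sn_inj : forall h f X, injective h -> B f X -> B (f \o h) X ;
  sn_lim : forall f X, (forall k, 0 <= f k) ->
    (forall s e, 0 < e -> exists2 g, B g X & 
       forall k, k \in s -> 0 <= g k /\ f k <= g k + e) -> B f X ;
  sn_ball1 : forall f X, (forall k, 0 <= f k) -> ball1 f X -> B f X ;
  sn_tail : forall f X e, (forall k, 0 <= f k) -> B f X -> 0 < e ->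
    exists s, B (fun k => if k \in s then 0 else f k) e }.

(** Otherwise every finite set could be enlarged by a disjoint finite set of mass more than [e], and
    finitely many such enlargements would exceed [X]. *)
Lemma ball1_tail f X e : (forall k, 0 <= f k) -> ball1 f X -> 0 < e ->
  exists s, ball1 (fun k => if k \in s then 0 else f k) e.
Proof.
move=> f0 fX e0; apply: contrapT => /forallNP H.
have K n : exists2 s, uniq s & e * n%:R <= \sum_(k <- s) f k.
  elim: n => [|n [s us IH]]; first by exists [::]; rewrite // mulr0 big_nil.
  have /existsNP[t /not_implyP[ut /negP]] := H s.
  rewrite -ltNge => tl.
  exists (s ++ [seq k <- t | k \notin s]).
    rewrite cat_uniq us filter_uniq// andbT; apply/hasPn => k.
    by rewrite mem_filter => /andP[].
  rewrite big_cat/= -natr1 mulrDr mulr1 lerD//.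
  rewrite big_filter (le_trans (ltW tl))// (bigID (mem s))/= big1 ?add0r.
    by apply: ler_sum => k /negbTE ->.
  by move=> k ->.
have [n nX] : exists n, X < e * n%:R.
  exists (Num.bound (X / e)); rewrite mulrC -ltr_pdivrMr//.
  exact: archi_boundP (divr_ge0 (ball1_ge0 fX) (ltW e0)).
have [s us] := K n; rewrite leNgt => /negP; apply.
exact: le_lt_trans (fX s us) nX.
Qed.

Lemma seqnorm_ball1 : seqnorm ball1.
Proof.
split.
- exact: ball1_ge0.
- by move=> f g X fg; apply: ball1_le => k; have /andP[] := fg k.
- exact: ball1_leX.
- by move=> f g X Y _ _; exact: ball1D.
- by move=> f X c; exact: ball1Z.
- move=> h f X hi fX s us; rewrite /= -(big_map h xpredT f).
  by apply: fX; rewrite map_inj_uniq.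
- move=> f X f0 H s us; apply/ler_addgt0Pr => e e0.
  have [|g gX gs] := H s (e / (size s).+1%:R); first by rewrite divr_gt0.
  apply: le_trans (_ : \sum_(k <- s) (g k + e / (size s).+1%:R) <= _).
    by rewrite big_seq_cond [leRHS]big_seq_cond; apply: ler_sum => k /andP[ks _]; have [] := gs k ks.
  rewrite big_split/= lerD ?gX// big_const_seq count_predT iter_addr_0.
  by rewrite -[_ *+ size s]mulr_natr -mulrA ger_pMr// mulrC ler_pdivrMr// mul1r ler_nat.
- by [].
- exact: ball1_tail.
Qed.

Definition ball2 f X := 0 <= X /\ forall s, uniq s -> \sum_(k <- s) f k ^+ 2 <= X ^+ 2.

(** Cauchy-Schwarz, from the squares (Y f - X g)^2 summed over [s]. The final division by 2 X Y is
    the reason for treating X = 0 and Y = 0 apart. *)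
Lemma cs_seq f g X Y s : 0 <= X -> 0 <= Y -> (forall k, 0 <= f k) -> (forall k, 0 <= g k) ->
  \sum_(k <- s) f k ^+ 2 <= X ^+ 2 -> \sum_(k <- s) g k ^+ 2 <= Y ^+ 2 ->
  \sum_(k <- s) f k * g k <= X * Y.
Proof.
move=> X0 Y0 f0 g0 fX gY.
have zero (h h' : I -> R) : \sum_(k <- s) h k ^+ 2 <= 0 ^+ 2 -> 
    \sum_(k <- s) h k * h' k <= 0.
  rewrite expr0n/= => hs; rewrite big_seq big1// => k ks.
  have : h k ^+ 2 == 0.
    rewrite eq_le sqr_ge0 andbT (le_trans _ hs)// (big_rem k)//= lerDl.
    by rewrite sumr_ge0// => ? _; rewrite sqr_ge0.
  by rewrite sqrf_eq0 => /eqP ->; rewrite mul0r.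
have [X00|Xn] := eqVneq X 0; first by rewrite X00 in fX *; rewrite mul0r; exact: zero.
have [Y00|Yn] := eqVneq Y 0.
  rewrite Y00 in gY *; rewrite mulr0; under eq_bigr do rewrite mulrC.
  exact: zero.
have XY : 0 < X * Y by rewrite mulr_gt0// lt_neqAle eq_sym ?Xn ?Yn.
have : 2 * (X * Y) * (\sum_(k <- s) f k * g k) <= 2 * (X * Y) * (X * Y).
  apply: le_trans (_ : Y ^+ 2 * (\sum_(k <- s) f k ^+ 2) + X ^+ 2 * (\sum_(k <- s) g k ^+ 2) <= _).
    rewrite !mulr_sumr -big_split/=; apply: ler_sum => k _.
    rewrite -subr_ge0; have -> : Y ^+ 2 * f k ^+ 2 + X ^+ 2 * g k ^+ 2 - 2 * (X * Y) * (f k * g k)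
      = (Y * f k - X * g k) ^+ 2 by ring.
    exact: sqr_ge0.
  have -> : 2 * (X * Y) * (X * Y) = Y ^+ 2 * X ^+ 2 + X ^+ 2 * Y ^+ 2 by ring.
  by rewrite lerD// ler_wpM2l// sqr_ge0.
by rewrite ler_pM2l// mulr_gt0.
Qed.

Lemma l2sumD f g X Y s : 0 <= X -> 0 <= Y -> (forall k, 0 <= f k) -> (forall k, 0 <= g k) ->
  \sum_(k <- s) f k ^+ 2 <= X ^+ 2 -> \sum_(k <- s) g k ^+ 2 <= Y ^+ 2 ->
  \sum_(k <- s) (f k + g k) ^+ 2 <= (X + Y) ^+ 2.
Proof.
move=> X0 Y0 f0 g0 fX gY; rewrite sqrrD.
under eq_bigr do rewrite sqrrD.
rewrite !big_split/= lerD// lerD//.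
by rewrite [leRHS]mulr2n; apply: lerD; exact: cs_seq.
Qed.

Lemma sqr_le_addgt0 (a X : R) : 0 <= X -> (forall e, 0 < e -> a <= (X + e) ^+ 2) -> a <= X ^+ 2.
Proof.
move=> X0 H; apply/ler_addgt0Pr => e e0.
(* For d <= 1 the excess (X + d)^2 - X^2 = d (2 X + d) is at most d (2 X + 1), hence at most [e]. *)
pose d := Num.min 1 (e / (2 * X + 1)).
have X1 : 0 < 2 * X + 1 by lra.
have d0 : 0 < d by rewrite lt_min ltr01 divr_gt0.
apply: le_trans (H d d0) _.
have d1 : d <= 1 by rewrite ge_min lexx.
have de : d * (2 * X + 1) <= e by rewrite -ler_pdivlMr// ge_min lexx orbT.
have -> : (X + d) ^+ 2 = X ^+ 2 + d * (2 * X + d) by ring.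
by rewrite lerD2l (le_trans _ de)// ler_wpM2l ?(ltW d0)// lerD2l.
Qed.

Lemma seqnorm_ball2 : seqnorm ball2.
Proof.
split.
- by move=> f X [].
- move=> f g X fg [X0 gX]; split=> // s us; apply: le_trans (gX s us).
  apply: ler_sum => k _; have /andP[f0 fgk] := fg k.
  by rewrite ler_sqr ?nnegrE// (le_trans f0).
- move=> f X Y XY [X0 fX]; split; first exact: le_trans XY.
  by move=> s us; rewrite (le_trans (fX s us))// ler_sqr ?nnegrE// (le_trans X0).
- move=> f g X Y f0 g0 [X0 fX] [Y0 gY]; split; first exact: addr_ge0.
  by move=> s us; apply: l2sumD; rewrite ?fX ?gY.
- move=> f X c c0 [X0 fX]; split; first exact: mulr_ge0.
  move=> s us; under eq_bigr do rewrite exprMn.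
  by rewrite -mulr_sumr exprMn ler_wpM2l ?sqr_ge0 ?fX.
- move=> h f X hi [X0 fX]; split=> // s us.
  rewrite /= -(big_map h xpredT (fun k => f k ^+ 2)).
  by apply: fX; rewrite map_inj_uniq.
- move=> f X f0 H; split.
    by have [|g [X0]] := H [::] 1.
  move=> s us; apply: sqr_le_addgt0; first by have [|g []] := H [::] 1.
  move=> e e0.
  have n0 : 0 < (size s).+1%:R :> R by [].
  have [|g [X0 gX] gs] := H s (e / (size s).+1%:R); first by rewrite divr_gt0.
  (* [g] is known to be nonnegative on [s] only, whereas the triangle inequality [l2sumD] asks for
     it everywhere. *)
  pose g' k := if k \in s then g k else 0.
  apply: le_trans (_ : \sum_(k <- s) (g' k + e / (size s).+1%:R) ^+ 2 <= _).
    rewrite big_seq_cond [leRHS]big_seq_cond; apply: ler_sum => k /andP[ks _].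
    rewrite /g' ks; have [g0 fg] := gs k ks.
    by rewrite ler_sqr ?nnegrE// addr_ge0// divr_ge0// ltW.
  apply: l2sumD => //; rewrite ?(ltW e0)//.
  + by move=> k; rewrite /g'; case: ifPn => // /gs[].
  + by move=> _; rewrite divr_ge0// ltW.
  + rewrite big_seq (eq_bigr (fun k => g k ^+ 2)) -?big_seq ?gX//.
    by move=> k ks; rewrite /g' ks.
  + rewrite big_const_seq count_predT iter_addr_0 -[_ *+ size s]mulr_natr expr_div_n.
    rewrite -mulrA ger_pMr ?exprn_gt0// mulrC ler_pdivrMr ?exprn_gt0// mul1r.
    by rewrite -natrX ler_nat (leq_trans (leqnSn _))// leq_pmulr.
- move=> f X f0 fX; split; first exact: ball1_ge0 fX.
  move=> s us; apply: le_trans (_ : (\sum_(k <- s) f k) ^+ 2 <= _); last first.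
    by rewrite ler_sqr ?nnegrE ?fX ?sumr_ge0// (ball1_ge0 fX).
  rewrite [leRHS]expr2 mulr_suml big_seq [leRHS]big_seq; apply: ler_sum => k ks.
  rewrite expr2 ler_wpM2l// (big_rem k)//= lerDl.
  exact: sumr_ge0.
- move=> f X e f0 [X0 fX] e0.
  have [|||s Hs] := @ball1_tail (fun k => f k ^+ 2) (X ^+ 2) (e ^+ 2); rewrite ?exprn_gt0//.
  - by move=> k; exact: sqr_ge0.
  exists s; split; first exact: ltW.
  move=> t ut; apply: le_trans (Hs t ut); apply: ler_sum => k _.
  by case: ifP => // _; rewrite expr0n.
Qed.

End seqs.

Lemma ball1_inj {R : realType} {I J : countType} (h : I -> J) (f : J -> R) X :
  injective h -> ball1 f X -> ball1 (f \o h) X.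
Proof.
move=> hi fX s us; rewrite /= -(big_map h xpredT f).
by apply: fX; rewrite map_inj_uniq.
Qed.

(** A finite set of pairs lies in the product of its two projections, where the sum factors. *)
Lemma ball1_prod {R : realType} {I J : countType} (f : I -> R) (g : J -> R) X Y :
  (forall i, 0 <= f i) -> (forall j, 0 <= g j) -> ball1 f X -> ball1 g Y ->
  ball1 (fun p : I * J => f p.1 * g p.2) (X * Y).
Proof.
move=> f0 g0 fX gY s us.
pose s1 := undup (map fst s); pose s2 := undup (map snd s).
apply: le_trans (_ : \sum_(p <- [seq (i, j) | i <- s1, j <- s2]) f p.1 * g p.2 <= _).
  apply: ball1_sub => //.
  - by move=> p; rewrite mulr_ge0.
  - by apply: allpairs_uniq; rewrite ?undup_uniq// => -[? ?] [? ?].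
  - by move=> [i j] ps; apply/allpairsP; exists (i, j); rewrite !mem_undup;
      split=> //; [exact: (map_f fst ps)|exact: (map_f snd ps)].
rewrite big_allpairs/=; under eq_bigr do rewrite -mulr_sumr.
rewrite -mulr_suml; apply: ler_pM; rewrite ?sumr_ge0// ?fX ?gY// undup_uniq//.
Qed.

Lemma ball1_inv_sqr_nat {R : realType} : ball1 (fun n : nat => (1 + n%:R ^+ 2 : R)^-1) 3.
Proof.
have pos (n : nat) : 0 < 1 + n%:R ^+ 2 :> R by rewrite ltr_pwDl// sqr_ge0.
(* The right-hand side is 1 plus the telescoping sum of 2 / (n (n + 1)), whose terms dominate 1 / (1
   + n^2). *)
have K M : \sum_(n <- iota 0 M.+1) (1 + n%:R ^+ 2 : R)^-1 <= 3 - 2 / M.+1%:R.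
  elim: M => [|M IH].
    rewrite big_cons big_nil expr0n/= addr0 !addr0 invr1; lra.
  rewrite -[X in iota _ X]addn1 iotaD big_cat big_seq1 add0n.
  apply: le_trans (lerD IH _) _; first exact: lexx.
  rewrite -lerBrDl.
  have M0 : 0 <= M%:R :> R by [].
  have -> : M.+2%:R = M%:R + 2 :> R by rewrite -!natr1; ring.
  have -> : M.+1%:R = M%:R + 1 :> R by rewrite natr1.
  have M1 : M%:R + 1 != 0 :> R by lra.
  have M2 : M%:R + 2 != 0 :> R by lra.
  have -> : 3 - 2 / (M%:R + 2) - (3 - 2 / (M%:R + 1)) = 2 / ((M%:R + 1) * (M%:R + 2)) :> R.
    by field; rewrite M1 M2.
  rewrite ler_pdivlMr; last by nra.
  rewrite mulrC ler_pdivrMr; last by nra.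
  nra.
move=> s us; apply: le_trans (_ : \sum_(n <- iota 0 (\max_(n <- s) n).+1) (1 + n%:R ^+ 2 : R)^-1 <= _).
  apply: ball1_sub; rewrite ?iota_uniq//.
  by move=> k ks; rewrite mem_iota/= ltnS; exact: leq_bigmax_seq.
by apply: le_trans (K _) _; rewrite lerBlDr lerDl divr_ge0.
Qed.

Lemma ball1_inv_sqr_int {R : realType} : ball1 (fun j : int => (1 + j%:~R ^+ 2 : R)^-1) 6.
Proof.
have E (j : int) : (1 + j%:~R ^+ 2 : R)^-1 = (1 + `|j|%N%:R ^+ 2)^-1.
  by case: j => n; rewrite //= NegzE mulrNz sqrrN.
move=> s us; under eq_bigr do rewrite E.
rewrite (bigID (fun j : int => 0 <= j))/=.
have -> : 6 = 3 + 3 :> R by ring.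
apply: lerD; rewrite -big_filter -(big_map (fun j : int => `|j|%N) xpredT (fun n : nat => (1 + n%:R ^+ 2)^-1));
  apply: ball1_inv_sqr_nat; rewrite map_inj_in_uniq ?filter_uniq// => i j;
  rewrite !mem_filter => /andP[+ _] /andP[+ _]; lia.
Qed.

Section lattice.
Context {R : realType} {d : nat}.
Local Notation Zd := 'rV[int]_d.
Local Notation nk := (@normk R d).

(* Closed under k |-> - k, so that partial Fourier sums of a Hermitian sequence are real. *)
Definition modes K : seq Zd :=
  undup (flatten [seq [:: k; - k] | k <- pmap unpickle (iota 0 K)]).

Lemma modes_uniq K : uniq (modes K). Proof. exact: undup_uniq. Qed.

Lemma mem_modes K k : (k \in modes K) =
  (k \in pmap unpickle (iota 0 K)) || (- k \in pmap unpickle (iota 0 K)).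
Proof.
rewrite mem_undup; elim: (pmap _ _) => //= l s IH.
rewrite !inE IH eqr_oppLR; case: (k == l) => //=.
by case: (k == - l); case: (k \in s).
Qed.

Lemma modesN K k : (- k \in modes K) = (k \in modes K).
Proof. by rewrite !mem_modes opprK orbC. Qed.

Lemma sub_modes K K' : (K <= K')%N -> {subset modes K <= modes K'}.
Proof.
move=> KK k; rewrite !mem_modes; have S : {subset pmap unpickle (iota 0 K) <= pmap (@unpickle Zd) (iota 0 K')}.
  by move=> l; rewrite -(subnKC KK) iotaD pmap_cat mem_cat => ->.
by case/orP => /S -> //; rewrite orbT.
Qed.

Lemma modes_cover (s : seq Zd) : exists K, {subset s <= modes K}.
Proof.
exists (\max_(k <- s) pickle k).+1 => k ks; rewrite mem_modes.
apply/orP; left; rewrite mem_pmap; apply/mapP; exists (pickle k); last by rewrite pickleK.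
by rewrite mem_iota/= ltnS (leq_bigmax_seq k).
Qed.

Lemma seqnorm_tail_modes B (f : Zd -> R) X e : seqnorm B -> (forall k, 0 <= f k) -> B f X ->
  0 < e -> exists K0, forall K, (K0 <= K)%N -> B (fun k => if k \in modes K then 0 else f k) e.
Proof.
move=> nB f0 fX e0; have [s Hs] := sn_tail nB f0 fX e0.
have [K0 sK0] := modes_cover s; exists K0 => K K0K.
apply: sn_le Hs => // k; case: ifPn => [_|kK]; first by case: ifP; rewrite lexx ?f0.
by rewrite ifN ?f0 ?lexx//; apply: contra kK => /sK0; exact: sub_modes.
Qed.

Lemma normk_ge0 k : 0 <= nk k. Proof. exact: sqrtr_ge0. Qed.

Lemma normk_sqr (k : Zd) : nk k ^+ 2 = \sum_i (k ord0 i)%:~R ^+ 2.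
Proof. by rewrite sqr_sqrtr// sumr_ge0// => i _; rewrite sqr_ge0. Qed.

Lemma normkN k : nk (- k) = nk k.
Proof. by rewrite /normk; under eq_bigr do rewrite mxE mulrNz sqrrN. Qed.

Lemma normk0 : nk 0 = 0.
Proof. by rewrite /normk big1 ?sqrtr0// => i _; rewrite mxE expr0n. Qed.

Lemma normk_coord (k : Zd) i : `|(k ord0 i)%:~R| <= nk k.
Proof.
rewrite -ler_sqr ?nnegrE ?normk_ge0// normk_sqr real_normK ?num_real//.
by rewrite (bigD1 i)//= lerDl sumr_ge0// => j _; rewrite sqr_ge0.
Qed.

(** The spectral gap of the lattice: on coefficients that vanish at 0, higher weights dominate lower
    ones. It turns dissipation into exponential decay and compares norms of different orders. *)
Lemma normk_ge1 (k : Zd) : k != 0 -> 1 <= nk k.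
Proof.
move=> k0; have [i ki] : exists i, k ord0 i != 0.
  apply: contrapT => /forallNP H; move/eqP: k0; apply; apply/rowP => i.
  by rewrite mxE; apply/eqP/negP => /negP /(H i).
apply: le_trans (normk_coord k i); rewrite -intr_norm.
by rewrite (_ : 1 = 1%:~R)// ler_int -gtz0_ge1 normr_gt0.
Qed.

Lemma normkD (k l : Zd) : nk (k + l) <= nk k + nk l.
Proof.
rewrite -ler_sqr ?nnegrE ?addr_ge0 ?normk_ge0// normk_sqr.
apply: le_trans (_ : \sum_i (`|(k ord0 i)%:~R| + `|(l ord0 i)%:~R|) ^+ 2 <= _).
  apply: ler_sum => i _; rewrite mxE intrD -[leLHS]real_normK ?num_real//.
  by rewrite ler_sqr ?nnegrE ?addr_ge0// ler_normD.
by apply: l2sumD; rewrite ?normk_ge0// normk_sqr;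
  under eq_bigr do rewrite real_normK ?num_real//.
Qed.

Lemma sqrrD_convex (N x y : R) : 0 < N -> (x + y) ^+ 2 <= (1 + N^-1) * x ^+ 2 + (1 + N) * y ^+ 2.
Proof.
move=> N0; rewrite -subr_ge0.
have -> : (1 + N^-1) * x ^+ 2 + (1 + N) * y ^+ 2 - (x + y) ^+ 2 = N^-1 * (x - N * y) ^+ 2.
  by field; rewrite gt_eqF.
by rewrite mulr_ge0 ?sqr_ge0// invr_ge0 ltW.
Qed.

(** The weighted square inequality is applied twice, which contributes one factor and then its
    square. [N] stays free: N = n splits one frequency off a sum of n + 1 frequencies while treating
    all of them evenly. *)
Lemma normk4_convex (N : R) (k l : Zd) : 0 < N ->
  nk (k + l) ^+ 4 <= (1 + N^-1) ^+ 3 * nk k ^+ 4 + (1 + N) ^+ 3 * nk l ^+ 4.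
Proof.
move=> N0.
have N10 : 0 <= 1 + N^-1 by rewrite addr_ge0// invr_ge0 ltW.
apply: le_trans (_ : (nk k + nk l) ^+ 4 <= _).
  by rewrite lerXn2r ?nnegrE ?addr_ge0 ?normk_ge0// normkD.
have E (x : R) : x ^+ 4 = (x ^+ 2) ^+ 2 by rewrite -exprM.
rewrite !E.
apply: le_trans (_ : ((1 + N^-1) * nk k ^+ 2 + (1 + N) * nk l ^+ 2) ^+ 2 <= _).
  rewrite lerXn2r ?nnegrE ?sqr_ge0 ?sqrrD_convex//.
  by rewrite addr_ge0// mulr_ge0 ?sqr_ge0// addr_ge0// ltW.
apply: le_trans (sqrrD_convex _ _ N0) _.
have F (a x : R) : a * (a * x) ^+ 2 = a ^+ 3 * x ^+ 2 by ring.
by rewrite !F.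
Qed.

(** The dimension enters here, through the convergence of the sum of |k|^(-4). As |k| >= 1 off the
    origin, it can be compared with the one-dimensional sum of 1 / (1 + j^2), or with the product of
    two of them. *)
Lemma ball2_inv_normk : d = 1%N \/ d = 2%N ->
  exists C, ball2 (fun k : Zd => if k == 0 then 0 else (nk k ^+ 2)^-1) C.
Proof.
move=> hd.
suff [C C0 HC] : exists2 C : R, 0 <= C & ball1 (fun k : Zd => if k == 0 then 0 else (nk k ^+ 4)^-1) C.
  exists (Num.sqrt C); split; first exact: sqrtr_ge0.
  move=> s us; rewrite sqr_sqrtr//; apply: le_trans (HC s us).
  apply: ler_sum => k _; case: ifP => _; first by rewrite expr0n.
  by rewrite exprVn -exprM.
have pos (x : R) : 0 < 1 + x ^+ 2 by rewrite ltr_pwDl// sqr_ge0.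
case: hd => dE.
  exists (4 * 6) => //; have i0 : 'I_d by rewrite dE; exact: ord0.
  have uniqi (i : 'I_d) : i = i0 by apply/val_inj => /=; case: i => i; case: i0 => j /=; rewrite dE; lia.
  have inj : injective (fun k : Zd => k ord0 i0).
    by move=> k l kl; apply/rowP => i; rewrite (uniqi i).
  apply: ball1_le (ball1Z _ (ball1_inj inj ball1_inv_sqr_int)) => // k /=.
  case: ifPn => k0; first by rewrite mulr_ge0// invr_ge0 ltW.
  have k1 := normk_ge1 k0; have k00 : 0 < nk k by exact: lt_le_trans k1.
have E4 : nk k ^+ 4 = (nk k ^+ 2) ^+ 2 by rewrite -exprM.
  have -> : 1 + (k ord0 i0)%:~R ^+ 2 = 1 + nk k ^+ 2.
    by rewrite normk_sqr (bigD1 i0)//= big1 ?addr0// => j; rewrite (uniqi j) eqxx.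
  have k2 : 1 <= nk k ^+ 2 by rewrite exprn_ege1.
  rewrite -[4 in leRHS]invrK -invfM lef_pV2 ?posrE ?mulr_gt0 ?invr_gt0 ?exprn_gt0//.
  rewrite E4; nra.
exists (4 * (6 * 6)) => //.
have o2 : (0 < d)%N /\ (1 < d)%N by rewrite dE.
pose i0 := Ordinal o2.1; pose i1 := Ordinal o2.2.
have uniqi (i : 'I_d) : i = i0 \/ i = i1.
  have : (i < 2)%N by rewrite -dE ltn_ord.
  by case Ei : (nat_of_ord i) => [|[|]]// _; [left|right]; apply/val_inj.
have inj : injective (fun k : Zd => (k ord0 i0, k ord0 i1)).
  by move=> k l [kl0 kl1]; apply/rowP => i; have [->|->] := uniqi i.
have pp := ball1_prod _ _ (@ball1_inv_sqr_int R) (@ball1_inv_sqr_int R).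
apply: ball1_le (ball1Z _ (ball1_inj inj (pp _ _))) => //; last 2 first.
- by move=> j; rewrite invr_ge0 ltW.
- by move=> j; rewrite invr_ge0 ltW.
move=> k /=.
case: ifPn => k0; first by rewrite mulr_ge0// mulr_ge0// invr_ge0 ltW.
have k1 := normk_ge1 k0; have k00 : 0 < nk k by exact: lt_le_trans k1.
have E4 : nk k ^+ 4 = (nk k ^+ 2) ^+ 2 by rewrite -exprM.
have k2 : 1 <= nk k ^+ 2 by rewrite exprn_ege1.
have kE : nk k ^+ 2 = (k ord0 i0)%:~R ^+ 2 + (k ord0 i1)%:~R ^+ 2.
  rewrite normk_sqr (bigD1 i0)//= (bigD1 i1)//= big1 ?addr0// => i /andP[/eqP i00 /eqP i11].
  by have [] := uniqi i.
rewrite -invfM -[4 in leRHS]invrK -invfM lef_pV2 ?posrE ?mulr_gt0 ?invr_gt0 ?exprn_gt0//.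
move: k2; rewrite E4 kE.
move: ((k ord0 i0)%:~R ^+ 2) (sqr_ge0 ((k ord0 i0)%:~R : R)) => x x0.
move: ((k ord0 i1)%:~R ^+ 2) (sqr_ge0 ((k ord0 i1)%:~R : R)) => y y0 xy.
nra.
Qed.

(** Cauchy-Schwarz against |k|^(-2): on coefficients vanishing at 0, H^2 embeds into the Wiener
    algebra. *)
Lemma ball2_ball1 : d = 1%N \/ d = 2%N -> exists2 C : R, 0 <= C &
  forall (f : Zd -> R) X, (forall k, 0 <= f k) -> f 0 = 0 ->
  ball2 (fun k => nk k ^+ 2 * f k) X -> ball1 f (C * X).
Proof.
move=> /ball2_inv_normk[C [C0 HC]]; exists C => // f X f0 f00 [X0 fX] s us.
have -> : \sum_(k <- s) f k = \sum_(k <- s) (if k == 0 then 0 else (nk k ^+ 2)^-1) * (nk k ^+ 2 * f k).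
  apply: eq_bigr => k _; case: eqVneq => [->|k0]; first by rewrite f00 mul0r.
  rewrite mulKf// gt_eqF// exprn_gt0// (lt_le_trans _ (normk_ge1 k0))//.
apply: cs_seq => //; rewrite ?HC ?fX//.
- by move=> k; case: ifP => // _; rewrite invr_ge0 sqr_ge0.
- by move=> k; rewrite mulr_ge0 ?sqr_ge0.
Qed.

End lattice.

(** * Integration and Fourier coefficients on the torus *)

Section ae_integral.
Local Open Scope ereal_scope.
Context dsp (T : measurableType dsp) (R : realType) (mu : {measure set T -> \bar R}).
Import HBNNSimple.

(* The integral of a nonnegative function is a supremum over simple functions,
   so no measurability is needed *)
Lemma ae_ge0_le_integral (f g : T -> \bar R) : (forall x, 0 <= f x) -> (forall x, 0 <= g x) ->
  {ae mu, forall x, f x <= g x} -> \int[mu]_x f x <= \int[mu]_x g x.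
Proof.
move=> f0 g0 [N [mN N0 fgN]].
rewrite (ge0_integralTE mu f0) (ge0_integralTE mu g0).
apply: ge_ereal_sup => _ [h /= hf <-].
pose k : {nnsfun T >-> R} := mul_nnsfun h (indic_nnsfun R (measurableC mN)).
apply: le_trans (_ : sintegral mu k <= _).
  rewrite -!integralT_nnsfun le_eqVlt; apply/orP; left; apply/eqP.
  apply: ae_eq_integral => //.
  - by apply/measurable_EFinP; exact: measurable_funPT.
  - by apply/measurable_EFinP; exact: measurable_funPT.
  exists N; split=> // x H; apply: contrapT => Nx; apply: H => _.
  by rewrite /= mindicE mem_set//= mulr1.
apply: ereal_sup_ubound; exists k => //= x; rewrite mindicE.
case: (boolP (x \in ~` N)) => [|_]; last by rewrite mulr0.
rewrite inE => Nx; rewrite mulr1; apply: le_trans (hf x) _.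
by apply: contrapT => xfg; apply: Nx; exact: fgN.
Qed.

Lemma ge0_le_integral_T (f g : T -> \bar R) : (forall x, 0 <= f x) ->
  (forall x, f x <= g x) -> \int[mu]_x f x <= \int[mu]_x g x.
Proof.
move=> f0 fg; apply: ae_ge0_le_integral => //; last exact: aeW.
by move=> x; apply: le_trans (fg x).
Qed.

Lemma ae_eq_integral_T (f g : T -> \bar R) :
  {ae mu, forall x, f x = g x} -> \int[mu]_x f x = \int[mu]_x g x.
Proof.
move=> fg; rewrite integralE [RHS]integralE.
by congr (_ - _); apply/le_anti/andP; split; apply: ae_ge0_le_integral => //;
  apply: filterS fg => x /=; rewrite ?funeposE ?funenegE => ->.
Qed.

End ae_integral.

Lemma integral_mrestr dsp (T : measurableType dsp) (R : realType)
    (mu : {measure set T -> \bar R}) (D : set T) (mD : measurable D) (f : T -> \bar R) :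
  (\int[mrestr mu mD]_x f x = \int[mu]_(x in D) f x)%E.
Proof.
rewrite -[RHS](_ : (\int[mrestr mu mD]_(x in D) f x)%E = _); last first.
  by apply: eq_measure_integral => A mA AD; change (mu (A `&` D) = mu A); rewrite setIidl.
rewrite [RHS]integral_mkcond; apply: ae_eq_integral_T.
exists (~` D); split.
- exact: measurableC.
- by change (mu (~` D `&` D) = 0%E); rewrite setICl measure0.
- by move=> x /= xD Dx; apply: xD; rewrite /patch mem_set.
Qed.

Section bounded_measurable.
Context dsp (T : measurableType dsp) (R : realType).
Implicit Types f g : T -> R.

(** Such functions form an algebra, stable under exp, and are integrable for every finite measure.
    Integrability conditions are thereby settled by the shape of the integrand. *)
Definition bm f := measurable_fun setT f /\ exists M : R, forall x, `|f x| <= M.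

Lemma bm_meas f : bm f -> measurable_fun setT f. Proof. by case. Qed.

Lemma bm_cst c : bm (fun=> c).
Proof. by split; [exact: measurable_cst|exists `|c|]. Qed.

Lemma bmD f g : bm f -> bm g -> bm (fun x => f x + g x).
Proof.
move=> [mf [M fM]] [mg [N gN]]; split; first exact: measurable_funD.
by exists (M + N) => x; rewrite (le_trans (ler_normD _ _))// lerD.
Qed.

Lemma bmN f : bm f -> bm (fun x => - f x).
Proof.
move=> [mf [M fM]]; split; first exact: measurableT_comp.
by exists M => x; rewrite normrN.
Qed.

Lemma bmB f g : bm f -> bm g -> bm (fun x => f x - g x).
Proof. by move=> bf bg; apply: bmD => //; exact: bmN. Qed.

Lemma bmM f g : bm f -> bm g -> bm (fun x => f x * g x).
Proof.
move=> [mf [M fM]] [mg [N gN]]; split; first exact: measurable_funM.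
by exists (M * N) => x; rewrite normrM ler_pM.
Qed.

Lemma bmZ c f : bm f -> bm (fun x => c * f x).
Proof. exact: bmM (bm_cst c). Qed.

Lemma bmX f n : bm f -> bm (fun x => f x ^+ n).
Proof.
move=> bf; elim: n => [|n IH]; first exact: bm_cst.
by under eq_fun do rewrite exprS; exact: bmM.
Qed.

Lemma bm_sum (I : Type) (s : seq I) (F : I -> T -> R) : (forall i, bm (F i)) ->
  bm (fun x => \sum_(i <- s) F i x).
Proof.
move=> bF; elim: s => [|i s IH]; first by under eq_fun do rewrite big_nil; exact: bm_cst.
by under eq_fun do rewrite big_cons; exact: bmD.
Qed.

Lemma bm_expR f : bm f -> bm (fun x => expR (f x)).
Proof.
move=> [mf [M fM]]; split; first exact: measurableT_comp.
exists (expR M) => x; rewrite ger0_norm ?expR_ge0// ler_expR.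
exact: le_trans (ler_norm _) (fM x).
Qed.

Lemma bm_lim (F : nat -> T -> R) f M : (forall n, measurable_fun setT (F n)) ->
  (forall x, F n x @[n --> \oo] --> f x) -> (forall x, `|f x| <= M) -> bm f.
Proof.
move=> mF Ff fM; split; last by exists M.
by apply: (measurable_fun_cvg mF) => x _; exact: Ff.
Qed.

Section measure_integral.
Variable mu : {measure set T -> \bar R}.

Lemma integrable_bmM f g : mu.-integrable setT (EFin \o f) -> bm g ->
  mu.-integrable setT (EFin \o (fun x => f x * g x)).
Proof.
move=> fi [mg [M gM]].
have mf : measurable_fun setT f by apply/measurable_EFinP; exact: measurable_int fi.
apply: le_integrable (integrableZl measurableT M fi) => //.
  by apply/measurable_EFinP; exact: measurable_funM.
move=> x _ /=; rewrite lee_fin !normrM mulrC ler_wpM2r//.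
exact: le_trans (gM x) (ler_norm _).
Qed.

Lemma L1Z r f : mu.-integrable setT (EFin \o f) -> mu.-integrable setT (EFin \o (fun x => r * f x)).
Proof. by move=> fi; have := integrableZl measurableT r fi; apply: eq_integrable. Qed.

Lemma L1D f g : mu.-integrable setT (EFin \o f) -> mu.-integrable setT (EFin \o g) ->
  mu.-integrable setT (EFin \o (fun x => f x + g x)).
Proof. by move=> fi gi; have := integrableD measurableT fi gi; apply: eq_integrable. Qed.

Lemma L1B f g : mu.-integrable setT (EFin \o f) -> mu.-integrable setT (EFin \o g) ->
  mu.-integrable setT (EFin \o (fun x => f x - g x)).
Proof. by move=> fi gi; have := integrableB measurableT fi gi; apply: eq_integrable. Qed.

End measure_integral.

Section integral.
Variable mu : {finite_measure set T -> \bar R}.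
Local Notation mass := (fine (mu setT)).

Lemma bm_integrable f : bm f -> mu.-integrable setT (EFin \o f).
Proof.
move=> [mf [M fM]]; apply: measurable_bounded_integrable => //.
  by rewrite ltey_eq fin_num_measure.
by exists M; split; [exact: num_real|move=> N MN x _; apply: le_trans (fM x) _; exact: ltW].
Qed.

Lemma integrable_seq_sum (I : Type) (s : seq I) (F : I -> T -> R) :
  (forall i, mu.-integrable setT (EFin \o F i)) ->
  mu.-integrable setT (EFin \o (fun x => \sum_(i <- s) F i x)).
Proof.
move=> bF; elim: s => [|i s IH].
  by under [X in _ \o X]eq_fun do rewrite big_nil; exact: (bm_integrable (bm_cst 0)).
under [X in _ \o X]eq_fun do rewrite big_cons.
by have := integrableD measurableT (bF i) IH; apply: eq_integrable.
Qed.

Lemma Rint_sum (I : Type) (s : seq I) (F : I -> T -> R) :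
  (forall i, mu.-integrable setT (EFin \o F i)) ->
  \int[mu]_x (\sum_(i <- s) F i x) = \sum_(i <- s) \int[mu]_x F i x.
Proof.
move=> bF; elim: s => [|i s IH].
  by rewrite big_nil; under eq_Rintegral do rewrite big_nil; rewrite Rintegral_cst// mul0r.
rewrite big_cons; under eq_Rintegral do rewrite big_cons.
rewrite RintegralD// ?IH//.
exact: integrable_seq_sum.
Qed.

Lemma Rint_le_norm f M : mu.-integrable setT (EFin \o f) -> (forall x, `|f x| <= M) ->
  `|\int[mu]_x f x| <= M * mass.
Proof.
move=> fi fM; apply: le_trans (le_normr_Rintegral _ fi) _ => //.
rewrite -Rintegral_cst//; apply: le_Rintegral => //.
  have := integrable_norm fi; exact.
exact/bm_integrable/bm_cst.
Qed.

End integral.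
End bounded_measurable.

(** * Product structure of the torus *)

Section row_cons_facts.
Context {R : realType}.

Lemma row_cons0 n y (x : 'rV[R]_n) : row_cons (y, x) ord0 ord0 = y.
Proof.
rewrite /row_cons (_ : ord0 = lshift n (ord0 : 'I_1)); last exact/val_inj.
by rewrite (row_mxEl (const_mx y : 'rV[R]_1)) mxE.
Qed.

Lemma row_cons_lift n y (x : 'rV[R]_n) j : row_cons (y, x) ord0 (lift ord0 j) = x ord0 j.
Proof.
rewrite /row_cons (_ : lift ord0 j = rshift 1 j); last exact/val_inj.
by rewrite (row_mxEr (const_mx y : 'rV[R]_1)).
Qed.

Lemma addZdeltaE m (r : 'rV[R]_m) h j i :
  (h *: delta_mx ord0 j + r) ord0 i = h * (i == j)%:R + r ord0 i.
Proof. by rewrite !mxE eqxx. Qed.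

Lemma row_consDl n h y (x : 'rV[R]_n) :
  row_cons (h + y, x) = h *: delta_mx ord0 ord0 + row_cons (y, x).
Proof.
apply/rowP => i; rewrite addZdeltaE; have [j ->|->] := unliftP ord0 i.
  by rewrite !row_cons_lift mulr0 add0r.
by rewrite !row_cons0 eqxx mulr1.
Qed.

Lemma row_consDr n h y (x : 'rV[R]_n) j :
  row_cons (y, h *: delta_mx ord0 j + x) = h *: delta_mx ord0 (lift ord0 j) + row_cons (y, x).
Proof.
apply/rowP => i; rewrite addZdeltaE; have [k ->|->] := unliftP ord0 i.
  by rewrite !row_cons_lift addZdeltaE (inj_eq lift_inj).
by rewrite !row_cons0 mulr0 add0r.
Qed.

Lemma rV_cvgP n (T : Type) (F : set_system T) {FF : Filter F} (f : T -> 'rV[R]_n) (l : 'rV[R]_n) :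
  (forall i, f t ord0 i @[t --> F] --> l ord0 i) -> f t @[t --> F] --> l.
Proof.
move=> H; apply/cvg_ballP => e e0.
suff : \forall t \near F, forall i, ball (l ord0 i) e (f t ord0 i).
  by apply: filterS => t Ht; split=> // i j; rewrite (ord1 i).
by apply: filter_forall => i; have /cvg_ballP := H i; exact.
Qed.

Lemma row_cons_continuousl n (x : 'rV[R]_n) : continuous (fun y => row_cons (y, x)).
Proof.
move=> y; apply: rV_cvgP => i; have [j ->|->] := unliftP ord0 i.
  under eq_fun do rewrite row_cons_lift.
  rewrite row_cons_lift; exact: cvg_cst.
under eq_fun do rewrite row_cons0.
by rewrite row_cons0; exact: cvg_id.
Qed.

Lemma row_cons_continuousr n (y : R) : continuous (fun x : 'rV[R]_n => row_cons (y, x)).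
Proof.
move=> x; apply: (rV_cvgP (FF := nbhs_filter x)) => i; have [j ->|->] := unliftP ord0 i.
  under eq_fun do rewrite row_cons_lift.
  rewrite row_cons_lift; exact: coord_continuous.
under eq_fun do rewrite row_cons0.
by rewrite row_cons0; exact: cvg_cst.
Qed.

(** The sigma-algebra on row vectors is generated by the coordinates, so continuity has to be
    related to it. [f] is the pointwise limit of its values at points rounded to the lattice of mesh
    1 / (m + 1), and a rounding takes countably many values, each on a measurable box. *)
Lemma continuous_measurable_rV n (f : 'rV[R]_n -> R) : continuous f -> measurable_fun setT f.
Proof.
move=> cf.
pose r (m : nat) (x : 'rV[R]_n) : 'rV[int]_n := \row_i Num.floor (m.+1%:R * x ord0 i).
pose q (m : nat) (z : 'rV[int]_n) : 'rV[R]_n := \row_i ((z ord0 i)%:~R / m.+1%:R).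
apply: (@measurable_fun_cvg _ _ _ _ (fun m => f \o q m \o r m)); last first.
  move=> x _; apply: (@continuous_cvg _ _ _ _ _ (fun m => q m (r m x)) f); first exact: cf.
  apply: rV_cvgP => i; apply/cvgrPdist_le => e e0.
  near=> m; rewrite !mxE.
  have m0 : 0 < m.+1%:R :> R by [].
  have /andP[l1 l2] := floor_itv (m.+1%:R * x ord0 i).
  apply: (@le_trans _ _ (m.+1%:R^-1)); last first.
    by near: m; apply: filterS (near_infty_natSinv_lt (PosNum e0)) => k /=; exact: ltW.
  rewrite -[leLHS](@mulfK _ m.+1%:R) ?gt_eqF// ler_pdivrMr// mulVf ?gt_eqF//.
  rewrite -[X in _ * X]ger0_norm// -normrM mulrBl divfK ?gt_eqF// mulrC.
  by rewrite ger0_norm ?subr_ge0// lerBlDl ltW//; move: l2; rewrite intrD.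
move=> m _ B mB; rewrite setTI.
have -> : (f \o q m \o r m) @^-1` B = \bigcup_(k in [set k : nat |
    exists2 z, unpickle k = Some z & B (f (q m z))]) [set x | Some (r m x) = unpickle k].
  apply/seteqP; split => [x /= Bx|x /= [k [z kz Bz]] /=].
    by exists (pickle (r m x)) => /=; rewrite pickleK//; exists (r m x).
  by rewrite kz => -[->].
apply: bigcup_measurable => k [z kz _].
have -> : [set x | Some (r m x) = unpickle k] = \big[setI/setT]_(i < n)
    ((fun x : 'rV[R]_n => x ord0 i) @^-1` [set y | Num.floor (m.+1%:R * y) = z ord0 i]).
  rewrite kz; apply/seteqP; split => x; rewrite -bigcap_seq.
    by move=> /= [<-] i _; rewrite /= mxE.
  move=> H; congr Some; apply/rowP => i; rewrite mxE.
  by apply: (H i); rewrite /= mem_index_enum.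
apply: bigsetI_measurable => i _.
rewrite -[X in measurable X]setTI; apply: measurable_coord => //.
have -> : [set y : R | Num.floor (m.+1%:R * y) = z ord0 i] =
    [set` `[(z ord0 i)%:~R / m.+1%:R, (z ord0 i + 1)%:~R / m.+1%:R[].
  apply/seteqP; split => y /=; rewrite in_itv/= ler_pdivrMr// ltr_pdivlMr// ![y * _]mulrC.
    by move=> <-; exact: floor_itv.
  exact: floor_def.
exact: measurable_itv.
Unshelve. all: by end_near. Qed.

End row_cons_facts.

Section torus_integral.
Context {R : realType}.
Local Notation mu d := (torus_measure R d).
Local Notation leb := (@lebesgue_measure R).

Lemma circle_integral (f : R -> \bar R) :
  (\int[@circle_measure R]_x f x = \int[leb]_(x in `[(- pi)%R, pi%R]%classic) f x)%E.
Proof. exact: integral_mrestr. Qed.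

Lemma circle_mass : @circle_measure R setT = (2 * pi)%:E.
Proof.
rewrite /circle_measure /mrestr setTI /= lebesgue_measure_itv/= lte_fin gtrN ?pi_gt0//.
by rewrite -EFinB opprK mulr_natl mulr2n.
Qed.

Lemma torus_mass d : mu d setT = ((2 * pi) ^+ d)%:E.
Proof.
elim: d => [|d IH]; first by rewrite /= diracT.
rewrite /= /torus_step /pushforward preimage_setT -setXTT product_measure1E//.
by apply: etrans (congr2 (fun z t => z * t)%E circle_mass IH) _; rewrite -EFinM exprS.
Qed.

Lemma bm_row_consl d (f : 'rV[R]_d.+1 -> R) y : bm f -> bm (fun x => f (row_cons (y, x))).
Proof.
move=> [mf [M fM]]; split; last by exists M.
apply: (measurableT_comp mf); apply: measurableT_comp (@measurable_row_cons R d) _.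
exact: measurable_pair1.
Qed.

Lemma bm_row_consr d (f : 'rV[R]_d.+1 -> R) x : bm f -> bm (fun y : R => f (row_cons (y, x))).
Proof.
move=> [mf [M fM]]; split; last by exists M.
apply: (measurableT_comp mf); apply: measurableT_comp (@measurable_row_cons R d) _.
exact: measurable_pair2.
Qed.

Lemma bm_row_cons d (f : 'rV[R]_d.+1 -> R) : bm f -> bm (fun p : measurableTypeR R * 'rV[R]_d => f (row_cons p)).
Proof.
move=> [mf [M fM]]; split; last by exists M.
exact: measurableT_comp mf (@measurable_row_cons R d).
Qed.

Section fubini.
Context d (f : 'rV[R]_d.+1 -> R) (bf : bm f).

Let pim : (@circle_measure R \x mu d)%E.-integrable setT (fun p => (f (row_cons p))%:E).
Proof.
have [mf [M fM]] := bm_row_cons bf.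
apply: (@measurable_bounded_integrable _ _ _ (@circle_measure R \x mu d)%E
  (fun p : measurableTypeR R * 'rV[R]_d => f (row_cons p)) setT) => //.
  have := @product_measure1E _ _ _ _ R (@circle_measure R) (mu d) setT setT measurableT measurableT.
  rewrite setXTT => H; apply: le_lt_trans (_ : (2 * pi)%:E * ((2 * pi) ^+ d)%:E < +oo)%E.
    by rewrite le_eqVlt; apply/orP; left; apply/eqP;
      exact: etrans H (congr2 (fun z t => z * t)%E circle_mass (torus_mass d)).
  by rewrite -EFinM ltry.
exists M; split; [exact: num_real|move=> N MN x _; apply: le_trans (fM x) _; exact: ltW].
Qed.

Let torusE : (\int[mu d.+1]_x (f x)%:E =
  \int[@circle_measure R \x mu d]_p (f (row_cons p))%:E)%E.
Proof.
have mf : measurable_fun setT (EFin \o f) by apply/measurable_EFinP; case: bf.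
have mr : measurable_fun (setT : set (measurableTypeR R * 'rV[R]_d)) (@row_cons R d).
  exact: measurable_row_cons.
exact: (integral_pushforward mr mf pim measurableT).
Qed.

Lemma torus_integralS : \int[mu d.+1]_x f x =
  \int[@circle_measure R]_y \int[mu d]_x f (row_cons (y, x)).
Proof.
rewrite /Rintegral; congr fine; rewrite torusE -(integral12_prod_meas1 pim)//.
apply: eq_integral => y _; rewrite /fubini_F fineK//.
have := integrable_fin_num measurableT (bm_integrable (mu d) (bm_row_consl y bf)).
exact.
Qed.

Lemma torus_integralS_swap : \int[mu d.+1]_x f x =
  \int[mu d]_x \int[@circle_measure R]_y f (row_cons (y, x)).
Proof.
rewrite /Rintegral; congr fine; rewrite torusE -(integral21_prod_meas1 pim)//.
apply: eq_integral => x _; rewrite /fubini_G fineK//.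
have := integrable_fin_num measurableT (bm_integrable (@circle_measure R) (bm_row_consr x bf)).
exact.
Qed.

End fubini.

Lemma circle_integral_derive (F : R -> R) : (forall y, derivable F y 1) ->
  continuous (derive1 F) -> F pi = F (- pi) -> \int[@circle_measure R]_y (derive1 F y) = 0.
Proof.
move=> dF cF Fpi; rewrite /Rintegral circle_integral.
have pp : - pi < pi :> R by rewrite gtrN// pi_gt0.
have cF' : continuous F by move=> y; apply/differentiable_continuous/derivable1_diffP.
have dLR : derivable_oo_LRcontinuous F (- pi) pi.
  split; first by move=> x _; exact: dF.
  - by apply: cvg_at_right_filter; exact: cF'.
  - by apply: cvg_at_left_filter; exact: cF'.
have := @continuous_FTC2 R (derive1 F) F (- pi) pi pp (continuous_subspaceT cF) dLR.
by move=> ->//; rewrite Fpi -EFinB subrr.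
Qed.

(** Induction on the dimension. A derivative in the first coordinate is integrated along that
    coordinate first, by the fundamental theorem of calculus; a derivative in another coordinate
    falls under the induction hypothesis on each slice. *)
Lemma torus_integral_partial d (f : 'rV[R]_d -> R) i : bm f -> bm (partial i f) ->
  (forall x, derivable f x (delta_mx ord0 i)) -> continuous (partial i f) ->
  (forall x, f (x + (2 * pi) *: delta_mx ord0 i) = f x) ->
  \int[mu d]_x partial i f x = 0.
Proof.
elim: d f i => [|d IH] f; first by case.
move=> i bf bpf df cpf pf; have [j ij|i0] := unliftP ord0 i.
  rewrite torus_integralS//; apply: etrans (_ : \int[@circle_measure R]_y 0 = _).
    apply: eq_Rintegral => y _.
    have E h x : f (row_cons (y, h *: delta_mx ord0 j + x)) = f (h *: delta_mx ord0 i + row_cons (y, x)).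
      by rewrite row_consDr ij.
    have pE x : partial j (fun x => f (row_cons (y, x))) x = partial i f (row_cons (y, x)).
      rewrite /partial /derive /=.
      by under [in LHS]eq_fun do rewrite E.
    under eq_Rintegral do rewrite -pE.
    apply: IH.
    - exact: bm_row_consl.
    - by rewrite (_ : partial j _ = fun x => partial i f (row_cons (y, x))); [exact: bm_row_consl|exact/funext].
    - move=> x; have := df (row_cons (y, x)); rewrite /derivable /=.
      by under [X in _ -> cvg (X @ _)]eq_fun do rewrite E.
    - rewrite (_ : partial j _ = fun x => partial i f (row_cons (y, x))); last exact/funext.
      move=> x; apply: (@continuous_comp _ _ _ (fun x => row_cons (y, x)) (partial i f)).
        exact: row_cons_continuousr.
      exact: cpf.
    - by move=> x; rewrite addrC E addrC pf.
  by rewrite Rintegral_cst// mul0r.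
rewrite torus_integralS_swap//; apply: etrans (_ : \int[mu d]_y 0 = _).
  apply: eq_Rintegral => x _.
  have E h y : f (row_cons (h + y, x)) = f (h *: delta_mx ord0 i + row_cons (y, x)).
    by rewrite row_consDl i0.
  have pE y : derive1 (fun y => f (row_cons (y, x))) y = partial i f (row_cons (y, x)).
    rewrite derive1E /partial /derive /=.
    by under [in LHS]eq_fun do rewrite scaler1 E.
  under eq_Rintegral do rewrite -pE.
  apply: circle_integral_derive.
  - move=> y; have := df (row_cons (y, x)); rewrite /derivable /=.
    by under [X in _ -> cvg (X @ _)]eq_fun do rewrite scaler1 E.
  - rewrite (_ : derive1 _ = fun y => partial i f (row_cons (y, x))); last exact/funext.
    move=> y; apply: (@continuous_comp _ _ _ (fun y => row_cons (y, x)) (partial i f)).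
      exact: row_cons_continuousl.
    exact: cpf.
  - have -> : f (row_cons (pi, x)) = f (row_cons (2 * pi + - pi, x)).
      by congr (f (row_cons (_, x))); ring.
    by rewrite E addrC pf.
by rewrite Rintegral_cst// mul0r.
Qed.

End torus_integral.

(** * Trigonometric modes and Fourier coefficients *)

Section mode.
Context {R : realType} {d : nat}.
Local Notation Zd := 'rV[int]_d.
Local Notation mu := (torus_measure R d).
Implicit Types (k l : Zd) (c : R[i]) (x : 'rV[R]_d).

(** The real part of c e^(i x.k). Working with real parts keeps all functions real-valued; nothing
    is lost for Hermitian sequences, where k and - k contribute conjugate terms. *)
Definition mode k c x : R :=
  complex.Re c * cos (dotk x k) - complex.Im c * sin (dotk x k).

(** The Fourier symbol of the derivative in direction i. *)
Definition ik k i : R[i] := Complex 0 (k ord0 i)%:~R.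

Lemma dotk_delta h x k i : dotk (h *: delta_mx ord0 i + x) k = h * (k ord0 i)%:~R + dotk x k.
Proof.
rewrite /dotk; under eq_bigr do rewrite addZdeltaE mulrDl.
rewrite big_split/=; congr (_ + _); rewrite (bigD1 i)//= eqxx mulr1 big1 ?addr0// => j /negbTE ->.
by rewrite mulr0 mul0r.
Qed.

Lemma derivable_line (f : 'rV[R]_d -> R) x v (g : R -> R) : (forall h, g h = f (h *: v + x)) ->
  forall dg, is_derive (0 : R) (1 : R) g dg -> derivable f x v /\ 'D_v f x = dg.
Proof.
move=> gE dg [dg1 dg2]; have E : (fun h => h^-1 *: ((f \o shift x) (h *: v) - f x)) =
   (fun h => h^-1 *: ((g \o shift 0) (h *: 1) - g 0)).
  by apply/funext => h /=; rewrite !gE scale0r add0r addr0 scaler1.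
by split; [rewrite /derivable E|rewrite /derive E].
Qed.

Lemma mode_derive k c x i : derivable (mode k c) x (delta_mx ord0 i) /\
  partial i (mode k c) x = mode k (ik k i * c) x.
Proof.
pose g (h : R) := complex.Re c * cos (h * (k ord0 i)%:~R + dotk x k)
   - complex.Im c * sin (h * (k ord0 i)%:~R + dotk x k).
apply: (@derivable_line (mode k c) x (delta_mx ord0 i) g).
  by move=> h; rewrite /g /mode dotk_delta.
rewrite /g.
have H : is_derive (0 : R) (1 : R) (fun h => h * (k ord0 i)%:~R + dotk x k) (k ord0 i)%:~R.
  by apply: is_derive_eq; rewrite scaler0 !addr0 add0r scaler1.
have H1 := @is_derive1_comp R cos (fun h => h * (k ord0 i)%:~R + dotk x k) 0 _ _ _ H.
have H2 := @is_derive1_comp R sin (fun h => h * (k ord0 i)%:~R + dotk x k) 0 _ _ _ H.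
apply: is_derive_eq.
rewrite mul0r add0r /mode /ik; case: c {g} => a b /=.
rewrite /GRing.scale/=; ring.
Qed.

Lemma ik_neq0 k i : k ord0 i != 0 -> ik k i != 0.
Proof. by move=> ki; rewrite /ik eq_complex/= negb_and intr_eq0 ki orbT. Qed.

Lemma dotkD x k l : dotk x (k + l) = dotk x k + dotk x l.
Proof. by rewrite /dotk -big_split/=; apply: eq_bigr => i _; rewrite mxE intrD mulrDr. Qed.

Lemma dotkN x k : dotk x (- k) = - dotk x k.
Proof. by rewrite /dotk -sumrN; apply: eq_bigr => i _; rewrite mxE mulrNz mulrN. Qed.

Lemma dotk0 x : dotk x 0 = 0.
Proof. by rewrite /dotk big1// => i _; rewrite mxE mulr0. Qed.

Lemma continuous_seq_sum (I : Type) (T : topologicalType) (s : seq I) (F : I -> T -> R) :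
  (forall i, continuous (F i)) -> continuous (fun t => \sum_(i <- s) F i t).
Proof.
move=> cF; elim: s => [|i s IH] t.
  by under eq_fun do rewrite big_nil; exact: cvg_cst.
under eq_fun do rewrite big_cons.
by apply: cvgD; [exact: cF|exact: IH].
Qed.

Lemma rV_coord_continuous i : continuous (fun x : 'rV[R]_d => x ord0 i).
Proof.
move=> x A /= nA; exists (fun _ j => [set y | j = i -> A y]) => /=.
  move=> i' j; rewrite (ord1 i'); case: (eqVneq j i) => [->|ji].
    by apply: filterS nA => y Ay _.
  by apply: filterE => y /eqP; rewrite (negbTE ji).
by move=> y /(_ ord0 i); exact.
Qed.

Lemma continuous_dotk k : continuous (fun x : 'rV[R]_d => dotk x k).
Proof.
apply: continuous_seq_sum => i x; have FF := nbhs_filter x.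
by apply: cvgM; [exact: rV_coord_continuous|exact: cvg_cst].
Qed.

Lemma continuous_mode k c : continuous (mode k c).
Proof.
move=> x; have FF := nbhs_filter x; apply: cvgB; (apply: cvgM; first exact: cvg_cst).
  by apply: (@continuous_comp _ _ _ (fun x => dotk x k) cos);
    [exact: continuous_dotk|exact: continuous_cos].
by apply: (@continuous_comp _ _ _ (fun x => dotk x k) sin);
    [exact: continuous_dotk|exact: continuous_sin].
Qed.

Local Notation nc := (@ComplexField.Normc.normc R).

Lemma nc_ge0 c : 0 <= nc c. Proof. by case: c => a b; exact: sqrtr_ge0. Qed.

Lemma nc_sqr c : nc c ^+ 2 = complex.Re c ^+ 2 + complex.Im c ^+ 2.
Proof. by case: c => a b; rewrite /= sqr_sqrtr// addr_ge0 ?sqr_ge0. Qed.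

Lemma nc_geRe c : `|complex.Re c| <= nc c.
Proof.
rewrite -ler_sqr ?nnegrE ?nc_ge0// nc_sqr real_normK ?num_real//.
by rewrite lerDl sqr_ge0.
Qed.

Lemma nc_geIm c : `|complex.Im c| <= nc c.
Proof.
rewrite -ler_sqr ?nnegrE ?nc_ge0// nc_sqr real_normK ?num_real//.
by rewrite lerDr sqr_ge0.
Qed.

Lemma nc_leReIm c : nc c <= `|complex.Re c| + `|complex.Im c|.
Proof.
rewrite -ler_sqr ?nnegrE ?nc_ge0 ?addr_ge0// nc_sqr sqrrD !real_normK ?num_real//.
by rewrite addrAC lerDl mulrn_wge0// mulr_ge0.
Qed.

Lemma ncD (c1 c2 : R[i]) : nc (c1 + c2) <= nc c1 + nc c2.
Proof. exact: le_normcD. Qed.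

Lemma ncN c : nc (- c) = nc c.
Proof. by case: c => a b; rewrite /= !sqrrN. Qed.

Lemma ncB (c1 c2 : R[i]) : nc (c1 - c2) <= nc c1 + nc c2.
Proof. by rewrite -(ncN c2) ncD. Qed.

Lemma nc_conj c : nc (conjc c) = nc c.
Proof. by case: c => a b; rewrite /= sqrrN. Qed.

Lemma nc0 : nc 0 = 0. Proof. exact: ComplexField.Normc.normc0. Qed.

Lemma ncM (c1 c2 : R[i]) : nc (c1 * c2) = nc c1 * nc c2.
Proof. exact: ComplexField.Normc.normcM. Qed.

Lemma nc_real (r : R) : nc (Complex r 0) = `|r|.
Proof. by rewrite /= expr0n/= addr0 sqrtr_sqr. Qed.

Lemma mode_bound k c x : `|mode k c x| <= nc c.
Proof.
have := nc_geRe (c * Complex (cos (dotk x k)) (sin (dotk x k))).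
rewrite ncM [X in nc c * X](_ : _ = 1); last by rewrite /= cos2Dsin2 sqrtr1.
by rewrite mulr1; apply: le_trans; rewrite /mode; case: c.
Qed.

Lemma bm_mode k c : bm (mode k c).
Proof.
split.
  apply: continuous_measurable_rV.
  exact: continuous_mode.
by exists (nc c) => x; exact: mode_bound.
Qed.

Lemma modeD k c1 c2 x : mode k (c1 + c2) x = mode k c1 x + mode k c2 x.
Proof. by rewrite /mode; case: c1 => ? ?; case: c2 => ? ? /=; ring. Qed.

Lemma modeN k c x : mode k (- c) x = - mode k c x.
Proof. by rewrite /mode; case: c => ? ? /=; ring. Qed.

Lemma mode0 k x : mode k 0 x = 0.
Proof. by rewrite /mode /= !mul0r subr0. Qed.

Lemma partial_mode k c i : partial i (mode k c) = mode k (ik k i * c).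
Proof. by apply/funext => x; case: (mode_derive k c x i). Qed.

Lemma cosDint (z : int) (t : R) : cos (t + z%:~R * (2 * pi)) = cos t /\
  sin (t + z%:~R * (2 * pi)) = sin t.
Proof.
have E : 2 * pi = pi *+ 2 :> R by rewrite mulr_natl.
have pos (n : nat) (s : R) : cos (s + n%:R * (2 * pi)) = cos s /\ sin (s + n%:R * (2 * pi)) = sin s.
  by rewrite mulr_natl E; split; rewrite periodicn//; [exact: cosD2pi|exact: sinD2pi].
case: z => n; first exact: pos.
rewrite NegzE mulrNz mulNr; have [<- <-] := pos n.+1 (t - n.+1%:R * (2 * pi)).
by rewrite subrK.
Qed.

Lemma mode_periodic k c x i : mode k c (x + (2 * pi) *: delta_mx ord0 i) = mode k c x.
Proof.
rewrite addrC /mode dotk_delta [_ + dotk x k]addrC [2 * pi * _]mulrC.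
by have [-> ->] := cosDint (k ord0 i) (dotk x k).
Qed.

Lemma smooth_periodic_mode k c : smooth_periodic (mode k c).
Proof.
split; last by move=> x i; exact: mode_periodic.
move=> s; have -> : foldr (@partial R d) (mode k c) s = mode k (foldr (fun i c => ik k i * c) c s).
  by elim: s => //= i s ->; rewrite partial_mode.
by split; [exact: continuous_mode|move=> x i; case: (mode_derive k (foldr (fun i c => ik k i * c) c s) x i)].
Qed.

Section smooth_periodic.
Variables (eta : 'rV[R]_d -> R) (seta : smooth_periodic eta).

Lemma smooth_periodic_continuous : continuous eta.
Proof. by case: seta => /(_ [::])[]. Qed.

Lemma smooth_periodic_derivable x i : derivable eta x (delta_mx ord0 i).
Proof. by case: seta => /(_ [::])[_]. Qed.

Lemma smooth_periodic_partial i : smooth_periodic (partial i eta).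
Proof.
case: seta => H P; split; first by move=> s; have := H (rcons s i); rewrite foldr_rcons.
move=> x j; rewrite /partial /derive /=.
by under eq_fun do rewrite addrA !P.
Qed.

Lemma smooth_periodic_shift (z : 'I_d -> int) (s : seq 'I_d) x :
  eta (x + \sum_(i <- s) ((z i)%:~R * (2 * pi)) *: delta_mx ord0 i) = eta x.
Proof.
case: seta => _ P.
have pos i (n : nat) y : eta (y + (n%:R * (2 * pi)) *: delta_mx ord0 i) = eta y.
  have := @periodicn _ _ eta ((2 * pi) *: delta_mx ord0 i) (fun u => P u i) n y.
  by rewrite -scaler_nat scalerA.
elim: s x => [|i s IH] x; first by rewrite big_nil addr0.
rewrite big_cons addrA IH; case: (z i) => n; first exact: pos.
rewrite NegzE mulrNz mulNr scaleNr.
by rewrite -[LHS](pos i n.+1) subrK.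
Qed.

(** Adding multiples of the periods moves any point into the cell, which is compact. *)
Lemma bm_smooth_periodic : bm eta.
Proof.
have ce := smooth_periodic_continuous.
split; first exact: continuous_measurable_rV.
pose K := [set v : 'rV[R]_d | forall i, `[- pi, pi]%classic (v ord0 i)].
have cK : compact K by apply: (@rV_compact _ _ (fun=> `[- pi, pi]%classic)) => i; exact: segment_compact.
have : compact (eta @` K) by apply: continuous_compact => //; exact: continuous_subspaceT.
move=> /compact_bounded[M [_ HM]]; exists (M + 1) => x.
pose z i : int := - Num.floor ((x ord0 i + pi) / (2 * pi)).
rewrite -(smooth_periodic_shift z (index_enum _) x).
apply: HM; first by rewrite ltrDl.
eexists; last reflexivity.
move=> i; rewrite /= in_itv/=.
have -> : (x + \sum_i0 ((z i0)%:~R * (2 * pi)) *: delta_mx ord0 i0) ord0 i =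
    x ord0 i + (z i)%:~R * (2 * pi).
  rewrite mxE summxE (bigD1 i)//= big1 ?addr0 => [|j /negbTE ji].
    by rewrite !mxE !eqxx mulr1.
  by rewrite !mxE eqxx eq_sym ji mulr0.
have p0 : 0 < 2 * pi :> R by rewrite mulr_gt0// pi_gt0.
have /andP[l1 l2] := floor_itv ((x ord0 i + pi) / (2 * pi)).
rewrite ler_pdivlMr// in l1; rewrite ltr_pdivrMr// intrD in l2.
by rewrite /z mulrNz; apply/andP; split; lra.
Qed.

End smooth_periodic.

(** The product of the mode and [eta] is periodic, so the integral of its derivative vanishes. *)
Lemma mode_ibp eta k c i : smooth_periodic eta ->
  \int[mu]_x (mode k (ik k i * c) x * eta x) = - \int[mu]_x (mode k c x * partial i eta x).
Proof.
move=> seta; have spe := smooth_periodic_partial seta i.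
have be := bm_smooth_periodic seta; have bpe := bm_smooth_periodic spe.
pose f x := mode k c x * eta x.
have H x : derivable f x (delta_mx ord0 i) /\
    partial i f x = mode k (ik k i * c) x * eta x + mode k c x * partial i eta x.
  have [d1 e1] := mode_derive k c x i; have d2 := @smooth_periodic_derivable eta seta x i.
  have Ef : f = (mode k c) * eta by apply/funext.
  split; first by rewrite Ef; exact: derivableM d1 d2.
  have -> : partial i f x = _ := etrans (congr1 (fun g => 'D_(delta_mx ord0 i) g x) Ef) (deriveM d1 d2).
  have -> : 'D_(delta_mx ord0 i) (mode k c) x = _ := e1.
  by rewrite addrC; congr (_ + _); exact: mulrC.
have pE : partial i f = fun x => mode k (ik k i * c) x * eta x + mode k c x * partial i eta x.
  by apply/funext => x; case: (H x).
have b1 : bm (fun x => mode k (ik k i * c) x * eta x) by apply: bmM => //; exact: bm_mode.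
have b2 : bm (fun x => mode k c x * partial i eta x) by apply: bmM => //; exact: bm_mode.
have : \int[mu]_x partial i f x = 0.
  apply: torus_integral_partial.
  - by apply: bmM => //; exact: bm_mode.
  - by rewrite pE; exact: bmD.
  - by move=> x; case: (H x).
  - rewrite pE => x; have FF := nbhs_filter x; apply: cvgD; apply: cvgM.
    + exact: continuous_mode.
    + exact: smooth_periodic_continuous.
    + exact: continuous_mode.
    + exact: smooth_periodic_continuous.
  - by move=> x; rewrite /f mode_periodic; case: seta => _ ->.
rewrite pE RintegralD//; [|exact: bm_integrable|exact: bm_integrable].
by move/eqP; rewrite addr_eq0 => /eqP.
Qed.

Lemma mode_integral k c : \int[mu]_x mode k c x = (k == 0)%:R * (2 * pi) ^+ d * complex.Re c.
Proof.
case: eqVneq => [->|k0].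
  under eq_Rintegral do rewrite /mode dotk0 cos0 sin0 mulr1 mulr0 subr0.
  rewrite Rintegral_cst// mul1r mulrC; congr (_ * _).
  by have := @torus_mass R d => /(congr1 fine).
have [i ki] : exists i, k ord0 i != 0.
  apply: contrapT => /forallNP H; move/eqP: k0; apply; apply/rowP => i.
  by rewrite mxE; apply/eqP/negP => /negP /(H i).
(* A mode with nonzero k_i is itself the derivative in direction i of the mode with coefficient c /
   (i k_i), so its integral vanishes. *)
rewrite !mul0r -(@mulVKf _ (ik k i) (ik_neq0 ki) c).
have bmm := bm_mode k; set c' := (_^-1 * c).
rewrite -partial_mode; apply: torus_integral_partial.
- exact: bmm.
- by rewrite partial_mode; exact: bmm.
- by move=> x; case: (mode_derive k c' x i).
- by rewrite partial_mode; exact: continuous_mode.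
- by move=> x; exact: mode_periodic.
Qed.

Section fourier.
Local Notation four := (@fourier R d).
Local Notation L1 u := (mu.-integrable setT (EFin \o u)).
Implicit Types u w : 'rV[R]_d -> R.

Lemma bm_cosk k : bm (fun x => cos (dotk x k)).
Proof.
have := bm_mode k 1; congr bm; apply/funext => x.
by rewrite /mode /= mul1r mul0r subr0.
Qed.

Lemma bm_sink k : bm (fun x => sin (dotk x k)).
Proof.
have := bm_mode k (Complex 0 (-1)); congr bm; apply/funext => x.
by rewrite /mode /= mulN1r mul0r sub0r opprK.
Qed.

Lemma complex_eqP (c1 c2 : R[i]) : complex.Re c1 = complex.Re c2 ->
  complex.Im c1 = complex.Im c2 -> c1 = c2.
Proof. by case: c1 => ? ?; case: c2 => ? ? /= -> ->. Qed.

Lemma ReD (c1 c2 : R[i]) : complex.Re (c1 + c2) = complex.Re c1 + complex.Re c2.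
Proof. by case: c1; case: c2. Qed.

Lemma ImD (c1 c2 : R[i]) : complex.Im (c1 + c2) = complex.Im c1 + complex.Im c2.
Proof. by case: c1; case: c2. Qed.

Lemma fourierD u w k : L1 u -> L1 w -> four (fun x => u x + w x) k = four u k + four w k.
Proof.
move=> iu iw; have bc := bm_cosk k; have bs := bm_sink k.
apply: complex_eqP => /=.
  under eq_Rintegral do rewrite mulrDl.
  by rewrite RintegralD ?mulrDr//; exact: integrable_bmM.
under eq_Rintegral do rewrite mulrDl.
by rewrite RintegralD ?mulrDr ?opprD//; exact: integrable_bmM.
Qed.

Lemma fourierZ r u k : L1 u -> four (fun x => r * u x) k = Complex r 0 * four u k.
Proof.
move=> iu; have bc := bm_cosk k; have bs := bm_sink k.
apply: complex_eqP => /=; rewrite mul0r.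
  under eq_Rintegral do rewrite -mulrA.
  by rewrite RintegralZl//; [ring|exact: integrable_bmM].
under eq_Rintegral do rewrite -mulrA.
by rewrite RintegralZl//; [ring|exact: integrable_bmM].
Qed.

Lemma fourierB u w k : L1 u -> L1 w -> four (fun x => u x - w x) k = four u k - four w k.
Proof.
move=> iu iw; have bc := bm_cosk k; have bs := bm_sink k.
apply: complex_eqP => /=.
  under eq_Rintegral do rewrite mulrBl.
  by rewrite RintegralB ?mulrBr//; exact: integrable_bmM.
under eq_Rintegral do rewrite mulrBl.
by rewrite RintegralB ?mulrBr ?opprB ?opprK//; [ring|exact: integrable_bmM..].
Qed.

Lemma fourier_sum (I : Type) (s : seq I) (F : I -> 'rV[R]_d -> R) k : (forall i, L1 (F i)) ->
  four (fun x => \sum_(i <- s) F i x) k = \sum_(i <- s) four (F i) k.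
Proof.
move=> iF; elim: s => [|i s IH].
  rewrite big_nil; apply: complex_eqP => /=;
    under eq_Rintegral do rewrite big_nil mul0r;
    by rewrite Rintegral_cst// mul0r mulr0 ?oppr0.
rewrite big_cons -IH -fourierD//; last exact: integrable_seq_sum.
by congr fourier; apply/funext => x; rewrite big_cons.
Qed.

Lemma fourierN u k : L1 u -> four u (- k) = conjc (four u k).
Proof.
move=> iu; apply: complex_eqP; rewrite /= ?opprK.
  by under eq_Rintegral do rewrite dotkN cosN.
under eq_Rintegral do rewrite dotkN sinN mulrN -mulN1r.
by rewrite RintegralZl//; [ring|apply: integrable_bmM => //; exact: bm_sink].
Qed.

(** A real mode carries the frequencies l and - l, with half the coefficient and half its conjugate;
    multiplication shifts the coefficients of [w] by both. *)
Lemma fourier_mode_mul l c w k : L1 w -> four (fun x => mode l c x * w x) k =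
  Complex 2^-1 0 * (c * four w (k - l) + conjc c * four w (k + l)).
Proof.
move=> iw; have bc := bm_cosk; have bs := bm_sink.
pose Cm := \int[mu]_x (w x * cos (dotk x (k - l))).
pose Sm := \int[mu]_x (w x * sin (dotk x (k - l))).
pose Cp := \int[mu]_x (w x * cos (dotk x (k + l))).
pose Sp := \int[mu]_x (w x * sin (dotk x (k + l))).
case: c => a b.
have lin (p q r s : R) : \int[mu]_x (p * (w x * cos (dotk x (k - l))) + q * (w x * sin (dotk x (k - l)))
    + (r * (w x * cos (dotk x (k + l))) + s * (w x * sin (dotk x (k + l))))) =
    p * Cm + q * Sm + (r * Cp + s * Sp).
  have i1 p' m : L1 (fun x => p' * (w x * cos (dotk x m))).
    by apply: L1Z; exact: integrable_bmM.
  have i2 p' m : L1 (fun x => p' * (w x * sin (dotk x m))).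
    by apply: L1Z; exact: integrable_bmM.
  rewrite RintegralD//; [|exact: L1D..].
  rewrite RintegralD// RintegralD//.
  by rewrite !RintegralZl//; exact: integrable_bmM.
have tc x : cos (dotk x k) = cos (dotk x k) by [].
apply: complex_eqP => /=.
  rewrite (@eq_Rintegral _ _ _ _ _ (fun x => (a / 2) * (w x * cos (dotk x (k - l))) + (b / 2) * (w x * sin (dotk x (k - l)))
    + ((a / 2) * (w x * cos (dotk x (k + l))) + (- b / 2) * (w x * sin (dotk x (k + l)))))); last first.
    move=> x _; rewrite /mode/= !dotkD !dotkN !cosD !sinD !cosN !sinN.
    by field.
  rewrite lin -/Cm -/Sm -/Cp -/Sp; move: ((2 * pi) ^- d) => N; clearbody Cm Sm Cp Sp.
  by field.
rewrite (@eq_Rintegral _ _ _ _ _ (fun x => (- b / 2) * (w x * cos (dotk x (k - l))) + (a / 2) * (w x * sin (dotk x (k - l)))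
    + ((b / 2) * (w x * cos (dotk x (k + l))) + (a / 2) * (w x * sin (dotk x (k + l)))))); last first.
  move=> x _; rewrite /mode/= !dotkD !dotkN !cosD !sinD !cosN !sinN.
  by field.
rewrite lin -/Cm -/Sm -/Cp -/Sp; move: ((2 * pi) ^- d) => N; clearbody Cm Sm Cp Sp.
  by field.
Qed.

Lemma fourier_cst1 k : four (fun=> 1) k = (k == 0)%:R.
Proof.
have N0 : (2 * pi : R) ^+ d != 0 by rewrite expf_neq0// mulf_neq0// gt_eqF// pi_gt0.
have E1 := mode_integral k 1; have E2 := mode_integral k (Complex 0 (-1)).
apply: complex_eqP => /=.
  rewrite (@eq_Rintegral _ _ _ _ _ (mode k 1)).
    by rewrite E1/= mulr1 mulrC; case: eqP => _; rewrite ?mul1r ?mul0r ?mulfV.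
  by move=> x _; rewrite /mode /= !mul1r mul0r subr0.
rewrite (@eq_Rintegral _ _ _ _ _ (mode k (Complex 0 (-1)))).
  by rewrite E2/= mulr0 mulr0 oppr0; case: eqP.
by move=> x _; rewrite /mode /= mul1r mulN1r mul0r sub0r opprK.
Qed.

Lemma fourier_mode l c k : four (mode l c) k =
  Complex 2^-1 0 * (c * (k == l)%:R + conjc c * (k == - l)%:R).
Proof.
rewrite (_ : mode l c = fun x => mode l c x * 1); last by apply/funext => x; rewrite mulr1.
have i1 : L1 (fun=> 1) by apply: bm_integrable; exact: bm_cst.
rewrite (fourier_mode_mul _ _ _ i1).
by rewrite !fourier_cst1 subr_eq0 addr_eq0.
Qed.

(** The factor 2 comes from bounding the real and the imaginary part separately. *)
Lemma fourier_bound u k (M : R) : L1 u -> (forall x, `|u x| <= M) -> nc (four u k) <= 2 * M.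
Proof.
move=> iu uM; apply: le_trans (nc_leReIm _) _ => /=.
have N0 : 0 < (2 * pi : R) ^+ d by rewrite exprn_gt0// mulr_gt0// pi_gt0.
have N0' : 0 <= ((2 * pi : R) ^+ d)^-1 by rewrite invr_ge0 ltW.
have K (g : 'rV[R]_d -> R) : bm g -> (forall x, `|g x| <= 1) ->
    `|((2 * pi) ^+ d)^-1 * \int[mu]_x (u x * g x)| <= M.
  move=> bg g1; rewrite normrM ger0_norm// mulrC ler_pdivrMr//.
  have := @torus_mass R d => /(congr1 fine) /= <-.
  apply: Rint_le_norm; first exact: integrable_bmM.
  move=> x; rewrite normrM -[leRHS]mulr1; apply: ler_pM => //.
rewrite normrN (_ : 2 * M = M + M); last by ring.
apply: lerD; apply: K.
- exact: bm_cosk.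
- by move=> x; rewrite ler_norml cos_geN1 cos_le1.
- exact: bm_sink.
- by move=> x; rewrite ler_norml sin_geN1 sin_le1.
Qed.

Definition herm (a : Zd -> R[i]) := forall k, a (- k) = conjc (a k).

Definition psum K (a : Zd -> R[i]) x := \sum_(k <- modes K) mode k (a k) x.

Lemma bm_psum K a : bm (psum K a).
Proof. by apply: bm_sum => k; exact: bm_mode. Qed.

(** The modes at k and at - k each contribute one half of [a k]. This is where [a] has to be
    Hermitian and [modes K] symmetric. *)
Lemma fourier_psum K a k : herm a -> four (psum K a) k = if k \in modes K then a k else 0.
Proof.
move=> ha; rewrite fourier_sum; last by move=> l; exact: (bm_integrable mu (bm_mode l (a l))).
under eq_bigr do rewrite fourier_mode.
rewrite -mulr_sumr big_split/=.
have S (F : Zd -> R[i]) m : \sum_(i <- modes K) F i * (m == i)%:R = if m \in modes K then F m else 0.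
  case: ifPn => mK.
    rewrite (bigD1_seq m)//= ?modes_uniq// eqxx mulr1 big1 ?addr0// => i.
    by rewrite eq_sym => /negbTE ->; rewrite mulr0.
  rewrite big_seq big1// => i iK; rewrite (_ : (m == i) = false) ?mulr0//.
  by apply: contraNF mK => /eqP ->.
have -> : \sum_(i <- modes K) conjc (a i) * (k == - i)%:R =
    \sum_(i <- modes K) conjc (a i) * ((- k) == i)%:R.
  by apply: eq_bigr => i _; rewrite eqr_oppLR.
rewrite !S modesN; case: ifP => _; last by rewrite addr0 mulr0.
by rewrite ha conjcK -mulr2n -mulr_natl; apply: complex_eqP; case: (a k) => p q /=; field.
Qed.

End fourier.

End mode.

(** * The exponential nonlinearity *)

Section exp_series.
Context {R : realType}.

Definition exp_partial M (x : R) := \sum_(0 <= n < M) x ^+ n / n`!%:R.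

Lemma exp_partial_cvg x : exp_partial M x @[M --> \oo] --> expR x.
Proof. exact: (is_cvg_series_exp_coeff x). Qed.

Lemma exp_partial_nd (x : R) M N : 0 <= x -> (M <= N)%N -> exp_partial M x <= exp_partial N x.
Proof.
move=> x0 MN; rewrite /exp_partial (@big_cat_nat _ _ _ M 0 N)//= lerDl.
by apply: sumr_ge0 => n _; rewrite divr_ge0 ?exprn_ge0.
Qed.

Lemma exp_partial_le (x : R) M : 0 <= x -> exp_partial M x <= expR x.
Proof.
move=> x0; apply: cvgr_to_ge (@exp_partial_cvg x) _.
by near=> N; apply: exp_partial_nd => //; near: N; exact: nbhs_infty_ge.
Unshelve. all: by end_near. Qed.

(** Termwise comparison of the tails beyond [M]; the value at [A] makes the convergence uniform on
    [-A, A]. *)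
Lemma exp_partial_dist (x A : R) M : `|x| <= A ->
  `|expR x - exp_partial M x| <= expR A - exp_partial M A.
Proof.
move=> xA; have A0 : 0 <= A by apply: le_trans xA.
have c1 : `|exp_partial N x - exp_partial M x| @[N --> \oo] --> `|expR x - exp_partial M x|.
  by apply: cvg_norm; apply: cvgB; [exact: exp_partial_cvg|exact: cvg_cst].
apply: cvgr_to_le c1 _.
near=> N; have MN : (M <= N)%N by near: N; exact: nbhs_infty_ge.
apply: (@le_trans _ _ (exp_partial N A - exp_partial M A)); last first.
  by rewrite lerD2r exp_partial_le.
have E y : exp_partial N y - exp_partial M y = \sum_(M <= n < N) y ^+ n / n`!%:R.
  by rewrite /exp_partial (@big_cat_nat _ _ _ M 0 N)//= addrAC subrr add0r.
rewrite !E; apply: le_trans (ler_norm_sum _ _ _) _; apply: ler_sum => n _.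
rewrite normrM normrX [X in _ * X]ger0_norm ?invr_ge0// ler_wpM2r ?invr_ge0//.
by rewrite lerXn2r ?nnegrE.
Unshelve. all: by end_near. Qed.

Lemma exp_partial_unif (A e : R) : 0 < e -> exists M0, forall M, (M0 <= M)%N ->
  forall x, `|x| <= A -> `|expR x - exp_partial M x| <= e.
Proof.
move=> e0; have /cvgrPdist_le/(_ _ e0)[M0 _ H] := @exp_partial_cvg A.
exists M0 => M /H HM x xA; apply: le_trans (exp_partial_dist M xA) _.
exact: le_trans (ler_norm _) HM.
Qed.

(* Bounds the sum of n^4 A^(n-1) / n! over n >= 2: the weight |k|^4 spread by convexity over
   the n factors of v^n in e^(-v) - 1 + v. *)
Definition growth (a : R) := expR a * (a ^+ 3 + 6 * a ^+ 2 + 7 * a + 1) - 1.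

Lemma growthE (a : R) : crystal_delta a = 1 - growth a.
Proof. by rewrite /crystal_delta /growth; ring. Qed.

(** In the exponential series the factor m cancels against m! and costs one factor [A]. Taking [F]
    at the predecessor allows iteration on the falling products m (m - 1) (m - 2). *)
Lemma exp_moment (A : R) (F : nat -> R) M : 0 <= A -> (forall m, 0 <= F m) ->
  \sum_(0 <= m < M) m%:R * F m.-1 * (A ^+ m / m`!%:R) <=
  A * \sum_(0 <= m < M) F m * (A ^+ m / m`!%:R).
Proof.
move=> A0 F0; case: M => [|M]; first by rewrite !big_geq// mulr0.
rewrite big_nat_recl// !mul0r add0r.
apply: (@le_trans _ _ (A * \sum_(0 <= m < M) F m * (A ^+ m / m`!%:R))).
  rewrite mulr_sumr; apply: ler_sum => m _ /=; rewrite factS natrM exprS invfM.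
  rewrite le_eqVlt; apply/orP; left; apply/eqP; field.
  by rewrite nat1r !pnatr_eq0 -lt0n fact_gt0.
apply: ler_wpM2l => //; rewrite [leRHS]big_nat_recr//= lerDl.
by rewrite mulr_ge0// divr_ge0// exprn_ge0.
Qed.

(** After the shift n = m + 1 the sum becomes a third moment of the exponential series. The missing
    term n = 1 is the 1 that [growth] subtracts. *)
Lemma growth_sum (A : R) M : 0 <= A ->
  \sum_(2 <= n < M) n%:R ^+ 4 * A ^+ n.-1 / n`!%:R <= growth A.
Proof.
move=> A0; rewrite /growth lerBrDr.
have [M2|M2] := leqP M 1.
  rewrite big_geq ?(leq_trans M2)// add0r; have H := expR_ge1Dx A.
  have A2 : 0 <= A ^+ 2 by rewrite exprn_ge0.
  have A3 : 0 <= A ^+ 3 by rewrite exprn_ge0.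
  by rewrite -[leLHS]mulr1; apply: ler_pM => //; lra.
case: M M2 => // M M1.
apply: (@le_trans _ _ (\sum_(0 <= m < M) m.+1%:R ^+ 3 * (A ^+ m / m`!%:R))).
  case: M M1 => // M _; rewrite [leRHS]big_nat_recl//= expr0 fact0 divr1 mulr1 expr1n [leRHS]addrC lerD2r.
  rewrite big_add1 big_add1/=; apply: ler_sum => m _.
  rewrite le_eqVlt; apply/orP; left; apply/eqP; rewrite (factS m.+1) natrM.
  have f0 : (m.+1)`!%:R != 0 :> R by rewrite pnatr_eq0 -lt0n fact_gt0.
  have n0 : m.+2%:R != 0 :> R by rewrite pnatr_eq0.
  move: (m.+2%:R) n0 ((m.+1)`!%:R) f0 => p p0 q q0.
  by field; rewrite p0 q0.
(* Expansion of (m + 1)^3 in falling factorials; the Stirling numbers 1, 6, 7, 1 become the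
   coefficients of [growth]. *)
have id3 m : m.+1%:R ^+ 3 = m%:R * (m.-1%:R * (m.-2%:R * 1)) + 6 * (m%:R * (m.-1%:R * 1)) + 7 * (m%:R * 1) + 1 :> R.
  case: m => [|[|m]]; rewrite /= ?mulr0 ?mul0r -?natr1; ring.
have id4 m c : m.+1%:R ^+ 3 * c = m%:R * (m.-1%:R * (m.-2%:R * 1)) * c +
    6 * (m%:R * (m.-1%:R * 1) * c) + 7 * (m%:R * 1 * c) + c :> R by rewrite id3; ring.
under eq_bigr do rewrite id4.
rewrite !big_split/= -!mulr_sumr.
have e := exp_partial_le M A0.
have E0 : 0 <= expR A by exact: expR_ge0.
have m1 F (F0 : forall m, 0 <= F m) C : \sum_(0 <= m < M) F m * (A ^+ m / m`!%:R) <= C ->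
    \sum_(0 <= m < M) m%:R * F m.-1 * (A ^+ m / m`!%:R) <= A * C.
  by move=> H; apply: le_trans (exp_moment M A0 F0) _; rewrite ler_wpM2l.
have h0 : \sum_(0 <= m < M) 1 * (A ^+ m / m`!%:R) <= expR A by under eq_bigr do rewrite mul1r.
have h1 := m1 (fun=> 1) (fun=> ler01) _ h0.
have h2 := m1 (fun m => m%:R * 1) _ _ h1.
have h3 := m1 (fun m => m%:R * (m.-1%:R * 1)) _ _ (h2 _).
have -> : expR A * (A ^+ 3 + 6 * A ^+ 2 + 7 * A + 1) = A * (A * (A * expR A)) +
  6 * (A * (A * expR A)) + 7 * (A * expR A) + expR A by ring.
apply: lerD => //; apply: lerD; [apply: lerD|].
- by apply: h3 => // m; rewrite !mulr1 ?mulr_ge0.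
- by rewrite ler_wpM2l// h2// => m; rewrite mulr1.
- by rewrite ler_wpM2l.
Qed.

End exp_series.

Section sn_more.
Context {R : realType} {I : countType} (B : (I -> R) -> R -> Prop) (nB : seqnorm B).

Lemma sn_0 : B (fun=> 0) 0.
Proof. by apply: (sn_ball1 nB) => // s us; rewrite big1. Qed.

Lemma sn_sum (J : Type) (s : seq J) (F : J -> I -> R) (X : J -> R) :
  (forall j k, 0 <= F j k) -> (forall j, B (F j) (X j)) ->
  B (fun k => \sum_(j <- s) F j k) (\sum_(j <- s) X j).
Proof.
move=> F0 FX; elim: s => [|j s IH].
  rewrite big_nil; apply: (sn_le nB) sn_0 => k; by rewrite big_nil lexx.
rewrite big_cons; apply: (sn_le nB (g := fun k => F j k + \sum_(j <- s) F j k)).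
  by move=> k; rewrite big_cons lexx addr_ge0// sumr_ge0.
by apply: (snD nB) => // k; rewrite sumr_ge0.
Qed.

Lemma sn_eq f g X : f =1 g -> B f X -> B g X.
Proof. by move=> /funext ->. Qed.

End sn_more.

Lemma sum_delta {V : pzSemiRingType} {I : eqType} (s : seq I) (F : I -> V) m : uniq s ->
  \sum_(i <- s) F i * (m == i)%:R = if m \in s then F m else 0.
Proof.
move=> us; case: ifPn => ms.
  rewrite (bigD1_seq m)//= eqxx mulr1 big1; first by rewrite addr0.
  by move=> i; rewrite eq_sym => /negbTE ->; rewrite mulr0.
rewrite big_seq big1// => i si; rewrite (_ : (m == i) = false) ?mulr0//.
by apply: contraNF ms => /eqP ->.
Qed.

(* The weights for which the convolution estimates lose at most n^4 on an n-fold product. *)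
Record subquartic {R : realType} {d : nat} (om : 'rV[int]_d -> R) : Prop := Subquartic {
  sq_zero : om 0 = 0 ;
  sq_ge0 : forall k, 0 <= om k ;
  sq_opp : forall k, om (- k) = om k ;
  sq_conv : forall (N : R) k l, 0 < N ->
    om (k + l) <= (1 + N^-1) ^+ 3 * om k + (1 + N) ^+ 3 * om l }.

Lemma subquartic4 {R : realType} {d : nat} : subquartic (fun k => @normk R d k ^+ 4).
Proof.
split=> [|k|k|N k l].
- by rewrite normk0 expr0n.
- by rewrite exprn_ge0// normk_ge0.
- by rewrite normkN.
- exact: normk4_convex.
Qed.

(** For the square, the first powers of the two factors do, and these are at most their cubes. This
    weight yields the H^2 bound of e^(-v) and thereby its uniform tails. *)
Lemma subquartic2 {R : realType} {d : nat} : subquartic (fun k => @normk R d k ^+ 2).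
Proof.
split=> [|k|k|N k l N0].
- by rewrite normk0 expr0n.
- by rewrite sqr_ge0.
- by rewrite normkN.
have p (x : R) : 1 <= x -> x <= x ^+ 3 by move=> x1; rewrite exprSr ler_peMl ?exprn_ege1// (le_trans _ x1).
apply: (@le_trans _ _ ((1 + N^-1) * normk R k ^+ 2 + (1 + N) * normk R l ^+ 2)).
  apply: le_trans (sqrrD_convex _ _ N0).
  by rewrite lerXn2r ?nnegrE ?addr_ge0 ?normk_ge0// normkD.
have i0 : 0 <= N^-1 by rewrite invr_ge0 ltW.
by rewrite lerD// ler_wpM2r ?sqr_ge0// p// lerDl// ltW.
Qed.

Section convolution.
Context {R : realType} {d : nat}.
Local Notation Zd := 'rV[int]_d.
Local Notation nk := (@normk R d).
Local Notation nc := (@ComplexField.Normc.normc R).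
Variable (B : (Zd -> R) -> R -> Prop) (nB : seqnorm B).
Variable (K : nat) (al : Zd -> R) (al0 : forall k, 0 <= al k).
Variables (A : R) (alA : \sum_(l <- modes K) al l <= A).
Local Notation S := (modes K).

(** Multiplication by a real mode of frequency l shifts coefficients by l and by - l, with half the
    amplitude each. This is the resulting majorant for the product with a partial sum. *)
Definition conv (f g : Zd -> R) k := \sum_(l <- S) f l / 2 * (g (k - l) + g (k + l)).

Lemma conv_ge0 f g : (forall k, 0 <= f k) -> (forall k, 0 <= g k) -> forall k, 0 <= conv f g k.
Proof. by move=> f0 g0 k; apply: sumr_ge0 => l _; rewrite mulr_ge0 ?divr_ge0 ?addr_ge0. Qed.

Lemma conv_ball g Y : (forall k, 0 <= g k) -> B g Y -> B (conv al g) (A * Y).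
Proof.
move=> g0 gY; have Y0 := sn_ge0 nB gY.
apply: (sn_leX nB (X := \sum_(l <- S) al l / 2 * (Y + Y))).
  rewrite (eq_bigr (fun l => al l * Y)); last by move=> l _; field.
  by rewrite -mulr_suml ler_wpM2r.
apply: (sn_sum nB) => l.
  by move=> k; rewrite mulr_ge0 ?divr_ge0 ?addr_ge0.
apply: (snZ nB); first by rewrite divr_ge0.
apply: (snD nB) => //.
  by apply: (sn_inj nB (h := fun k => k - l)) => //; exact: addIr.
by apply: (sn_inj nB (h := fun k => k + l)) => //; exact: addIr.
Qed.

(** Moves the factor that carries the weight to the innermost place, where [conv_delta] bounds
    it. *)
Lemma conv_swap f g k : conv f (conv al g) k = conv al (conv f g) k.
Proof.
rewrite /conv.
under eq_bigr do rewrite -big_split/= mulr_sumr.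
rewrite exchange_big/=; apply: eq_bigr => m _.
rewrite -big_split/= mulr_sumr; apply: eq_bigr => l _.
by rewrite (addrAC k (- l) (- m)) (addrAC k (- l) m) (addrAC k l (- m)) (addrAC k l m); ring.
Qed.

(** The n-fold convolution power, starting from the coefficients of the constant 1; it dominates the
    coefficients of the n-th power of a partial sum. *)
Fixpoint gam n : Zd -> R :=
  if n is n'.+1 then conv al (gam n') else fun k => (k == 0)%:R.

Lemma gam_ge0 n k : 0 <= gam n k.
Proof. by elim: n k => [|n IH] k //=; exact: conv_ge0. Qed.

Variables (om : Zd -> R) (omq : subquartic om).

Let om_ge0 k : 0 <= om k. Proof. exact: (sq_ge0 omq). Qed.

Variables (X : R) (omX : B (fun k => if k \in S then om k * al k else 0) X).

Let oal k := om k * al k.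
Let oal0 k : 0 <= oal k. Proof. exact: mulr_ge0. Qed.

Lemma conv_delta f : B (fun k => if k \in S then f k else 0) X -> (forall k, 0 <= f k) ->
  B (conv f (gam 0)) X.
Proof.
move=> fX f0; have E : forall k, conv f (gam 0) k = 2^-1 * (if k \in S then f k else 0) +
    2^-1 * (if - k \in S then f (- k) else 0).
  move=> k; rewrite /conv /=.
  under eq_bigr do rewrite mulrDr.
  have D m : \sum_(l <- S) f l / 2 * (m == l)%:R = 2^-1 * (if m \in S then f m else 0).
    rewrite sum_delta ?modes_uniq//; case: ifP => _; last by rewrite mulr0.
    exact: mulrC.
  rewrite big_split/= -!D; congr (_ + _); apply: eq_bigr => l _.
    by rewrite subr_eq0.
  by rewrite addr_eq0 eqr_oppLR.
apply: (sn_eq (f := fun k => 2^-1 * (if k \in S then f k else 0) +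
    2^-1 * (if - k \in S then f (- k) else 0))) => [k|]; first by rewrite E.
have -> : X = 2^-1 * X + 2^-1 * X by field.
apply: (snD nB) => [k|k||].
- by rewrite mulr_ge0//; case: ifP.
- by rewrite mulr_ge0//; case: ifP.
- exact: (snZ nB).
- apply: (snZ nB) => //; apply: (sn_inj nB (h := fun k => - k) _ fX); exact: oppr_inj.
Qed.

Lemma conv_gam_ball n : B (conv oal (gam n)) (A ^+ n * X).
Proof.
have fam k : 0 <= conv oal (gam n) k by apply: conv_ge0 => // l; exact: gam_ge0.
elim: n fam => [|n IH] _; first by rewrite mul1r; exact: conv_delta.
apply: (sn_eq (f := conv al (conv oal (gam n)))) => [k|]; first by rewrite conv_swap.
by rewrite exprS -mulrA; apply: conv_ball;
  [apply: conv_ge0 => // l; exact: gam_ge0|apply: IH => k; apply: conv_ge0 => // l; exact: gam_ge0].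
Qed.

(** The weight is distributed by [sq_conv] with N equal to the number of factors already multiplied.
    The induction closes exactly: (1 + 1/p)^3 p^4 + (1 + p)^3 = (p + 1)^4 with p = n + 1. *)
Lemma om_gam_ball n : B (fun k => om k * gam n.+1 k) (n.+1%:R ^+ 4 * A ^+ n * X).
Proof.
have A0 : 0 <= A by apply: le_trans alA; exact: sumr_ge0.
have X0 := sn_ge0 nB omX.
elim: n => [|n IH].
  rewrite expr1n !mul1r; apply: (sn_eq (f := conv oal (gam 0))); last exact: conv_delta.
  move=> k; rewrite /= /conv mulr_sumr; apply: eq_bigr => l _ /=.
  rewrite /oal subr_eq0 addr_eq0; case: (eqVneq k l) => [->|_]; case: (eqVneq k (- l)) => [E|_];
    rewrite /= ?E ?(sq_opp omq); ring.
have N0 : 0 < n.+1%:R :> R by [].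
pose c1 : R := (1 + n.+1%:R^-1) ^+ 3; pose c2 : R := (1 + n.+1%:R) ^+ 3.
have c10 : 0 <= c1 by rewrite exprn_ge0 ?addr_ge0 ?invr_ge0.
have c20 : 0 <= c2 by rewrite exprn_ge0 ?addr_ge0.
have g0 : forall k, 0 <= om k * gam n.+1 k by move=> k; rewrite mulr_ge0 ?gam_ge0.
have gg0 := gam_ge0.
have G0 : forall k, 0 <= conv al (fun k => om k * gam n.+1 k) k by exact: conv_ge0.
have G1 : forall k, 0 <= conv oal (gam n.+1) k by exact: conv_ge0.
apply: (sn_le nB (g := fun k => c1 * conv al (fun k => om k * gam n.+1 k) k + c2 * conv oal (gam n.+1) k)).
  move=> k; rewrite mulr_ge0 ?gam_ge0//=.
  have gk0 : forall k, 0 <= conv al (gam n) k := gg0 n.+1.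
  move: (conv al (gam n)) gk0 => g gk0; rewrite /conv !mulr_sumr -big_split/=.
  apply: ler_sum => l _.
  have o1 : om k <= c1 * om (k - l) + c2 * om l.
    by rewrite -[in om k](subrK l k) (sq_conv omq).
  have o2 : om k <= c1 * om (k + l) + c2 * om l.
    by rewrite -[in om k](addrK l k) -(sq_opp omq l) (sq_conv omq).
  rewrite /oal mulrCA.
  have -> : c1 * (al l / 2 * (om (k - l) * g (k - l) + om (k + l) * g (k + l))) +
    c2 * (om l * al l / 2 * (g (k - l) + g (k + l))) =
    al l / 2 * ((c1 * om (k - l) + c2 * om l) * g (k - l) +
                (c1 * om (k + l) + c2 * om l) * g (k + l)) by ring.
  apply: ler_wpM2l; first by rewrite divr_ge0.
  by rewrite mulrDr; apply: lerD; apply: ler_wpM2r.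
apply: (sn_leX nB (X := c1 * (A * (n.+1%:R ^+ 4 * A ^+ n * X)) + c2 * (A ^+ n.+1 * X))).
  rewrite le_eqVlt; apply/orP; left; apply/eqP; rewrite /c1 /c2 (exprS A).
  have -> : n.+2%:R = n.+1%:R + 1 :> R by rewrite natr1.
  have p0 : n.+1%:R != 0 :> R by rewrite gt_eqF.
  by move: (n.+1%:R : R) p0 => p p0; field.
apply: (snD nB).
- by move=> k; rewrite mulr_ge0.
- by move=> k; rewrite mulr_ge0.
- by apply: (snZ nB) => //; exact: conv_ball.
- by apply: (snZ nB) => //; exact: conv_gam_ball.
Qed.

End convolution.

Arguments ComplexField.Normc.normc : simpl never.
Arguments fourier : simpl never.

Section nonlinearity.
Context {R : realType} {d : nat}.
Local Notation Zd := 'rV[int]_d.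
Local Notation mu := (torus_measure R d).
Local Notation nk := (@normk R d).
Local Notation nc := (@ComplexField.Normc.normc R).
Local Notation four := (@fourier R d).
Local Notation L1 u := (mu.-integrable setT (EFin \o u)).
Implicit Types (a : Zd -> R[i]) (u w : 'rV[R]_d -> R).

Lemma nc_fourier_psum_mul K a w k : bm w ->
  nc (four (fun x => psum K a x * w x) k) <= conv K (fun k => nc (a k)) (fun k => nc (four w k)) k.
Proof.
move=> bw; rewrite (_ : (fun x => psum K a x * w x) = fun x => \sum_(l <- modes K) (mode l (a l) x * w x)); last first.
  by apply/funext => x; rewrite /psum mulr_suml.
rewrite fourier_sum; last by move=> l; apply: bm_integrable; apply: bmM => //; exact: bm_mode.
rewrite /conv; elim: (modes K) => [|l s IH]; first by rewrite !big_nil nc0.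
rewrite !big_cons; apply: le_trans (ncD _ _) _; apply: lerD => //.
rewrite fourier_mode_mul; last exact: bm_integrable.
rewrite ncM nc_real ger0_norm// mulrC -mulrA [2^-1 * _]mulrC mulrA.
rewrite ler_wpM2r// (le_trans (ncD _ _))// mulrDr !ncM nc_conj//.
Qed.

Lemma nc_fourier_pow K a n k :
  nc (four (fun x => psum K a x ^+ n) k) <= gam K (fun k => nc (a k)) n k.
Proof.
elim: n k => [|n IH] k.
  rewrite (_ : (fun x => psum K a x ^+ 0) = fun=> 1); last by apply/funext => x; rewrite expr0.
  by rewrite fourier_cst1; rewrite [leRHS]/=; case: eqP => _; rewrite ?nc0// -[1]/(Complex 1 0) nc_real normr1.
rewrite [leRHS]/= (_ : (fun x => psum K a x ^+ n.+1) = fun x => psum K a x * psum K a x ^+ n); last first.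
  by apply/funext => x; rewrite exprS.
apply: le_trans (nc_fourier_psum_mul _ _ _ (bmX n (bm_psum K a))) _.
apply: ler_sum => l _; apply: ler_wpM2l; first by rewrite divr_ge0// nc_ge0.
exact: lerD.
Qed.

Lemma psum_bound K a x : `|psum K a x| <= \sum_(k <- modes K) nc (a k).
Proof. by apply: le_trans (ler_norm_sum _ _ _) _; apply: ler_sum => k _; exact: mode_bound. Qed.

Lemma fourier_unif_cvg (u : 'rV[R]_d -> R) (F : nat -> 'rV[R]_d -> R) (s : seq Zd) (e : R) : 
  bm u -> (forall M, bm (F M)) ->
  (forall e, 0 < e -> exists M0, forall M, (M0 <= M)%N -> forall x, `|u x - F M x| <= e) ->
  0 < e -> exists M0, forall M, (M0 <= M)%N -> forall k,
    nc (four u k - four (F M) k) <= e.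
Proof.
move=> bu bF Fu e0; have [|M0 H] := Fu (e / 2); first by rewrite divr_gt0.
exists M0 => M /H HM k; rewrite -fourierB; [|exact: bm_integrable|exact: bm_integrable].
have -> : e = 2 * (e / 2) by field.
by apply: fourier_bound => //; apply: bm_integrable; exact: bmB.
Qed.

Variables (om : Zd -> R) (omq : subquartic om).
Let w0 k : 0 <= om k. Proof. exact: (sq_ge0 omq). Qed.

(** Lower semicontinuity of the weighted norm: uniform convergence of functions gives convergence of
    each coefficient, and on a finite set the weight is bounded by [W]. *)
Lemma sn_fourier_lim (B : (Zd -> R) -> R -> Prop) (nB : seqnorm B) u (F : nat -> 'rV[R]_d -> R) X :
  bm u -> (forall M, bm (F M)) ->
  (forall e, 0 < e -> exists M0, forall M, (M0 <= M)%N -> forall x, `|u x - F M x| <= e) ->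
  (forall M, B (fun k => om k * nc (four (F M) k)) X) ->
  B (fun k => om k * nc (four u k)) X.
Proof.
move=> bu bF Fu BF.
apply: (sn_lim nB) => [k|s e e0]; first by rewrite mulr_ge0 ?nc_ge0// w0.
pose W : R := \sum_(k <- s) om k.
have W0 : 0 <= W by apply: sumr_ge0 => k _.
have [||||M0 HM] := @fourier_unif_cvg u F s (e / (1 + W)) => //.
  by rewrite divr_gt0// ltr_pwDl.
exists (fun k => om k * nc (four (F M0) k)) => // k ks.
have nk0 := w0 k.
split; first by rewrite mulr_ge0 ?nc_ge0.
have -> : four u k = four (F M0) k + (four u k - four (F M0) k) by rewrite addrC subrK.
apply: le_trans (_ : om k * (nc (four (F M0) k) + e / (1 + W)) <= _).
  by apply: ler_wpM2l => //; apply: le_trans (ncD _ _) _; rewrite lerD2l HM.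
rewrite mulrDr lerD2l mulrCA ger_pMr// ler_pdivrMr ?mul1r ?ltr_pwDl//.
by rewrite ler_wpDl// /W (big_rem k)//= lerDl sumr_ge0.
Qed.

Section finite.
Variables (B : (Zd -> R) -> R -> Prop) (nB : seqnorm B).
Variables (K : nat) (a : Zd -> R[i]) (A X : R).
Hypothesis alA : \sum_(l <- modes K) nc (a l) <= A.
Hypothesis omX : B (fun k => if k \in modes K then om k * nc (a k) else 0) X.

Let A0 : 0 <= A. Proof. by apply: le_trans alA; apply: sumr_ge0 => l _; exact: nc_ge0. Qed.
Let X0 : 0 <= X. Proof. exact: (sn_ge0 nB omX). Qed.

Lemma exp_term_ball n : B (fun k => om k * nc (four (fun x => (- psum K a x) ^+ n.+1 / (n.+1)`!%:R) k))
   (n.+1%:R ^+ 4 * A ^+ n / (n.+1)`!%:R * X).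
Proof.
have f0 : 0 < (n.+1)`!%:R :> R by rewrite ltr0n fact_gt0.
have fi0 : 0 <= (n.+1)`!%:R^-1 :> R by rewrite invr_ge0 ltW.
rewrite mulrAC mulrC.
apply: (sn_le nB (g := fun k => (n.+1)`!%:R^-1 * (om k * gam K (fun k => nc (a k)) n.+1 k))).
  move=> k; rewrite mulr_ge0 ?nc_ge0//= mulrCA ler_wpM2l//.
  rewrite (_ : (fun x => (- psum K a x) ^+ n.+1 / (n.+1)`!%:R) = fun x => ((-1) ^+ n.+1 / (n.+1)`!%:R) * psum K a x ^+ n.+1); last first.
    by apply/funext => x; rewrite -[- _]mulN1r exprMn mulrAC.
  rewrite fourierZ; last by apply: bm_integrable; apply: bmX; exact: bm_psum.
  rewrite ncM nc_real normrM normrX normrN1 expr1n mul1r ger0_norm//.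
  by apply: ler_wpM2l => //; exact: (nc_fourier_pow K a n.+1 k).
apply: (snZ nB) => //.
by apply: om_gam_ball => // k; exact: nc_ge0.
Qed.

Let expF m M x := \sum_(m <= n < M) (- psum K a x) ^+ n / n`!%:R.

Lemma exp_tail_ball m M G : (0 < m)%N ->
  \sum_(m <= n < M) n%:R ^+ 4 * A ^+ n.-1 / n`!%:R <= G ->
  B (fun k => om k * nc (four (expF m M) k)) (G * X).
Proof.
move=> m0 sG.
apply: (sn_leX nB (X := \sum_(m <= n < M) (n%:R ^+ 4 * A ^+ n.-1 / n`!%:R * X))).
  by rewrite -mulr_suml ler_wpM2r.
have bt n : bm (fun x => (- psum K a x) ^+ n / n`!%:R).
  by apply: bmM; [apply: bmX; apply: bmN; exact: bm_psum|exact: bm_cst].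
pose F n k := om k * nc (four (fun x => (- psum K a x) ^+ n / n`!%:R) k).
apply: (sn_le nB (g := fun k => \sum_(n <- index_iota m M) F n k)).
  move=> k; rewrite mulr_ge0 ?nc_ge0//= /expF fourier_sum; last by move=> n; exact: bm_integrable.
  rewrite -mulr_sumr ler_wpM2l//; elim: (index_iota m M) => [|n s IH].
    by rewrite !big_nil nc0.
  by rewrite !big_cons (le_trans (ncD _ _))// lerD2l.
(* The bound [exp_term_ball] concerns positive powers only. The summands are replaced by ones that
   vanish at index 0, which is out of range because 0 < m. *)
have E (G1 G2 : nat -> R) (H : forall n, (0 < n)%N -> G1 n = G2 n) : 
    \sum_(m <= n < M) G1 n = \sum_(m <= n < M) G2 n.
  by apply: eq_big_nat => n /andP[mn _]; apply: H; exact: leq_trans mn.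
rewrite (E _ (fun n => if n is n'.+1 then n'.+1%:R ^+ 4 * A ^+ n' / (n'.+1)`!%:R * X else 0)); last by case.
rewrite (_ : (fun k => _) = fun k => \sum_(m <= n < M) (if n is n'.+1 then F n'.+1 k else 0)); last first.
  by apply/funext => k; apply: E; case.
apply: (sn_sum nB) => [[|n] k //|[|n]].
- by rewrite /F mulr_ge0 ?nc_ge0.
- exact: sn_0.
- exact: exp_term_ball.
Qed.

Let vA x : `|- psum K a x| <= A.
Proof. by rewrite normrN (le_trans (psum_bound _ _ _)). Qed.

Let bexp : bm (fun x => expR (- psum K a x)).
Proof. by apply: bm_expR; apply: bmN; exact: bm_psum. Qed.

Let bexpF m M : bm (expF m M).
Proof.
by apply: bm_sum => n; apply: bmM; [apply: bmX; apply: bmN; exact: bm_psum|exact: bm_cst].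
Qed.

(** Removing the terms of order 0 and 1 of the exponential series leaves the sum estimated in
    [growth_sum]; uniform convergence on [-A, A] passes from the truncated series to the
    exponential. *)
Lemma nonlin_ball : B (fun k => om k *
   nc (four (fun x => expR (- psum K a x) - 1 + psum K a x) k)) (growth A * X).
Proof.
apply: (sn_fourier_lim nB (F := expF 2)).
- by apply: bmD; [apply: bmB => //; exact: bm_cst|exact: bm_psum].
- by [].
- move=> e e0; have [M0 H] := exp_partial_unif A e0.
  exists (maxn 2 M0) => M; rewrite geq_max => /andP[M2 /H HM] x.
  rewrite (_ : _ - _ = expR (- psum K a x) - exp_partial M (- psum K a x)) ?HM//.
  rewrite /exp_partial (@big_cat_nat _ _ _ 2 0 M)//= big_nat_recl// big_nat1.
  by rewrite -/(expF 2 M x) expr0 expr1 (_ : 0`! = 1%N)// (_ : 1`! = 1%N)// !divr1; ring.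
- by move=> M; apply: exp_tail_ball => //; exact: growth_sum.
Qed.

(** The constant term only affects k = 0, where [om] vanishes; the linear term accounts for the 1 in
    1 + growth A. *)
Lemma expN_psum_ball : B (fun k => om k * nc (four (fun x => expR (- psum K a x)) k))
   ((1 + growth A) * X).
Proof.
apply: (sn_eq (f := fun k => om k * nc (four (fun x => expR (- psum K a x) - 1) k))).
  move=> k; case: (eqVneq k 0) => [->|k0]; first by rewrite (sq_zero omq) !mul0r.
  rewrite fourierB; [|exact: bm_integrable|by apply: bm_integrable; exact: bm_cst].
  by rewrite fourier_cst1 (negbTE k0) subr0.
apply: (sn_fourier_lim nB (F := expF 1)).
- by apply: bmB => //; exact: bm_cst.
- by [].
- move=> e e0; have [M0 H] := exp_partial_unif A e0.
  exists (maxn 1 M0) => M; rewrite geq_max => /andP[M2 /H HM] x.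
  rewrite (_ : _ - _ = expR (- psum K a x) - exp_partial M (- psum K a x)) ?HM//.
  rewrite /exp_partial (@big_cat_nat _ _ _ 1 0 M)//= big_nat1.
  by rewrite -/(expF 1 M x) expr0 (_ : 0`! = 1%N)// divr1; ring.
- move=> M; apply: exp_tail_ball => //; case: M => [|[|M]].
  + by rewrite big_geq// addr_ge0// (le_trans _ (@growth_sum _ A 0 A0))// big_geq.
  + by rewrite big_geq// addr_ge0// (le_trans _ (@growth_sum _ A 0 A0))// big_geq.
  + rewrite big_ltn// expr1n expr0 (_ : 1`! = 1%N)// mul1r divr1 lerD2l; exact: growth_sum.
Qed.

End finite.
End nonlinearity.

Section synth.
Context {R : realType} {d : nat}.
Local Notation Zd := 'rV[int]_d.
Local Notation mu := (torus_measure R d).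
Local Notation nk := (@normk R d).
Local Notation nc := (@ComplexField.Normc.normc R).
Local Notation four := (@fourier R d).
Implicit Types (a b : Zd -> R[i]) (x : 'rV[R]_d).

Definition synth a x : R := limn (fun K => psum K a x).

Local Notation offmodes K f := (fun k => if k \in modes K then 0 else f k).

Lemma psum_split a K K' x : (K <= K')%N ->
  psum K' a x = psum K a x + \sum_(k <- modes K' | k \notin modes K) mode k (a k) x.
Proof.
move=> KK; rewrite /psum (bigID (mem (modes K)))/=; congr (_ + _).
rewrite -big_filter; apply: perm_big; apply: uniq_perm; rewrite ?filter_uniq ?modes_uniq// => k.
by rewrite mem_filter andb_idr//; exact: sub_modes.
Qed.

Lemma psum_dist a K K' e x : ball1 (offmodes K (fun k => nc (a k))) e -> (K <= K')%N ->
  `|psum K' a x - psum K a x| <= e.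
Proof.
move=> ae KK; rewrite (psum_split a x KK) addrC addKr.
apply: le_trans (ae _ (modes_uniq K')); apply: le_trans (ler_norm_sum _ _ _) _.
rewrite [leRHS](bigID (mem (modes K)))/= [X in _ <= X + _]big1 ?add0r; last by move=> k ->.
by apply: ler_sum => k /negbTE ->; exact: mode_bound.
Qed.

Lemma nc_ball1_tail a A e : ball1 (fun k => nc (a k)) A -> 0 < e ->
  exists K0, forall K, (K0 <= K)%N -> ball1 (offmodes K (fun k => nc (a k))) e.
Proof.
move=> aA e0; apply: (seqnorm_tail_modes seqnorm_ball1 _ aA e0) => k; exact: nc_ge0.
Qed.

Lemma synth_cvg a A x : ball1 (fun k => nc (a k)) A -> psum K a x @[K --> \oo] --> synth a x.
Proof.
move=> aA; apply/cauchy_cvgP; apply: cauchy_exP => e e0.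
have [|K0 H] := nc_ball1_tail aA (e := e / 2); first by rewrite divr_gt0.
exists (psum K0 a x); exists K0 => // K /= KK; rewrite /ball/= distrC.
by rewrite (le_lt_trans (psum_dist x (H K0 (leqnn _)) KK))// ltr_pdivrMr// ltr_pMr// ltr1n.
Qed.

Lemma synth_dist a A K e x : ball1 (fun k => nc (a k)) A ->
  ball1 (offmodes K (fun k => nc (a k))) e -> `|synth a x - psum K a x| <= e.
Proof.
move=> aA ae.
have c : `|psum K' a x - psum K a x| @[K' --> \oo] --> `|synth a x - psum K a x|.
  by apply: cvg_norm; apply: cvgB; [exact: (@synth_cvg a A x aA)|exact: cvg_cst].
apply: cvgr_to_le c _; near=> K'; apply: psum_dist => //.
by near: K'; exact: nbhs_infty_ge.
Unshelve. all: by end_near. Qed.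

Lemma synth_unif a A e : ball1 (fun k => nc (a k)) A -> 0 < e ->
  exists K0, forall K, (K0 <= K)%N -> forall x, `|synth a x - psum K a x| <= e.
Proof.
move=> aA e0; have [K0 H] := nc_ball1_tail aA e0.
by exists K0 => K /H HK x; exact: synth_dist aA HK.
Qed.

Lemma synth_bound a A x : ball1 (fun k => nc (a k)) A -> `|synth a x| <= A.
Proof.
move=> aA; have c : `|psum K a x| @[K --> \oo] --> `|synth a x|.
  by apply: cvg_norm; exact: (@synth_cvg a A x aA).
apply: cvgr_to_le c _.
by near=> K; rewrite (le_trans (psum_bound _ _ _))// aA// modes_uniq.
Unshelve. all: by end_near. Qed.

Lemma bm_synth a A : ball1 (fun k => nc (a k)) A -> bm (synth a).
Proof.
move=> aA; apply: (@bm_lim _ _ _ (fun K => psum K a) _ A).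
- by move=> K; exact: bm_meas (bm_psum K a).
- by move=> x; exact: (synth_cvg aA).
- by move=> x; exact: synth_bound.
Qed.

Lemma synthB a b A A' x : ball1 (fun k => nc (a k)) A -> ball1 (fun k => nc (b k)) A' ->
  synth (fun k => a k - b k) x = synth a x - synth b x.
Proof.
move=> aA bA; apply/cvg_lim => //.
rewrite (_ : (fun K => _) = fun K => psum K a x - psum K b x).
  by apply: cvgB; [exact: (synth_cvg aA)|exact: (synth_cvg bA)].
apply/funext => K; rewrite /psum -sumrB; apply: eq_bigr => k _.
by rewrite modeD modeN.
Qed.

Lemma synthD a b A A' x : ball1 (fun k => nc (a k)) A -> ball1 (fun k => nc (b k)) A' ->
  synth (fun k => a k + b k) x = synth a x + synth b x.
Proof.
move=> aA bA; apply/cvg_lim => //.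
rewrite (_ : (fun K => _) = fun K => psum K a x + psum K b x).
  by apply: cvgD; [exact: (synth_cvg aA)|exact: (synth_cvg bA)].
apply/funext => K; rewrite /psum -big_split/=; apply: eq_bigr => k _.
by rewrite modeD.
Qed.

Lemma synth_fin a K : synth (fun k => if k \in modes K then a k else 0) = psum K a.
Proof.
apply/funext => x; apply/cvg_lim => //.
rewrite -(cvg_shiftn K); rewrite (_ : [sequence _]_n = fun=> psum K a x); first exact: cvg_cst.
apply/funext => n /=; rewrite (psum_split _ x (leq_addl n K)).
rewrite [X in _ + X]big1 ?addr0; last by move=> k /negbTE ->; rewrite mode0.
by rewrite /psum big_seq [RHS]big_seq; apply: eq_bigr => k ->.
Qed.

Lemma fourier_synth a A : herm a -> ball1 (fun k => nc (a k)) A -> four (synth a) = a.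
Proof.
move=> ha aA; apply/funext => k.
have bs := bm_synth aA.
have : nc (four (synth a) k - a k) <= 0.
  apply/ler_addgt0Pr => e e0; rewrite add0r.
  have [|||K0 H] := @fourier_unif_cvg _ _ (synth a) (fun K => psum K a) [::] e bs => //.
  - by move=> K; exact: bm_psum.
  - by move=> e' e'0; exact: synth_unif aA e'0.
  have [K1 K1k] := modes_cover [:: k].
  have := H (maxn K0 K1) (leq_maxl _ _) k; rewrite fourier_psum//.
  by rewrite (sub_modes (leq_maxr K0 K1)) ?K1k ?mem_head.
move=> n0; apply/eqP; rewrite -subr_eq0; apply/eqP; apply: ComplexField.Normc.eq0_normc.
by apply/le_anti; rewrite n0 nc_ge0.
Qed.

Lemma expR_lip (p q A : R) : `|p| <= A -> `|q| <= A -> `|expR p - expR q| <= expR A * `|p - q|.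
Proof.
have H (x y : R) : `|x| <= A -> y <= x -> `|expR x - expR y| <= expR A * `|x - y|.
  move=> xA yx; rewrite !ger0_norm ?subr_ge0 ?ler_expR//.
  have -> : expR y = expR x * expR (y - x) by rewrite -expRD addrC subrK.
  have e1 := expR_ge1Dx (y - x).
  have ex : expR x <= expR A by rewrite ler_expR (le_trans (ler_norm _)).
  have e0 := expR_gt0 x.
  apply: (@le_trans _ _ (expR x * (x - y))); last by rewrite ler_wpM2r ?subr_ge0.
  by rewrite -[X in X - _]mulr1 -mulrBr ler_wpM2l ?(ltW e0)//; lra.
move=> pA qA; have [pq|/ltW qp] := leP q p; first exact: H.
by rewrite distrC [`|p - q|]distrC; exact: H.
Qed.

Lemma fourier_exp_lip (u w : 'rV[R]_d -> R) A D k : bm u -> bm w -> (forall x, `|u x| <= A) ->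
  (forall x, `|w x| <= A) -> (forall x, `|u x - w x| <= D) ->
  nc (four (fun x => expR (- u x)) k - four (fun x => expR (- w x)) k) <= 2 * (expR A * D).
Proof.
move=> bu bw uA wA uw.
have be (g : 'rV[R]_d -> R) : bm g -> bm (fun x => expR (- g x)).
  by move=> bg; apply: bm_expR; exact: bmN.
rewrite -fourierB; [|by apply: bm_integrable; exact: be..].
apply: fourier_bound.
  by apply: bm_integrable; apply: bmB; exact: be.
move=> x; apply: le_trans (expR_lip (A := A) _ _) _; rewrite ?normrN//.
by rewrite -opprD normrN ler_wpM2l ?expR_ge0// opprK.
Qed.

Lemma exp_unif_lim (u : 'rV[R]_d -> R) (F : nat -> 'rV[R]_d -> R) A : 
  (forall x, `|u x| <= A) -> (forall M x, `|F M x| <= A) ->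
  (forall e, 0 < e -> exists M0, forall M, (M0 <= M)%N -> forall x, `|u x - F M x| <= e) ->
  forall e, 0 < e -> exists M0, forall M, (M0 <= M)%N -> forall x, `|expR (- u x) - expR (- F M x)| <= e.
Proof.
move=> uA FA H e e0; have [|M0 HM] := H (e / expR A); first by rewrite divr_gt0// expR_gt0.
exists M0 => M /HM HMM x; apply: le_trans (expR_lip (A := A) _ _) _; rewrite ?normrN//.
by rewrite -opprD normrN mulrC -ler_pdivlMr ?expR_gt0.
Qed.

Lemma expN_synth_ball om (omq : subquartic om) B (nB : seqnorm B) a A X : ball1 (fun k => nc (a k)) A ->
  B (fun k => om k * nc (a k)) X ->
  B (fun k => om k * nc (four (fun x => expR (- synth a x)) k)) ((1 + growth A) * X).
Proof.
move=> aA aX; have bs := bm_synth aA.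
have pA K : \sum_(l <- modes K) nc (a l) <= A by rewrite aA// modes_uniq.
apply: (sn_fourier_lim omq nB (F := fun K x => expR (- psum K a x))).
- by apply: bm_expR; exact: bmN.
- by move=> K; apply: bm_expR; apply: bmN; exact: bm_psum.
- apply: (@exp_unif_lim _ _ A).
  + by move=> x; exact: synth_bound.
  + by move=> K x; exact: le_trans (psum_bound _ _ _) (pA K).
  + by move=> e e0; exact: synth_unif aA e0.
- move=> K; apply: (expN_psum_ball omq nB) => //.
  have w0 k : 0 <= om k * nc (a k) by rewrite mulr_ge0 ?nc_ge0// (sq_ge0 omq).
  by apply: (sn_le nB) aX => k; case: ifP => _; rewrite w0 lexx.
Qed.

End synth.

(** * Euler scheme and its limit *)

Section euler.
Context {R : realType} {d : nat}.
Local Notation Zd := 'rV[int]_d.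
Local Notation mu := (torus_measure R d).
Local Notation nk := (@normk R d).
Local Notation nc := (@ComplexField.Normc.normc R).
Local Notation four := (@fourier R d).
Variables (N : nat) (tau A H0 : R) (a0 : Zd -> R[i]).
Hypothesis tau0 : 0 < tau.
Hypothesis cfl : forall k, k \in modes N -> tau * nk k ^+ 4 <= 1.
Hypothesis ha0 : herm a0.
Hypothesis a00 : a0 0 = 0.
Hypothesis a0A : \sum_(k <- modes N) nc (a0 k) <= A.
Hypothesis a0H : \sum_(k <- modes N) nk k ^+ 4 * nc (a0 k) ^+ 2 <= H0.
Hypothesis gA : growth A < 1.
Local Notation delta := (1 - growth A).
Local Notation expN a := (fun x : 'rV[R]_d => expR (- psum N a x)).

(* Under the condition cfl a step is a convex combination mode by mode (euler_convex), which
   turns growth A < 1 into monotonicity of the weighted l^1 and l^2 norms. *)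
Definition euler_step (a : Zd -> R[i]) k : R[i] :=
  if k \in modes N then a k + Complex (tau * nk k ^+ 4) 0 * four (expN a) k else 0.

Definition euler j := iter j euler_step (fun k => if k \in modes N then a0 k else 0).

Lemma eulerS j k : k \in modes N ->
  euler j.+1 k = euler j k + Complex (tau * nk k ^+ 4) 0 * four (expN (euler j)) k.
Proof. by move=> kN; rewrite /euler /= -/(euler j) /euler_step kN. Qed.

Lemma euler_supp j k : k \notin modes N -> euler j k = 0.
Proof. by case: j => [|j] /negbTE kN; rewrite /euler /= ?/euler_step kN. Qed.

Let bexpN a : bm (expN a).
Proof. by apply: bm_expR; apply: bmN; exact: bm_psum. Qed.

Lemma euler_herm j : herm (euler j).
Proof.
elim: j => [|j IH] k; rewrite /euler /=.
  by rewrite modesN; case: ifP; rewrite ?ha0// rmorph0.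
rewrite -/(euler j) /euler_step modesN; case: ifP => _; last by rewrite rmorph0.
rewrite rmorphD rmorphM IH normkN fourierN; last exact: bm_integrable.
by congr (_ + _ * _); apply: complex_eqP; rewrite //= oppr0.
Qed.

Lemma euler_zero j : euler j 0 = 0.
Proof.
elim: j => [|j IH]; rewrite /euler /=; first by case: ifP.
rewrite -/(euler j) /euler_step IH normk0 expr0n mulr0 add0r; case: ifP => // _.
by rewrite (_ : Complex 0 0 = 0)// mul0r.
Qed.

Arguments euler : simpl never.

Let nl a := fun x : 'rV[R]_d => expR (- psum N a x) - 1 + psum N a x.

(** Separating the linear part - v of e^(-v) from the remainder exposes the damping. The constant 1
    has no effect, because it lives at k = 0 and the weight is zero there. *)
Lemma euler_convex j k : k \in modes N -> 
  euler j.+1 k = Complex (1 - tau * nk k ^+ 4) 0 * euler j k +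
   Complex (tau * nk k ^+ 4) 0 * four (nl (euler j)) k.
Proof.
move=> kN; rewrite eulerS// /nl.
have bp := bm_psum N (euler j); have be := bexpN (euler j); have b1 := @bm_cst _ 'rV[R]_d _ (1 : R).
have bb := bmB be b1.
rewrite fourierD; [|exact: bm_integrable..].
rewrite fourierB; [|exact: bm_integrable..].
rewrite fourier_psum ?kN; last exact: euler_herm.
rewrite fourier_cst1; case: (eqVneq k 0) => [->|k0].
  by rewrite normk0 expr0n mulr0 subr0 euler_zero (_ : Complex 0 0 = 0)// !mul0r mulr0.
rewrite subr0; apply: complex_eqP; case: (euler j k) => p q; case: (four _ k) => r s /=; ring.
Qed.

(** [S1] is the Wiener norm and [S2] the squared H^2 norm of an iterate; [W1], the l^1 norm of order
    4, and [W2], the squared H^4 norm, are the matching dissipations. *)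
Definition S1 j := \sum_(k <- modes N) nc (euler j k).
Definition W1 j := \sum_(k <- modes N) nk k ^+ 4 * nc (euler j k).
Definition S2 j := \sum_(k <- modes N) nk k ^+ 4 * nc (euler j k) ^+ 2.
Definition W2 j := \sum_(k <- modes N) (nk k ^+ 4 * nc (euler j k)) ^+ 2.

Let w0 k : 0 <= nk k ^+ 4. Proof. by rewrite exprn_ge0// normk_ge0. Qed.
Let wnc0 j k : 0 <= nk k ^+ 4 * nc (euler j k). Proof. by rewrite mulr_ge0 ?nc_ge0. Qed.

Let A0 : 0 <= A. Proof. by apply: le_trans a0A; apply: sumr_ge0 => k _; exact: nc_ge0. Qed.
Lemma growth_ge0 (B : R) : 0 <= B -> 0 <= growth B.
Proof. by move=> B0; apply: le_trans (@growth_sum _ B 0 B0); rewrite big_geq. Qed.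
Let g0 : 0 <= growth A. Proof. exact: growth_ge0. Qed.

Lemma W1_ge0 j : 0 <= W1 j. Proof. by apply: sumr_ge0 => k _. Qed.
Lemma W2_ge0 j : 0 <= W2 j. Proof. by apply: sumr_ge0 => k _; exact: sqr_ge0. Qed.

Let ball1_W1 j : ball1 (fun k => if k \in modes N then nk k ^+ 4 * nc (euler j k) else 0) (W1 j).
Proof.
move=> s us; rewrite -big_mkcond/= -big_filter; apply: ball1_sub => //.
- by rewrite filter_uniq.
- exact: modes_uniq.
- by move=> k; rewrite mem_filter => /andP[].
Qed.

Let ball2_W2 j : ball2 (fun k => if k \in modes N then nk k ^+ 4 * nc (euler j k) else 0) (Num.sqrt (W2 j)).
Proof.
split; first exact: sqrtr_ge0.
move=> s us; rewrite sqr_sqrtr ?W2_ge0//.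
rewrite (eq_bigr (fun k => if k \in modes N then (nk k ^+ 4 * nc (euler j k)) ^+ 2 else 0)); last first.
  by move=> k _; case: ifP => // _; rewrite expr0n.
rewrite -big_mkcond/= -big_filter; apply: ball1_sub => //.
- by move=> k; exact: sqr_ge0.
- by rewrite filter_uniq.
- exact: modes_uniq.
- by move=> k; rewrite mem_filter => /andP[].
Qed.

(** The remainder estimate needs the bound [A] at step j. Since the norm then decreases,
    [euler_S1_le] propagates the bound by induction and removes the assumption. *)
Lemma euler_l1_step j : S1 j <= A -> S1 j.+1 + tau * delta * W1 j <= S1 j.
Proof.
move=> SA.
have nb := nonlin_ball subquartic4 seqnorm_ball1 SA (ball1_W1 j).
have {}nb := nb _ (modes_uniq N).
rewrite -lerBrDr; apply: (@le_trans _ _ (S1 j - tau * W1 j + tau * \sum_(k <- modes N) nk k ^+ 4 * nc (four (nl (euler j)) k))).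
  rewrite /S1 /W1 !mulr_sumr -sumrB -big_split/= big_seq [leRHS]big_seq; apply: ler_sum => k kN.
  rewrite euler_convex//; apply: le_trans (ncD _ _) _; rewrite !ncM !nc_real.
  rewrite !ger0_norm ?subr_ge0 ?cfl//; last by rewrite mulr_ge0// ltW.
  by rewrite mulrBl mul1r !mulrA.
have : tau * \sum_(k <- modes N) nk k ^+ 4 * nc (four (nl (euler j)) k) <= tau * (growth A * W1 j).
  by rewrite ler_wpM2l ?(ltW tau0).
rewrite -subr_ge0 => H; rewrite -subr_ge0; apply: le_trans H _.
by rewrite le_eqVlt; apply/orP; left; apply/eqP; ring.
Qed.

Lemma euler_S1_le j : S1 j <= A.
Proof.
elim: j => [|j IH].
  rewrite /S1 /euler /= big_seq; under eq_bigr => k -> do [].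
  by rewrite -big_seq.
apply: le_trans (IH); apply: le_trans (euler_l1_step IH); rewrite lerDl.
by rewrite mulr_ge0 ?W1_ge0// mulr_ge0 ?subr_ge0 ?ltW.
Qed.

Lemma euler_l1 j : S1 j.+1 + tau * delta * W1 j <= S1 j.
Proof. exact: euler_l1_step (euler_S1_le j). Qed.

Lemma euler_l2 j : S2 j.+1 + tau * delta * W2 j <= S2 j.
Proof.
have nb := nonlin_ball subquartic4 seqnorm_ball2 (euler_S1_le j) (ball2_W2 j).
have {nb}[_ nb] := nb; have {}nb := nb _ (modes_uniq N).
rewrite exprMn sqr_sqrtr ?W2_ge0// in nb.
rewrite -lerBrDr; apply: (@le_trans _ _ (S2 j - tau * W2 j + tau * \sum_(k <- modes N) (nk k ^+ 4 * nc (four (nl (euler j)) k)) ^+ 2)).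
  rewrite /S2 /W2 !mulr_sumr -sumrB -big_split/= big_seq [leRHS]big_seq; apply: ler_sum => k kN.
  set n := nc (four (nl (euler j)) k); set e := nc (euler j k); set t := tau * nk k ^+ 4.
  have t01 : 0 <= t <= 1 by rewrite cfl// mulr_ge0// ltW.
  have nce : nc (euler j.+1 k) <= (1 - t) * e + t * n.
    rewrite euler_convex//; apply: le_trans (ncD _ _) _; rewrite !ncM !nc_real -/t.
    by rewrite !ger0_norm ?subr_ge0//; case/andP: t01.
  (* Convexity of the square lets the weights 1 - t and t survive squaring; the defect is t (1 - t)
     (e - n)^2. *)
  have sq : nc (euler j.+1 k) ^+ 2 <= (1 - t) * e ^+ 2 + t * n ^+ 2.
    apply: (@le_trans _ _ (((1 - t) * e + t * n) ^+ 2)).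
      by rewrite ler_sqr ?nnegrE ?nc_ge0// (le_trans _ nce)// nc_ge0.
    rewrite -subr_ge0 (_ : _ - _ = t * (1 - t) * (e - n) ^+ 2); last by ring.
    by case/andP: t01 => t0 t1; rewrite mulr_ge0 ?sqr_ge0// mulr_ge0// subr_ge0.
  apply: (@le_trans _ _ (nk k ^+ 4 * ((1 - t) * e ^+ 2 + t * n ^+ 2))); first by rewrite ler_wpM2l.
  by rewrite le_eqVlt; apply/orP; left; apply/eqP; rewrite /t; ring.
(* The l^2 estimate produces the square of growth, which is at most growth because growth < 1. *)
have : tau * \sum_(k <- modes N) (nk k ^+ 4 * nc (four (nl (euler j)) k)) ^+ 2 <= tau * (growth A * W2 j).
  rewrite ler_wpM2l ?(ltW tau0)// (le_trans nb)// ler_wpM2r ?W2_ge0//.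
  by rewrite expr2 -[leRHS]mulr1; apply: ler_wpM2l => //; exact: ltW.
rewrite -subr_ge0 => H; rewrite -subr_ge0; apply: le_trans H _.
by rewrite le_eqVlt; apply/orP; left; apply/eqP; ring.
Qed.

Let delta0 : 0 < delta. Proof. by rewrite subr_gt0. Qed.

Lemma euler_S2_ge0 j : 0 <= S2 j.
Proof. by apply: sumr_ge0 => k _; rewrite mulr_ge0 ?sqr_ge0. Qed.

Lemma euler_S1_ge0 j : 0 <= S1 j.
Proof. by apply: sumr_ge0 => k _; exact: nc_ge0. Qed.

Let S1W1 j : S1 j <= W1 j.
Proof.
apply: ler_sum => k _; case: (eqVneq k 0) => [->|k0].
  by rewrite euler_zero nc0 mulr0.
by rewrite ler_peMl ?nc_ge0// exprn_ege1// normk_ge1.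
Qed.

Let S2W2 j : S2 j <= W2 j.
Proof.
apply: ler_sum => k _; case: (eqVneq k 0) => [->|k0].
  by rewrite euler_zero nc0 expr0n/= !mulr0 expr0n.
rewrite exprMn ler_wpM2r ?sqr_ge0// expr2 ler_peMl// exprn_ege1// normk_ge1//.
Qed.

(** Since S <= W, one step multiplies S by at most 1 - tau delta, hence by at most e^(- tau
    delta). *)
Let decay (S W : nat -> R) C : (forall j, S j <= W j) -> (forall j, S j.+1 + tau * delta * W j <= S j) ->
  (forall j, 0 <= S j) -> S 0%N <= C -> forall j, S j <= C * expR (- (delta * (tau * j%:R))).
Proof.
move=> SW step S0 SC; elim=> [|j IH]; first by rewrite !mulr0 oppr0 expR0 mulr1.
have td : 0 <= tau * delta by rewrite mulr_ge0 ?ltW.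
have e1 := expR_ge1Dx (- (tau * delta)).
apply: (@le_trans _ _ (S j * expR (- (tau * delta)))).
  have := step j; have : tau * delta * S j <= tau * delta * W j by rewrite ler_wpM2l.
  have : S j * (1 + - (tau * delta)) <= S j * expR (- (tau * delta)) by rewrite ler_wpM2l.
  lra.
have -> : - (delta * (tau * j.+1%:R)) = - (delta * (tau * j%:R)) + - (tau * delta) by rewrite -natr1; ring.
by rewrite expRD mulrA ler_wpM2r ?expR_ge0.
Qed.

Lemma euler_S1_decay j : S1 j <= A * expR (- (delta * (tau * j%:R))).
Proof.
apply: (decay (W := W1)) => //; [exact: euler_l1|exact: euler_S1_ge0|exact: euler_S1_le].
Qed.

Lemma euler_S2_decay j : S2 j <= H0 * expR (- (delta * (tau * j%:R))).
Proof.
apply: (decay (W := W2)) => //; [exact: euler_l2|exact: euler_S2_ge0|].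
rewrite /S2 /euler /= big_seq; under eq_bigr => k -> do [].
by rewrite -big_seq.
Qed.

Let telesc (S W : nat -> R) C : (forall j, S j.+1 + tau * delta * W j <= S j) ->
  (forall j, 0 <= S j) -> S 0%N <= C -> forall n, \sum_(0 <= j < n) tau * W j <= C / delta.
Proof.
move=> step S0 SC n; rewrite ler_pdivlMr//.
suff : (\sum_(0 <= j < n) tau * W j) * delta + S n <= S 0%N.
  by have := S0 n; lra.
elim: n => [|n IH]; first by rewrite big_geq// mul0r add0r.
by rewrite big_nat_recr//=; have := step n; lra.
Qed.

Lemma euler_W1_sum n : \sum_(0 <= j < n) tau * W1 j <= A / delta.
Proof. apply: (telesc (S := S1)); [exact: euler_l1|exact: euler_S1_ge0|exact: euler_S1_le]. Qed.

Lemma euler_W2_sum n : \sum_(0 <= j < n) tau * W2 j <= H0 / delta.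
Proof.
apply: (telesc (S := S2)); [exact: euler_l2|exact: euler_S2_ge0|].
rewrite /S2 /euler /= big_seq; under eq_bigr => k -> do [].
by rewrite -big_seq.
Qed.

Lemma nc_expN_euler j k : nc (four (expN (euler j)) k) <= 2 * expR A.
Proof.
apply: fourier_bound; first exact: bm_integrable.
move=> x; rewrite ger0_norm ?expR_ge0// ler_expR (le_trans (ler_norm _))// normrN.
exact: le_trans (psum_bound _ _ _) (euler_S1_le j).
Qed.

(** The drift of mode k is |k|^4 times a coefficient of e^(-v), which is bounded in terms of [A].
    The Lipschitz constant depends on k but not on the scheme. *)
Lemma euler_lip i m k : nc (euler (i + m) k - euler i k) <= tau * m%:R * (nk k ^+ 4 * (2 * expR A)).
Proof.
case: (boolP (k \in modes N)) => [kN|kN]; last first.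
  rewrite !euler_supp// subrr nc0; apply: mulr_ge0; first by rewrite mulr_ge0// ltW.
  by apply: mulr_ge0 => //; rewrite mulr_ge0// expR_ge0.
elim: m => [|m IH]; first by rewrite addn0 subrr nc0 mulr0 mul0r.
rewrite addnS eulerS// addrAC; apply: le_trans (ncD _ _) _.
rewrite -natr1 mulrDr mulrDl mulr1; apply: lerD => //.
rewrite ncM nc_real ger0_norm; last by rewrite mulr_ge0// ltW.
by rewrite mulrA ler_wpM2l ?nc_expN_euler// mulr_ge0// ltW.
Qed.

End euler.

(** * From difference equations to integral equations in time *)

Section increments.
Context {R : realType}.
Local Notation leb := (@lebesgue_measure R).

(** [x] has the forward increments of a primitive of the uniformly continuous [y], with an error
    uniform in time. Hence it has derivative [y] at positive times, and the fundamental theorem of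
    calculus applies; at time 0 right continuity is enough. *)
Lemma integral_of_increments (x y : R -> R) :
  (forall e : R, 0 < e -> exists2 r : R, 0 < r & forall s t : R, 0 <= s -> s <= t -> t - s <= r ->
     `|x t - x s - (t - s) * y s| <= (t - s) * e) ->
  (forall e : R, 0 < e -> exists2 r : R, 0 < r & forall s t : R, s <= t -> t - s <= r -> `|y t - y s| <= e) ->
  continuous y /\ forall s t : R, 0 <= s -> s <= t -> x t - x s = \int[leb]_(u in `[s, t]) y u.
Proof.
move=> Hx Hy.
have cy : continuous y.
  move=> u; apply/cvgrPdist_le => e e0; have [r r0 Hr] := Hy e e0.
  near=> v; have uv : `|u - v| <= r by near: v; exists r => //= v; exact: ltW.
  have [vu|/ltW uv'] := leP v u.
    by apply: Hr => //; rewrite (le_trans (ler_norm _)).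
  by rewrite distrC; apply: Hr => //; rewrite (le_trans (ler_norm _))// distrC.
have dx (u : R) : 0 < u -> is_derive u (1 : R) x (y u).
  move=> u0; have L : h^-1 *: ((x \o shift u) (h *: 1) - x u) @[h --> 0^'] --> y u.
    apply/cvgrPdist_le => e e0; have e20 : 0 < e / 2 by rewrite divr_gt0.
    have [r r0 Hr] := Hx _ e20; have [r' r'0 Hr'] := Hy _ e20.
    near=> h; rewrite /= scaler1.
    have h0 : h != 0 by near: h; exact: nbhs_dnbhs_neq.
    have hr : `|h| <= r by near: h; apply: dnbhs0_le.
    have hr' : `|h| <= r' by near: h; apply: dnbhs0_le.
    have hu : `|h| <= u by near: h; apply: dnbhs0_le.
    have n0 : 0 < `|h| by rewrite normr_gt0.
    rewrite -(ler_pM2l n0) -normrM mulrBr /GRing.scale/= mulVKf//.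
    have [h1|h1] := leP 0 h.
      have := Hr u (h + u) (ltW u0); rewrite addrK lerDr -(ger0_norm h1) => /(_ (normr_ge0 _) hr).
      rewrite (ger0_norm h1) distrC => /le_trans; apply.
      by rewrite [`|h|]ger0_norm// ler_wpM2l// ler_pdivrMr// ler_pMr// ler1n.
    rewrite (ltr0_norm h1) in hr hr' hu n0 *.
    have hu0 : 0 <= h + u by lra.
    have hule : h + u <= u by lra.
    have hud : u - (h + u) = - h by ring.
    have := Hr (h + u) u hu0 hule; rewrite hud => /(_ hr) H1.
    have := Hr' (h + u) u hule; rewrite hud => /(_ hr') H2.
    (* To the left of u the increment is expanded at its own left endpoint h + u, and [y] is then
       moved from there to u. *)
    have -> : h * y u - (x (h + u) - x u) =
      (x u - x (h + u) - - h * y (h + u)) - (- h) * (y u - y (h + u)) by ring.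
    apply: le_trans (ler_normB _ _) _; rewrite normrM (gtr0_norm n0).
    have : - h * `|y u - y (h + u)| <= - h * (e / 2) by rewrite ler_wpM2l// ltW.
    have : - h * (e / 2) + - h * (e / 2) = - h * e by field.
    lra.
  by split; [apply/cvg_ex; exists (y u)|exact/cvg_lim].
split=> // s t s0 st; move: st; rewrite le_eqVlt => /predU1P[->|st].
  by rewrite subrr set_itv1 Rintegral_set1.
have xc (u : R) : 0 <= u -> x v @[v --> u^'+] --> x u.
  move=> u0; apply/cvgrPdist_le => e e0; have [r r0 Hr] := Hx 1 ltr01.
  near=> v; have uv : u < v by near: v; exact: nbhs_right_gt.
  have vr : v - u <= r.
    by rewrite lerBlDl; near: v; apply: nbhs_right_le; rewrite ltrDl.
  have ve : v - u <= e / (1 + `|y u|).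
    rewrite lerBlDl; near: v; apply: nbhs_right_le; rewrite ltrDl.
    by rewrite divr_gt0// ltr_pwDl.
  have := Hr u v u0 (ltW uv) vr; rewrite mulr1 => H.
  rewrite distrC (_ : x v - x u = x v - x u - (v - u) * y u + (v - u) * y u); last by ring.
  apply: le_trans (ler_normD _ _) _; rewrite normrM [`|v - u|]ger0_norm ?subr_ge0 ?(ltW uv)//.
  apply: (@le_trans _ _ ((v - u) * (1 + `|y u|))); first by rewrite mulrDr mulr1 lerD2r.
  by rewrite -ler_pdivlMr// ltr_pwDl.
have dLR : derivable_oo_LRcontinuous x s t.
  split.
  - move=> u; rewrite in_itv/= => /andP[su _]; have := dx u (le_lt_trans s0 su); exact: @ex_derive.
  - exact: xc.
  - have t0 := le_lt_trans s0 st; apply: cvg_at_left_filter.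
    have dt : derivable x t 1 by have := dx t t0; exact: @ex_derive.
    by apply/differentiable_continuous/derivable1_diffP.
have := @continuous_FTC2 R y x s t st (continuous_subspaceT cy) dLR.
rewrite /Rintegral => -> //.
move=> u; rewrite in_itv/= => /andP[su _].
by rewrite derive1E; have := dx u (le_lt_trans s0 su); exact: @derive_val.
Unshelve. all: by end_near. Qed.

End increments.

(* Bounded sequences converge along a free ultrafilter: no subsequences are needed to take
   the limit of the countably many Fourier coefficients at all times. *)
Section ultralimit.
Context {R : realType} (U : set_system nat) (UU : UltraFilter U).
Hypothesis Uoo : forall P : set nat, (\forall n \near \oo, P n) -> U P.

Lemma ultra_cvg (u : nat -> R) (C : R) : (forall n, `|u n| <= C) -> exists l : R, u n @[n --> U] --> l.
Proof.
move=> uC.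
have PU : ProperFilter (u @ U) by exact: fmap_proper_filter.
have UuU : UltraFilter (u @ U).
  split; first exact: PU.
  move=> G GG uG; apply/seteqP; split; last exact: uG.
  move=> B GB; apply: contrapT => nUB.
  have [UB|UnB] := in_ultra_setVsetC (u @^-1` B) UU; first exact: nUB.
  have GnB : G (~` B) by apply: uG.
  have : G (B `&` ~` B) by exact: filterI.
  by rewrite setICr; exact: filter_not_empty.
have := @segment_compact R (- C) C; rewrite compact_ultra => /(_ (u @ U) UuU) [].
  by apply: Uoo; apply: nearW => n /=; rewrite in_itv/= -ler_norml.
by move=> l [_ ul]; exists l.
Qed.

Lemma ultra_le (u : nat -> R) (l C : R) : u n @[n --> U] --> l ->
  (\forall n \near \oo, u n <= C) -> l <= C.
Proof. by move=> ul uC; apply: cvgr_to_le ul _; exact: Uoo. Qed.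

Lemma cvg_ultra (u : nat -> R) (l : R) : u n @[n --> \oo] --> l -> u n @[n --> U] --> l.
Proof. by move=> ul A /ul; exact: Uoo. Qed.

Variable tau : nat -> R.
Hypothesis tau0 : forall N, 0 < tau N.
Hypothesis tau_cvg : tau N @[N --> \oo] --> 0.

(** The Euler step current at time t. Negative times get index 0, so the limits are constant before
    time 0 and continuity at 0 is two-sided. *)
Definition tidx N (t : R) := Num.truncn (t / tau N).

Lemma tidx_le N (t : R) : 0 <= t -> tau N * (tidx N t)%:R <= t.
Proof.
move=> t0; have t0' : 0 <= t / tau N by rewrite divr_ge0// ltW.
by rewrite mulrC -ler_pdivlMr//; case/andP: (truncn_itv t0').
Qed.

Lemma tidx_lt N (t : R) : 0 <= t -> t < tau N * (tidx N t)%:R + tau N.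
Proof.
move=> t0; have t0' : 0 <= t / tau N by rewrite divr_ge0// ltW.
rewrite -[X in _ + X]mulr1 -mulrDr natr1 mulrC -ltr_pdivrMr//.
by case/andP: (truncn_itv t0').
Qed.

Lemma tidx0 N (t : R) : t <= 0 -> tidx N t = 0%N.
Proof.
move=> t0; rewrite /tidx; have : t / tau N <= 0 by rewrite mulr_le0_ge0// invr_ge0 ltW.
by move=> tl; apply/truncn0Pn; rewrite -ltNge (le_lt_trans tl).
Qed.

Lemma tidx_mono N (s t : R) : s <= t -> exists2 m, tidx N t = (tidx N s + m)%N &
  tau N * m%:R <= t - s + tau N.
Proof.
move=> st; have tN := tau0 N.
have ss : (tidx N s <= tidx N t)%N.
  by rewrite /tidx le_truncn// ler_pM2r ?invr_gt0.
exists (tidx N t - tidx N s)%N; first by rewrite subnKC.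
rewrite natrB// mulrBr.
have [t0|/ltW t0] := leP t 0.
  by rewrite !tidx0//; [rewrite mulr0 subrr; lra|exact: le_trans t0].
have := tidx_le N t0.
have [s0|/ltW s0] := leP s 0.
  by rewrite (tidx0 N s0) mulr0; lra.
by have := tidx_lt N s0; lra.
Qed.

Lemma tidx_cvg (t : R) : 0 <= t -> tau N * (tidx N t)%:R @[N --> U] --> t.
Proof.
move=> t0; apply: cvg_ultra; apply/cvgrPdist_le => e e0.
have /cvgrPdist_le/(_ _ e0) := tau_cvg; apply: filterS => N.
rewrite sub0r normrN gtr0_norm// => te.
have := tidx_le N t0; have := tidx_lt N t0 => h1 h2.
by rewrite ger0_norm ?subr_ge0//; lra.
Qed.

(** Equicontinuity of the drift replaces m steps of the scheme by m times the first one, up to an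
    error proportional to the elapsed time. This estimate passes to the limit and is what
    [integral_of_increments] asks for. *)
Lemma discrete_limit (xN yN : nat -> nat -> R) (y : R -> R) (C : R) :
  (forall N j, `|xN N j| <= C) ->
  (\forall N \near \oo, forall j, xN N j.+1 = xN N j + tau N * yN N j) ->
  (forall e : R, 0 < e -> exists2 r : R, 0 < r & forall N i m,
    tau N * m%:R <= r -> `|yN N (i + m)%N - yN N i| <= e) ->
  (forall t, yN N (tidx N t) @[N --> U] --> y t) ->
  exists x : R -> R, [/\ forall t, xN N (tidx N t) @[N --> U] --> x t, continuous y &
    forall s t : R, 0 <= s -> s <= t -> x t - x s = \int[@lebesgue_measure R]_(u in `[s, t]) y u].
Proof.
move=> xC rec equi ycvg.
have /choice[x xcvg] : forall t, exists l : R, xN N (tidx N t) @[N --> U] --> l.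
  by move=> t; apply: (@ultra_cvg (fun N => xN N (tidx N t)) C).
exists x.
have tsmall (e : R) : 0 < e -> \forall N \near \oo, tau N <= e.
  move=> e0; have /cvgrPdist_le/(_ _ e0) := tau_cvg; apply: filterS => N.
  by rewrite sub0r normrN gtr0_norm.
suff [Hx Hy] : (forall e : R, 0 < e -> exists2 r : R, 0 < r & forall s t : R, 0 <= s -> s <= t -> t - s <= r ->
     `|x t - x s - (t - s) * y s| <= (t - s) * e) /\
  (forall e : R, 0 < e -> exists2 r : R, 0 < r & forall s t : R, s <= t -> t - s <= r -> `|y t - y s| <= e).
  by have [] := integral_of_increments Hx Hy.
split=> e e0; have [r r0 Hr] := equi e e0; exists (r / 2); rewrite ?divr_gt0//.
  move=> s t s0 st tsr; have t0 : 0 <= t := le_trans s0 st.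
  pose z N := `|xN N (tidx N t) - xN N (tidx N s) - (tau N * (tidx N t)%:R - tau N * (tidx N s)%:R) * yN N (tidx N s)|.
  have zc : z N @[N --> U] --> `|x t - x s - (t - s) * y s|.
    apply: cvg_norm; apply: cvgB; first by apply: cvgB; exact: xcvg.
    by apply: cvgM; [apply: cvgB; exact: tidx_cvg|exact: ycvg].
  have bc : (tau N * (tidx N t)%:R - tau N * (tidx N s)%:R) * e @[N --> U] --> (t - s) * e.
    by apply: cvgM; [apply: cvgB; exact: tidx_cvg|exact: cvg_cst].
  apply: (ler_cvg_to zc bc); apply: Uoo.
  near=> N.
  have recN : forall j, xN N j.+1 = xN N j + tau N * yN N j by near: N.
  rewrite /z; have [m -> tm] := tidx_mono N st.
  have mr : tau N * m%:R <= r.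
    apply: le_trans tm _; have : tau N <= r / 2 by near: N; apply: tsmall; rewrite divr_gt0.
    lra.
  rewrite -mulrBr natrD [X in tau N * X]addrAC subrr add0r.
  move: (tidx N s) => i; clear -recN mr Hr tau0; have tN := tau0 N; have tN0 := ltW tN.
  elim: m mr => [|m IH] mr; first by rewrite addn0 subrr mulr0 !mul0r subr0 normr0.
  have mr' : tau N * m%:R <= r by apply: le_trans mr; rewrite ler_wpM2l// ler_nat.
  rewrite addnS recN -natr1.
  have -> : xN N (i + m)%N + tau N * yN N (i + m)%N - xN N i - tau N * (m%:R + 1) * yN N i =
    (xN N (i + m)%N - xN N i - tau N * m%:R * yN N i) + tau N * (yN N (i + m)%N - yN N i) by ring.
  apply: le_trans (ler_normD _ _) _; rewrite (_ : tau N * (m%:R + 1) * e = tau N * m%:R * e + tau N * e) ?lerD ?IH//; last by ring.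
  by rewrite normrM gtr0_norm// ler_wpM2l// Hr.
move=> s t st tsr.
have zc : `|yN N (tidx N t) - yN N (tidx N s)| @[N --> U] --> `|y t - y s|.
  by apply: cvg_norm; apply: cvgB; exact: ycvg.
apply: ultra_le zc _; near=> N.
have [m -> tm] := tidx_mono N st; apply: Hr; apply: le_trans tm _.
have : tau N <= r / 2 by near: N; apply: tsmall; rewrite divr_gt0.
lra.
Unshelve. all: by end_near. Qed.

End ultralimit.

Section l1_close.
Context {R : realType} {d : nat}.
Local Notation Zd := 'rV[int]_d.
Local Notation nk := (@normk R d).
Local Notation nc := (@ComplexField.Normc.normc R).
Local Notation four := (@fourier R d).
Hypothesis hd : d = 1%N \/ d = 2%N.

(** As |k|^(-2) is square summable, its tail is small in l^2. Cauchy-Schwarz makes the tail of [f]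
    small with a cut-off chosen before [f]: this is the compactness behind the limits. *)
Lemma ball2_tail_ball1 (e : R) : 0 < e -> exists K0, forall K, (K0 <= K)%N ->
  forall (f : Zd -> R) X, (forall k, 0 <= f k) -> f 0 = 0 ->
  ball2 (fun k => nk k ^+ 2 * f k) X -> ball1 (fun k => if k \in modes K then 0 else f k) (e * X).
Proof.
move=> e0; have [C HC] := @ball2_inv_normk R d hd.
have i0 (k : Zd) : 0 <= (if k == 0 then 0 else (nk k ^+ 2)^-1).
  by case: ifP => // _; rewrite invr_ge0 sqr_ge0.
have [K0 HK] := seqnorm_tail_modes seqnorm_ball2 i0 HC e0.
exists K0 => K /HK [_ {}HK] f X f0 f00 [X0 fX] s us.
have -> : \sum_(k <- s) (if k \in modes K then 0 else f k) =
   \sum_(k <- s) (if k \in modes K then 0 else (if k == 0 then 0 else (nk k ^+ 2)^-1)) * (nk k ^+ 2 * f k).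
  apply: eq_bigr => k _; case: ifP => _; first by rewrite mul0r.
  case: eqVneq => [->|k0]; first by rewrite f00 mul0r.
  rewrite mulKf// gt_eqF// exprn_gt0// (lt_le_trans _ (normk_ge1 k0))//.
apply: cs_seq; rewrite ?HK ?fX//; first exact: ltW.
- by move=> k; case: ifP.
- by move=> k; rewrite mulr_ge0 ?sqr_ge0.
Qed.

(** In an H^2 ball, l^1 closeness is decided by finitely many coefficients. This upgrades
    coefficientwise convergence to uniform convergence of the functions. *)
Lemma l1_close (X e : R) : 0 < e -> exists K, exists2 th : R, 0 < th & forall b c : Zd -> R[i],
  b 0 = 0 -> c 0 = 0 -> ball2 (fun k => nk k ^+ 2 * nc (b k)) X ->
  ball2 (fun k => nk k ^+ 2 * nc (c k)) X ->
  (forall k, k \in modes K -> nc (b k - c k) <= th) -> ball1 (fun k => nc (b k - c k)) e.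
Proof.
move=> e0; pose Y := 1 + `|X|; have Y0 : 0 < Y by rewrite ltr_pwDl.
have [|K0 HK] := @ball2_tail_ball1 (e / (4 * Y)); first by rewrite divr_gt0// mulr_gt0.
exists K0, (e / (2 * (1 + (size (modes K0 : seq Zd))%:R))).
  by rewrite divr_gt0// mulr_gt0// ltr_pwDl.
move=> b c b0 c0 bX cX bc s us.
have tl (g : Zd -> R[i]) : g 0 = 0 -> ball2 (fun k => nk k ^+ 2 * nc (g k)) X ->
    ball1 (fun k => if k \in modes K0 then 0 else nc (g k)) (e / 4).
  move=> g0 gX; have gY : ball1 (fun k => if k \in modes K0 then 0 else nc (g k)) (e / (4 * Y) * X).
    by apply: HK gX => // [k|]; [exact: nc_ge0|rewrite g0 nc0].
  apply: ball1_leX gY; rewrite invfM mulrA -mulrA ger_pMr ?divr_gt0// mulrC ler_pdivrMr// mul1r.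
  by rewrite /Y (le_trans (ler_norm _))// lerDr.
have d0 k : 0 <= nc (b k - c k) by exact: nc_ge0.
apply: le_trans (ball1_split (modes K0) d0 us) _.
have -> : e = e / 2 + (e / 4 + e / 4) by field.
apply: lerD.
  apply: (@le_trans _ _ (\sum_(k <- (modes K0 : seq Zd)) e / (2 * (1 + (size (modes K0 : seq Zd))%:R)))).
    by rewrite big_seq [leRHS]big_seq; apply: ler_sum => k /bc.
  rewrite big_const_seq count_predT iter_addr_0 -[X in X <= _]mulr_natr invfM mulrA.
  by rewrite -mulrA ger_pMr ?divr_gt0// mulrC ler_pdivrMr ?mul1r ?ltr_pwDl// lerDr.
have := ball1D (tl b b0 bX) (tl c c0 cX); move/(_ [seq k <- s | k \notin modes K0]).
rewrite filter_uniq// => /(_ isT); apply: le_trans.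
rewrite big_seq [leRHS]big_seq; apply: ler_sum => k; rewrite mem_filter => /andP[/negbTE -> _].
exact: ncB.
Qed.

(** Every coefficient of e^(-v) depends on all coefficients of v; inside such a ball it is
    nevertheless continuous for coefficientwise convergence. *)
Lemma exp_close (X A e : R) k : 0 < e -> exists K, exists2 th : R, 0 < th & forall b c : Zd -> R[i],
  ball1 (fun k => nc (b k)) A -> ball1 (fun k => nc (c k)) A ->
  b 0 = 0 -> c 0 = 0 -> ball2 (fun k => nk k ^+ 2 * nc (b k)) X ->
  ball2 (fun k => nk k ^+ 2 * nc (c k)) X ->
  (forall k, k \in modes K -> nc (b k - c k) <= th) ->
  nc (four (fun x => expR (- synth b x)) k - four (fun x => expR (- synth c x)) k) <= e.
Proof.
move=> e0; have e1 : 0 < e / (2 * expR A) by rewrite divr_gt0// mulr_gt0// expR_gt0.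
have [K [th th0 H]] := l1_close X e1; exists K, th => // b c bA cA b0 c0 bX cX bc.
have -> : e = 2 * (expR A * (e / (2 * expR A))) by field; rewrite gt_eqF// expR_gt0.
apply: fourier_exp_lip.
- exact: bm_synth bA.
- exact: bm_synth cA.
- by move=> x; exact: synth_bound.
- by move=> x; exact: synth_bound.
- by move=> x; rewrite -(synthB x bA cA); apply: synth_bound; exact: H.
Qed.

End l1_close.

Lemma ReB {R : realType} (c1 c2 : R[i]) : complex.Re (c1 - c2) = complex.Re c1 - complex.Re c2.
Proof. by case: c1; case: c2. Qed.

Lemma ImB {R : realType} (c1 c2 : R[i]) : complex.Im (c1 - c2) = complex.Im c1 - complex.Im c2.
Proof. by case: c1; case: c2. Qed.

Lemma nc_dist {R : realType} (c1 c2 : R[i]) :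
  `|ComplexField.Normc.normc c1 - ComplexField.Normc.normc c2| <= ComplexField.Normc.normc (c1 - c2).
Proof.
rewrite ler_norml; apply/andP; split.
  by rewrite lerNl opprB lerBlDr -[X in _ <= X + _]ncN opprB; apply: le_trans (ncD _ _); rewrite subrK.
by rewrite lerBlDr; apply: le_trans (ncD _ _); rewrite subrK.
Qed.

Section limit.
Context {R : realType} {d : nat}.
Local Notation Zd := 'rV[int]_d.
Local Notation mu := (torus_measure R d).
Local Notation nk := (@normk R d).
Local Notation nc := (@ComplexField.Normc.normc R).
Local Notation four := (@fourier R d).
Local Notation leb := (@lebesgue_measure R).
Hypothesis hd : d = 1%N \/ d = 2%N.
Variables (A H : R) (a0 : Zd -> R[i]).
Hypothesis ha0 : herm a0.
Hypothesis a00 : a0 0 = 0.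
Hypothesis a0A : ball1 (fun k => nc (a0 k)) A.
Hypothesis a0H : ball2 (fun k => nk k ^+ 2 * nc (a0 k)) H.
Hypothesis gA : growth A < 1.
Local Notation delta := (1 - growth A).

Let w0 (k : Zd) : 0 <= nk k ^+ 4. Proof. by rewrite exprn_ge0// normk_ge0. Qed.
Let H0 : 0 <= H. Proof. by case: a0H. Qed.
Let A0 : 0 <= A. Proof. exact: ball1_ge0 a0A. Qed.
Let delta0 : 0 < delta. Proof. by rewrite subr_gt0. Qed.

(** The bracket dominates every |k|^4 with k in [modes N], which gives the stability condition; the
    factor N + 1 sends the time step to 0. *)
Definition euler_dt (N : nat) : R := (N.+1%:R * (1 + \sum_(k <- (modes N : seq Zd)) nk k ^+ 4))^-1.
Local Notation tau := euler_dt.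

Let W0 N : 0 <= \sum_(k <- (modes N : seq Zd)) nk k ^+ 4. Proof. by apply: sumr_ge0 => k _. Qed.

Let tau0 N : 0 < tau N. Proof. by rewrite invr_gt0 mulr_gt0// ltr_pwDl. Qed.

Let cfl N k : k \in modes N -> tau N * nk k ^+ 4 <= 1.
Proof.
move=> kN; have p : 0 < N.+1%:R * (1 + \sum_(k <- (modes N : seq Zd)) nk k ^+ 4) by rewrite mulr_gt0// ltr_pwDl.
rewrite /tau mulrC ler_pdivrMr// mul1r.
apply: (@le_trans _ _ (1 + \sum_(k <- (modes N : seq Zd)) nk k ^+ 4)).
  by rewrite (big_rem k)//= addrCA lerDl addr_ge0// sumr_ge0.
by rewrite ler_peMl ?addr_ge0// ler1n.
Qed.

Let tau_cvg : tau N @[N --> \oo] --> 0.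
Proof.
apply/cvgrPdist_le => e e0; near=> N.
rewrite sub0r normrN gtr0_norm//.
apply: (@le_trans _ _ N.+1%:R^-1).
  by rewrite /tau lef_pV2 ?posrE// ?mulr_gt0 ?ltr_pwDl// ler_peMr// lerDl.
by near: N; apply: filterS (near_infty_natSinv_lt (PosNum e0)) => N /=; exact: ltW.
Unshelve. all: by end_near. Qed.

Let e N j := euler N (tau N) a0 j.

Let a0A' N : \sum_(k <- modes N) nc (a0 k) <= A. Proof. exact/a0A/modes_uniq. Qed.
Let a0H' N : \sum_(k <- modes N) nk k ^+ 4 * nc (a0 k) ^+ 2 <= H ^+ 2.
Proof.
have [_ /(_ _ (modes_uniq N))] := a0H; apply: le_trans; apply: ler_sum => k _.
by rewrite exprMn -exprM.
Qed.

Let eball1d N j : ball1 (fun k => nc (e N j k)) (A * expR (- (delta * (tau N * j%:R)))).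
Proof.
have dec := @euler_S1_decay _ _ N (tau N) A a0 (tau0 N) (@cfl N) ha0 a00 (a0A' N) gA j.
move=> s us; apply: le_trans dec; rewrite (bigID (mem (modes N)))/=.
rewrite [X in _ + X]big1 ?addr0 => [|k kN]; last by rewrite /e euler_supp ?nc0.
rewrite -big_filter; apply: ball1_sub; rewrite ?filter_uniq ?modes_uniq//.
- by move=> k; exact: nc_ge0.
- by move=> k; rewrite mem_filter => /andP[].
Qed.

Let eball2d N j s : uniq s -> \sum_(k <- s) (nk k ^+ 2 * nc (e N j k)) ^+ 2 <= H ^+ 2 * expR (- (delta * (tau N * j%:R))).
Proof.
have dec := @euler_S2_decay _ _ N (tau N) A (H ^+ 2) a0 (tau0 N) (@cfl N) ha0 a00 (a0A' N) (a0H' N) gA j.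
move=> us; apply: le_trans dec; rewrite (bigID (mem (modes N)))/=.
rewrite [X in _ + X]big1 ?addr0 => [|k kN]; last by rewrite /e euler_supp ?nc0 ?mulr0 ?expr0n.
rewrite -big_filter /S2 [leRHS](eq_bigr (fun k => (nk k ^+ 2 * nc (euler N (tau N) a0 j k)) ^+ 2)); last first.
  by move=> k _; rewrite exprMn -exprM.
apply: ball1_sub; rewrite ?filter_uniq ?modes_uniq//.
- by move=> k; exact: sqr_ge0.
- by move=> k; rewrite mem_filter => /andP[].
Qed.

Let expN1 N j : expR (- (delta * (tau N * j%:R))) <= 1.
Proof.
rewrite -[leRHS]expR0 ler_expR oppr_le0 mulr_ge0 ?(ltW delta0)// mulr_ge0//.
exact: ltW.
Qed.

Let eball1 N j : ball1 (fun k => nc (e N j k)) A.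
Proof. by apply: ball1_leX (eball1d N j); rewrite ler_piMr. Qed.

Let eball2 N j : ball2 (fun k => nk k ^+ 2 * nc (e N j k)) H.
Proof.
by split=> // s /eball2d us; apply: le_trans (us _ _) _; rewrite ler_piMr ?sqr_ge0.
Qed.

Let e0 N j : e N j 0 = 0. Proof. exact: euler_zero. Qed.

Let esynth N j : psum N (e N j) = synth (e N j).
Proof.
rewrite -synth_fin; congr synth; apply/funext => k; case: ifPn => // kN.
by rewrite /e euler_supp.
Qed.

Let elip N i m k : nc (e N (i + m)%N k - e N i k) <= tau N * m%:R * (nk k ^+ 4 * (2 * expR A)).
Proof. exact: (euler_lip (tau0 N) (@cfl N) ha0 a00 (a0A' N) gA). Qed.

Let enc N j k : nc (e N j k) <= A.
Proof. exact: (ball1_term _ (eball1 N j)). Qed.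

Section ultra.
Variables (U : set_system nat) (UU : UltraFilter U).
Hypothesis Uoo : forall P : set nat, (\forall n \near \oo, P n) -> U P.
Local Notation idx := (tidx tau).
Variable a : R -> Zd -> R[i].
Hypothesis aRe : forall t k, complex.Re (e N (idx N t) k) @[N --> U] --> complex.Re (a t k).
Hypothesis aIm : forall t k, complex.Im (e N (idx N t) k) @[N --> U] --> complex.Im (a t k).

Let near_nc (uN : nat -> R[i]) (c : R[i]) : complex.Re (uN N) @[N --> U] --> complex.Re c ->
  complex.Im (uN N) @[N --> U] --> complex.Im c -> nc (uN N - c) @[N --> U] --> (0 : R).
Proof.
move=> uR uI.
have z : `|complex.Re c - complex.Re (uN N)| + `|complex.Im c - complex.Im (uN N)| @[N --> U] --> (0 : R).
  rewrite -[X in _ --> X](_ : `|complex.Re c - complex.Re c| + `|complex.Im c - complex.Im c| = 0); last first.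
    by rewrite !subrr normr0 addr0.
  by apply: cvgD; apply: cvg_norm; apply: cvgB => //; exact: cvg_cst.
apply/cvgrPdist_le => eps eps0; have /cvgrPdist_le/(_ _ eps0) := z; apply: filterS => N.
rewrite !sub0r !normrN [in X in X -> _]ger0_norm ?addr_ge0//; apply: le_trans; rewrite ger0_norm ?nc_ge0//.
by rewrite -ncN opprB (le_trans (nc_leReIm _))// ReB ImB.
Qed.

Let ncvg (uN : nat -> R[i]) (c : R[i]) : complex.Re (uN N) @[N --> U] --> complex.Re c ->
  complex.Im (uN N) @[N --> U] --> complex.Im c -> nc (uN N) @[N --> U] --> nc c.
Proof.
move=> uR uI; have := near_nc uR uI => z; apply/cvgrPdist_le => eps eps0.
have /cvgrPdist_le/(_ _ eps0) := z; apply: filterS => N; rewrite sub0r normrN ger0_norm ?nc_ge0//.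
apply: le_trans; rewrite distrC; exact: nc_dist.
Qed.

Let cvg_seqsum (I : Type) (s : seq I) (F : I -> nat -> R) (G : I -> R) :
  (forall i, F i N @[N --> U] --> G i) -> \sum_(i <- s) F i N @[N --> U] --> \sum_(i <- s) G i.
Proof.
move=> FG; elim: s => [|i s IH].
  by rewrite big_nil; under eq_fun do rewrite big_nil; exact: cvg_cst.
by rewrite big_cons; under eq_fun do rewrite big_cons; exact: cvgD.
Qed.

Let anc t k : nc (e N (idx N t) k) @[N --> U] --> nc (a t k).
Proof. exact: ncvg. Qed.

Lemma lim_herm t : herm (a t).
Proof.
move=> k; apply: complex_eqP.
  have h := @aRe t (- k); have h' := @aRe t k.
  have -> : complex.Re (conjc (a t k)) = complex.Re (a t k) by case: (a t k).
  apply: (cvg_unique _ h) => //.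
  rewrite (_ : (fun N => complex.Re (e N (idx N t) (- k))) = fun N => complex.Re (e N (idx N t) k))//.
  by apply/funext => N; rewrite /e (euler_herm _ _ ha0); case: (euler _ _ _ _ _).
have h := @aIm t (- k); have h' := @aIm t k.
have -> : complex.Im (conjc (a t k)) = - complex.Im (a t k) by case: (a t k).
apply: (cvg_unique _ h) => //.
rewrite (_ : (fun N => complex.Im (e N (idx N t) (- k))) = fun N => - complex.Im (e N (idx N t) k)); first exact: cvgN.
by apply/funext => N; rewrite /e (euler_herm _ _ ha0); case: (euler _ _ _ _ _).
Qed.

Lemma lim_zero t : a t 0 = 0.
Proof.
apply: complex_eqP; [apply: (cvg_unique _ (@aRe t 0))|apply: (cvg_unique _ (@aIm t 0))] => //.
- by apply: cvg_near_cst; apply: Uoo; apply: nearW => N; rewrite e0.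
- by apply: cvg_near_cst; apply: Uoo; apply: nearW => N; rewrite e0.
Qed.

Lemma lim_init t : t <= 0 -> a t = a0.
Proof.
move=> t0; apply/funext => k.
have ek : \forall N \near U, e N (idx N t) k = a0 k.
  apply: Uoo; have [K Kk] := modes_cover [:: k]; exists K => // N /= KN.
  by rewrite tidx0// /e /euler/= (sub_modes KN) ?Kk ?mem_head.
apply: complex_eqP; [apply: (cvg_unique _ (@aRe t k))|apply: (cvg_unique _ (@aIm t k))] => //.
- by apply: cvg_near_cst; apply: filterS ek => N ->.
- by apply: cvg_near_cst; apply: filterS ek => N ->.
Qed.

Let expcvg (c t : R) : 0 <= t -> expR (- (c * (tau N * (idx N t)%:R))) @[N --> U] --> expR (- (c * t)).
Proof.
move=> t0; apply: (@cvg_comp _ _ _ (fun N => - (c * (tau N * (idx N t)%:R))) expR _ (nbhs (- (c * t)))); last exact: continuous_expR.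
by apply: cvgN; apply: cvgMr; exact: (@tidx_cvg _ _ Uoo _ tau0 tau_cvg t t0).
Qed.

Lemma lim_ball1 t : 0 <= t -> ball1 (fun k => nc (a t k)) (A * expR (- (delta * t))).
Proof.
move=> t0 s us.
have c1 : \sum_(k <- s) nc (e N (idx N t) k) @[N --> U] --> \sum_(k <- s) nc (a t k).
  by apply: cvg_seqsum => k; exact: anc.
have c2 : A * expR (- (delta * (tau N * (idx N t)%:R))) @[N --> U] --> A * expR (- (delta * t)).
  by apply: cvgMr; exact: expcvg.
apply: (ler_cvg_to c1 c2); apply: Uoo; apply: nearW => N.
exact: (eball1d N _ us).
Qed.

(** The scheme controls the squared H^2 norm at rate delta; the square root halves the rate. *)
Lemma lim_ball2 t : 0 <= t -> ball2 (fun k => nk k ^+ 2 * nc (a t k)) (H * expR (- (delta / 2 * t))).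
Proof.
move=> t0; split=> [|s us]; first by rewrite mulr_ge0 ?expR_ge0.
have c1 : \sum_(k <- s) (nk k ^+ 2 * nc (e N (idx N t) k)) ^+ 2 @[N --> U] --> \sum_(k <- s) (nk k ^+ 2 * nc (a t k)) ^+ 2.
  apply: cvg_seqsum => k; apply: (@cvgM _ _ U _ (fun N => nk k ^+ 2 * nc (e N (idx N t) k)) (fun N => nk k ^+ 2 * nc (e N (idx N t) k))); apply: cvgMr; exact: anc.
have c2 : H ^+ 2 * expR (- (delta * (tau N * (idx N t)%:R))) @[N --> U] --> H ^+ 2 * expR (- (delta * t)).
  by apply: cvgMr; exact: expcvg.
have -> : (H * expR (- (delta / 2 * t))) ^+ 2 = H ^+ 2 * expR (- (delta * t)).
  by rewrite exprMn -expRM_natl; congr (_ * expR _); rewrite mulr2n mulrDl mul1r; field.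
apply: (ler_cvg_to c1 c2); apply: Uoo; apply: nearW => N.
exact: (eball2d N _ us).
Qed.

Lemma lim_lip s t k : s <= t -> nc (a t k - a s k) <= (t - s) * (nk k ^+ 4 * (2 * expR A)).
Proof.
move=> st.
have c1 : nc (e N (idx N t) k - e N (idx N s) k) @[N --> U] --> nc (a t k - a s k).
  by apply: ncvg; [under eq_fun do rewrite ReB|under eq_fun do rewrite ImB]; rewrite ?ReB ?ImB; apply: cvgB.
have c2 : (t - s + tau N) * (nk k ^+ 4 * (2 * expR A)) @[N --> U] --> (t - s) * (nk k ^+ 4 * (2 * expR A)).
  apply: cvgMl; rewrite -[X in _ --> X]addr0; apply: cvgD; first exact: cvg_cst.
  exact: (cvg_ultra Uoo tau_cvg).
apply: (ler_cvg_to c1 c2); apply: Uoo; apply: nearW => N.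
have [m -> tm] := tidx_mono tau0 N st; apply: le_trans (elip _ _ _ _) _.
by rewrite ler_wpM2r// mulr_ge0// mulr_ge0// expR_ge0.
Qed.

Let aball1 t : ball1 (fun k => nc (a t k)) A.
Proof.
have [t0|/ltW/lim_init ->//] := leP 0 t.
apply: ball1_leX (lim_ball1 t0); rewrite ler_piMr// -[leRHS]expR0 ler_expR oppr_le0.
by rewrite mulr_ge0// ltW.
Qed.

Let aball2 t : ball2 (fun k => nk k ^+ 2 * nc (a t k)) H.
Proof.
have [t0|/ltW/lim_init ->//] := leP 0 t.
apply: (sn_leX seqnorm_ball2) (lim_ball2 t0); rewrite ler_piMr// -[leRHS]expR0 ler_expR oppr_le0.
by rewrite mulr_ge0// ltW// divr_gt0.
Qed.

Let Ef t k := four (fun x => expR (- synth (a t) x)) k.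
Let Ee N j k := four (fun x => expR (- synth (e N j) x)) k.

Let Ecvg t k : nc (Ee N (idx N t) k - Ef t k) @[N --> U] --> (0 : R).
Proof.
apply/cvgrPdist_le => eps eps0; have [K [th th0 HK]] := @exp_close _ _ hd H A eps k eps0.
have c : \sum_(l <- modes K) nc (e N (idx N t) l - a t l) @[N --> U] --> (0 : R).
  rewrite -[X in _ --> X](_ : \sum_(l <- (modes K : seq Zd)) 0 = 0); last by rewrite big1.
  by apply: cvg_seqsum => l; exact: near_nc.
have /cvgrPdist_le/(_ _ th0) := c; apply: filterS => N; rewrite !sub0r !normrN.
rewrite ger0_norm ?ger0_norm ?nc_ge0//; last by apply: sumr_ge0 => l _; exact: nc_ge0.
move=> le; apply: HK => //; rewrite ?lim_zero// => l lK; apply: le_trans le.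
by rewrite (big_rem l)//= lerDl sumr_ge0// => *; exact: nc_ge0.
Qed.

Let Eequi k (eps : R) : 0 < eps -> exists2 r : R, 0 < r & forall N i m,
  tau N * m%:R <= r -> nc (Ee N (i + m)%N k - Ee N i k) <= eps.
Proof.
move=> eps0; have [K [th th0 HK]] := @exp_close _ _ hd H A eps k eps0.
pose D := 1 + \sum_(l <- (modes K : seq Zd)) (nk l ^+ 4 * (2 * expR A)).
have t0 l : 0 <= nk l ^+ 4 * (2 * expR A) by rewrite mulr_ge0// mulr_ge0// expR_ge0.
have D0 : 0 < D by rewrite ltr_pwDl// sumr_ge0.
exists (th / D); first by rewrite divr_gt0.
move=> N i m tm; apply: HK; rewrite ?e0// => l lK; apply: le_trans (elip _ _ _ _) _.
apply: le_trans (ler_wpM2r (t0 l) tm) _; rewrite -mulrA ger_pMr// mulrC ler_pdivrMr// mul1r.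
by rewrite /D (big_rem l)//= addrCA lerDl addr_ge0// sumr_ge0.
Qed.

Let distw s t k : nc (a t k - a s k) <= `|t - s| * (nk k ^+ 4 * (2 * expR A)).
Proof.
have [st|/ltW ts] := leP s t; first by rewrite ger0_norm ?subr_ge0// lim_lip.
by rewrite -ncN opprB -normrN opprB ger0_norm ?subr_ge0// lim_lip.
Qed.

Let wA0 l : 0 <= nk l ^+ 4 * (2 * expR A).
Proof. by rewrite mulr_ge0// mulr_ge0// expR_ge0. Qed.

Lemma lim_exp_cont k : continuous (fun t => complex.Re (Ef t k)) /\ continuous (fun t => complex.Im (Ef t k)).
Proof.
suff H0' (eps : R) t : 0 < eps -> \forall s \near t, nc (Ef t k - Ef s k) <= eps.
  split=> t; apply/cvgrPdist_le => eps eps0; have := H0' eps t eps0; apply: filterS => s; apply: le_trans.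
    by rewrite -ReB; exact: nc_geRe.
  by rewrite -ImB; exact: nc_geIm.
move=> eps0; have [K [th th0 HK]] := @exp_close _ _ hd H A eps k eps0.
pose D := 1 + \sum_(l <- (modes K : seq Zd)) (nk l ^+ 4 * (2 * expR A)).
have D0 : 0 < D by rewrite ltr_pwDl// sumr_ge0.
have r0 : 0 < th / D by rewrite divr_gt0.
near=> s; have ts : `|t - s| <= th / D by near: s; exists (th / D) => //= s; exact: ltW.
apply: HK; rewrite ?lim_zero// => l lK; apply: le_trans (distw _ _ _) _.
apply: le_trans (ler_wpM2r (wA0 l) ts) _; rewrite -mulrA ger_pMr// mulrC ler_pdivrMr// mul1r.
by rewrite /D (big_rem l)//= addrCA lerDl addr_ge0// sumr_ge0.
Unshelve. all: by end_near. Qed.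

Lemma lim_ode k s t : 0 <= s -> s <= t ->
  complex.Re (a t k) - complex.Re (a s k) = \int[leb]_(u in `[s, t]) (nk k ^+ 4 * complex.Re (Ef u k)) /\
  complex.Im (a t k) - complex.Im (a s k) = \int[leb]_(u in `[s, t]) (nk k ^+ 4 * complex.Im (Ef u k)).
Proof.
have kN : \forall N \near \oo, k \in modes N.
  by have [K Kk] := modes_cover [:: k]; exists K => // N /= KN; exact/(sub_modes KN)/Kk/mem_head.
(* [p] stands for the real or the imaginary part: additive, homogeneous over the reals, and bounded
   by the modulus. *)
have gen (p : R[i] -> R) : (forall z w, p (z + w) = p z + p w) -> (forall r z, p (Complex r 0 * z) = r * p z) ->
   (forall z w, p (z - w) = p z - p w) -> (forall z, `|p z| <= nc z) ->
   (forall t k, p (e N (idx N t) k) @[N --> U] --> p (a t k)) ->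
   0 <= s -> s <= t ->
   p (a t k) - p (a s k) = \int[leb]_(u in `[s, t]) (nk k ^+ 4 * p (Ef u k)).
  move=> pD pM pB pn pc.
  have cc u : nk k ^+ 4 * p (Ee N (idx N u) k) @[N --> U] --> nk k ^+ 4 * p (Ef u k).
    apply: cvgMr; apply/cvgrPdist_le => eps eps0; have /cvgrPdist_le/(_ _ eps0) := @Ecvg u k.
    apply: filterS => N; rewrite sub0r normrN ger0_norm ?nc_ge0//; apply: le_trans.
    by rewrite distrC -pB.
  have bb N j : `|p (e N j k)| <= A by exact: le_trans (pn _) (enc _ _ _).
  have equi (eps : R) : 0 < eps -> exists2 r : R, 0 < r & forall N i m,
      tau N * m%:R <= r -> `|nk k ^+ 4 * p (Ee N (i + m)%N k) - nk k ^+ 4 * p (Ee N i k)| <= eps.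
    move=> eps0; have e1 : 0 < eps / (1 + nk k ^+ 4) by rewrite divr_gt0// ltr_pwDl.
    have [r r0 Hr] := @Eequi k _ e1; exists r => // N i m tm; have H1 := Hr N i m tm; rewrite -mulrBr normrM [`|nk k ^+ 4|]ger0_norm ?w0// -pB.
    apply: le_trans (ler_wpM2l (w0 k) (le_trans (pn _) H1)) _.
    by rewrite mulrCA ger_pMr// ler_pdivrMr ?mul1r ?lerDr// ltr_pwDl.
  have rec : \forall N \near \oo, forall j, p (e N j.+1 k) = p (e N j k) + tau N * (nk k ^+ 4 * p (Ee N j k)).
    apply: filterS kN => N kN j.
    have -> : e N j.+1 k = e N j k + Complex (tau N * nk k ^+ 4) 0 * Ee N j k.
      by rewrite /Ee -esynth; exact: eulerS.
    by rewrite pD pM -mulrA.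
  have [x [xc _ xi]] := @discrete_limit _ U UU Uoo _ tau0 tau_cvg (fun N j => p (e N j k)) (fun N j => nk k ^+ 4 * p (Ee N j k)) (fun t => nk k ^+ 4 * p (Ef t k)) A bb rec equi cc.
  by move=> s0 st; rewrite -xi//; congr (_ - _); apply: (cvg_unique _ (pc _ _)) => //; exact: xc.
split; apply: gen => //.
- exact: ReD.
- by move=> r [z w]/=; rewrite mul0r subr0.
- exact: ReB.
- exact: nc_geRe.
- exact: ImD.
- by move=> r [z w]/=; rewrite mul0r addr0.
- exact: ImB.
- exact: nc_geIm.
Qed.

(** The Riemann sums of the dissipation obey a trivial recurrence, so [discrete_limit] identifies
    their limit with the time integral and keeps their bound. [phi] covers both dissipations. *)
Let gen_int (phi : Zd -> R -> R) (L C t : R) K : 0 <= t -> 0 <= L ->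
  (forall k x y, 0 <= x <= A -> 0 <= y <= A -> `|phi k x - phi k y| <= L * `|x - y|) ->
  (forall k x, 0 <= phi k x) ->
  (forall N n, \sum_(0 <= j < n) tau N * \sum_(k <- modes K) phi k (nc (e N j k)) <= C) ->
  \int[leb]_(u in `[0, t]) \sum_(k <- modes K) phi k (nc (a u k)) <= C.
Proof.
move=> t0 L0 phiL phi0 phiC.
pose y u := \sum_(k <- modes K) phi k (nc (a u k)).
pose yN N j := \sum_(k <- modes K) phi k (nc (e N j k)).
have cc u : yN N (idx N u) @[N --> U] --> y u.
  apply: cvg_seqsum => k; apply/cvgrPdist_le => eps eps0.
  have e1 : 0 < eps / (1 + L) by rewrite divr_gt0// ltr_pwDl.
  have /cvgrPdist_le/(_ _ e1) := @anc u k; apply: filterS => N H1.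
  apply: le_trans (phiL _ _ _ _ _) _.
  - by rewrite nc_ge0 (ball1_term _ (aball1 u)).
  - by rewrite nc_ge0 enc.
  apply: le_trans (ler_wpM2l L0 H1) _.
  by rewrite mulrCA ger_pMr// ler_pdivrMr ?mul1r ?lerDr// ltr_pwDl.
have [|||x [xc _ xi]] := @discrete_limit _ U UU Uoo _ tau0 tau_cvg (fun N j => \sum_(0 <= i < j) tau N * yN N i) yN y C _ _ _ cc.
- move=> N j; rewrite ger0_norm ?phiC//; apply: sumr_ge0 => i _.
  by rewrite mulr_ge0 ?(ltW (tau0 N))// sumr_ge0.
- by apply: nearW => N j; rewrite big_nat_recr.
- move=> eps eps0; pose D := 1 + \sum_(l <- (modes K : seq Zd)) (nk l ^+ 4 * (2 * expR A)).
  have D0 : 0 < D by rewrite ltr_pwDl// sumr_ge0.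
  have L1 : 0 < 1 + L by rewrite ltr_pwDl.
  exists (eps / D / (1 + L)); first by rewrite !divr_gt0.
  move=> N i m tm; rewrite /yN -sumrB; apply: le_trans (ler_norm_sum _ _ _) _.
  apply: (@le_trans _ _ (\sum_(l <- modes K) (1 + L) * (eps / D / (1 + L) * (nk l ^+ 4 * (2 * expR A))))).
    apply: ler_sum => l _; apply: le_trans (phiL _ _ _ _ _) _; rewrite ?nc_ge0 ?enc//.
    apply: ler_pM => //; first by rewrite lerDr.
    apply: (@le_trans _ _ (nc (e N (i + m)%N l - e N i l))).
      exact: nc_dist.
    by apply: le_trans (elip _ _ _ _) _; rewrite ler_wpM2r.
  rewrite -mulr_sumr -mulr_sumr mulrA mulrCA mulrA mulfK ?gt_eqF//.
  rewrite -mulrA ger_pMr// mulrC ler_pdivrMr// mul1r /D lerDr//.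
have x0 : x 0 = 0.
  apply: (cvg_unique _ (@xc 0)) => //; apply: cvg_near_cst; apply: Uoo; apply: nearW => N.
  by rewrite tidx0// big_geq.
have := xi 0 t (lexx _) t0; rewrite x0 subr0 => <-.
by apply: (ultra_le UU Uoo (@xc t)); apply: nearW => N.
Qed.

Let sub_W (phi : Zd -> R -> R) K N j : (forall k, phi k 0 = 0) -> (forall k x, 0 <= phi k x) ->
  \sum_(k <- modes K) phi k (nc (e N j k)) <= \sum_(k <- modes N) phi k (nc (e N j k)).
Proof.
move=> phi00 phi0; rewrite (bigID (mem (modes N)))/=.
rewrite [X in _ + X]big1 ?addr0 => [|k kN]; last by rewrite /e euler_supp ?nc0.
rewrite -big_filter; apply: ball1_sub; rewrite ?filter_uniq ?modes_uniq//.
by move=> k; rewrite mem_filter => /andP[].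
Qed.

Lemma lim_int1 K t : 0 <= t -> \int[leb]_(u in `[0, t]) \sum_(k <- modes K) nk k ^+ 4 * `|nc (a u k)| <= A / delta.
Proof.
move=> t0; pose M := \sum_(k <- (modes K : seq Zd)) nk k ^+ 4.
have c k : k \in modes K -> nk k ^+ 4 <= M by move=> kK; rewrite /M (big_rem k)//= lerDl sumr_ge0.
(* The weight is cut off outside [modes K] so that one Lipschitz constant serves all modes. *)
have := @gen_int (fun k x => if k \in modes K then nk k ^+ 4 * `|x| else 0) M (A / delta) t K t0 (W0 K).
rewrite (_ : (fun u => \sum_(k <- modes K) (if k \in modes K then nk k ^+ 4 * `|nc (a u k)| else 0)) =
   fun u => \sum_(k <- modes K) nk k ^+ 4 * `|nc (a u k)|); last first.
  by apply/funext => u; rewrite big_seq [RHS]big_seq; apply: eq_bigr => k ->.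
apply.
- move=> k x y /andP[x0 _] /andP[y0 _]; case: ifPn => kK; last by rewrite subrr normr0 mulr_ge0 ?(W0 K).
  rewrite [`|x|]ger0_norm// [`|y|]ger0_norm// -mulrBr normrM [`|nk k ^+ 4|]ger0_norm ?w0//.
  by rewrite ler_wpM2r// c.
- by move=> k x; case: ifP => // _; rewrite mulr_ge0.
- move=> N n; apply: le_trans (euler_W1_sum (tau0 N) (@cfl N) ha0 a00 (a0A' N) gA n).
  apply: ler_sum => j _; rewrite ler_wpM2l ?(ltW (tau0 N))//.
  apply: le_trans (@sub_W (fun k x => if k \in modes K then nk k ^+ 4 * `|x| else 0) K N j _ _) _.
  + by move=> k; rewrite normr0 mulr0 if_same.
  + by move=> k x; case: ifP => // _; rewrite mulr_ge0.
  + apply: ler_sum => k _; rewrite [`|nc _|]ger0_norm ?nc_ge0//.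
    by case: ifP => _; [exact: lexx|rewrite mulr_ge0 ?nc_ge0].
Qed.

Lemma lim_int2 K t : 0 <= t -> \int[leb]_(u in `[0, t]) \sum_(k <- modes K) (nk k ^+ 4 * nc (a u k)) ^+ 2 <= H ^+ 2 / delta.
Proof.
move=> t0; pose M := \sum_(k <- (modes K : seq Zd)) nk k ^+ 8.
have w8 (k : Zd) : 0 <= nk k ^+ 8 by rewrite exprn_ge0// normk_ge0.
have c k : k \in modes K -> nk k ^+ 8 <= M by move=> kK; rewrite /M (big_rem k)//= lerDl sumr_ge0.
have M0 : 0 <= M by exact: sumr_ge0.
(* On [0, A] the square has Lipschitz constant A + A. *)
have := @gen_int (fun k x => if k \in modes K then (nk k ^+ 4 * x) ^+ 2 else 0) (M * (A + A)) (H ^+ 2 / delta) t K t0.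
rewrite (_ : (fun u => \sum_(k <- modes K) (if k \in modes K then (nk k ^+ 4 * nc (a u k)) ^+ 2 else 0)) =
   fun u => \sum_(k <- modes K) (nk k ^+ 4 * nc (a u k)) ^+ 2); last first.
  by apply/funext => u; rewrite big_seq [RHS]big_seq; apply: eq_bigr => k ->.
apply.
- by rewrite mulr_ge0// addr_ge0.
- move=> k x y /andP[x0 xA] /andP[y0 yA]; case: ifPn => kK; last by rewrite subrr normr0 !mulr_ge0// addr_ge0.
  have -> : (nk k ^+ 4 * x) ^+ 2 - (nk k ^+ 4 * y) ^+ 2 = nk k ^+ 8 * (x + y) * (x - y) by ring.
  rewrite normrM ler_wpM2r// ger0_norm; last by apply: mulr_ge0 => //; exact: addr_ge0.
  by rewrite ler_pM ?addr_ge0 ?lerD ?c.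
- by move=> k x; case: ifP => // _; rewrite sqr_ge0.
- move=> N n; apply: le_trans (euler_W2_sum (tau0 N) (@cfl N) ha0 a00 (a0A' N) (a0H' N) gA n).
  apply: ler_sum => j _; rewrite ler_wpM2l ?(ltW (tau0 N))//.
  apply: le_trans (@sub_W (fun k x => if k \in modes K then (nk k ^+ 4 * x) ^+ 2 else 0) K N j _ _) _.
  + by move=> k; rewrite mulr0 expr0n if_same.
  + by move=> k x; case: ifP => // _; rewrite sqr_ge0.
  + by apply: ler_sum => k _; case: ifP => _; [exact: lexx|exact: sqr_ge0].
Qed.

End ultra.

Lemma galerkin_limit : exists a : R -> Zd -> R[i],
  ([/\ forall t, herm (a t), forall t, a t 0 = 0,
     forall t, 0 <= t -> ball1 (fun k => nc (a t k)) (A * expR (- (delta * t))),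
     forall t, 0 <= t -> ball2 (fun k => nk k ^+ 2 * nc (a t k)) (H * expR (- (delta / 2 * t))) &
     forall t, t <= 0 -> a t = a0] /\
  [/\ forall k, continuous (fun t => complex.Re (four (fun x => expR (- synth (a t) x)) k)),
     forall k, continuous (fun t => complex.Im (four (fun x => expR (- synth (a t) x)) k)),
     forall k s t, 0 <= s -> s <= t -> complex.Re (a t k) - complex.Re (a s k) =
       \int[leb]_(u in `[s, t]) (nk k ^+ 4 * complex.Re (four (fun x => expR (- synth (a u) x)) k)) &
     forall k s t, 0 <= s -> s <= t -> complex.Im (a t k) - complex.Im (a s k) =
       \int[leb]_(u in `[s, t]) (nk k ^+ 4 * complex.Im (four (fun x => expR (- synth (a u) x)) k))]) /\
  [/\ forall K t, 0 <= t -> \int[leb]_(u in `[0, t]) \sum_(k <- modes K) nk k ^+ 4 * `|nc (a u k)| <= A / delta,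
     forall K t, 0 <= t -> \int[leb]_(u in `[0, t]) \sum_(k <- modes K) (nk k ^+ 4 * nc (a u k)) ^+ 2 <= H ^+ 2 / delta &
     forall k s t, nc (a t k - a s k) <= `|t - s| * (nk k ^+ 4 * (2 * expR A))].
Proof.
have [U [UU Usub]] := ultraFilterLemma eventually_filter.
have Uoo (P : set nat) : (\forall n \near \oo, P n) -> U P by exact: Usub.
have /choice[b bc] : forall p : R * Zd, exists z : R[i],
    complex.Re (e N (tidx tau N p.1) p.2) @[N --> U] --> complex.Re z /\
    complex.Im (e N (tidx tau N p.1) p.2) @[N --> U] --> complex.Im z.
  move=> [t k].
  have [x xc] := @ultra_cvg _ _ UU Uoo (fun N => complex.Re (e N (tidx tau N t) k)) A (fun N => le_trans (nc_geRe _) (enc _ _ _)).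
  have [y yc] := @ultra_cvg _ _ UU Uoo (fun N => complex.Im (e N (tidx tau N t) k)) A (fun N => le_trans (nc_geIm _) (enc _ _ _)).
  by exists (Complex x y).
pose a t k := b (t, k).
have aRe t k : complex.Re (e N (tidx tau N t) k) @[N --> U] --> complex.Re (a t k) by case: (bc (t, k)).
have aIm t k : complex.Im (e N (tidx tau N t) k) @[N --> U] --> complex.Im (a t k) by case: (bc (t, k)).
exists a; split; [split; split|split].
- by move=> t; exact: (lim_herm UU aRe aIm).
- by move=> t; exact: (lim_zero UU Uoo aRe aIm).
- by move=> t; exact: (lim_ball1 UU Uoo aRe aIm).
- by move=> t; exact: (lim_ball2 UU Uoo aRe aIm).
- by move=> t; exact: (lim_init UU Uoo aRe aIm).
- by move=> k; case: (lim_exp_cont UU Uoo aRe aIm k).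
- by move=> k; case: (lim_exp_cont UU Uoo aRe aIm k).
- by move=> k s t s0 st; case: (lim_ode UU Uoo aRe aIm k s0 st).
- by move=> k s t s0 st; case: (lim_ode UU Uoo aRe aIm k s0 st).
- by move=> K t t0; exact: (lim_int1 UU Uoo aRe aIm).
- by move=> K t t0; exact: (lim_int2 UU Uoo aRe aIm).
- move=> k s t; have [st|/ltW ts] := leP s t; first by rewrite ger0_norm ?subr_ge0// (lim_lip UU Uoo aRe aIm).
  by rewrite -ncN opprB -normrN opprB ger0_norm ?subr_ge0// (lim_lip UU Uoo aRe aIm).
Qed.

End limit.

(** * Real-valued Fubini theorems and integration by parts in time *)

Section fubini_real.
Context d1 d2 (T1 : measurableType d1) (T2 : measurableType d2) (R : realType).
Variables (m1 : {sigma_finite_measure set T1 -> \bar R}) (m2 : {sigma_finite_measure set T2 -> \bar R}).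

(** The inner integral is finite for almost every point only. Where it is infinite, [fine] gives it
    the value 0, which does not affect the outer integral. *)
Lemma Rintegrable_fubini1 (F : T1 * T2 -> R) : (m1 \x m2)%E.-integrable setT (EFin \o F) ->
  m1.-integrable setT (EFin \o (fun x => \int[m2]_y F (x, y))) /\
  \int[(m1 \x m2)%E]_z F z = \int[m1]_x \int[m2]_y F (x, y).
Proof.
move=> iF; have fE : {ae m1, forall x, fubini_F m2 (EFin \o F) x = (\int[m2]_y F (x, y))%:E}.
  apply: filterS (ae_integrable1 iF) => x ix; rewrite /fubini_F /Rintegral fineK//.
  exact: integrable_fin_num.
have mF := measurable_fubini_F iF; split.
  apply: (@eq_integrable _ _ _ _ _ measurableT (EFin \o (fine \o fubini_F m2 (EFin \o F)))) => //.
  apply/integrableP; split; first by apply/measurable_EFinP; exact: measurableT_comp.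
  have /integrableP[_] := integrable_fubini_F iF; apply: le_lt_trans; apply: ge0_le_integral_T => // x /=.
  by case: (fubini_F _ _ _) => //= *; rewrite ?leey ?normr0.
rewrite /Rintegral -(integral12_prod_meas1 iF); congr fine; exact: ae_eq_integral_T.
Qed.

Lemma Rintegrable_fubini2 (F : T1 * T2 -> R) : (m1 \x m2)%E.-integrable setT (EFin \o F) ->
  m2.-integrable setT (EFin \o (fun y => \int[m1]_x F (x, y))) /\
  \int[(m1 \x m2)%E]_z F z = \int[m2]_y \int[m1]_x F (x, y).
Proof.
move=> iF; have fE : {ae m2, forall y, fubini_G m1 (EFin \o F) y = (\int[m1]_x F (x, y))%:E}.
  apply: filterS (ae_integrable2 iF) => x ix; rewrite /fubini_G /Rintegral fineK//.
  exact: integrable_fin_num.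
have mF := measurable_fubini_G iF; split.
  apply: (@eq_integrable _ _ _ _ _ measurableT (EFin \o (fine \o fubini_G m1 (EFin \o F)))) => //.
  apply/integrableP; split; first by apply/measurable_EFinP; exact: measurableT_comp.
  have mF' := measurable_int _ iF.
  have := (integrable21ltyP _ _ mF').1 iF; apply: le_lt_trans; apply: ge0_le_integral_T => // y /=.
  apply: (@le_trans _ _ `|fubini_G m1 (EFin \o F) y|%E); last first.
    by apply: le_abse_integral => //; apply: measurableT_comp mF' _; exact: measurable_pair2.
  by case: (fubini_G _ _ _) => //= *; rewrite ?leey ?normr0.
rewrite /Rintegral -(integral21_prod_meas1 iF); congr fine; exact: ae_eq_integral_T.
Qed.

Lemma integrable_prod2 (f : T1 -> R) (g : T2 -> R) : m1.-integrable setT (EFin \o f) ->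
  m2.-integrable setT (EFin \o g) -> (m1 \x m2)%E.-integrable setT (EFin \o (fun z => f z.1 * g z.2)).
Proof.
move=> fi gi; have mf := measurable_int _ fi; have mg := measurable_int _ gi.
have mF : measurable_fun setT (EFin \o (fun z : T1 * T2 => f z.1 * g z.2)).
  apply/measurable_EFinP; apply: measurable_funM.
    by apply: (measurableT_comp (f := f)) => //; exact/measurable_EFinP.
  by apply: (measurableT_comp (f := g)) => //; exact/measurable_EFinP.
apply/(integrable12ltyP _ _ mF).
have /integrableP[_ gf] := gi.
have g0 : (0 <= \int[m2]_y `|(g y)%:E|)%E by exact: integral_ge0.
have [G gE] : exists G, (\int[m2]_y `|(g y)%:E|)%E = G%:E.
  by exists (fine (\int[m2]_y `|(g y)%:E|)%E); rewrite fineK// ge0_fin_numE.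
have inner x : (\int[m2]_y `|(EFin \o (fun z : T1 * T2 => f z.1 * g z.2)%R) (x, y)| =
    G%:E * `|(EFin \o f) x|)%E.
  rewrite -gE muleC [in RHS]/= -ge0_integralZl_EFin//; last first.
    by apply/measurable_EFinP; apply: measurableT_comp => //; exact/measurable_EFinP.
  by apply: eq_integral => y _; rewrite /= normrM EFinM.
under eq_integral do rewrite inner.
have /integrableP[_ ff] := fi.
rewrite ge0_integralZl_EFin//; first by rewrite lte_mul_pinfty// -gE.
  exact: measurableT_comp.
by rewrite -lee_fin -gE.
Qed.

End fubini_real.

Section time.
Context {R : realType}.
Implicit Types (T t s : R) (x y f g : R -> R).
Local Notation leb := (@lebesgue_measure R).
Local Notation tm := (@time_measure R).

Lemma time_measure_fin T : fin_num_fun (time_measure T).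
Proof.
apply: lty_fin_num_fun; rewrite /= /time_measure /mrestr setTI.
by rewrite lebesgue_measure_itv; case: ifPn => //= _; rewrite -EFinB ltry.
Qed.
HB.instance Definition _ T := Measure_isFinite.Build _ _ _ (time_measure T) (time_measure_fin T).

Lemma time_mass T : 0 <= T -> time_measure T setT = T%:E.
Proof.
move=> T0; rewrite /time_measure /mrestr setTI lebesgue_measure_itv/= lte_fin.
by case: (ltgtP 0 T) T0 => // [_ _|<- _//]; rewrite -EFinD subr0.
Qed.

Lemma time_ae T (P : R -> Prop) : (forall t, 0 <= t <= T -> P t) -> {ae time_measure T, forall t, P t}.
Proof.
move=> H; exists (~` `[0, T]); split.
- by apply: measurableC.
- by rewrite /time_measure /mrestr setICl measure0.
- by move=> t /= nP; rewrite in_itv/= => /H.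
Qed.

#[global] Instance time_ae_filter T : Filter (nbhs (almost_everywhere (time_measure T))).
Proof. exact: ae_filter_ringOfSetsType. Qed.

Lemma time_null1 T t : time_measure T [set t] = 0%E.
Proof.
apply/eqP; rewrite eq_le measure_ge0 andbT; rewrite /time_measure /mrestr.
apply: (@le_trans _ _ (leb [set t])); last by rewrite lebesgue_measure_set1.
by apply: le_measure; rewrite ?inE//; apply: measurableI.
Qed.

Lemma time_integral_itv T s t f : 0 <= s -> s <= t -> t <= T ->
  \int[leb]_(u in `[s, t]) f u = \int[time_measure T]_u (\1_`[s, t] u * f u).
Proof.
move=> s0 st tT; rewrite /Rintegral integral_mrestr; congr fine.
rewrite [RHS]integral_mkcond [LHS]integral_mkcond; apply: eq_integral => u _; rewrite /patch.
case: ifPn => [|/negbTE us]; rewrite mem_setE in_itv/=.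
  move=> /andP[su ut]; rewrite mem_setE in_itv/= (le_trans s0)//= (le_trans ut)//.
  by rewrite indicE mem_setE in_itv/= su ut mul1r.
by case: ifP => // _; rewrite indicE us mul0r.
Qed.

Lemma bm_indic dsp (X : measurableType dsp) (A : set X) : measurable A -> bm (\1_A : X -> R).
Proof.
move=> mA; split; first exact: measurable_indic.
by exists 1 => z; rewrite indicE; case: (_ \in _); rewrite ?normr1 ?normr0.
Qed.

Lemma time_integral_mono T t f : 0 <= t -> t <= T -> bm (f : measurableTypeR R -> R) -> (forall u, 0 <= f u) ->
  \int[tm t]_u f u <= \int[tm T]_u f u.
Proof.
move=> t0 tT bf f0.
have -> : \int[tm t]_u f u = \int[leb]_(u in `[0, t]) f u by rewrite /Rintegral integral_mrestr.
rewrite (time_integral_itv _ (lexx 0) t0 tT); apply: le_Rintegral => //.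
- by apply: bm_integrable; apply: bmM => //; exact: bm_indic.
- exact: bm_integrable.
- by move=> u _; rewrite indicE; case: (_ \in _); rewrite ?mul1r ?mul0r.
Qed.

Lemma eq_Rint_ae T f g : {ae time_measure T, forall t, f t = g t} ->
  \int[time_measure T]_u f u = \int[time_measure T]_u g u.
Proof. by move=> fg; rewrite /Rintegral; congr fine; apply: ae_eq_integral_T; apply: filterS fg => t ->. Qed.

Lemma eq_Rint_time T f g : (forall t, 0 <= t <= T -> f t = g t) ->
  \int[time_measure T]_u f u = \int[time_measure T]_u g u.
Proof. by move=> fg; apply: eq_Rint_ae; exact: time_ae. Qed.

Lemma indic_itv0 (t u : R) : 0 <= u -> \1_`[0, t] u = (u <= t)%R%:R :> R.
Proof. by move=> u0; rewrite indicE mem_setE in_itv/= u0. Qed.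

(** Integration by parts for absolutely continuous functions, by Fubini for x'(s) y'(u) on the
    square [0, T]^2: the whole integral is the product of the two increments, and the triangles on
    either side of the diagonal yield the two terms. *)
Lemma ibp_ac T x x' y y' (T0 : 0 <= T) :
  (time_measure T).-integrable setT (EFin \o x') -> (time_measure T).-integrable setT (EFin \o y') ->
  (forall t, 0 <= t <= T -> x t = x 0 + \int[time_measure T]_u (\1_`[0, t] u * x' u)) ->
  (forall t, 0 <= t <= T -> y t = y 0 + \int[time_measure T]_u (\1_`[0, t] u * y' u)) ->
  x T * y T - x 0 * y 0 = \int[time_measure T]_u (x' u * y u + x u * y' u).
Proof.
move=> ix iy xE yE; have iF := integrable_prod2 ix iy.
have mle : measurable [set z : measurableTypeR R * measurableTypeR R | z.2 <= z.1].
  have := @measurable_fun_ler _ _ R setT (snd : measurableTypeR R * measurableTypeR R -> R) fst measurable_snd measurable_fst.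
  by move=> m; have := m measurableT [set true] I; rewrite setTI.
pose F z := x' z.1 * y' z.2.
pose A : set (measurableTypeR R * measurableTypeR R) := [set z | z.2 <= z.1].
have i1 := integrable_bmM iF (bm_indic mle).
have i2 := integrable_bmM iF (bm_indic (measurableC mle)).
have [j1 e1] := Rintegrable_fubini1 i1.
have [j2 e2] := Rintegrable_fubini2 i2.
have ind_int t f : (tm T).-integrable setT (EFin \o f) ->
    (tm T).-integrable setT (EFin \o (fun u => \1_`[0, t] u * f u)).
  move=> fi; have := integrable_bmM fi (bm_indic (measurable_itv `[0, t])).
  by apply: eq_integrable => // u _ /=; rewrite mulrC.
have full z z' : (forall t, 0 <= t <= T -> z t = z 0 + \int[tm T]_u (\1_`[0, t] u * z' u)) ->
    z T - z 0 = \int[tm T]_u z' u.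
  move=> ->; last by rewrite T0 lexx.
  rewrite addrAC subrr add0r; apply: eq_Rint_time => t tT.
  by rewrite indicE mem_setE in_itv/= tT mul1r.
have E0 : \int[(tm T \x tm T)%E]_z F z = (x T - x 0) * (y T - y 0).
  have [_ ->] := Rintegrable_fubini1 iF.
  rewrite (full _ _ xE) (full _ _ yE) -RintegralZr//; apply: eq_Rintegral => s _.
  by rewrite -RintegralZl.
have E12 : \int[(tm T \x tm T)%E]_z F z =
    \int[(tm T \x tm T)%E]_z (F z * \1_A z) + \int[(tm T \x tm T)%E]_z (F z * \1_(~` A) z).
  rewrite -RintegralD//; apply: eq_Rintegral => z _; rewrite !indicE in_setC.
  by case: (z \in A); rewrite ?mulr1 ?mulr0 ?addr0 ?add0r.
have g1 s : 0 <= s <= T -> \int[tm T]_u (F (s, u) * \1_A (s, u)) = x' s * (y s - y 0).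
  move=> sT; rewrite yE// [X in _ = _ * X]addrAC subrr add0r -RintegralZl//; last exact: ind_int.
  apply: eq_Rint_time => u /andP[u0 uT]; rewrite /F/= -mulrA [y' u * _]mulrC; congr (_ * (_ * _)).
  rewrite (indic_itv0 s u0) indicE; congr ((nat_of_bool _)%:R).
  by apply/idP/idP => [/set_mem|us]; [exact|apply/mem_set].
have g2 u : 0 <= u <= T -> \int[tm T]_s (F (s, u) * \1_(~` A) (s, u)) = y' u * (x u - x 0).
  move=> uT; rewrite xE// [X in _ = _ * X]addrAC subrr add0r -RintegralZl//; last exact: ind_int.
  (* The complementary triangle excludes the diagonal, whereas the integral formula for [x] includes
     the endpoint u; the difference is a null set. *)
  have nu : {ae tm T, forall s, s <> u}.
    exists [set u]; split => //; first exact: time_null1.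
    by move=> s /= /contrapT.
  have t0 : {ae tm T, forall s, 0 <= s <= T} by apply: time_ae.
  apply: eq_Rint_ae; apply: filterS2 nu t0 => s su /andP[s0 sT].
  rewrite /F/= [x' s * _]mulrC -mulrA [x' s * _]mulrC; congr (_ * (_ * _)).
  rewrite (indic_itv0 u s0) indicE; congr ((nat_of_bool _)%:R).
  rewrite in_setC; have -> : ((s, u) \in A) = (u <= s)%R by apply/idP/idP => [/set_mem|us]; [exact|apply/mem_set].
  by rewrite -ltNge le_eqVlt (introF eqP su).
have fin : \int[tm T]_u (x' u * y u + x u * y' u) =
   \int[tm T]_u (\int[tm T]_v (F (u, v) * \1_A (u, v)) + y 0 * x' u + (\int[tm T]_s (F (s, u) * \1_(~` A) (s, u)) + x 0 * y' u)).
  by apply: eq_Rint_time => u uT; rewrite g1// g2//; ring.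
have ix0 := L1Z (y 0) ix; have iy0 := L1Z (x 0) iy.
rewrite fin RintegralD//; [|exact: L1D|exact: L1D].
rewrite RintegralD// RintegralD// -e1 -e2 !RintegralZl//.
rewrite -(full _ _ xE) -(full _ _ yE) addrACA -E12 E0; ring.
Qed.

End time.

Section nonneg_series.
Context {R : realType} {d : nat}.
Local Notation Zd := 'rV[int]_d.
Local Notation tm := (@time_measure R).
Variable g : Zd -> R -> R.
Hypothesis g0 : forall k t, 0 <= g k t.
Hypothesis bg : forall k, bm (g k : measurableTypeR R -> R).

(** An extended real, summed along the exhaustion by [modes K]: monotone convergence bounds its
    integral before finiteness is known, and finiteness almost everywhere follows. *)
Definition gsum t : \bar R := limn (fun K => (\sum_(k <- modes K) g k t)%:E).

Let bP K : bm ((fun t => \sum_(k <- modes K) g k t) : measurableTypeR R -> R).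
Proof. exact: bm_sum. Qed.

Let ndP t : nondecreasing_seq (fun K => (\sum_(k <- modes K) g k t)%:E).
Proof.
move=> K K' KK; rewrite lee_fin; apply: ball1_sub; rewrite ?modes_uniq// => k.
exact: sub_modes.
Qed.

Lemma gsum_cvg t : (\sum_(k <- modes K) g k t)%:E @[K --> \oo] --> gsum t.
Proof. exact: ereal_nondecreasing_is_cvgn (ndP t). Qed.

Lemma gsum_ge s t : uniq s -> ((\sum_(k <- s) g k t)%:E <= gsum t)%E.
Proof.
move=> us; have [K sK] := modes_cover s.
apply: (@le_trans _ _ (\sum_(k <- modes K) g k t)%:E).
  by rewrite lee_fin; apply: ball1_sub; rewrite ?modes_uniq.
rewrite /gsum (cvg_lim _ (ereal_nondecreasing_cvgn (ndP t)))//.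
by apply: ereal_sup_ubound; exists K.
Qed.

Lemma gsum_ge0 t : (0 <= gsum t)%E.
Proof. by have := @gsum_ge [::] t isT; rewrite big_nil. Qed.

Lemma gsum_ball1 t : (gsum t < +oo)%E -> ball1 (g^~ t) (fine (gsum t)).
Proof. by move=> gf s us; rewrite -lee_fin fineK ?gsum_ge// ge0_fin_numE// gsum_ge0. Qed.

Lemma measurable_gsum : measurable_fun (setT : set (measurableTypeR R)) gsum.
Proof.
apply: (emeasurable_fun_cvg (fun K (t : measurableTypeR R) => (\sum_(k <- modes K) g k t)%:E)).
  by move=> K; apply/measurable_EFinP; exact: bm_meas (bP K).
by move=> t _; exact: (@gsum_cvg t).
Qed.

Lemma integral_gsum_le T C : (forall K, \int[tm T]_t \sum_(k <- modes K) g k t <= C) ->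
  (\int[tm T]_t gsum t <= C%:E)%E.
Proof.
move=> HC.
have := @cvg_monotone_convergence _ (measurableTypeR R) R (tm T) setT measurableT (fun K t => (\sum_(k <- modes K) g k t)%:E).
move=> mc.
have c : (\int[tm T]_t (\sum_(k <- modes K) g k t)%:E)%E @[K --> \oo] --> (\int[tm T]_t gsum t)%E.
  apply: mc.
  - by move=> K; apply/measurable_EFinP; exact: bm_meas (bP K).
  - by move=> K t _; rewrite lee_fin sumr_ge0.
  - by move=> t _; exact: ndP.
apply: (cvge_le _ c); apply: nearW => K.
rewrite -[X in (X <= _)%E]fineK; first by rewrite lee_fin; exact: HC.
exact: integrable_fin_num (bm_integrable (tm T) (bP K)).
Qed.

Lemma gsum_ae T C : (\int[tm T]_t gsum t <= C%:E)%E -> {ae tm T, forall t, (gsum t < +oo)%E}.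
Proof.
move=> gC; have ig : (tm T).-integrable setT gsum.
  apply/integrableP; split; first exact: measurable_gsum.
  under eq_integral => t _ do rewrite gee0_abs ?gsum_ge0//.
  exact: le_lt_trans gC (ltry _).
have := integrable_ae measurableT ig; apply: filterS => t /(_ I).
by rewrite ge0_fin_numE// gsum_ge0.
Qed.

End nonneg_series.

(** All that is retained of the limit: the later parts refer neither to the scheme nor to the
    ultrafilter. The flow is constant before time 0, so that continuity can be stated on the whole
    line. *)
Record flow {R : realType} {d : nat} (A H : R) (a : R -> 'rV[int]_d -> R[i]) : Prop := Flow {
  fl_herm : forall t, herm (a t) ;
  fl_zero : forall t, a t 0 = 0 ;
  fl_ball1 : forall t, 0 <= t ->
    ball1 (fun k => ComplexField.Normc.normc (a t k)) (A * expR (- ((1 - growth A) * t))) ;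
  fl_ball2 : forall t, 0 <= t ->
    ball2 (fun k => normk R k ^+ 2 * ComplexField.Normc.normc (a t k)) (H * expR (- ((1 - growth A) / 2 * t))) ;
  fl_init : forall t, t <= 0 -> a t = a 0 ;
  fl_Re : forall k, continuous (fun t => complex.Re (fourier (fun x => expR (- synth (a t) x)) k)) ;
  fl_Im : forall k, continuous (fun t => complex.Im (fourier (fun x => expR (- synth (a t) x)) k)) ;
  fl_odeRe : forall k s t, 0 <= s -> s <= t -> complex.Re (a t k) - complex.Re (a s k) =
    \int[@lebesgue_measure R]_(u in `[s, t]) (normk R k ^+ 4 * complex.Re (fourier (fun x => expR (- synth (a u) x)) k)) ;
  fl_odeIm : forall k s t, 0 <= s -> s <= t -> complex.Im (a t k) - complex.Im (a s k) =
    \int[@lebesgue_measure R]_(u in `[s, t]) (normk R k ^+ 4 * complex.Im (fourier (fun x => expR (- synth (a u) x)) k)) ;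
  fl_int1 : forall K t, 0 <= t -> \int[@lebesgue_measure R]_(u in `[0, t])
    \sum_(k <- modes K) normk R k ^+ 4 * `|ComplexField.Normc.normc (a u k)| <= A / (1 - growth A) ;
  fl_int2 : forall K t, 0 <= t -> \int[@lebesgue_measure R]_(u in `[0, t])
    \sum_(k <- modes K) (normk R k ^+ 4 * ComplexField.Normc.normc (a u k)) ^+ 2 <= H ^+ 2 / (1 - growth A) ;
  fl_lip : forall k s t, ComplexField.Normc.normc (a t k - a s k) <= `|t - s| * (normk R k ^+ 4 * (2 * expR A)) }.

(** * Uniform estimates on the limit flow *)

Section flow.
Context {R : realType} {d : nat}.
Local Notation Zd := 'rV[int]_d.
Local Notation mu := (torus_measure R d).
Local Notation tm := (@time_measure R).
Local Notation nk := (@normk R d).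
Local Notation nc := (@ComplexField.Normc.normc R).
Local Notation four := (@fourier R d).
Local Notation offmodes K f := (fun k => if k \in modes K then 0 else f k).
Hypothesis hd : d = 1%N \/ d = 2%N.
Variables (A H : R) (a : R -> Zd -> R[i]).
Hypothesis fa : flow A H a.
Hypothesis gA : growth A < 1.
Local Notation delta := (1 - growth A).

Let delta0 : 0 < delta. Proof. by rewrite subr_gt0. Qed.
Let A0 : 0 <= A.
Proof. by have := ball1_ge0 (fl_ball1 fa (lexx 0)); rewrite mulr0 oppr0 expR0 mulr1. Qed.
Let H0 : 0 <= H.
Proof. by have [] := fl_ball2 fa (lexx 0); rewrite mulr0 oppr0 expR0 mulr1. Qed.
Let w0 (k : Zd) : 0 <= nk k ^+ 4. Proof. by rewrite exprn_ge0// normk_ge0. Qed.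

Lemma flow_ball1 t : ball1 (fun k => nc (a t k)) A.
Proof.
have H1 s : 0 <= s -> ball1 (fun k => nc (a s k)) A.
  move=> s0; apply: ball1_leX (fl_ball1 fa s0); rewrite ler_piMr// -[leRHS]expR0 ler_expR oppr_le0.
  by rewrite mulr_ge0// ltW.
by have [t0|/ltW t0] := leP 0 t; [exact: H1|rewrite (fl_init fa t0); exact: H1].
Qed.

Lemma flow_ball2 t : ball2 (fun k => nk k ^+ 2 * nc (a t k)) H.
Proof.
have H1 s : 0 <= s -> ball2 (fun k => nk k ^+ 2 * nc (a s k)) H.
  move=> s0; apply: (sn_leX seqnorm_ball2) (fl_ball2 fa s0); rewrite ler_piMr// -[leRHS]expR0 ler_expR oppr_le0.
  by rewrite mulr_ge0// ltW// divr_gt0.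
by have [t0|/ltW t0] := leP 0 t; [exact: H1|rewrite (fl_init fa t0); exact: H1].
Qed.

Definition expc t k := four (fun x => expR (- synth (a t) x)) k.

Lemma bm_expN t : bm (fun x => expR (- synth (a t) x)).
Proof. by apply: bm_expR; apply: bmN; exact: bm_synth (flow_ball1 t). Qed.

Lemma nc_expc t k : nc (expc t k) <= 2 * expR A.
Proof.
apply: fourier_bound; first by apply: bm_integrable; exact: bm_expN.
move=> x; rewrite ger0_norm ?expR_ge0// ler_expR (le_trans (ler_norm _))// normrN.
exact: synth_bound (flow_ball1 t).
Qed.

Lemma nc_flow t k : nc (a t k) <= A. Proof. exact: ball1_term (flow_ball1 t). Qed.

Let continuous_bm (f : R -> R) M : continuous f -> (forall t, `|f t| <= M) -> bm (f : measurableTypeR R -> R).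
Proof.
move=> cf fM; split; last by exists M.
exact: continuous_measurable_fun.
Qed.

Let lip_continuous (f : R -> R) L : 0 <= L -> (forall s t, `|f t - f s| <= `|t - s| * L) -> continuous f.
Proof.
move=> L0 fL t; apply/cvgrPdist_le => e e0; have r0 : 0 < e / (1 + L) by rewrite divr_gt0// ltr_pwDl.
near=> s; have ts : `|t - s| <= e / (1 + L) by near: s; exists (e / (1 + L)) => //= s; exact: ltW.
apply: le_trans (fL _ _) _; apply: le_trans (ler_wpM2r L0 ts) _.
by rewrite -mulrA ger_pMr// mulrC ler_pdivrMr ?mul1r ?lerDr// ltr_pwDl.
Unshelve. all: by end_near. Qed.

Let L0 (k : Zd) : 0 <= nk k ^+ 4 * (2 * expR A).
Proof. by rewrite mulr_ge0// mulr_ge0// expR_ge0. Qed.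

Lemma flow_Re_continuous k : continuous (fun t => complex.Re (a t k)).
Proof.
apply: (lip_continuous (L0 k)) => s t; apply: le_trans (fl_lip fa k s t).
by rewrite -ReB nc_geRe.
Qed.

Lemma flow_Im_continuous k : continuous (fun t => complex.Im (a t k)).
Proof.
apply: (lip_continuous (L0 k)) => s t; apply: le_trans (fl_lip fa k s t).
by rewrite -ImB nc_geIm.
Qed.

Lemma bm_flow_Re k : bm ((fun t => complex.Re (a t k)) : measurableTypeR R -> R).
Proof.
apply: (@continuous_bm _ A); first exact: flow_Re_continuous.
by move=> t; exact: le_trans (nc_geRe _) (nc_flow _ _).
Qed.

Lemma bm_flow_Im k : bm ((fun t => complex.Im (a t k)) : measurableTypeR R -> R).
Proof.
apply: (@continuous_bm _ A); first exact: flow_Im_continuous.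
by move=> t; exact: le_trans (nc_geIm _) (nc_flow _ _).
Qed.

Lemma bm_flow_nc k : bm ((fun t => nc (a t k)) : measurableTypeR R -> R).
Proof.
apply: (@continuous_bm _ A); last by move=> t; rewrite ger0_norm ?nc_ge0// nc_flow.
apply: (lip_continuous (L0 k)) => s t; apply: le_trans (fl_lip fa k s t).
exact: nc_dist.
Qed.

Lemma bm_expc_Re k : bm ((fun t => complex.Re (expc t k)) : measurableTypeR R -> R).
Proof.
apply: (@continuous_bm _ (2 * expR A)); first exact: fl_Re fa k.
by move=> t; exact: le_trans (nc_geRe _) (nc_expc _ _).
Qed.

Lemma bm_expc_Im k : bm ((fun t => complex.Im (expc t k)) : measurableTypeR R -> R).
Proof.
apply: (@continuous_bm _ (2 * expR A)); first exact: fl_Im fa k.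
by move=> t; exact: le_trans (nc_geIm _) (nc_expc _ _).
Qed.

Lemma bm_expc_nc k : bm ((fun t => nc (expc t k)) : measurableTypeR R -> R).
Proof.
split; last by exists (2 * expR A) => t; rewrite ger0_norm ?nc_ge0// nc_expc.
rewrite (_ : (fun t => _) = fun t => Num.sqrt (complex.Re (expc t k) ^+ 2 + complex.Im (expc t k) ^+ 2)).
  apply: (@measurableT_comp _ _ _ _ _ _ (@Num.sqrt R)); first by apply: continuous_measurable_fun; exact: sqrt_continuous.
  by apply: bm_meas; apply: bmD; apply: bmX; [exact: bm_expc_Re|exact: bm_expc_Im].
by apply/funext => t; rewrite -nc_sqr sqrtr_sqr ger0_norm ?nc_ge0.
Qed.

Definition flow1 k t := nk k ^+ 4 * nc (a t k).
Definition flow2 k t := (nk k ^+ 4 * nc (a t k)) ^+ 2.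

Lemma flow1_ge0 k t : 0 <= flow1 k t. Proof. by rewrite mulr_ge0 ?nc_ge0. Qed.
Lemma flow2_ge0 k t : 0 <= flow2 k t. Proof. exact: sqr_ge0. Qed.
Lemma bm_flow1 k : bm (flow1 k : measurableTypeR R -> R).
Proof. by apply: bmZ; exact: bm_flow_nc. Qed.
Lemma bm_flow2 k : bm (flow2 k : measurableTypeR R -> R).
Proof. by apply: bmX; apply: bmZ; exact: bm_flow_nc. Qed.

Lemma integral_flow1 T : 0 <= T -> (\int[tm T]_t gsum flow1 t <= (A / delta)%:E)%E.
Proof.
move=> T0; apply: integral_gsum_le; [exact: flow1_ge0|exact: bm_flow1|].
move=> K; rewrite /Rintegral integral_mrestr; have := fl_int1 fa K T0; apply: le_trans.
rewrite /Rintegral le_eqVlt; apply/orP; left; apply/eqP; congr fine; apply: eq_integral => t _; congr (_%:E).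
by apply: eq_bigr => k _; rewrite /flow1 ger0_norm ?nc_ge0.
Qed.

Lemma integral_flow2 T : 0 <= T -> (\int[tm T]_t gsum flow2 t <= (H ^+ 2 / delta)%:E)%E.
Proof.
move=> T0; apply: integral_gsum_le; [exact: flow2_ge0|exact: bm_flow2|].
by move=> K; rewrite /Rintegral integral_mrestr; exact: (fl_int2 fa K T0).
Qed.

Lemma flow_tail (e : R) : 0 < e -> exists K0, forall K, (K0 <= K)%N -> forall t,
  ball1 (offmodes K (fun k => nc (a t k))) e.
Proof.
move=> e0; have e1 : 0 < e / (1 + H) by rewrite divr_gt0// ltr_pwDl.
have [K0 HK] := @ball2_tail_ball1 R d hd _ e1; exists K0 => K /HK {}HK t.
apply: (@ball1_leX _ _ _ (e / (1 + H) * H)).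
  by rewrite -mulrA ger_pMr// mulrC ler_pdivrMr ?mul1r ?lerDr// ltr_pwDl.
by apply: HK; [move=> k; exact: nc_ge0|rewrite (fl_zero fa) nc0|exact: flow_ball2].
Qed.

Lemma expc_ball2 t : ball2 (fun k => nk k ^+ 2 * nc (expc t k)) ((1 + growth A) * H).
Proof. exact: (expN_synth_ball subquartic2 seqnorm_ball2 (flow_ball1 t) (flow_ball2 t)). Qed.

Lemma expc_tail (e : R) : 0 < e -> exists K0, forall K, (K0 <= K)%N -> forall t,
  ball1 (offmodes K (fun k => nc (expc t k))) e.
Proof.
pose M := (1 + growth A) * H; have M0 : 0 <= M by rewrite mulr_ge0// addr_ge0// growth_ge0.
move=> e0; have e1 : 0 < e / (1 + M) by rewrite divr_gt0// ltr_pwDl.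
have [K0 HK] := @ball2_tail_ball1 R d hd _ e1; have [K1 K1s] := @modes_cover d [:: 0].
exists (maxn K0 K1) => K; rewrite geq_max => /andP[/HK {}HK KK1] t.
(* e^(-v) does not have mean zero, and the weight |k|^2 does not see its mean; the cut-off is
   therefore taken large enough to contain k = 0. *)
pose f k := if k == 0 then 0 else nc (expc t k).
have : ball1 (offmodes K f) (e / (1 + M) * M).
  apply: HK; first by move=> k; rewrite /f; case: ifP => // _; exact: nc_ge0.
    by rewrite /f eqxx.
  apply: (sn_le seqnorm_ball2) (expc_ball2 t) => k; rewrite /f; case: eqP => [->|_].
    by rewrite mulr0 lexx mulr_ge0 ?sqr_ge0 ?nc_ge0.
  by rewrite lexx mulr_ge0 ?sqr_ge0 ?nc_ge0.
move=> /ball1_leX bf; apply: (@ball1_le _ _ _ (offmodes K f)); last apply: bf.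
  move=> k; case: ifPn => // kK; rewrite /f; case: eqP => // k0; move: kK.
  by rewrite k0 (sub_modes KK1)// K1s// mem_head.
by rewrite -mulrA ger_pMr// mulrC ler_pdivrMr ?mul1r ?lerDr// ltr_pwDl.
Qed.

Lemma flow_Re_int T k t : 0 <= t <= T -> complex.Re (a t k) =
  complex.Re (a 0 k) + \int[tm T]_u (\1_`[0, t] u * (nk k ^+ 4 * complex.Re (expc u k))).
Proof.
move=> /andP[t0 tT]; rewrite -(time_integral_itv _ (lexx 0) t0 tT) -(fl_odeRe fa k (lexx 0) t0).
by rewrite addrC subrK.
Qed.

Lemma flow_Im_int T k t : 0 <= t <= T -> complex.Im (a t k) =
  complex.Im (a 0 k) + \int[tm T]_u (\1_`[0, t] u * (nk k ^+ 4 * complex.Im (expc u k))).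
Proof.
move=> /andP[t0 tT]; rewrite -(time_integral_itv _ (lexx 0) t0 tT) -(fl_odeIm fa k (lexx 0) t0).
by rewrite addrC subrK.
Qed.

(** From 2 |k|^4 x x' <= (|k|^4 x)^2 + (x')^2 for the real and the imaginary part. The right-hand
    side is independent of t and [flow_sup] sums it over k, which makes the H^2 tails uniform in
    time, as continuity into H^2 requires. *)
Lemma flow_energy T k t : 0 <= t <= T ->
  (nk k ^+ 2 * nc (a t k)) ^+ 2 <= (nk k ^+ 2 * nc (a 0 k)) ^+ 2 +
    \int[tm T]_u (flow2 k u + (nk k ^+ 4 * nc (expc u k)) ^+ 2).
Proof.
move=> /andP[t0 tT].
have bR := bm_flow_Re k; have bI := bm_flow_Im k; have bER := bmZ (nk k ^+ 4) (bm_expc_Re k).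
have bEI := bmZ (nk k ^+ 4) (bm_expc_Im k).
have half (x x' : measurableTypeR R -> R) : bm x -> bm x' ->
    (forall s, 0 <= s <= t -> x s = x 0 + \int[tm t]_u (\1_`[0, s] u * x' u)) ->
    nk k ^+ 4 * x t ^+ 2 <= nk k ^+ 4 * x 0 ^+ 2 + \int[tm t]_u ((nk k ^+ 4 * x u) ^+ 2 + x' u ^+ 2).
  move=> bx bx' xE.
  have := ibp_ac t0 (bm_integrable (tm t) bx') (bm_integrable (tm t) bx') xE xE.
  rewrite -lerBlDl -mulrBr !expr2 => ->; rewrite -RintegralZl//; last first.
    by apply: bm_integrable; apply: bmD; exact: bmM.
  apply: le_Rintegral => //.
  - by apply: bm_integrable; apply: bmZ; apply: bmD; exact: bmM.
  - by apply: bm_integrable; apply: bmD; apply: bmX => //; exact: bmZ.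
  - move=> u _; rewrite -subr_ge0.
    rewrite (_ : _ - _ = (nk k ^+ 4 * x u - x' u) ^+ 2) ?sqr_ge0//; ring.
have := lerD (half _ _ bR bER (fun s st => flow_Re_int k st)) (half _ _ bI bEI (fun s st => flow_Im_int k st)).
rewrite addrACA -RintegralD//; try (by apply: bm_integrable; apply: bmD; apply: bmX => //; exact: bmZ).
rewrite -!mulrDr -!nc_sqr.
have sq z : (nk k ^+ 2 * nc z) ^+ 2 = nk k ^+ 4 * nc z ^+ 2 by rewrite exprMn -exprM.
rewrite !sq => /le_trans; apply; rewrite lerD2l.
have -> : \int[tm t]_x ((nk k ^+ 4 * complex.Re (a x k)) ^+ 2 + (nk k ^+ 4 * complex.Re (expc x k)) ^+ 2 +
    ((nk k ^+ 4 * complex.Im (a x k)) ^+ 2 + (nk k ^+ 4 * complex.Im (expc x k)) ^+ 2)) =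
    \int[tm t]_u (flow2 k u + (nk k ^+ 4 * nc (expc u k)) ^+ 2).
  apply: eq_Rintegral => u _; rewrite /flow2; have := nc_sqr (a u k); have := nc_sqr (expc u k).
  move: (nk k ^+ 4) (nc (a u k)) (nc (expc u k)) (complex.Re (a u k)) (complex.Im (a u k))
    (complex.Re (expc u k)) (complex.Im (expc u k)) => w n1 n2 p q r s h1 h2.
  by rewrite !exprMn h1 h2; ring.
apply: time_integral_mono => //; last by move=> u; rewrite addr_ge0 ?sqr_ge0.
by apply: bmD; [exact: bm_flow2|exact: bmX (bmZ _ (bm_expc_nc k))].
Qed.

(** e^(-v) inherits the weighted l^2 bound of v up to the factor 1 + growth A, so both integrands
    are controlled by the H^4 dissipation of v. *)
Lemma flow_sup T s : 0 <= T -> uniq s -> \sum_(k <- s) ((nk k ^+ 2 * nc (a 0 k)) ^+ 2 +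
    \int[tm T]_u (flow2 k u + (nk k ^+ 4 * nc (expc u k)) ^+ 2)) <=
  H ^+ 2 + (1 + (1 + growth A) ^+ 2) * (H ^+ 2 / delta).
Proof.
move=> T0 us; rewrite big_split/=; apply: lerD; first by have [_ /(_ _ us)] := flow_ball2 0.
have bb k : bm ((fun u => flow2 k u + (nk k ^+ 4 * nc (expc u k)) ^+ 2) : measurableTypeR R -> R).
  by apply: bmD; [exact: bm_flow2|exact: bmX (bmZ _ (bm_expc_nc k))].
rewrite -Rint_sum; last by move=> k; exact: bm_integrable.
have g1 : 0 <= 1 + growth A by rewrite addr_ge0// growth_ge0.
have c0 : 0 <= 1 + (1 + growth A) ^+ 2 by rewrite addr_ge0// sqr_ge0.
rewrite -lee_fin /Rintegral fineK; last exact: integrable_fin_num (bm_integrable (tm T) (bm_sum _ bb)).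
apply: (@le_trans _ _ (\int[tm T]_u ((1 + (1 + growth A) ^+ 2)%:E * gsum flow2 u))%E); last first.
  rewrite ge0_integralZl_EFin//.
  - by rewrite EFinM lee_wpmul2l ?lee_fin// integral_flow2.
  - by move=> u _; apply: gsum_ge0; exact: flow2_ge0.
  - by apply: measurable_gsum; [exact: flow2_ge0|exact: bm_flow2].
apply: ge0_le_integral_T => u.
  by rewrite lee_fin sumr_ge0// => k _; rewrite addr_ge0 ?sqr_ge0.
(* At times where the dissipation is infinite the bound holds trivially. *)
have := @gsum_ge0 _ _ _ flow2_ge0 u; case E : (gsum flow2 u) => [r| |] // r0; last first.
  by rewrite mulry gtr0_sg ?mul1e ?leey// ltr_pwDl// sqr_ge0.
rewrite -EFinM lee_fin mulrDl mul1r big_split/=.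
have fin : (gsum flow2 u < +oo)%E by rewrite E ltry.
have b1 := gsum_ball1 flow2_ge0 fin; rewrite E/= in b1.
apply: lerD; first exact: b1.
have b2 : ball2 (fun k => nk k ^+ 4 * nc (a u k)) (Num.sqrt r).
  by split; [exact: sqrtr_ge0|move=> s' us'; rewrite sqr_sqrtr// -?lee_fin//; exact: b1].
have [_ /(_ _ us)] := expN_synth_ball subquartic4 seqnorm_ball2 (flow_ball1 u) b2.
by rewrite exprMn sqr_sqrtr.
Qed.

Lemma flow_tail2 T (e : R) : 0 <= T -> 0 < e -> exists K0, forall K, (K0 <= K)%N -> forall t, 0 <= t <= T ->
  ball2 (offmodes K (fun k => nk k ^+ 2 * nc (a t k))) e.
Proof.
move=> T0 e0.
pose r k := (nk k ^+ 2 * nc (a 0 k)) ^+ 2 + \int[tm T]_u (flow2 k u + (nk k ^+ 4 * nc (expc u k)) ^+ 2).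
have r0 k : 0 <= r k.
  by rewrite addr_ge0 ?sqr_ge0// Rintegral_ge0// => u _; rewrite addr_ge0 ?sqr_ge0.
have rb : ball1 r (H ^+ 2 + (1 + (1 + growth A) ^+ 2) * (H ^+ 2 / delta)) by move=> s; exact: flow_sup.
have e2 : 0 < e ^+ 2 by rewrite exprn_gt0.
have [K0 HK] := seqnorm_tail_modes seqnorm_ball1 r0 rb e2.
exists K0 => K /HK {}HK t tT; split=> [|s us]; first exact: ltW.
apply: le_trans (HK _ us); apply: ler_sum => k _; case: ifP => _; first by rewrite expr0n.
exact: flow_energy.
Qed.

End flow.

(** * Function spaces *)

Section lnorm.
Local Open Scope ereal_scope.
Context dsp (T : measurableType dsp) (R : realType) (mu : {measure set T -> \bar R}).
Implicit Types (f g : T -> \bar R).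

Lemma ler_poweR (r : R) (x y : \bar R) : (0 <= r)%R -> 0 <= x -> x <= y -> x `^ r <= y `^ r.
Proof.
move=> r0 x0 xy; apply: gt0_ler_poweR => //; rewrite in_itv/= leey andbT//.
exact: le_trans xy.
Qed.

Lemma Lnorm_le_ae (p : \bar R) f g : 0 < p -> {ae mu, forall x, `|f x| <= `|g x|} ->
  'N[mu]_p[f] <= 'N[mu]_p[g].
Proof.
move=> p0 fg; rewrite unlock; case: p p0 => [r| |]//= r0.
  rewrite lte_fin in r0; apply: ler_poweR.
  - by rewrite invr_ge0 ltW.
  - by rewrite integral_ge0// => x _; exact: poweR_ge0.
  apply: ae_ge0_le_integral => [x|x|]; [exact: poweR_ge0|exact: poweR_ge0|].
  apply: filterS fg => x fgx; apply: ler_poweR => //; exact: ltW.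
by case: ifPn => // _; apply: le_ess_sup; apply: filterS fg.
Qed.

End lnorm.

Section lnorm_fin.
Local Open Scope ereal_scope.
Context dsp (T : measurableType dsp) (R : realType) (mu : {finite_measure set T -> \bar R}).

Lemma Lnorm_cst_fin (p : \bar R) : 0 < p -> exists2 C : R, (0 <= C)%R &
  forall M : R, (0 <= M)%R -> 'N[mu]_p[cst M%:E] <= (C * M)%:E.
Proof.
case: p => [r| |]//.
  rewrite lte_fin => r0; exists (fine (mu setT) `^ r^-1)%R; first exact: powR_ge0.
  move=> M M0; rewrite unlock/=.
  have -> : \int[mu]_x `|M%:E| `^ r = (M `^ r * fine (mu setT))%:E.
    by rewrite integral_cst//= ger0_norm// EFinM fineK// fin_num_measure.
  rewrite /= powRM ?powR_ge0//; last by rewrite fine_ge0.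
  by rewrite -powRrM mulfV ?gt_eqF// powRr1// mulrC.
move=> _; exists 1%R => // M M0; rewrite mul1r unlock; case: ifPn => [_|_]; last by rewrite lee_fin.
by apply/ess_supP; apply: aeW => x /=; rewrite ger0_norm.
Qed.

Lemma Lnorm_bound (p : \bar R) : 0 < p -> exists2 C : R, (0 <= C)%R &
  forall (f : T -> \bar R) (M : R), {ae mu, forall x, `|f x| <= M%:E} -> (0 <= M)%R -> 'N[mu]_p[f] <= (C * M)%:E.
Proof.
move=> p0; have [C C0 HC] := Lnorm_cst_fin p0; exists C => // f M fM M0.
apply: le_trans (HC M M0); apply: Lnorm_le_ae => //; apply: filterS fM => x.
by rewrite /= [(`|M|)%R]ger0_norm.
Qed.

Lemma bm_Lfun (p : \bar R) (f : T -> R) : 0 < p -> bm f -> f \in Lfun mu p.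
Proof.
move=> p0 [mf [M fM]]; rewrite inE; apply/andP; split; rewrite inE//=.
rewrite /finite_norm; have [C _ HC] := Lnorm_bound p0.
apply: le_lt_trans (HC _ `|M|%R _ _) (ltry _) => //.
by apply: aeW => x /=; rewrite lee_fin (le_trans (fM x))// ler_norm.
Qed.

End lnorm_fin.

Section esum_ball.
Context {R : realType} {I : countType}.

Lemma esum_le_ball1 (f : I -> R) X : ball1 f X -> (\esum_(k in [set: I]) (f k)%:E <= X%:E)%E.
Proof.
move=> fX; apply: ge_ereal_sup => _ [A [finA _] <-].
by rewrite fsbig_finite//= sumEFin lee_fin fX// finmap.fset_uniq.
Qed.

Lemma esum_ge_seq (f : I -> R) s : uniq s -> ((\sum_(k <- s) f k)%:E <= \esum_(k in [set: I]) (f k)%:E)%E.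
Proof.
move=> us; apply: esum_ge; exists [set` s]; first by split => //; exact: finite_seq.
by rewrite -sumEFin -fsbig_seq.
Qed.

Lemma ball1_esum (f : I -> R) : (forall k, 0 <= f k) -> (\esum_(k in [set: I]) (f k)%:E < +oo)%E ->
  ball1 f (fine (\esum_(k in [set: I]) (f k)%:E)).
Proof.
move=> f0 ff s us; rewrite -lee_fin fineK ?esum_ge_seq//.
by rewrite ge0_fin_numE// esum_ge0// => k _; rewrite lee_fin.
Qed.

End esum_ball.

Section spaces.
Context {R : realType} {d : nat}.
Local Notation Zd := 'rV[int]_d.
Local Notation mu := (torus_measure R d).
Local Notation nk := (@normk R d).
Local Notation nc := (@ComplexField.Normc.normc R).
Local Notation four := (@fourier R d).
Implicit Types (c : Zd -> R[i]).

(** The interface between sequences and function spaces. Strong measurability and continuity in time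
    are proved once for any space whose norm is dominated in this sense, then applied to L^p, H^n
    and W^(n,oo). *)
Definition dominated (X : fspace R d) (B : (Zd -> R) -> R -> Prop) (w : Zd -> R) (C : R) : Prop :=
  forall c A Y, herm c -> c 0 = 0 -> ball1 (fun k => nc (c k)) A -> B (fun k => w k * nc (c k)) Y ->
  fcarrier X (synth c) /\ (fnorm X (synth c) <= (C * Y)%:E)%E.

Lemma dominated_Lp (p : \bar R) : (0 < p)%E -> exists2 C : R, 0 <= C &
  dominated (Lp_space d p) ball1 (fun=> 1) C.
Proof.
move=> p0; have [C C0 HC] := Lnorm_bound mu p0; exists C => // c A Y hc c0 cA cY.
split; first by apply: bm_Lfun => //; exact: bm_synth cA.
have {}cY : ball1 (fun k => nc (c k)) Y by apply: ball1_le cY => k; rewrite mul1r.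
apply: HC; last exact: ball1_ge0 cY.
by apply: aeW => x /=; rewrite lee_fin synth_bound.
Qed.

Lemma normk_powR (k : Zd) (n : nat) : nk k `^ (2 * n%:R) = nk k ^+ (2 * n).
Proof. by rewrite -natrM powR_mulrn// normk_ge0. Qed.

(** Orders r <= n are compared on nonzero frequencies, where |k| >= 1, and the coefficient at 0
    vanishes. With n = 2 the H^2 bound covers every r < 2. *)
Lemma h_norm_le (r : R) (n : nat) c A Y : 0 <= r <= n%:R -> herm c -> c 0 = 0 -> ball1 (fun k => nc (c k)) A ->
  ball2 (fun k => nk k ^+ n * nc (c k)) Y -> (h_norm r (synth c) <= Y%:E)%E.
Proof.
move=> /andP[r0 rn] hc c0 cA [Y0 cY]; rewrite /h_norm (fourier_synth hc cA).
have e : (\esum_(k in [set: Zd]) (nk k `^ (2 * r) * nc (c k) ^+ 2)%:E <= (Y ^+ 2)%:E)%E.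
  apply: esum_le_ball1 => s us; apply: le_trans (cY s us); apply: ler_sum => k _.
  case: (eqVneq k 0) => [->|k0]; first by rewrite c0 nc0 expr0n/= !mulr0 expr0n.
  rewrite exprMn ler_wpM2r ?sqr_ge0// -exprM mulnC -normk_powR ler_powR ?normk_ge1//.
  by rewrite ler_pM2l.
have -> : Y%:E = ((Y ^+ 2)%:E `^ 2^-1)%E.
  by rewrite /= powR12_sqrt ?sqr_ge0// sqrtr_sqr ger0_norm.
apply: ler_poweR => //.
by apply: esum_ge0 => k _; rewrite lee_fin mulr_ge0 ?powR_ge0 ?sqr_ge0.
Qed.

Lemma dominated_H (n : nat) : d = 1%N \/ d = 2%N -> (2 <= n)%N -> exists2 C : R, 0 <= C &
  dominated (Hspace d n%:R) ball2 (fun k => nk k ^+ n) C.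
Proof.
move=> hd n2; have [C1 C10 HC1] := @ball2_ball1 R d hd.
have [|C2 C20 HC2] := @Lnorm_bound _ _ _ mu 2%:E; first by rewrite lte_fin.
exists (C2 * C1 + 1); first by rewrite addr_ge0// mulr_ge0.
move=> c A Y hc c0 cA cY.
have hY : (h_norm n%:R (synth c) <= Y%:E)%E by apply: (h_norm_le _ hc c0 cA cY); rewrite lexx ler0n.
split; first by split; [apply: bm_Lfun => //; exact: bm_synth cA|exact: le_lt_trans hY (ltry _)].
have -> : ((C2 * C1 + 1) * Y)%:E = ((C2 * (C1 * Y))%:E + Y%:E)%E by rewrite -EFinD mulrDl mul1r mulrA.
apply: leeD => //.
have c1 : ball1 (fun k => nc (c k)) (C1 * Y).
  apply: HC1; [by move=> k; exact: nc_ge0|by rewrite c0 nc0|].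
  apply: (sn_le seqnorm_ball2) cY => k; rewrite mulr_ge0 ?sqr_ge0 ?nc_ge0//=.
  case: (eqVneq k 0) => [->|k0]; first by rewrite c0 nc0 !mulr0.
  by rewrite ler_wpM2r ?nc_ge0// ler_weXn2l// normk_ge1.
apply: HC2; last exact: ball1_ge0 c1.
by apply: aeW => x /=; rewrite lee_fin synth_bound.
Qed.

Lemma Rint_unif_lim (u w : 'rV[R]_d -> R) (F : nat -> 'rV[R]_d -> R) : bm u -> (forall K, bm (F K)) ->
  mu.-integrable setT (EFin \o w) ->
  (forall e : R, 0 < e -> exists K0, forall K, (K0 <= K)%N -> forall x, `|u x - F K x| <= e) ->
  \int[mu]_x (F K x * w x) @[K --> \oo] --> \int[mu]_x (u x * w x).
Proof.
move=> bu bF iw Fu; apply/cvgrPdist_le => e e0.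
have imul v : bm v -> mu.-integrable setT (EFin \o (fun x => v x * w x)).
  by move=> bv; have := integrable_bmM iw bv; apply: eq_integrable => // x _ /=; rewrite mulrC.
pose W := \int[mu]_x `|w x|.
have W0 : 0 <= W by exact: Rintegral_ge0.
have [|K0 HK] := Fu (e / (1 + W)); first by rewrite divr_gt0// ltr_pwDl.
exists K0 => // K /= /HK {}HK; rewrite -RintegralB//; [|exact: imul..].
apply: le_trans (le_normr_Rintegral _ _) _ => //; first by apply: L1B; exact: imul.
have iw' : mu.-integrable setT (EFin \o (fun x => `|w x|)) by have := integrable_norm iw.
apply: (@le_trans _ _ (\int[mu]_x (e / (1 + W) * `|w x|))).
  apply: le_Rintegral => //; first by have := integrable_norm (L1B (imul _ bu) (imul _ (bF K))).
    exact: L1Z.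
  by move=> x _; rewrite -mulrBl normrM ler_wpM2r.
rewrite RintegralZl// -mulrA ger_pMr// mulrC ler_pdivrMr ?mul1r ?lerDr//.
by rewrite ltr_pwDl.
Qed.

(** The Fourier symbol of the mixed derivative with multi-index [a]. *)
Definition ikpow (a : 'I_d -> nat) (k : Zd) : R[i] := \prod_(i <- enum 'I_d) ik k i ^+ a i.

Lemma nc_prod (I : Type) (s : seq I) (F : I -> R[i]) : nc (\prod_(i <- s) F i) = \prod_(i <- s) nc (F i).
Proof.
elim: s => [|i s IH]; last by rewrite !big_cons ncM IH.
by rewrite !big_nil -[1]/(Complex 1 0) nc_real normr1.
Qed.

Lemma ncX (z : R[i]) n : nc (z ^+ n) = nc z ^+ n.
Proof.
elim: n => [|n IH]; last by rewrite !exprS ncM IH.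
by rewrite !expr0 -[1]/(Complex 1 0) nc_real normr1.
Qed.

Lemma nc_ikpow (a : 'I_d -> nat) (k : Zd) : nc (ikpow a k) <= nk k ^+ (\sum_i a i).
Proof.
rewrite /ikpow nc_prod -prodrXr big_enum/=; apply: ler_prod => i _; rewrite nc_ge0/= ncX.
rewrite lerXn2r ?nnegrE ?nc_ge0 ?normk_ge0//; apply: le_trans (nc_leReIm _) _.
by rewrite /ik/= normr0 add0r normk_coord.
Qed.

Lemma mode_mpartial (a : 'I_d -> nat) eta (k : Zd) (c : R[i]) : smooth_periodic eta ->
  \int[mu]_x (mode k (ikpow a k * c) x * eta x) =
  (-1) ^+ (\sum_i a i)%N * \int[mu]_x (mode k c x * mpartial a eta x).
Proof.
move=> seta; rewrite /ikpow /mpartial; have -> : (\sum_i a i = \sum_(i <- enum 'I_d) a i)%N by rewrite big_enum.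
have iterS i n f : smooth_periodic f -> smooth_periodic (iter n (partial i) f).
  by move=> sf; elim: n => //= n sfn; exact: smooth_periodic_partial.
have iter_ibp i n f (c' : R[i]) : smooth_periodic f ->
    \int[mu]_x (mode k c' x * iter n (partial i) f x) =
    (-1) ^+ n * \int[mu]_x (mode k (ik k i ^+ n * c') x * f x).
  move=> sf; elim: n c' => [|n IH] c'; first by rewrite !expr0 !mul1r.
  rewrite /= -[LHS]opprK -mode_ibp; last exact: iterS.
  by rewrite IH exprSr mulrA exprSr mulrN1 mulNr.
elim: (enum 'I_d) c => [|i s IH] c /=.
  by rewrite !big_nil !expr0 !mul1r.
have sf : smooth_periodic (foldr (fun i => iter (a i) (partial i)) eta s).
  by elim: (s) => //= j s' sf; exact: iterS.
rewrite iter_ibp// !big_cons exprD mulrACA -expr2 -exprM mulnC exprM sqrrN expr1n expr1n mul1r.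
by rewrite -IH mulrCA mulrA.
Qed.

Lemma bm_mpartial (a : 'I_d -> nat) (eta : 'rV[R]_d -> R) : smooth_periodic eta -> bm (mpartial a eta).
Proof.
move=> seta; apply: bm_smooth_periodic; rewrite /mpartial; elim: (enum 'I_d) => //= i s sf.
by elim: (a i) => //= n sfn; exact: smooth_periodic_partial.
Qed.

(** Each partial sum satisfies the identity by repeated integration by parts, and both series
    converge uniformly. *)
Lemma weak_partial_synth (a : 'I_d -> nat) c A Y : ball1 (fun k => nc (c k)) A ->
  ball1 (fun k => nc (ikpow a k * c k)) Y ->
  weak_partial a (synth c) (synth (fun k => ikpow a k * c k)).
Proof.
move=> cA cY eta seta; have be := bm_smooth_periodic seta; have bp := bm_mpartial a seta.
have l1 := Rint_unif_lim (bm_synth cY) (fun K => bm_psum K _) (bm_integrable mu be) (fun e e0 => synth_unif cY e0).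
have l2 := Rint_unif_lim (bm_synth cA) (fun K => bm_psum K _) (bm_integrable mu bp) (fun e e0 => synth_unif cA e0).
have ps (b : Zd -> R[i]) K w : bm w -> \int[mu]_x (psum K b x * w x) = \sum_(k <- modes K) \int[mu]_x (mode k (b k) x * w x).
  move=> bw; rewrite -Rint_sum; last by move=> k; apply: bm_integrable; apply: bmM => //; exact: bm_mode.
  by apply: eq_Rintegral => x _; rewrite /psum mulr_suml.
apply: (cvg_unique _ l1) => //.
have -> : (fun K => \int[mu]_x (psum K (fun k => ikpow a k * c k) x * eta x)) =
    fun K => (-1) ^+ (\sum_i a i)%N * \int[mu]_x (psum K c x * mpartial a eta x).
  apply/funext => K; rewrite !ps// mulr_sumr; apply: eq_bigr => k _.
  exact: mode_mpartial.
exact: cvgMr.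
Qed.

Lemma dominated_W (n : nat) : exists2 C : R, 0 <= C & dominated (Wspace d n +oo%E) ball1 (fun k => nk k ^+ n) C.
Proof.
have [|C C0 HC] := @Lnorm_bound _ _ _ mu +oo%E; first by [].
(* The number of all multi-indices bounds the number of those of total order at most n. *)
exists (C *+ #|{ffun 'I_d -> 'I_n.+1}|); first by rewrite mulrn_wge0.
move=> c A Y hc c0 cA cY.
have ab (a : {ffun 'I_d -> 'I_n.+1}) : (\sum_i a i <= n)%N -> ball1 (fun k => nc (ikpow (fun i => a i : nat) k * c k)) Y.
  move=> an; apply: ball1_le cY => k; rewrite ncM; case: (eqVneq k 0) => [->|k0].
    by rewrite c0 nc0 !mulr0.
  rewrite ler_wpM2r ?nc_ge0// (le_trans (nc_ikpow _ _))// ler_weXn2l// normk_ge1//.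
suff sn : (sobolev_norm n +oo (synth c) <= (C *+ #|{ffun 'I_d -> 'I_n.+1}| * Y)%:E)%E.
  split; last exact: sn.
  by split; [apply: bm_Lfun => //; exact: bm_synth cA|exact: le_lt_trans sn (ltry _)].
pose g (a : {ffun 'I_d -> 'I_n.+1}) := synth (fun k => ikpow (fun i => a i : nat) k * c k).
apply: (@le_trans _ _ (\sum_(a : {ffun 'I_d -> 'I_n.+1} | (\sum_i a i <= n)%N) 'N[mu]_+oo [EFin \o g a])%E).
  apply: ereal_inf_lbound; exists g; split=> // a an; split.
    by apply: bm_Lfun => //; exact: bm_synth (ab a an).
  exact: weak_partial_synth cA (ab a an).
have Y0 := ball1_ge0 cY.
apply: (@le_trans _ _ (\sum_(a : {ffun 'I_d -> 'I_n.+1} | (\sum_i a i <= n)%N) (C * Y)%:E)%E).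
  apply: lee_sum => a an; apply: HC => //.
  by apply: aeW => x /=; rewrite lee_fin; apply: synth_bound; exact: ab.
rewrite sumEFin lee_fin sumr_const -mulrnAl ler_wpM2r// ler_wpMn2l//.
exact: max_card.
Qed.

End spaces.

Lemma cvge0_le {R : realType} (u : nat -> \bar R) : (forall n, (0 <= u n)%E) ->
  (forall e : R, 0 < e -> \forall n \near \oo, (u n <= e%:E)%E) -> u n @[n --> \oo] --> 0%E.
Proof.
move=> u0 ue; have fin : \forall n \near \oo, u n \is a fin_num.
  by apply: filterS (ue 1 ltr01) => n un; rewrite ge0_fin_numE ?u0// (le_lt_trans un)// ltry.
rewrite -(_ : (0%:R)%:E = 0%E)//; apply/fine_cvgP; split=> //.
apply/cvgrPdist_le => e e0; apply: filterS2 fin (ue e e0) => n fn un.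
by rewrite sub0r normrN /= ger0_norm ?fine_ge0// -lee_fin fineK.
Qed.

Lemma cvge0_le_filter {R : realType} (F : set_system R) {FF : Filter F} (u : R -> \bar R) : (forall n, (0 <= u n)%E) ->
  (forall e : R, 0 < e -> \forall n \near F, (u n <= e%:E)%E) -> u n @[n --> F] --> 0%E.
Proof.
move=> u0 ue; have fin : \forall n \near F, u n \is a fin_num.
  by apply: filterS (ue 1 ltr01) => n un; rewrite ge0_fin_numE ?u0// (le_lt_trans un)// ltry.
rewrite -(_ : (0%:R)%:E = 0%E)//; apply/fine_cvgP; split=> //.
apply/cvgrPdist_le => e e0; apply: filterS2 fin (ue e e0) => n fn un.
by rewrite sub0r normrN /= ger0_norm ?fine_ge0// -lee_fin fineK.
Qed.

Section gsum_fine.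
Context {R : realType} {d : nat}.
Local Notation tm := (@time_measure R).

Lemma gsum_fine (g : 'rV[int]_d -> R -> R) T C : (forall k t, 0 <= g k t) ->
  (forall k, bm (g k : measurableTypeR R -> R)) -> (\int[tm T]_t gsum g t <= C%:E)%E ->
  exists h : R -> R, [/\ forall t, 0 <= h t, (tm T).-integrable setT (EFin \o h),
    \int[tm T]_t h t <= C & {ae tm T, forall t, ball1 (g^~ t) (h t)}].
Proof.
move=> g0 bg gC; pose h t := fine (gsum g t).
have h0 t : 0 <= h t by rewrite fine_ge0// gsum_ge0.
have ha : {ae tm T, forall t, (h t)%:E = gsum g t}.
  by apply: filterS (gsum_ae g0 bg gC) => t gt; rewrite /h fineK// ge0_fin_numE// gsum_ge0.
have hE : (\int[tm T]_t (h t)%:E = \int[tm T]_t gsum g t)%E by exact: ae_eq_integral_T.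
have ih : (tm T).-integrable setT (EFin \o h).
  apply/integrableP; split.
    by apply/measurable_EFinP; apply: measurableT_comp => //; exact: measurable_gsum.
  rewrite (_ : (\int[tm T]_t _)%E = \int[tm T]_t (h t)%:E)%E; first by rewrite hE (le_lt_trans gC)// ltry.
  by apply: eq_integral => t _; rewrite /= ger0_norm.
exists h; split=> //.
  by rewrite -lee_fin /Rintegral fineK ?hE// -hE; exact: integrable_fin_num ih.
by apply: filterS (gsum_ae g0 bg gC) => t; exact: gsum_ball1.
Qed.

End gsum_fine.

(** * Approximation by step functions and strong measurability *)

Section steps.
Context {R : realType} {d : nat}.
Local Notation Zd := 'rV[int]_d.
Local Notation mu := (torus_measure R d).
Local Notation tm := (@time_measure R).
Local Notation nk := (@normk R d).
Local Notation nc := (@ComplexField.Normc.normc R).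
Local Notation offmodes K f := (fun k => if k \in modes K then 0 else f k).
Hypothesis hd : d = 1%N \/ d = 2%N.
Variables (A H : R) (a : R -> Zd -> R[i]).
Hypothesis fa : flow A H a.
Hypothesis gA : growth A < 1.

Let aA t := flow_ball1 fa gA t.

Variables (w : Zd -> R).
Hypothesis w0 : forall k, 0 <= w k.

(** Chosen against the Lipschitz constants of the coefficients: over one mesh interval the
    coefficients in [modes n] move by at most 1 / (n + 1) in total, measured with the weight [w]. *)
Definition mesh n : R := (n.+1%:R * (1 + \sum_(k <- modes n) w k * (nk k ^+ 4 * (2 * expR A))))^-1.
Definition node n t := mesh n * (Num.truncn (t / mesh n))%:R.
Definition trunc_coef n (b : Zd -> R[i]) k : R[i] := if k \in modes n then b k else 0.

Let W0 n : 0 <= \sum_(k <- modes n) w k * (nk k ^+ 4 * (2 * expR A)).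
Proof.
by apply: sumr_ge0 => k _; rewrite mulr_ge0// mulr_ge0 ?exprn_ge0 ?normk_ge0// mulr_ge0// expR_ge0.
Qed.

Lemma mesh_gt0 n : 0 < mesh n.
Proof. by rewrite invr_gt0 mulr_gt0// ltr_pwDl. Qed.

Lemma node_dist n t : 0 <= t -> `|t - node n t| <= mesh n.
Proof.
move=> t0; have h0 := mesh_gt0 n; rewrite /node.
have := truncn_itv (divr_ge0 t0 (ltW h0)); rewrite ler_pdivlMr// ltr_pdivrMr// -natr1 => /andP[h1 h2].
by rewrite mulrC ger0_norm ?subr_ge0//; lra.
Qed.

(** On each mesh interval the partial sum is frozen at the left end. The time set [E] is built in
    because the values of the vector measure are integrals over [E]. *)
Definition tstep T (E : set (measurableTypeR R)) n : step R d :=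
  @Step R d (Num.truncn (T / mesh n)).+1
    (fun j => E `&` `[mesh n * (j : nat)%:R, mesh n * (j : nat).+1%:R[ )
    (fun j => psum n (a (mesh n * (j : nat)%:R))).

Lemma step_indic n t j : 0 <= t -> \1_(`[mesh n * j%:R, mesh n * j.+1%:R[ : set (measurableTypeR R)) t =
  (j == Num.truncn (t / mesh n))%:R :> R.
Proof.
move=> t0; have h0 := mesh_gt0 n; rewrite indicE mem_setE in_itv/=; congr ((nat_of_bool _)%:R).
have d0 := divr_ge0 t0 (ltW h0).
rewrite mulrC -ler_pdivlMr// [mesh n * _]mulrC -ltr_pdivrMr//.
by rewrite eq_sym truncn_eq.
Qed.

Lemma sum_step (T : R) (E : set (measurableTypeR R)) n (t : R) (F : nat -> R) : 0 <= t <= T ->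
  \sum_(j < (Num.truncn (T / mesh n)).+1) \1_(E `&` `[mesh n * j%:R, mesh n * j.+1%:R[) t * F j =
  \1_E t * F (Num.truncn (t / mesh n)).
Proof.
move=> /andP[t0 tT]; have h0 := mesh_gt0 n.
have jT : (Num.truncn (t / mesh n) < (Num.truncn (T / mesh n)).+1)%N.
  by rewrite ltnS; apply: le_truncn; apply: ler_wpM2r => //; rewrite invr_ge0 ltW.
rewrite (bigD1 (Ordinal jT))//= big1 ?addr0.
  by rewrite indicI/= step_indic// eqxx mulr1.
move=> j jn; rewrite indicI/= step_indic// (_ : (j == _ :> nat) = false) ?mulr0 ?mul0r//.
by apply/negbTE; apply: contra jn => /eqP jE; apply/eqP/val_inj.
Qed.

Lemma tstep_fun (T : R) (E : set (measurableTypeR R)) n (t : R) x : 0 <= t <= T ->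
  step_fun (tstep T E n) t x = \1_E t * psum n (a (node n t)) x.
Proof. by move=> tT; rewrite /step_fun/= (sum_step E n (fun j => psum n (a (mesh n * j%:R)) x) tT). Qed.

Variables (X : fspace R d) (B : (Zd -> R) -> R -> Prop) (nB : seqnorm B) (C : R).
Hypothesis C0 : 0 <= C.
Hypothesis X0 : forall u, (0 <= fnorm X u)%E.
Hypothesis dX : dominated X B w C.

Lemma herm_trunc n b : herm b -> herm (trunc_coef n b).
Proof. by move=> hb k; rewrite /trunc_coef modesN; case: ifP => _; rewrite ?hb ?rmorph0. Qed.

Lemma psum_carrier n t : fcarrier X (psum n (a t)).
Proof.
rewrite -synth_fin -/(trunc_coef n (a t)); have [] // := @dX (trunc_coef n (a t)) A (\sum_(k <- modes n) w k * nc (a t k)).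
- by apply: herm_trunc; exact: fl_herm fa t.
- by rewrite /trunc_coef; case: ifP => _ //; rewrite (fl_zero fa).
- apply: ball1_le (aA t) => k; rewrite /trunc_coef; case: ifP => _ //.
  by rewrite nc0 nc_ge0.
- apply: (sn_ball1 nB) => [k|s us]; first by rewrite mulr_ge0 ?nc_ge0.
  rewrite (bigID (mem (modes n)))/= [X in _ + X <= _]big1 ?addr0; last first.
    by move=> k /negbTE kn; rewrite /trunc_coef kn nc0 mulr0.
  rewrite -big_filter; apply: (@le_trans _ _ (\sum_(k <- [seq i <- s | i \in modes n]) w k * nc (a t k))).
    rewrite big_seq [leRHS]big_seq; apply: ler_sum => k; rewrite mem_filter => /andP[kn _].
    by rewrite /trunc_coef kn.
  apply: ball1_sub; rewrite ?filter_uniq ?modes_uniq// => k.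
    by rewrite mulr_ge0 ?nc_ge0.
  by rewrite mem_filter => /andP[].
Qed.

Lemma tstep_in T E n : measurable E -> step_in X (tstep T E n).
Proof.
move=> mE i; split; last exact: psum_carrier.
exact: measurableI.
Qed.

Definition err n t k : R[i] := a t k - trunc_coef n (a (node n t)) k.

Lemma nc_err n t k : 0 <= t -> nc (err n t k) <=
  offmodes n (fun k => nc (a t k)) k + (if k \in modes n then mesh n * (nk k ^+ 4 * (2 * expR A)) else 0).
Proof.
move=> t0; rewrite /err /trunc_coef; case: ifP => _; last by rewrite subr0 addr0.
rewrite add0r; apply: le_trans (fl_lip fa k _ _) _; rewrite ler_wpM2r ?node_dist//.
by rewrite mulr_ge0 ?exprn_ge0 ?normk_ge0// mulr_ge0// expR_ge0.
Qed.

Lemma err_ball1 n t : ball1 (fun k => nc (err n t k)) (A + A).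
Proof.
have h := ball1D (aA t) (aA (node n t)); apply: ball1_le h => k.
apply: le_trans (ncB _ _) _; rewrite lerD2l /trunc_coef; case: ifP => // _.
by rewrite nc0 nc_ge0.
Qed.

Lemma err_ball n t Y : 0 <= t -> B (offmodes n (fun k => w k * nc (a t k))) Y ->
  B (fun k => w k * nc (err n t k)) (Y + n.+1%:R^-1).
Proof.
move=> t0 aY; have v0 k : 0 <= mesh n * (nk k ^+ 4 * (2 * expR A)).
  by rewrite mulr_ge0 ?(ltW (mesh_gt0 n))// mulr_ge0 ?exprn_ge0 ?normk_ge0// mulr_ge0// expR_ge0.
apply: (sn_le nB (g := fun k => (if k \in modes n then 0 else w k * nc (a t k)) +
   (if k \in modes n then w k * (mesh n * (nk k ^+ 4 * (2 * expR A))) else 0))).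
  move=> k; rewrite mulr_ge0 ?nc_ge0//=; apply: le_trans (ler_wpM2l (w0 k) (nc_err n k t0)) _.
  by rewrite mulrDr; case: ifP => _; rewrite ?mulr0 ?add0r ?addr0.
apply: (snD nB) => // [k|k|].
- by case: ifP => // _; rewrite mulr_ge0 ?nc_ge0.
- by case: ifP => // _; rewrite mulr_ge0.
apply: (sn_ball1 nB) => [k|s us]; first by case: ifP => // _; rewrite mulr_ge0.
rewrite -big_mkcond/= -big_filter.
apply: (@le_trans _ _ (\sum_(k <- modes n) w k * (mesh n * (nk k ^+ 4 * (2 * expR A))))).
  apply: ball1_sub; rewrite ?filter_uniq ?modes_uniq// => k; first by rewrite mulr_ge0.
  by rewrite mem_filter => /andP[].
under eq_bigr do rewrite mulrCA; rewrite -mulr_sumr /mesh invfM -mulrA ger_pMr ?invr_gt0//.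
by rewrite mulrC ler_pdivrMr ?mul1r ?lerDr// ltr_pwDl.
Qed.

(** Restriction in time is carried out on the coefficients, so that the restricted function is again
    synthesized and [dominated] applies to it. *)
Definition cut (E : set R) t (b : Zd -> R[i]) k : R[i] := Complex (\1_E t) 0 * b k.

Lemma synth_cut E t b : synth (cut E t b) = fun x => \1_E t * synth b x.
Proof.
apply/funext => x; rewrite indicE; case: (boolP (t \in E)) => tE.
  by rewrite mul1r; congr (synth _ x); apply/funext => k; rewrite /cut indicE tE -[X in X * _]/(1 : R[i]) mul1r.
rewrite mul0r (_ : cut E t b = fun=> 0); last first.
  by apply/funext => k; rewrite /cut indicE (negbTE tE) -[X in X * _]/(0 : R[i]) mul0r.
apply/cvg_lim => //; rewrite (_ : (fun K => _) = fun=> 0); first exact: cvg_cst.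
by apply/funext => K; rewrite /psum big1// => k _; rewrite mode0.
Qed.

Lemma nc_cut E t b k : nc (cut E t b k) <= nc (b k).
Proof.
by rewrite /cut ncM nc_real indicE; case: (_ \in _); rewrite ?normr1 ?normr0 ?mul1r ?mul0r ?nc_ge0.
Qed.

Lemma herm_err n t : herm (err n t).
Proof.
move=> k; rewrite /err rmorphB (fl_herm fa); congr (_ - _).
by rewrite herm_trunc//; exact: fl_herm fa _.
Qed.

Lemma err_zero n t : err n t 0 = 0.
Proof. by rewrite /err /trunc_coef (fl_zero fa) (fl_zero fa) if_same subrr. Qed.

Lemma synth_err n t x : synth (err n t) x = synth (a t) x - psum n (a (node n t)) x.
Proof.
rewrite (@synthB _ _ (a t) (trunc_coef n (a (node n t))) A A)//; first by rewrite /trunc_coef synth_fin.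
by apply: ball1_le (aA (node n t)) => k; rewrite /trunc_coef; case: ifP => // _; rewrite nc0 nc_ge0.
Qed.

Lemma tstep_err (T : R) (E : set (measurableTypeR R)) n (t : R) Y : 0 <= t <= T -> B (offmodes n (fun k => w k * nc (a t k))) Y ->
  (fnorm X ((fun x => \1_E t * synth (a t) x) \- step_fun (tstep T E n) t)%R <= (C * (Y + n.+1%:R^-1))%:E)%E.
Proof.
move=> tT aY; have t0 : 0 <= t by case/andP: tT.
have -> : (fun x => \1_E t * synth (a t) x) \- step_fun (tstep T E n) t = synth (cut E t (err n t)).
  by rewrite synth_cut; apply/funext => x /=; rewrite tstep_fun// -mulrBr synth_err.
have [] // := @dX (cut E t (err n t)) (A + A) (Y + n.+1%:R^-1).
- by move=> k; rewrite /cut rmorphM herm_err; congr (_ * _); apply: complex_eqP; rewrite //= oppr0.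
- by rewrite /cut err_zero mulr0.
- by apply: ball1_le (err_ball1 n t) => k; exact: nc_cut.
- apply: (sn_le nB) (err_ball t0 aY) => k.
  by rewrite mulr_ge0 ?nc_ge0//= ler_wpM2l// nc_cut.
Qed.

Lemma cut_carrier (E : set R) t Y : B (fun k => w k * nc (a t k)) Y ->
  fcarrier X (fun x => \1_E t * synth (a t) x) /\ (fnorm X (fun x => \1_E t * synth (a t) x)%R <= (C * Y)%:E)%E.
Proof.
move=> aY; rewrite -synth_cut; apply: (@dX _ A).
- by move=> k; rewrite /cut rmorphM (fl_herm fa); congr (_ * _); apply: complex_eqP; rewrite //= oppr0.
- by rewrite /cut (fl_zero fa) mulr0.
- by apply: ball1_le (aA t) => k; exact: nc_cut.
- apply: (sn_le nB) aY => k.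
  by rewrite mulr_ge0 ?nc_ge0//= ler_wpM2l// nc_cut.
Qed.

(** The error is a truncation tail plus a freezing error of at most 1 / (n + 1). Both tend to 0 at
    every time where the weighted norm is finite, which is almost every time. *)
Lemma flow_strongly_measurable T (E : set (measurableTypeR R)) : measurable E ->
  {ae tm T, forall t, exists Y, B (fun k => w k * nc (a t k)) Y} ->
  strongly_measurable T X (fun t x => \1_E t * synth (a t) x).
Proof.
move=> mE aeY; split; first by apply: filterS aeY => t [Y /(@cut_carrier E)[]].
exists (tstep T E); split; first by move=> n; exact: tstep_in.
have t0 : {ae tm T, forall t, 0 <= t <= T} by apply: time_ae.
apply: filterS2 t0 aeY => t tT [Y aY]; apply: cvge0_le => // e e0.
have e1 : 0 < e / 2 / (1 + C) by rewrite !divr_gt0// ltr_pwDl.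
have [|K0 HK] := seqnorm_tail_modes nB _ aY e1; first by move=> k; rewrite mulr_ge0 ?nc_ge0.
near=> n; apply: le_trans (tstep_err E tT (HK n _)) _; first by near: n; exact: nbhs_infty_ge.
rewrite lee_fin; have n1 : n.+1%:R^-1 <= e / 2 / (1 + C).
  by near: n; apply: filterS (near_infty_natSinv_lt (PosNum e1)) => n /=; exact: ltW.
apply: (@le_trans _ _ ((1 + C) * (e / 2 / (1 + C) + e / 2 / (1 + C)))).
  by apply: ler_pM => //; rewrite ?lerD2l ?lerDr// addr_ge0 ?invr_ge0// ltW.
by rewrite le_eqVlt; apply/orP; left; apply/eqP; field; rewrite gt_eqF// ltr_pwDl.
Unshelve. all: by end_near. Qed.

End steps.

Section bochner_intro.
Context {R : realType} {d : nat}.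
Local Notation mu := (torus_measure R d).
Local Notation tm := (@time_measure R).
Variables (T : R) (X : fspace R d) (f : R -> 'rV[R]_d -> R).
Hypothesis X0 : forall u, (0 <= fnorm X u)%E.
Hypothesis sf : strongly_measurable T X f.

Lemma bochner_bounded (p : \bar R) (M : R) : (0 < p)%E -> 0 <= M ->
  {ae tm T, forall t, (fnorm X (f t) <= M%:E)%E} -> bochner_Lp T p X f.
Proof.
move=> p0 M0 fM; split=> //; have [C C0 HC] := Lnorm_bound (tm T) p0.
apply: le_lt_trans (HC _ M _ M0) (ltry _).
by apply: filterS fM => t /= ft; rewrite gee0_abs.
Qed.

Lemma bochner_integrable (r : R) (g : R -> R) : 0 < r -> (forall t, 0 <= g t) ->
  (tm T).-integrable setT (EFin \o g) ->
  {ae tm T, forall t, (fnorm X (f t) `^ r <= (g t)%:E)%E} -> bochner_Lp T r%:E X f.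
Proof.
move=> r0 g0 ig fg; split=> //; rewrite unlock; apply: poweR_lty.
have /integrableP[_] := ig; apply: le_lt_trans; apply: ae_ge0_le_integral => [t|t|].
- exact: poweR_ge0.
- exact: abse_ge0.
- by apply: filterS fg => t; rewrite /= gee0_abs// ger0_norm.
Qed.

End bochner_intro.

Section fnorm_ge0.
Context {R : realType} {d : nat}.

Lemma fnorm_Lp_ge0 p u : (0 <= fnorm (Lp_space (R := R) d p) u)%E. Proof. exact: Lnorm_ge0. Qed.

Lemma fnorm_H_ge0 r u : (0 <= fnorm (Hspace (R := R) d r) u)%E.
Proof. by apply: adde_ge0; [exact: Lnorm_ge0|exact: poweR_ge0]. Qed.

Lemma fnorm_W_ge0 n p u : (0 <= fnorm (Wspace (R := R) d n p) u)%E.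
Proof.
apply: le_ereal_inf_tmp => _ [g [_ ->]]; apply: sume_ge0 => a _; exact: Lnorm_ge0.
Qed.

End fnorm_ge0.

Section flow_spaces.
Context {R : realType} {d : nat}.
Local Notation Zd := 'rV[int]_d.
Local Notation mu := (torus_measure R d).
Local Notation tm := (@time_measure R).
Local Notation nk := (@normk R d).
Local Notation nc := (@ComplexField.Normc.normc R).
Local Notation four := (@fourier R d).
Local Notation offmodes K f := (fun k => if k \in modes K then 0 else f k).
Hypothesis hd : d = 1%N \/ d = 2%N.
Variables (A H : R) (a : R -> Zd -> R[i]).
Hypothesis fa : flow A H a.
Hypothesis gA : growth A < 1.
Variable (T : R) (T0 : 0 <= T).
Local Notation delta := (1 - growth A).
Local Notation v := (fun t => synth (a t)).

Let A0 : 0 <= A. Proof. exact: ball1_ge0 (flow_ball1 fa gA 0). Qed.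
Let H0 : 0 <= H. Proof. by case: (flow_ball2 fa gA 0). Qed.
Let aA t := flow_ball1 fa gA t.

Lemma flow_fine1 : exists h : R -> R, [/\ forall t, 0 <= h t, (tm T).-integrable setT (EFin \o h),
  \int[tm T]_t h t <= A / delta & {ae tm T, forall t, ball1 (fun k => nk k ^+ 4 * nc (a t k)) (h t)}].
Proof.
exact: (gsum_fine (flow1_ge0 a) (bm_flow1 fa gA) (integral_flow1 fa gA T0)).
Qed.

Lemma flow_fine2 : exists h : R -> R, [/\ forall t, 0 <= h t, (tm T).-integrable setT (EFin \o h),
  \int[tm T]_t h t <= H ^+ 2 / delta & {ae tm T, forall t, ball2 (fun k => nk k ^+ 4 * nc (a t k)) (Num.sqrt (h t))}].
Proof.
have [h [h0 ih Ih hh]] := gsum_fine (flow2_ge0 a) (bm_flow2 fa gA) (integral_flow2 fa gA T0).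
exists h; split=> //; apply: filterS hh => t ht; split=> [|s us]; first exact: sqrtr_ge0.
by rewrite sqr_sqrtr//; exact: ht.
Qed.

Lemma flow_sm (X : fspace R d) B w C : seqnorm B -> 0 <= C -> (forall k, 0 <= w k) ->
  (forall u, (0 <= fnorm X u)%E) -> dominated X B w C ->
  {ae tm T, forall t, exists Y, B (fun k => w k * nc (a t k)) Y} ->
  strongly_measurable T X v.
Proof.
move=> nB C0 w0 X0 dX aeY.
have := @flow_strongly_measurable R d A H a fa gA w w0 X B nB C C0 X0 dX T setT measurableT aeY.
by congr strongly_measurable; apply/funext => t; apply/funext => x; rewrite indicT mul1r.
Qed.

Lemma bochner_v_Lp (p q : \bar R) : (0 < p)%E -> (0 < q)%E -> bochner_Lp T q (Lp_space d p) v.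
Proof.
move=> p0 q0; have [C C0 dC] := @dominated_Lp R d p p0.
have aA1 t : ball1 (fun k => 1 * nc (a t k)) A by apply: ball1_le (aA t) => k; rewrite mul1r.
apply: (@bochner_bounded _ _ _ _ _ _ _ _ (C * A)) => //; first by move=> u; exact: fnorm_Lp_ge0.
- apply: (flow_sm seqnorm_ball1 C0) dC _ => //; first by move=> u; exact: fnorm_Lp_ge0.
  by apply: aeW => t; exists A.
- exact: mulr_ge0.
- apply: aeW => t.
  by have [_] := dC (a t) A A (fl_herm fa t) (fl_zero fa t) (aA t) (aA1 t).
Qed.

Lemma bochner_v_H2 (q : \bar R) : (0 < q)%E -> bochner_Lp T q (Hspace d 2) v.
Proof.
move=> q0; have [C C0 dC] := @dominated_H R d 2 hd (leqnn _).
apply: (@bochner_bounded _ _ _ _ _ _ _ _ (C * H)) => //; first by move=> u; exact: fnorm_H_ge0.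
- apply: (flow_sm seqnorm_ball2 C0) dC _ => //; first by move=> k; exact: sqr_ge0.
    by move=> u; exact: fnorm_H_ge0.
  by apply: aeW => t; exists H; exact: (flow_ball2 fa gA t).
- exact: mulr_ge0.
- apply: aeW => t.
  by have [_] := dC (a t) A H (fl_herm fa t) (fl_zero fa t) (aA t) (flow_ball2 fa gA t).
Qed.

Lemma bochner_v_H4 : bochner_Lp T 2%:E (Hspace d 4) v.
Proof.
have [C C0 dC] := @dominated_H R d 4 hd isT.
have [h [h0 ih _ hh]] := flow_fine2.
apply: (@bochner_integrable _ _ _ _ _ _ _ _ (fun t => C ^+ 2 * h t)) => //.
- by move=> u; exact: fnorm_H_ge0.
- apply: (flow_sm seqnorm_ball2 C0) dC _ => //; first by move=> k; rewrite exprn_ge0// normk_ge0.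
    by move=> u; exact: fnorm_H_ge0.
  by apply: filterS hh => t ht; exists (Num.sqrt (h t)).
- by move=> t; rewrite mulr_ge0 ?sqr_ge0.
- exact: L1Z.
- apply: filterS hh => t ht.
  have [_ le] := dC (a t) A _ (fl_herm fa t) (fl_zero fa t) (aA t) ht.
  apply: le_trans (ler_poweR _ _ le) _ => //; first exact: fnorm_H_ge0.
  by rewrite /= lee_fin powR_mulrn ?mulr_ge0 ?sqrtr_ge0// exprMn sqr_sqrtr.
Qed.

Lemma bochner_v_W3 : bochner_Lp T (4 / 3)%:E (Wspace d 3 +oo%E) v.
Proof.
have [C C0 dC] := @dominated_W R d 3.
have [h [h0 ih _ hh]] := flow_fine1.
(* Interpolation: |k|^3 <= L^3 + |k|^4 / L for every L > 0. As [A] and [h] bound the norms of order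
   0 and 4, L^4 = h bounds the norm of order 3 by (1 + A) L^3, and its power 4/3 is a multiple of
   h. *)
pose L t := h t `^ 4^-1.
have L0 t : 0 <= L t by exact: powR_ge0.
have L4 t : L t ^+ 4 = h t.
  by rewrite -powR_mulrn// -powRrM mulVf ?pnatr_eq0// powRr1.
have b3 : {ae tm T, forall t, ball1 (fun k => nk k ^+ 3 * nc (a t k)) ((1 + A) * L t ^+ 3)}.
  apply: filterS hh => t ht.
  (* If h t = 0 the interpolation cannot be used, but then |k|^3 <= |k|^4 off the origin already
     bounds the norm of order 3 by 0. *)
  have [Lt0|Lt0] := eqVneq (L t) 0.
    rewrite Lt0 expr0n mulr0; move: ht; rewrite -L4 Lt0 expr0n/=.
    apply: ball1_le => k; case: (eqVneq k 0) => [->|k0]; first by rewrite (fl_zero fa) nc0 !mulr0.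
    by rewrite ler_wpM2r ?nc_ge0// ler_weXn2l// normk_ge1.
  have Lp : 0 < L t by rewrite lt_neqAle eq_sym Lt0 L0.
  have b := ball1D (ball1Z (exprn_ge0 3 (L0 t)) (aA t)) (ball1Z (ltW (_ : 0 < (L t)^-1)) ht).
  have e1 : L t ^+ 3 * A + (L t)^-1 * h t = (1 + A) * L t ^+ 3 by rewrite -L4; field.
  rewrite -e1; apply: ball1_le (b _); last by rewrite invr_gt0.
  move=> k; rewrite mulrA -mulrDl ler_wpM2r ?nc_ge0//.
  have n0 := normk_ge0 (R := R) k.
  have [nL|/ltW Ln] := leP (nk k) (L t).
    by rewrite ler_wpDr ?lerXn2r ?nnegrE// mulr_ge0 ?invr_ge0// exprn_ge0.
  rewrite ler_wpDl ?exprn_ge0// mulrC ler_pdivlMr// [leRHS]exprSr.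
  by rewrite ler_wpM2l// exprn_ge0.
have CA : 0 <= C * (1 + A) by rewrite mulr_ge0// addr_ge0.
apply: (@bochner_integrable _ _ _ _ _ _ _ _ (fun t => (C * (1 + A)) `^ (4 / 3) * h t)) => //.
- by move=> u; exact: fnorm_W_ge0.
- apply: (flow_sm seqnorm_ball1 C0) dC _ => //; first by move=> k; rewrite exprn_ge0// normk_ge0.
    by move=> u; exact: fnorm_W_ge0.
  by apply: filterS b3 => t ht; exists ((1 + A) * L t ^+ 3).
- by move=> t; rewrite mulr_ge0 ?powR_ge0.
- exact: L1Z.
- apply: filterS b3 => t ht.
  have [_ le] := dC (a t) A _ (fl_herm fa t) (fl_zero fa t) (aA t) ht.
  apply: le_trans (ler_poweR _ _ le) _ => //; first exact: fnorm_W_ge0.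
  rewrite /= lee_fin mulrA powRM ?exprn_ge0// ler_wpM2l ?powR_ge0//.
  rewrite -powR_mulrn// -powRrM (_ : 3%:R * (4 / 3) = 4%:R :> R); last by field.
  by rewrite powR_mulrn// L4.
Qed.

(** The error has three parts: finitely many modes, which are Lipschitz in time, and the tails at s
    and at t. The latter must be small uniformly in time, since s varies while the cut-off is
    fixed. *)
Lemma flow_continuous_into (X : fspace R d) B w C : seqnorm B -> 0 <= C -> (forall k, 0 <= w k) ->
  (forall u, (0 <= fnorm X u)%E) -> dominated X B w C ->
  (forall t, exists Y, B (fun k => w k * nc (a t k)) Y) ->
  (forall e : R, 0 < e -> exists K, forall t, 0 <= t <= T -> B (offmodes K (fun k => w k * nc (a t k))) e) ->
  continuous_into T X v.
Proof.
move=> nB C0 w0 X0 dX aY tl t tT; split.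
  by have [Y atY] := aY t; have [] := dX (a t) A Y (fl_herm fa t) (fl_zero fa t) (aA t) atY.
apply: cvge0_le_filter => // e e0.
have C1 : 0 < 1 + C by rewrite ltr_pwDl.
have e3 : 0 < e / 3 / (1 + C) by rewrite !divr_gt0.
have [K HK] := tl _ e3.
pose W : R := \sum_(k <- modes K) w k * (nk k ^+ 4 * (2 * expR A)).
have u0 (k : Zd) : 0 <= w k * (nk k ^+ 4 * (2 * expR A)).
  by rewrite mulr_ge0// mulr_ge0 ?exprn_ge0 ?normk_ge0// mulr_ge0// expR_ge0.
have W0 : 0 <= W by exact: sumr_ge0.
have r0 : 0 < e / 3 / (1 + C) / (1 + W) by rewrite divr_gt0// ltr_pwDl.
rewrite near_withinE; near=> s => sT.
have st : `|t - s| <= e / 3 / (1 + C) / (1 + W).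
  by near: s; exists (e / 3 / (1 + C) / (1 + W)) => //= s; exact: ltW.
have {sT}sT : 0 <= s <= T by move: sT; rewrite /= in_itv.
have bd : B (fun k => w k * nc (a s k - a t k)) (e / 3 / (1 + C) + (e / 3 / (1 + C) + e / 3 / (1 + C))).
  apply: (sn_le nB (g := fun k => (if k \in modes K then `|t - s| * (w k * (nk k ^+ 4 * (2 * expR A))) else 0) +
     (offmodes K (fun k => w k * nc (a s k)) k + offmodes K (fun k => w k * nc (a t k)) k))).
    move=> k; rewrite mulr_ge0 ?nc_ge0//=; case: ifP => _.
      by rewrite !addr0 mulrCA ler_wpM2l// distrC (fl_lip fa).
    by rewrite add0r -mulrDr ler_wpM2l// ncB.
  have o0 b k : 0 <= (if k \in modes K then 0 else w k * nc (b k)).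
    by case: ifP => // _; rewrite mulr_ge0 ?nc_ge0.
  apply: (snD nB) => [k|k||].
  - by case: ifP => // _; rewrite mulr_ge0.
  - by rewrite addr_ge0 ?o0.
  - apply: (sn_ball1 nB) => [k|s' us]; first by case: ifP => // _; rewrite mulr_ge0.
    rewrite -big_mkcond/= -big_filter.
    apply: (@le_trans _ _ (\sum_(k <- modes K) `|t - s| * (w k * (nk k ^+ 4 * (2 * expR A))))).
      apply: ball1_sub; rewrite ?filter_uniq ?modes_uniq// => k; first by rewrite mulr_ge0.
      by rewrite mem_filter => /andP[].
    rewrite -mulr_sumr -/W; apply: le_trans (ler_wpM2r W0 st) _.
    rewrite -[leLHS]mulrA ger_pMr// mulrC ler_pdivrMr ?mul1r ?lerDr//.
    by rewrite ltr_pwDl.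
  - by apply: (snD nB) => [k|k||]; [exact: o0|exact: o0|exact: HK|exact: HK].
have -> : (synth (a s) \- synth (a t)) = synth (fun k => a s k - a t k).
  by apply/funext => x; rewrite (synthB x (aA s) (aA t)).
have [] := dX (fun k => a s k - a t k) (A + A) _ _ _ _ bd.
- by move=> k; rewrite rmorphB !(fl_herm fa).
- by rewrite !(fl_zero fa) subrr.
- by apply: ball1_le (ball1D (aA s) (aA t)) => k; exact: ncB.
move=> _ /le_trans; apply; rewrite lee_fin.
apply: (@le_trans _ _ ((1 + C) * (e / 3 / (1 + C) + (e / 3 / (1 + C) + e / 3 / (1 + C))))).
  by apply: ler_wpM2r; rewrite ?lerDr// !addr_ge0// ltW.
by rewrite le_eqVlt; apply/orP; left; apply/eqP; field; rewrite gt_eqF.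
Unshelve. all: by end_near. Qed.

Lemma continuous_into_v_L2 : continuous_into T (Lp_space d 2%:E) v.
Proof.
have [|C C0 dC] := @dominated_Lp R d 2%:E; first by rewrite lte_fin.
apply: (flow_continuous_into seqnorm_ball1 C0) dC _ _ => //.
- by move=> u; exact: fnorm_Lp_ge0.
- by move=> t; exists A; apply: ball1_le (aA t) => k; rewrite mul1r.
- move=> e e0; have [K HK] := flow_tail hd fa gA e0; exists K => t _.
  by apply: ball1_le (HK K (leqnn _) t) => k; rewrite mul1r.
Qed.

Lemma continuous_into_v_H2 : continuous_into T (Hspace d 2) v.
Proof.
have [C C0 dC] := @dominated_H R d 2 hd (leqnn _).
apply: (flow_continuous_into seqnorm_ball2 C0) dC _ _ => //.
- by move=> k; exact: sqr_ge0.
- by move=> u; exact: fnorm_H_ge0.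
- by move=> t; exists H; exact: (flow_ball2 fa gA t).
- move=> e e0; have [K HK] := flow_tail2 fa gA T0 e0; exists K => t; exact: HK.
Qed.

Lemma h_norm2_v t : (h_norm 2 (v t) <= H%:E)%E.
Proof.
by apply: (h_norm_le (n := 2) _ (fl_herm fa t) (fl_zero fa t) (aA t) (flow_ball2 fa gA t)); rewrite lexx ler0n.
Qed.

Lemma h_norm4_v : (\int[tm T]_s (h_norm 4 (v s) * h_norm 4 (v s)) <= (H ^+ 2 / delta)%:E)%E.
Proof.
have [h [h0 ih Ih hh]] := flow_fine2.
apply: (@le_trans _ _ (\int[tm T]_s (h s)%:E)%E).
  apply: ae_ge0_le_integral => [t|t|].
  - by rewrite mule_ge0// poweR_ge0.
  - by rewrite lee_fin.
  apply: filterS hh => t ht.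
  have := h_norm_le (r := 4) (n := 4) _ (fl_herm fa t) (fl_zero fa t) (aA t) ht.
  rewrite lexx ler0n => /(_ isT) le.
  apply: (@le_trans _ _ ((Num.sqrt (h t))%:E * (Num.sqrt (h t))%:E)%E).
    by apply: lee_pmul => //; exact: poweR_ge0.
  by rewrite -EFinM -expr2 sqr_sqrtr.
rewrite -lee_fin in Ih; apply: le_trans Ih; rewrite /Rintegral fineK//; exact: integrable_fin_num ih.
Qed.

Lemma h_norm_v_decay (r t : R) : 0 <= t -> 0 <= r < 2 ->
  (h_norm r (v t) <= (H * expR (- (delta / 2) * t))%:E)%E.
Proof.
move=> t0 /andP[r0 r2]; rewrite mulNr.
apply: (h_norm_le (n := 2) _ (fl_herm fa t) (fl_zero fa t) (aA t) (fl_ball2 fa t0)).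
by rewrite r0 ltW.
Qed.

Lemma Lnorm_oo_v t : 0 <= t -> ('N[mu]_+oo [EFin \o v t] <= (A * expR (- delta * t))%:E)%E.
Proof.
move=> t0; rewrite mulNr unlock; have b := fl_ball1 fa t0; case: ifPn => _; last first.
  by rewrite lee_fin; exact: ball1_ge0 b.
apply/ess_supP; apply: aeW => x /=; rewrite lee_fin; exact: synth_bound b.
Qed.

(** Joint measurability is inherited from the partial sums, whose terms are products of a function
    of time and a function of space. *)
Lemma joint_v : (fun p : measurableTypeR R * 'rV[R]_d => v p.1 p.2) \in Lfun (tm T \x mu)%E +oo%E.
Proof.
have [mv vb] : bm (fun p : measurableTypeR R * 'rV[R]_d => v p.1 p.2).
  apply: (@bm_lim _ _ _ (fun K (p : measurableTypeR R * 'rV[R]_d) => psum K (a p.1) p.2) _ A).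
  - move=> K; apply: (@measurable_sum _ _ _ _ _ _ (fun k (p : measurableTypeR R * 'rV[R]_d) => mode k (a p.1 k) p.2)) => k.
    apply: measurable_funB; apply: measurable_funM.
    + by apply: (measurableT_comp (f := fun t : measurableTypeR R => complex.Re (a t k))) => //; exact: bm_meas (bm_flow_Re fa gA k).
    + by apply: (measurableT_comp (f := fun x : 'rV[R]_d => cos (dotk x k))) => //; exact: bm_meas (bm_cosk k).
    + by apply: (measurableT_comp (f := fun t : measurableTypeR R => complex.Im (a t k))) => //; exact: bm_meas (bm_flow_Im fa gA k).
    + by apply: (measurableT_comp (f := fun x : 'rV[R]_d => sin (dotk x k))) => //; exact: bm_meas (bm_sink k).
  - by move=> p; exact: (@synth_cvg _ _ (a p.1) A p.2 (aA p.1)).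
  - by move=> p; exact: synth_bound (aA p.1).
rewrite inE; apply/andP; split; rewrite inE//=.
rewrite /finite_norm unlock; case: ifPn => _; last exact: ltry.
apply: (@le_lt_trans _ _ A%:E); last exact: ltry.
by apply/ess_supP; apply: aeW => p /=; rewrite lee_fin; exact: synth_bound (aA p.1).
Qed.

End flow_spaces.

(** * Time integrals of coefficients and the vector measure *)

Section tint.
Context {R : realType} {d : nat}.
Local Notation Zd := 'rV[int]_d.
Local Notation mu := (torus_measure R d).
Local Notation tm := (@time_measure R).
Local Notation nk := (@normk R d).
Local Notation nc := (@ComplexField.Normc.normc R).
Variable (T : R).

Definition tint (b : R -> Zd -> R[i]) (k : Zd) : R[i] :=
  Complex (\int[tm T]_t complex.Re (b t k)) (\int[tm T]_t complex.Im (b t k)).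

Definition bmc (b : R -> Zd -> R[i]) := forall k,
  bm ((fun t => complex.Re (b t k)) : measurableTypeR R -> R) /\
  bm ((fun t => complex.Im (b t k)) : measurableTypeR R -> R).

(** The factor 2 comes from integrating the real and the imaginary part separately. *)
Lemma tint_ball1 b (w : Zd -> R) (h : R -> R) : bmc b -> (forall k, 0 <= w k) -> (forall t, 0 <= h t) ->
  (tm T).-integrable setT (EFin \o h) ->
  {ae tm T, forall t, ball1 (fun k => w k * nc (b t k)) (h t)} ->
  ball1 (fun k => w k * nc (tint b k)) (2 * \int[tm T]_t h t).
Proof.
move=> bb w0 h0 ih bh s us.
have iR k : (tm T).-integrable setT (EFin \o (fun t => `|complex.Re (b t k)|)).
  by have := integrable_norm (bm_integrable (tm T) (bb k).1).
have iI k : (tm T).-integrable setT (EFin \o (fun t => `|complex.Im (b t k)|)).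
  by have := integrable_norm (bm_integrable (tm T) (bb k).2).
have iS k := L1Z (w k) (L1D (iR k) (iI k)).
apply: (@le_trans _ _ (\sum_(k <- s) \int[tm T]_t (w k * (`|complex.Re (b t k)| + `|complex.Im (b t k)|)))).
  apply: ler_sum => k _; rewrite RintegralZl//; last exact: L1D.
  rewrite ler_wpM2l// RintegralD//; apply: le_trans (nc_leReIm _) _.
  by apply: lerD; apply: le_normr_Rintegral => //; apply: bm_integrable; case: (bb k).
rewrite -Rint_sum// -RintegralZl//.
have iSs := integrable_seq_sum s iS; have i2h := L1Z 2 ih.
rewrite /Rintegral; apply: fine_le; [exact: integrable_fin_num iSs|exact: integrable_fin_num i2h|].
apply: ae_ge0_le_integral => [t|t|].
- by rewrite lee_fin sumr_ge0// => k _; rewrite mulr_ge0// addr_ge0.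
- by rewrite lee_fin mulr_ge0.
apply: filterS bh => t bt; rewrite lee_fin; apply: (@le_trans _ _ (\sum_(k <- s) 2 * (w k * nc (b t k)))).
  apply: ler_sum => k _; rewrite mulrCA ler_wpM2l// mulr2n mulrDl mul1r lerD ?nc_geRe ?nc_geIm//.
by rewrite -mulr_sumr ler_wpM2l// bt.
Qed.

Lemma herm_tint b : bmc b -> (forall t, herm (b t)) -> herm (tint b).
Proof.
move=> bb hb k; apply: complex_eqP => /=.
  by apply: eq_Rintegral => t _; rewrite hb; case: (b t k).
rewrite -mulN1r -RintegralZl//; last by apply: bm_integrable; case: (bb k).
by apply: eq_Rintegral => t _; rewrite hb mulN1r; case: (b t k).
Qed.

Lemma tint_zero b : (forall t, b t 0 = 0) -> tint b 0 = 0.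
Proof.
move=> b0; apply: complex_eqP; rewrite /=; under eq_Rintegral do rewrite b0 /=;
  by rewrite Rintegral_cst// mul0r.
Qed.

Lemma tintD b b' k : bmc b -> bmc b' -> tint (fun t k => b t k + b' t k) k = tint b k + tint b' k.
Proof.
move=> bb bb'; apply: complex_eqP => /=.
  rewrite -RintegralD//; try (by apply: bm_integrable; case: (bb k)); last by apply: bm_integrable; case: (bb' k).
  by apply: eq_Rintegral => t _; rewrite ReD.
rewrite -RintegralD//; try (by apply: bm_integrable; case: (bb k)); last by apply: bm_integrable; case: (bb' k).
by apply: eq_Rintegral => t _; rewrite ImD.
Qed.

Lemma tintB b b' k : bmc b -> bmc b' -> tint (fun t k => b t k - b' t k) k = tint b k - tint b' k.
Proof.
move=> bb bb'; apply: complex_eqP => /=.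
  rewrite -RintegralB//; try (by apply: bm_integrable; case: (bb k)); last by apply: bm_integrable; case: (bb' k).
  by apply: eq_Rintegral => t _; rewrite ReB.
rewrite -RintegralB//; try (by apply: bm_integrable; case: (bb k)); last by apply: bm_integrable; case: (bb' k).
by apply: eq_Rintegral => t _; rewrite ImB.
Qed.

Lemma bmcB b b' : bmc b -> bmc b' -> bmc (fun t k => b t k - b' t k).
Proof.
move=> bb bb' k; have [b1 b2] := bb k; have [b1' b2'] := bb' k; split.
  by under [X in bm X]eq_fun do rewrite ReB; exact: bmB.
by under [X in bm X]eq_fun do rewrite ImB; exact: bmB.
Qed.

Lemma bmc_trunc n b : bmc b -> bmc (fun t => trunc_coef n (b t)).
Proof.
move=> bb k; rewrite /trunc_coef; case: (k \in modes n); first exact: bb.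
by split; exact: bm_cst.
Qed.

Lemma Re_cut (E : set R) t b k : complex.Re (@cut R d E t b k) = \1_E t * complex.Re (b k).
Proof. by rewrite /cut; case: (b k) => p q /=; rewrite mul0r subr0. Qed.

Lemma Im_cut (E : set R) t b k : complex.Im (@cut R d E t b k) = \1_E t * complex.Im (b k).
Proof. by rewrite /cut; case: (b k) => p q /=; rewrite mul0r addr0. Qed.

Lemma bmc_cut (E : set (measurableTypeR R)) b : measurable E -> bmc b -> bmc (fun t => cut E t (b t)).
Proof.
move=> mE bb k; have [b1 b2] := bb k; split.
  by under [X in bm X]eq_fun do rewrite Re_cut; apply: bmM => //; exact: bm_indic.
by under [X in bm X]eq_fun do rewrite Im_cut; apply: bmM => //; exact: bm_indic.
Qed.

Lemma herm_cut (E : set R) t b : herm b -> herm (@cut R d E t b).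
Proof. by move=> hb k; rewrite /cut rmorphM hb; congr (_ * _); apply: complex_eqP; rewrite //= oppr0. Qed.

Lemma indic_setU (E1 E2 : set R) t : E1 `&` E2 = set0 -> \1_(E1 `|` E2) t = \1_E1 t + \1_E2 t :> R.
Proof.
move=> E12; rewrite !indicE in_setU; case: (boolP (t \in E1)) => t1; case: (boolP (t \in E2)) => t2;
  rewrite ?addr0 ?add0r//=.
have : (E1 `&` E2) t by split; exact: set_mem.
by rewrite E12.
Qed.

Lemma time_Rintegral_indic (E : set (measurableTypeR R)) : measurable E ->
  \int[tm T]_t \1_E t = fine (tm T E).
Proof. by move=> mE; rewrite /Rintegral integral_indic// setIT. Qed.

Lemma mode_real (k : Zd) (r : R) (z : R[i]) x : mode k (Complex r 0 * z) x = r * mode k z x :> R.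
Proof. by rewrite /mode; case: z => p q /=; ring. Qed.

Lemma mode_sum (k : Zd) (I : Type) (s : seq I) (F : I -> R[i]) x :
  mode k (\sum_(i <- s) F i) x = \sum_(i <- s) mode k (F i) x :> R.
Proof.
elim: s => [|i s IH]; first by rewrite !big_nil mode0.
by rewrite !big_cons modeD IH.
Qed.

Lemma tint_sum (I : Type) (s : seq I) (F : I -> R -> Zd -> R[i]) k : (forall i, bmc (F i)) ->
  bmc (fun t k => \sum_(i <- s) F i t k) /\
  tint (fun t k => \sum_(i <- s) F i t k) k = \sum_(i <- s) tint (F i) k.
Proof.
move=> bF; have b0 : bmc (fun _ _ => 0) by move=> ?; split; exact: bm_cst.
elim: s => [|i s [IH1 IH2]].
  split; first by under [X in bmc X]eq_fun do under eq_fun do rewrite big_nil.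
  rewrite big_nil; apply: complex_eqP => /=; under eq_Rintegral do rewrite big_nil /=;
    by rewrite Rintegral_cst// mul0r.
have E : (fun t k => \sum_(i <- i :: s) F i t k) = fun t k => F i t k + \sum_(i <- s) F i t k.
  by apply/funext => t; apply/funext => k'; rewrite big_cons.
rewrite E big_cons tintD// IH2; split=> // k'; have [b1 b2] := bF i k'; have [c1 c2] := IH1 k'; split.
  by under [X in bm X]eq_fun do rewrite ReD; exact: bmD.
by under [X in bm X]eq_fun do rewrite ImD; exact: bmD.
Qed.

End tint.

Section measure_valued.
Context {R : realType} {d : nat}.
Local Notation Zd := 'rV[int]_d.
Local Notation mu := (torus_measure R d).
Local Notation tm := (@time_measure R).
Local Notation nk := (@normk R d).
Local Notation nc := (@ComplexField.Normc.normc R).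
Local Notation offmodes K f := (fun k => if k \in modes K then 0 else f k).
Hypothesis hd : d = 1%N \/ d = 2%N.
Variables (A H : R) (a : R -> Zd -> R[i]).
Hypothesis fa : flow A H a.
Hypothesis gA : growth A < 1.
Variable (T : R) (T0 : 0 <= T).
Local Notation delta := (1 - growth A).
Local Notation v := (fun t => synth (a t)).

Let A0 : 0 <= A. Proof. exact: ball1_ge0 (flow_ball1 fa gA 0). Qed.
Let aA t := flow_ball1 fa gA t.
Let w1 := fun k : Zd => 1 : R.
Let w10 k : 0 <= w1 k. Proof. by []. Qed.

Let ba : bmc a.
Proof. by move=> k; split; [exact: bm_flow_Re fa gA k|exact: bm_flow_Im fa gA k]. Qed.

(** The Fourier coefficients of the integral of v over [E]. *)
Let mcoef (E : set (measurableTypeR R)) := tint T (fun t => cut E t (a t)).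

Let herm_mcoef E : measurable E -> herm (mcoef E).
Proof.
move=> mE; apply: herm_tint; first exact: bmc_cut.
by move=> t; apply: herm_cut; exact: fl_herm fa t.
Qed.

Let mcoef0 E : mcoef E 0 = 0.
Proof. by apply: tint_zero => t; rewrite /cut (fl_zero fa) mulr0. Qed.

Let mcoef_ball1 E (w : Zd -> R) (h : R -> R) : measurable E -> (forall k, 0 <= w k) ->
  (forall t, 0 <= h t) -> (tm T).-integrable setT (EFin \o h) ->
  {ae tm T, forall t, ball1 (fun k => w k * nc (a t k)) (h t)} ->
  ball1 (fun k => w k * nc (mcoef E k)) (2 * \int[tm T]_t (\1_E t * h t)).
Proof.
move=> mE w0 h0 ih wh; apply: tint_ball1 => //.
- exact: bmc_cut.
- by move=> t; rewrite mulr_ge0// indicE.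
- have := integrable_bmM ih (bm_indic mE); apply: eq_integrable => // t _ /=.
  by rewrite mulrC.
apply: filterS wh => t ht; rewrite indicE; case: (boolP (t \in E)) => tE.
  by rewrite mul1r; apply: ball1_le ht => k; rewrite ler_wpM2l// nc_cut.
rewrite mul0r => s us; rewrite big1// => k _.
by rewrite /cut indicE (negbTE tE) ncM nc_real normr0 mul0r mulr0.
Qed.

Let mcoefA E : measurable E -> ball1 (fun k => nc (mcoef E k)) (2 * \int[tm T]_t (\1_E t * A)).
Proof.
move=> mE; apply: (ball1_le (g := fun k => w1 k * nc (mcoef E k))) => [k|]; first by rewrite mul1r.
apply: mcoef_ball1 => //; first exact/bm_integrable/bm_cst.
by apply: aeW => t; apply: ball1_le (aA t) => k; rewrite mul1r.
Qed.

(** The l^1 tails of v are uniform in time, so the step functions converge uniformly on [0, T]. The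
    integral of the difference is estimated through its Fourier coefficients, which are time
    integrals. *)
Lemma flow_bochner_L1 (E : set (measurableTypeR R)) : measurable E ->
  is_bochner_int T (Lp_space d 1%:E) (fun t x => \1_E t * v t x) (synth (mcoef E)).
Proof.
move=> mE; have [|C C0 dC] := @dominated_Lp R d 1%:E; first by rewrite lte_fin.
have X0 (u : 'rV[R]_d -> R) : (0 <= fnorm (Lp_space d 1%:E) u)%E by exact: (fnorm_Lp_ge0 1%:E u).
have aw t : ball1 (fun k => w1 k * nc (a t k)) A by apply: ball1_le (aA t) => k; rewrite mul1r.
have carr c B : herm c -> c 0 = 0 -> ball1 (fun k => nc (c k)) B ->
    fcarrier (Lp_space d 1%:E) (synth c) /\ (fnorm (Lp_space d 1%:E) (synth c) <= (C * B)%:E)%E.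
  by move=> hc c0 cB; apply: (dC c B) => //; apply: ball1_le cB => k; rewrite mul1r.
split.
- apply: (@flow_strongly_measurable R d A H a fa gA w1 w10 _ _ seqnorm_ball1 C C0 X0 dC T E mE).
  by apply: aeW => t; exists A.
- by have [] := carr _ _ (herm_mcoef mE) (mcoef0 E) (mcoefA mE).
(* The errors acquire the factors T and C; adding 1 to each keeps the division safe when they
   vanish. *)
have TC : 0 < (1 + T) * (1 + C) by rewrite mulr_gt0// ltr_pwDl.
have unif (e : R) : 0 < e -> \forall n \near \oo, forall t, 0 <= t <= T ->
   ball1 (fun k => nc (err A a w1 n t k)) e.
  move=> e0; have e2 : 0 < e / 2 by rewrite divr_gt0.
  have [K0 HK] := flow_tail hd fa gA e2; near=> n => t /andP[t0 _].
  have KN : (K0 <= n)%N by near: n; exact: nbhs_infty_ge.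
  have n1 : n.+1%:R^-1 <= e / 2.
    by near: n; apply: filterS (near_infty_natSinv_lt (PosNum e2)) => n /=; exact: ltW.
  have b0 : ball1 (offmodes n (fun k => w1 k * nc (a t k))) (e / 2).
    by apply: ball1_le (HK n KN t) => k; rewrite mul1r.
  have b := err_ball fa w10 seqnorm_ball1 t0 b0.
  apply: (ball1_le (g := fun k => w1 k * nc (err A a w1 n t k))) => [k|]; first by rewrite mul1r.
  apply: ball1_leX b; rewrite [leRHS](_ : e = e / 2 + e / 2) ?lerD2l//; by field.
exists (tstep A a w1 T E); split.
- move=> n; exact: (tstep_in fa gA w10 seqnorm_ball1 dC).
- apply: cvge0_le => [n|e e0]; first by apply: integral_ge0 => t _; exact: X0.
  have e1 : 0 < e / ((1 + T) * (1 + C)) by rewrite divr_gt0.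
  apply: filterS (unif _ e1) => n Hn.
  apply: (@le_trans _ _ (\int[tm T]_t (C * (e / ((1 + T) * (1 + C))))%:E)%E).
    apply: ae_ge0_le_integral => [t|t|]; [exact: X0|by rewrite lee_fin mulr_ge0// ltW|].
    apply: time_ae => t tT.
    have -> : (fun x => \1_E t * synth (a t) x) \- step_fun (tstep A a w1 T E n) t = synth (cut E t (err A a w1 n t)).
      rewrite synth_cut; apply/funext => x /=.
      by rewrite tstep_fun// -mulrBr (synth_err fa gA).
    have [] // := carr (cut E t (err A a w1 n t)) (e / ((1 + T) * (1 + C))).
    - by apply: herm_cut => l; exact: (herm_err fa).
    - by rewrite /cut (err_zero fa) mulr0.
    - by apply: ball1_le (Hn t tT) => k; exact: nc_cut.
  rewrite integral_cst// [X in (_ * X)%E](time_mass T0) -EFinM lee_fin.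
  rewrite (_ : _ * T = e * ((C * T) / ((1 + T) * (1 + C)))); last by ring.
  by rewrite ger_pMr// ler_pdivrMr// mul1r; nra.
- apply: cvge0_le => [n|e e0]; first exact: X0.
  have e1 : 0 < e / 2 / ((1 + T) * (1 + C)) by rewrite !divr_gt0.
  apply: filterS (unif _ e1) => n Hn.
  pose h := mesh A w1 n.
  pose J := (Num.truncn (T / h)).+1.
  pose I j : set (measurableTypeR R) := E `&` `[h * j%:R, h * j.+1%:R[.
  have mI j : measurable (I j) by exact: measurableI.
  (* The coefficients of the step function at time t; their time integrals are those of
     [step_int]. *)
  pose sn t := trunc_coef n (fun k => \sum_(j < J) cut (I j) t (a (h * j%:R)) k).
  have bcst (b : Zd -> R[i]) : bmc (fun _ => b) by move=> k; split; exact: bm_cst.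
  have bc j : bmc (fun t => cut (I j) t (a (h * j%:R))) by apply: bmc_cut.
  have bsn : bmc sn.
    apply: (@bmc_trunc _ _ _ (fun t k => \sum_(j < J) cut (I j) t (a (h * j%:R)) k)) => k.
    by have [b _] := tint_sum T (index_enum 'I_J) k (fun j => bc j); exact: b.
  have bcE : bmc (fun t => cut E t (a t)) by exact: bmc_cut.
  have Resum (S : seq 'I_J) (F : 'I_J -> R[i]) : complex.Re (\sum_(j <- S) F j) = \sum_(j <- S) complex.Re (F j).
    by elim: S => [|j S IH]; rewrite ?big_nil// !big_cons ReD IH.
  have Imsum (S : seq 'I_J) (F : 'I_J -> R[i]) : complex.Im (\sum_(j <- S) F j) = \sum_(j <- S) complex.Im (F j).
    by elim: S => [|j S IH]; rewrite ?big_nil// !big_cons ImD IH.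
  pose bn t k := cut E t (a t) k - sn t k.
  have bnE t : 0 <= t <= T -> bn t = cut E t (err A a w1 n t).
    move=> tT; apply/funext => k; rewrite /bn /sn /err /trunc_coef; case: ifP => kn.
      apply: complex_eqP.
        rewrite ReB Resum !Re_cut ReB mulrBr kn; congr (_ - _).
        under eq_bigr do rewrite Re_cut.
        exact: (@sum_step R d A w1 w10 T E n t (fun j => complex.Re (a (h * j%:R) k)) tT).
      rewrite ImB Imsum !Im_cut ImB mulrBr kn; congr (_ - _).
      under eq_bigr do rewrite Im_cut.
      exact: (@sum_step R d A w1 w10 T E n t (fun j => complex.Im (a (h * j%:R) k)) tT).
    by rewrite /cut kn !subr0.
  pose Y k := \sum_(j < J) Complex (fine (tm T (I j))) 0 * a (h * j%:R) k.
  have tbn k : tint T bn k = mcoef E k - trunc_coef n Y k.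
    rewrite /bn tintB//; congr (_ - _); rewrite /sn /trunc_coef /tint; case: (k \in modes n); last first.
      by apply: complex_eqP; rewrite /= Rintegral_cst// mul0r.
    have [_] := tint_sum T (index_enum 'I_J) k (fun j => bc j); rewrite /tint => ->.
    apply: eq_bigr => j _; rewrite -(time_Rintegral_indic T (mI j)).
    have ii := bm_integrable (tm T) (bm_indic (mI j)).
    apply: complex_eqP => /=.
      under eq_Rintegral do rewrite Re_cut.
      by rewrite RintegralZr//; case: (a (h * j%:R) k) => p q /=; rewrite mul0r subr0.
    under eq_Rintegral do rewrite Im_cut.
    by rewrite RintegralZr//; case: (a (h * j%:R) k) => p q /=; rewrite mul0r addr0.
  have hY : herm Y.
    move=> k; rewrite /Y rmorph_sum; apply: eq_bigr => j _.
    by rewrite rmorphM (fl_herm fa); congr (_ * _); apply: complex_eqP; rewrite //= oppr0.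
  have -> : synth (mcoef E) \- step_int T (tstep A a w1 T E n) = synth (tint T bn).
    apply/funext => x /=.
    have -> : tint T bn = fun k => mcoef E k - trunc_coef n Y k by apply/funext.
    have ft : ball1 (fun k => nc (trunc_coef n Y k)) (\sum_(k <- modes n) nc (Y k)).
      move=> s us; rewrite (bigID (mem (modes n)))/= [X in _ + X <= _]big1 ?addr0; last first.
        by move=> k /negbTE kn; rewrite /trunc_coef kn nc0.
      rewrite -big_filter; apply: (@le_trans _ _ (\sum_(k <- [seq i <- s | i \in modes n]) nc (Y k))).
        rewrite big_seq [leRHS]big_seq; apply: ler_sum => k; rewrite mem_filter => /andP[kn _].
        by rewrite /trunc_coef kn.
      apply: ball1_sub; rewrite ?filter_uniq ?modes_uniq// => k; first exact: nc_ge0.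
      by rewrite mem_filter => /andP[].
    rewrite (synthB x (mcoefA mE) ft); congr (_ - _).
    rewrite /trunc_coef synth_fin /step_int/= /psum.
    rewrite [RHS](eq_bigr (fun k => \sum_(j < J) fine (tm T (I j)) * mode k (a (h * j%:R) k) x)).
      by rewrite exchange_big/=; apply: eq_bigr => j _; rewrite mulr_sumr.
    by move=> k _; rewrite /Y mode_sum; apply: eq_bigr => j _; rewrite mode_real.
  have bt : ball1 (fun k => nc (tint T bn k)) (2 * \int[tm T]_t (e / 2 / ((1 + T) * (1 + C)))).
    apply: (ball1_le (g := fun k => w1 k * nc (tint T bn k))) => [k|]; first by rewrite mul1r.
    apply: tint_ball1 => //.
    - exact: bmcB.
    - by move=> t; exact: ltW.
    - exact/bm_integrable/bm_cst.
    apply: time_ae => t tT; rewrite bnE//; apply: ball1_le (Hn t tT) => k.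
    by rewrite mul1r; exact: nc_cut.
  have [] // := carr (tint T bn) _ _ _ bt.
  - have -> : tint T bn = fun k => mcoef E k - trunc_coef n Y k by apply/funext.
    by move=> k; rewrite rmorphB herm_mcoef// (herm_trunc n hY).
  - rewrite tbn mcoef0 /trunc_coef; case: ifP => _; rewrite ?subrr// /Y big1 ?subrr// => j _.
    by rewrite (fl_zero fa) mulr0.
  move=> _ /le_trans; apply; rewrite lee_fin Rintegral_cst// [fine _](congr1 fine (time_mass T0)) [fine _]/=.
  rewrite (_ : C * _ = e * ((C * T) / ((1 + T) * (1 + C)))); last by field; rewrite !gt_eqF// ltr_pwDl.
  by rewrite ger_pMr// ler_pdivrMr// mul1r; nra.
Unshelve. all: by end_near. Qed.

Let dtm E1 E2 : measurable E1 -> measurable E2 -> E1 `&` E2 = set0 ->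
  mcoef (E1 `|` E2) = fun k => mcoef E1 k + mcoef E2 k.
Proof.
move=> m1 m2 E12; apply/funext => k; rewrite /mcoef -tintD; [|exact: bmc_cut..].
congr (tint T _ k); apply/funext => t; apply/funext => k'; rewrite /cut -mulrDl; congr (_ * _).
apply: complex_eqP; rewrite /= ?addr0//; exact: indic_setU.
Qed.

(** [h] majorizes |v|_4 at almost every time, so the norm of the value on [E] is at most a multiple
    of [nu E]. Countable additivity and bounded variation thus reduce to the finite scalar measure
    [nu]. *)
Lemma flow_measure_into : measure_into T (Wspace d 4 +oo%E) v.
Proof.
exists (fun E => synth (mcoef E)); last by move=> E mE _; exact: flow_bochner_L1.
have [C C0 dC] := @dominated_W R d 4.
have [h [h0 ih Ih hh]] := flow_fine1 fa gA T0.
have X0 (u : 'rV[R]_d -> R) : (0 <= fnorm (Wspace d 4 +oo%E) u)%E by exact: (fnorm_W_ge0 4 +oo%E u).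
pose nu E := \int[tm T]_t (\1_E t * h t).
have w40 (k : Zd) : 0 <= nk k ^+ 4 by rewrite exprn_ge0// normk_ge0.
have carr E : measurable E -> fcarrier (Wspace d 4 +oo%E) (synth (mcoef E)) /\ (fnorm (Wspace d 4 +oo%E) (synth (mcoef E)) <= (C * (2 * nu E))%:E)%E.
  move=> mE; apply: (dC _ _ _ (herm_mcoef mE) (mcoef0 E) (mcoefA mE)).
  exact: mcoef_ball1.
have iE E : measurable E -> (tm T).-integrable setT (EFin \o (fun t => \1_E t * h t)).
  by move=> mE; have := integrable_bmM ih (bm_indic mE); apply: eq_integrable => // t _ /=; rewrite mulrC.
have nuD E1 E2 : measurable E1 -> measurable E2 -> E1 `&` E2 = set0 -> nu (E1 `|` E2) = nu E1 + nu E2.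
  move=> m1 m2 E12; rewrite /nu -RintegralD//; [|exact: iE..].
  by apply: eq_Rintegral => t _; rewrite indic_setU// mulrDl.
have nu0 E : 0 <= nu E by apply: Rintegral_ge0 => t _; rewrite mulr_ge0// indicE.
(* [G n] is the union of the [F i] with i >= n: the remainder after n terms is the value on [G n],
   and [nu (G n)] tends to 0 by dominated convergence. *)
have tails (F : (set (measurableTypeR R))^nat) : (forall n, measurable (F n)) -> trivIset setT F ->
    exists G : nat -> set (measurableTypeR R), [/\ G 0%N = \bigcup_n F n, forall n, measurable (G n),
      forall n, G n = F n `|` G n.+1, forall n, F n `&` G n.+1 = set0 & forall t, \forall n \near \oo, ~ G n t].
  move=> mF tF; exists (fun n => \bigcup_(i in [set i | (n <= i)%N]) F i); split=> [|n|n|n|t].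
  - by apply/seteqP; split=> t [i _ Fi]; exists i.
  - exact: bigcup_measurable.
  - apply/seteqP; split=> [t [i /= ni Fi]|t [Fn|[i /= ni Fi]]].
    + by move: ni; rewrite leq_eqVlt => /predU1P[->|ni]; [left|right; exists i].
    + by exists n => /=.
    + by exists i => //=; exact: ltnW.
  - rewrite -subset0 => t [Fn [i /= ni Fi]].
    by have := tF n i I I (ex_intro _ t (conj Fn Fi)) => ni'; move: ni; rewrite ni' ltnn.
  - have [[i _ Fi]|nF] := pselect ((\bigcup_n F n) t).
      exists i.+1 => // n /= ni [j /= nj Fj].
      have ij := tF i j I I (ex_intro _ t (conj Fi Fj)); move: nj; rewrite -ij => nj.
      by have := leq_trans ni nj; rewrite ltnn.
    by apply: nearW => n [j /= nj Fj]; apply: nF; exists j.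
split.
- by move=> E mE _; have [] := carr E mE.
- move=> F mF _ tF; apply: cvge0_le => [n|e e0]; first exact: X0.
  have [G [G0 mG GS GI Gt]] := tails F mF tF.
  have E n : synth (mcoef (\bigcup_n F n)) \- (fun x => \sum_(i < n) synth (mcoef (F i)) x) = synth (mcoef (G n)).
    elim: n => [|n IH].
      by rewrite -G0; apply/funext => x /=; rewrite big_ord0 subr0.
    apply/funext => x; move/(congr1 (fun f => f x)): IH => /= IH.
    have sD : synth (mcoef (G n)) x = synth (mcoef (F n)) x + synth (mcoef (G n.+1)) x.
      rewrite {1}GS (dtm (mF n) (mG n.+1) (GI n)).
      by rewrite (synthD x (mcoefA (mF n)) (mcoefA (mG n.+1))).
    have alg (p q r s u : R) : p - q = r -> r = s + u -> p - (q + s) = u.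
      by move=> h1 h2; rewrite opprD addrA h1 h2 addrC addKr.
    by rewrite big_ord_recr; exact: alg IH sD.
  have lim : nu (G n) @[n --> \oo] --> (0 : R).
    have [|||||_ _ L] := @dominated_convergence _ (measurableTypeR R) R (tm T) setT measurableT
      (fun n t => (\1_(G n) t * h t)%:E) (fun=> 0%E) (EFin \o h).
    - by move=> n; exact: measurable_int (iE _ (mG n)).
    - exact: measurable_cst.
    - apply: aeW => t _; apply: cvg_near_cst.
      by apply: filterS (Gt t) => n nG; rewrite indicE memNset ?mul0r.
    - exact: ih.
    - apply: aeW => t n _ /=; rewrite lee_fin normrM [`|h t|]ger0_norm//.
      by rewrite indicE; case: (_ \in _); rewrite ?normr1 ?normr0 ?mul1r ?mul0r.
    move: L; rewrite integral0 => /fine_cvgP[_]; apply: cvg_trans.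
    by apply: near_eq_cvg; apply: nearW.
  have Ce : 0 < e / (1 + C * 2) by rewrite divr_gt0// ltr_pwDl// mulr_ge0.
  have /cvgrPdist_le/(_ _ Ce) := lim; apply: filterS => n; rewrite sub0r normrN ger0_norm// => le.
  rewrite E; have [_ le'] := carr _ (mG n); apply: le_trans le' _; rewrite lee_fin mulrA.
  apply: le_trans (ler_wpM2l _ le) _; first by rewrite mulr_ge0.
  by rewrite mulrCA ger_pMr// ler_pdivrMr ?mul1r ?lerDr// ltr_pwDl// mulr_ge0.
- exists (C * (2 * (A / delta))) => F mF _ tF n.
  have [G [G0 mG GS GI _]] := tails F mF tF.
  have S : \sum_(i < n) nu (F i) + nu (G n) = nu (\bigcup_n F n).
    elim: n => [|n IH]; first by rewrite big_ord0 add0r G0.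
    have nuG := nuD _ _ (mF n) (mG n.+1) (GI n); rewrite -GS in nuG.
    by rewrite big_ord_recr/= -addrA -nuG.
  apply: (@le_trans _ _ (\sum_(i < n) (C * (2 * nu (F i)))%:E)%E).
    by apply: lee_sum => i _; have [] := carr _ (mF i).
  rewrite sumEFin lee_fin -mulr_sumr ler_wpM2l// -mulr_sumr ler_wpM2l//.
  apply: (@le_trans _ _ (nu (\bigcup_n F n))); first by rewrite -S lerDl.
  have mU : measurable (\bigcup_n F n) by rewrite -G0.
  apply: le_trans Ih; apply: (le_Rintegral measurableT (iE _ mU) ih) => t _.
  by rewrite indicE; case: (_ \in _); rewrite ?mul1r ?mul0r.
Qed.

End measure_valued.

(** * Uniqueness of Fourier coefficients *)

Section torus_null.
Context {R : realType}.

Lemma torus_coord_null d (i : 'I_d) (B : set (measurableTypeR R)) : measurable B -> @circle_measure R B = 0%E ->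
  torus_measure R d [set x | B (x ord0 i)] = 0%E.
Proof.
move=> mB B0; elim: d i => [[]//|d IH i].
have mA m (j : 'I_m) : measurable [set x : 'rV[R]_m | B (x ord0 j)].
  by have := @measurable_coord R m j measurableT B mB; rewrite setTI.
change (pushforward (@circle_measure R \x torus_measure R d)%E (@row_cons R d) [set x : 'rV[R]_d.+1 | B (x ord0 i)] = 0%E).
rewrite /pushforward; case: (unliftP ord0 i) => [j ->|->].
  rewrite (_ : _ @^-1` _ = setT `*` [set x : 'rV[R]_d | B (x ord0 j)]).
    have IHj : torus_measure R d [set x | B (x ord0 j)] = 0%E := IH j.
    by rewrite (product_measure1E _ _ measurableT (mA d j)); apply/eqP; rewrite mule_eq0; apply/orP; right; apply/eqP; exact: IHj.
  by apply/seteqP; split=> -[y x] /=; rewrite row_cons_lift; [split|case].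
rewrite (_ : _ @^-1` _ = B `*` setT).
  by rewrite (product_measure1E _ _ mB measurableT); apply/eqP; rewrite mule_eq0; apply/orP; left; apply/eqP; exact: B0.
by apply/seteqP; split=> -[y x] /=; rewrite row_cons0; [split|case].
Qed.

(** The faces of the cell are null; on the open cell half-spaces can be read off from the signs of
    sines. *)
Lemma torus_ae_cell d : {ae torus_measure R d, forall x : 'rV[R]_d, forall i, - pi < x ord0 i < pi}.
Proof.
pose B : set (measurableTypeR R) := ~` `]- pi, pi[.
have mB : measurable B by apply: measurableC; exact: measurable_itv.
have B0 : @circle_measure R B = 0%E.
  rewrite /circle_measure /mrestr.
  have -> : B `&` `[- pi, pi] = [set - pi] `|` [set pi].
    apply/seteqP; split=> x /=.
      rewrite /B /= !in_itv/= => -[/negP]; rewrite negb_and -!leNgt => H /andP[h1 h2].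
      by case/orP: H => h; [left|right]; apply/le_anti; rewrite ?h ?h1 ?h2.
    have pp := @pi_gt0 R; rewrite /B /= !in_itv/=.
    by case=> ->; rewrite ltxx ?andbF ?lexx; split => //; lra.
  apply/eqP; rewrite eq_le measure_ge0 andbT; apply: le_trans (measureU2 _ _ _) _ => //.
  by rewrite [X in (X + _)%E]lebesgue_measure_set1 [X in (_ + X)%E]lebesgue_measure_set1 adde0.
have ei (i : 'I_d) : {ae torus_measure R d, forall x : 'rV[R]_d, - pi < x ord0 i < pi}.
  exists [set x : 'rV[R]_d | B (x ord0 i)]; split.
  - by have := @measurable_coord R d i measurableT B mB; rewrite setTI.
  - exact: (torus_coord_null i mB B0).
  - by move=> x /= nx; rewrite /B /= in_itv/=.
exact: filter_forall.
Qed.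

End torus_null.

(* Polynomials converging to a step: a sharp cut-off is thus a limit of trigonometric polynomials. *)
Lemma half_approx {R : realType} (u : R) : 0 <= u <= 1 ->
  (1 - u ^+ n) ^+ (n * 2 ^ n)%N @[n --> \oo] --> ((u < 2^-1)%R%:R : R).
Proof.
move=> /andP[u0 u1]; have un n : 0 <= u ^+ n <= 1 by rewrite exprn_ge0 ?exprn_ile1.
have q0 n : 0 <= (1 - u ^+ n) ^+ (n * 2 ^ n)%N by rewrite exprn_ge0// subr_ge0; case/andP: (un n).
have q1 n : (1 - u ^+ n) ^+ (n * 2 ^ n)%N <= 1.
  by rewrite exprn_ile1// ?subr_ge0 ?gerBl; case/andP: (un n).
have nat2 n : ((2 ^ n)%N%:R : R) = 2 ^+ n by rewrite natrX.
apply/cvgrPdist_le => e e0; have [uh|uh] := ltP u 2^-1.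
  (* By the Bernoulli inequality the distance to 1 is at most n 2^n u^n = (n y^n) y^n, where n y^n
     is bounded because y < 1. *)
  pose y := Num.sqrt (2 * u); have y0 : 0 <= y by exact: sqrtr_ge0.
  have yy : y ^+ 2 = 2 * u by rewrite sqr_sqrtr// mulr_ge0.
  have y1 : y < 1.
    rewrite -(@ltr_pXn2r _ 2)// ?nnegrE// yy expr1n; lra.
  have [C HC] : exists C : R, forall n, n%:R * y ^+ n <= C.
    exists (1 - y)^-1 => n; have y1' : 0 < 1 - y by rewrite subr_gt0.
    rewrite -(ler_pM2r y1') mulVf ?gt_eqF//.
    have : n%:R * y ^+ n * (1 - y) + y ^+ n <= 1; last by have := exprn_ge0 n y0; lra.
    elim: n => [|n IH]; first by rewrite !mul0r add0r expr0.
    apply: le_trans IH; rewrite exprS -natr1; have := exprn_ge0 n y0.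
    move: (y ^+ n) (n%:R : R) (ler0n R n) => z m m0 z0.
    rewrite -subr_ge0 [leRHS](_ : _ = z * (1 - y) ^+ 2 * (m + 1)); last by ring.
    by rewrite mulr_ge0 ?addr_ge0// mulr_ge0 ?sqr_ge0.
  have yc : y ^+ n @[n --> \oo] --> (0 : R) by apply: cvg_expr; rewrite ger0_norm.
  have C0 : 0 <= C by apply: le_trans (HC 0%N); rewrite mul0r.
  have e1 : 0 < e / (1 + C) by rewrite divr_gt0// ltr_pwDl.
  have /cvgrPdist_le/(_ _ e1) := yc; apply: filterS => n; rewrite sub0r normrN ger0_norm ?exprn_ge0// => yn.
  rewrite ger0_norm ?subr_ge0// lerBlDl.
  have bern m (t : R) : 0 <= t <= 1 -> 1 - m%:R * t <= (1 - t) ^+ m.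
    move=> /andP[t0 t1]; elim: m => [|m IH]; first by rewrite mul0r subr0 expr0.
    have t1' : 0 <= 1 - t by rewrite subr_ge0.
    rewrite exprSr; apply: le_trans (ler_wpM2r t1' IH); rewrite -natr1.
    have := ler0n R m; move: (m%:R : R) => q q0'; nra.
  have := bern (n * 2 ^ n)%N _ (un n); rewrite natrM nat2 -mulrA -exprMn -yy -exprM mul2n -addnn exprD mulrA.
  have : n%:R * y ^+ n * y ^+ n <= C * (e / (1 + C)) by apply: ler_pM; rewrite ?mulr_ge0 ?exprn_ge0.
  have : C * (e / (1 + C)) <= e.
    by rewrite mulrCA ger_pMr// ler_pdivrMr ?mul1r ?lerDr// ltr_pwDl.
  have t1 : true%:R = 1 :> R by [].
  rewrite t1; move: (_ ^+ _) (_ * _) (_ * _) => p q r *; lra.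
near=> n; rewrite sub0r normrN ger0_norm//.
(* For u >= 1/2, from 1 - x <= e^(-x) and (2 u)^n >= 1. *)
have ex : (1 - u ^+ n) ^+ (n * 2 ^ n)%N <= expR (- n%:R).
  apply: (@le_trans _ _ (expR (- u ^+ n) ^+ (n * 2 ^ n)%N)).
    rewrite lerXn2r ?nnegrE ?expR_ge0 ?subr_ge0//; first by case/andP: (un n).
    exact: expR_ge1Dx.
  rewrite -expRM_natl ler_expR natrM nat2 mulrN lerN2 -mulrA -exprMn ler_peMr// exprn_ege1//.
  by rewrite mulrC -ler_pdivrMr ?mul1r.
apply: le_trans ex _; rewrite expRN.
have e1 := expR_ge1Dx (n%:R : R).
apply: (@le_trans _ _ (n.+1%:R)^-1).
  by rewrite lef_pV2 ?posrE ?expR_gt0// -natr1 addrC.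
by near: n; apply: filterS (near_infty_natSinv_lt (PosNum e0)) => n /=; exact: ltW.
Unshelve. all: by end_near. Qed.

Section trig_poly.
Context {R : realType} {d : nat}.
Local Notation Zd := 'rV[int]_d.
Local Notation mu := (torus_measure R d).
Local Notation four := (@fourier R d).

Definition trig (p : 'rV[R]_d -> R) := exists s : seq (Zd * R[i]), p = fun x => \sum_(z <- s) mode z.1 z.2 x.

Lemma trig_mode k c : trig (mode k c).
Proof. by exists [:: (k, c)]; apply/funext => x; rewrite big_seq1. Qed.

Lemma trigD p q : trig p -> trig q -> trig (fun x => p x + q x).
Proof. by move=> [s ->] [s' ->]; exists (s ++ s'); apply/funext => x; rewrite big_cat. Qed.

Lemma trigZ r p : trig p -> trig (fun x => r * p x).
Proof.
move=> [s ->]; exists [seq (z.1, Complex r 0 * z.2) | z <- s]; apply/funext => x.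
rewrite big_map mulr_sumr; apply: eq_bigr => z _; rewrite /mode; case: (z.2) => a b /=; ring.
Qed.

Lemma trig_cst r : trig (fun=> r).
Proof.
rewrite (_ : (fun=> r) = mode 0 (Complex r 0)); first exact: trig_mode.
by apply/funext => x; rewrite /mode dotk0 cos0 sin0/= mulr1 mul0r subr0.
Qed.

Lemma mode_mul (k : Zd) c (l : Zd) c' (x : 'rV[R]_d) : mode k c x * mode l c' x =
  2^-1 * (mode (k + l) (c * c') x + mode (k - l) (c * conjc c') x) :> R.
Proof.
rewrite /mode dotkD dotkD dotkN !cosD !sinD cosN sinN; case: c => a b; case: c' => a' b' /=.
by field.
Qed.

Lemma trigM p q : trig p -> trig q -> trig (fun x => p x * q x).
Proof.
move=> [s ->] tq; elim: s => [|z s IH].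
  by rewrite (_ : (fun x => _) = fun=> 0); [exact: trig_cst|apply/funext => x; rewrite big_nil mul0r].
rewrite (_ : (fun x => _) = fun x => mode z.1 z.2 x * q x + (\sum_(j <- s) mode j.1 j.2 x) * q x); last first.
  by apply/funext => x; rewrite big_cons mulrDl.
apply: trigD => //; case: tq => s' ->; elim: s' => [|z' s' IH'].
  by rewrite (_ : (fun x => _) = fun=> 0); [exact: trig_cst|apply/funext => x; rewrite big_nil mulr0].
rewrite (_ : (fun x => _) = fun x => 2^-1 * (mode (z.1 + z'.1) (z.2 * z'.2) x + mode (z.1 - z'.1) (z.2 * conjc z'.2) x)
  + mode z.1 z.2 x * (\sum_(j <- s') mode j.1 j.2 x)); last first.
  by apply/funext => x; rewrite big_cons mulrDr mode_mul.
by apply: trigD => //; apply: trigZ; apply: trigD; exact: trig_mode.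
Qed.

Lemma trigX p n : trig p -> trig (fun x => p x ^+ n).
Proof.
move=> tp; elim: n => [|n IH].
  by rewrite (_ : (fun x => _) = fun=> 1); [exact: trig_cst|apply/funext => x; rewrite expr0].
rewrite (_ : (fun x => _) = fun x => p x * p x ^+ n); first exact: trigM.
by apply/funext => x; rewrite exprS.
Qed.

Lemma trig_bm p : trig p -> bm p.
Proof. by move=> [s ->]; apply: bm_sum => z; exact: bm_mode. Qed.

Lemma trig_sin i r : trig (fun x : 'rV[R]_d => sin (x ord0 i - r)).
Proof.
rewrite (_ : (fun x => _) = mode (delta_mx ord0 i) (Complex (- sin r) (- cos r))); first exact: trig_mode.
apply/funext => x; rewrite /mode /dotk (bigD1 i)//= big1 ?addr0 => [|j /negbTE ji].
  by rewrite mxE !eqxx mulr1 sinD cosN sinN; ring.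
by rewrite mxE eqxx ji mulr0.
Qed.

Variable f : 'rV[R]_d -> R.
Hypothesis fi : mu.-integrable setT (EFin \o f).
Hypothesis f0 : forall k, four f k = 0.

Let fbm g : bm g -> mu.-integrable setT (EFin \o (fun x => f x * g x)).
Proof. exact: integrable_bmM. Qed.

Lemma trig_orth p : trig p -> \int[mu]_x (f x * p x) = 0.
Proof.
have nz : (2 * pi) ^- d != 0 :> R by rewrite invr_eq0 expf_neq0// mulf_neq0// gt_eqF// pi_gt0.
move=> [s ->]; under eq_Rintegral do rewrite mulr_sumr.
rewrite Rint_sum; last by move=> z; apply: fbm; exact: bm_mode.
apply: big1 => -[k c] _ /=; have /(congr1 (fun z => (complex.Re z, complex.Im z))) := f0 k.
rewrite /fourier /= => -[/eqP + /eqP]; rewrite oppr_eq0 !mulf_eq0 !(negbTE nz)/= => /eqP hc /eqP hs.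
rewrite (_ : (\int[mu]_x _) = \int[mu]_x (complex.Re c * (f x * cos (dotk x k)) - complex.Im c * (f x * sin (dotk x k)))); last first.
  by apply: eq_Rintegral => x _; rewrite /mode; ring.
have ic := fbm (bm_cosk k); have si := fbm (bm_sink k).
rewrite RintegralB//; [|exact: L1Z|exact: L1Z].
by rewrite !RintegralZl// hc hs !mulr0 subrr.
Qed.

(* Integrable functions without Fourier coefficients are orthogonal to such limits, and the
   indicators of the generating boxes are among them. *)
Definition tlim (g : 'rV[R]_d -> R) := exists p : nat -> 'rV[R]_d -> R,
  [/\ forall n, trig (p n), forall n x, 0 <= p n x <= 1 & {ae mu, forall x, p n x @[n --> \oo] --> g x}].

Lemma tlimM g h : tlim g -> tlim h -> tlim (fun x => g x * h x).
Proof.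
move=> [p [tp p1 pg]] [q [tq q1 qh]]; exists (fun n x => p n x * q n x); split.
- by move=> n; exact: trigM.
- move=> n x; have /andP[a1 a2] := p1 n x; have /andP[b1 b2] := q1 n x.
  by rewrite mulr_ge0 ?mulr_ile1.
- by apply: filterS2 pg qh => x px qx; exact: cvgM.
Qed.

Lemma tlimC g : tlim g -> tlim (fun x => 1 - g x).
Proof.
move=> [p [tp p1 pg]]; exists (fun n x => 1 - p n x); split.
- move=> n; rewrite (_ : (fun x => _) = fun x => 1 + (-1) * p n x).
    by apply: trigD; [exact: trig_cst|exact: trigZ].
  by apply/funext => x; rewrite mulN1r.
- by move=> n x; have /andP[a1 a2] := p1 n x; rewrite subr_ge0 a2 gerBl a1.
- by apply: filterS pg => x px; apply: cvgB => //; exact: cvg_cst.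
Qed.

Lemma tlim_cst (b : bool) : tlim (fun=> b%:R).
Proof.
exists (fun _ _ => b%:R); split.
- by move=> n; exact: trig_cst.
- by move=> n x; case: b => /=; rewrite lexx ler01.
- by apply: nearW => x; exact: cvg_cst.
Qed.

Lemma tlim_ae g h : {ae mu, forall x, g x = h x} -> tlim g -> tlim h.
Proof.
move=> gh [p [tp p1 pg]]; exists p; split=> //.
by apply: filterS2 gh pg => x <-.
Qed.

(** The substitution u = (1 - sin) / 2 sends the sign of the sine to the threshold 1/2 of
    [half_approx]. *)
Lemma tlim_sin i r : tlim (fun x => (0 < sin (x ord0 i - r))%R%:R).
Proof.
pose u (x : 'rV[R]_d) := (1 - sin (x ord0 i - r)) / 2.
have u01 x : 0 <= u x <= 1.
  have := @sin_geN1 R (x ord0 i - r); have := @sin_le1 R (x ord0 i - r); rewrite /u; lra.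
exists (fun n x => (1 - u x ^+ n) ^+ (n * 2 ^ n)%N); split.
- move=> n; apply: trigX; rewrite (_ : (fun x => _) = fun x => 1 + (-1) * u x ^+ n); last first.
    by apply/funext => x; rewrite mulN1r.
  apply: trigD; first exact: trig_cst.
  apply: trigZ; apply: trigX; rewrite (_ : u = fun x => 2^-1 + (- 2^-1) * sin (x ord0 i - r)).
    by apply: trigD; [exact: trig_cst|apply: trigZ; exact: trig_sin].
  by apply/funext => x; rewrite /u; field.
- move=> n x; have /andP[a1 a2] := u01 x.
  have q1 : u x ^+ n <= 1 by exact: exprn_ile1.
  by rewrite exprn_ge0 ?subr_ge0//= exprn_ile1 ?subr_ge0// gerBl exprn_ge0.
- apply: nearW => x; have := half_approx (u01 x).
  suff -> : (u x < 2^-1)%R = (0 < sin (x ord0 i - r))%R by [].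
  by apply/idP/idP; rewrite /u => ?; lra.
Qed.

(** On the open cell, for 0 <= r < pi the half-space is given by sin x_i > 0 and sin (x_i - r) > 0.
    For - pi < r < 0 its complement is given by x_i < 0, that is sin (x_i - pi) > 0, together with
    sin (x_i - r) <= 0. For other r the indicator is constant. *)
Lemma tlim_coord i r : tlim (fun x => (r < x ord0 i)%R%:R).
Proof.
have cell := torus_ae_cell (R := R) d; have pp := @pi_gt0 R.
have spos (y : R) : - pi < y < pi -> (0 < sin y) = (0 < y).
  move=> /andP[y1 y2]; apply/idP/idP => [sy|y0]; last by rewrite sin_gt0_pi// y0 y2.
  rewrite ltNge; apply: contraTN sy => y0; rewrite -leNgt -oppr_ge0 -sinN.
  by apply: sin_ge0_pi; rewrite oppr_ge0 y0 lerNl ltW.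
have sneg (y : R) : - (2 * pi) < y < 0 -> (0 < sin y) = (y < - pi).
  move=> hy; have hy' : - pi < y + pi < pi by lra.
  have <- : - sin (y + pi) = sin y by rewrite sinDpi opprK.
  rewrite -sinN spos; last by lra.
  by apply/idP/idP => ?; lra.
have [rp|rp] := leP pi r.
  apply: tlim_ae (tlim_cst false); apply: filterS cell => x /(_ i) hx.
  by congr (nat_of_bool _)%:R; apply/esym/negbTE; rewrite -leNgt; lra.
have [rn|rn] := leP r (- pi).
  apply: tlim_ae (tlim_cst true); apply: filterS cell => x /(_ i) hx.
  by congr (nat_of_bool _)%:R; apply/esym; lra.
have [r0|r0] := leP 0 r.
  apply: tlim_ae (tlimM (tlim_sin i 0) (tlim_sin i r)); apply: filterS cell => x /(_ i) hx.
  rewrite -natrM mulnb; congr (nat_of_bool _)%:R; rewrite subr0 spos//.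
  have [x0|x0] /= := ltP 0 (x ord0 i); first by rewrite spos ?subr_gt0//; lra.
  by apply/esym/negbTE; rewrite -leNgt; lra.
apply: tlim_ae (tlimC (tlimM (tlim_sin i pi) (tlimC (tlim_sin i r)))); apply: filterS cell => x /(_ i) hx.
have -> : (0 < sin (x ord0 i - pi)) = (x ord0 i < 0).
  have [x0|x0] := ltP (x ord0 i) 0; first by rewrite sneg; lra.
  have [->|xn] := eqVneq (x ord0 i) 0; first by rewrite sub0r sinN sinpi oppr0 ltxx.
  have x1 : 0 < x ord0 i by rewrite lt_neqAle eq_sym xn.
  by rewrite spos; lra.
have [x0|x0] := ltP (x ord0 i) 0; last by rewrite mul0r subr0; have -> : (r < x ord0 i)%R by lra.
rewrite spos; last by lra.
by rewrite subr_gt0; case: (r < x ord0 i)%R; rewrite ?mul1r ?subrr ?subr0 ?subrr.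
Qed.

Lemma tlim_orth g : tlim g -> measurable_fun setT g -> \int[mu]_x (f x * g x) = 0.
Proof.
move=> [p [tp p1 pg]] mg.
have ff : mu.-integrable setT (fun x => `|(f x)%:E|%E) by exact: integrable_abse fi.
have [|||||_ _ L] := @dominated_convergence _ _ R mu setT measurableT (fun n x => (f x * p n x)%:E)
  (fun x => (f x * g x)%:E) (fun x => `|(f x)%:E|%E).
- by move=> n; exact: measurable_int (fbm (trig_bm (tp n))).
- by apply/measurable_EFinP; apply: measurable_funM => //; apply/measurable_EFinP; exact: measurable_int fi.
- apply: filterS pg => x px _; apply: cvg_EFin; first by apply: nearW.
  by apply: cvgMr.
- exact: ff.
- apply: aeW => x n _; rewrite lee_fin normrM ler_piMr//.
  by have /andP[a1 a2] := p1 n x; rewrite ger0_norm.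
have L0 : (\int[mu]_x (f x * g x)%:E)%E = 0%E.
  apply: (cvg_unique _ L) => //; apply: cvg_near_cst; apply: nearW => n /=.
  rewrite -[LHS]fineK; first by congr (_%:E); exact: (trig_orth (tp n)).
  exact: integrable_fin_num (fbm (trig_bm (tp n))).
by rewrite /Rintegral L0.
Qed.

Let box (s : seq ('I_d * R)) : set 'rV[R]_d := [set x | all (fun z => z.2 < x ord0 z.1) s].
Let Q : set (set 'rV[R]_d) := [set E | exists s, E = box s].

Let mQ E : Q E -> measurable E.
Proof.
move=> [s ->]; elim: s => [|z s IH].
  by rewrite (_ : box _ = setT)//; apply/seteqP.
rewrite (_ : box _ = [set x : 'rV[R]_d | z.2 < x ord0 z.1] `&` box s); last first.
  by apply/seteqP; split => x /=; [move/andP|move=> H; apply/andP].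
apply: measurableI => //.
have := @measurable_coord R d z.1 measurableT `]z.2, +oo[%classic (measurable_itv _).
by rewrite setTI; congr measurable; apply/seteqP; split => x /=; rewrite in_itv/= andbT.
Qed.

Let mem_box s x : (x \in box s) = all (fun z => z.2 < x ord0 z.1) s.
Proof. by apply/idP/idP; rewrite inE. Qed.

Let tlim_box s : tlim \1_(box s).
Proof.
elim: s => [|z s IH].
  by apply: tlim_ae (tlim_cst true); apply: nearW => x; rewrite indicE mem_box.
apply: tlim_ae (tlimM (tlim_coord z.1 z.2) IH); apply: nearW => x.
by rewrite !indicE !mem_box /= -natrM mulnb.
Qed.

Let gen_measurable E : measurable E -> <<s Q >> E.
Proof.
move=> mE; have := @measurable_fun_rowP R _ (g_sigma_algebraType Q) d id _ measurableT E mE.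
rewrite setTI; apply => i; apply: (measurability _ (RGenOInfty.measurableE R)) => //.
move=> /= _ [_ [r ->] <-]; rewrite setTI; apply: sub_sigma_algebra.
exists [:: (i, r)]; by apply/seteqP; split => x /=; rewrite in_itv/= /box /= !andbT.
Qed.

Let orth (E : set 'rV[R]_d) := measurable E /\ \int[mu]_x (f x * \1_E x) = 0.

Let orth_lambda : lambda_system setT orth.
Proof.
split => //.
- split => //; rewrite (_ : (fun x => _) = fun x => f x * mode 0 (Complex 1 0) x).
    by apply: trig_orth; exact: trig_mode.
  apply/funext => x; rewrite indicE in_setT /mode dotk0 cos0 sin0 /=; ring.
- move=> E F FE [mE oE] [mF oF]; split; first exact: measurableD.
  rewrite (_ : (fun x => _) = fun x => f x * \1_E x - f x * \1_F x).
    by rewrite RintegralB ?oE ?oF ?subrr//; apply: fbm; exact: bm_indic.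
  apply/funext => x; rewrite -mulrBr; congr (_ * _); rewrite !indicE in_setD.
  case: (boolP (x \in F)) => xF; last by rewrite andbT subr0.
  have -> : x \in E by rewrite inE; apply: FE; rewrite inE in xF.
  by rewrite subrr.
- move=> F nF oF; have mF n : measurable (F n) by have [] := oF n.
  split; first exact: bigcup_measurable.
  have ff : mu.-integrable setT (fun x => `|(f x)%:E|%E) by exact: integrable_abse fi.
  have mU : measurable (\bigcup_n F n) by exact: bigcup_measurable.
  have [|||||_ _ L] := @dominated_convergence _ _ R mu setT measurableT (fun n x => (f x * \1_(F n) x)%:E)
    (fun x => (f x * \1_(\bigcup_n F n) x)%:E) (fun x => `|(f x)%:E|%E).
  + by move=> n; exact: measurable_int (fbm (bm_indic (mF n))).
  + exact: measurable_int (fbm (bm_indic mU)).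
  + apply: aeW => x _; apply: cvg_EFin; first by apply: nearW.
    apply: cvgMr; have [[n _ Fnx]|nU] := pselect ((\bigcup_n F n) x).
      rewrite indicE mem_set; last by exists n.
      apply: cvg_near_cst; exists n => // m /= nm; rewrite indicE mem_set//.
      by have /subsetPset := nF _ _ nm; apply.
    rewrite indicE memNset//; apply: cvg_near_cst; apply: nearW => n; rewrite indicE memNset// => Fnx.
    by apply: nU; exists n.
  + exact: ff.
  + apply: aeW => x n _; rewrite lee_fin normrM ler_piMr// indicE.
    by case: (_ \in _); rewrite ?normr1 ?normr0.
  have L0 : (\int[mu]_x (f x * \1_(\bigcup_n F n) x)%:E)%E = 0%E.
    apply: (cvg_unique _ L) => //; apply: cvg_near_cst; apply: nearW => n /=.
    rewrite -[LHS]fineK; first by congr (_%:E); have [_] := oF n.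
    exact: integrable_fin_num (fbm (bm_indic (mF n))).
  by rewrite /Rintegral L0.
Qed.

(** The boxes are stable under intersection and generate the sigma-algebra. By the pi-lambda theorem
    [f] integrates to 0 over every measurable set, hence vanishes almost everywhere. *)
Lemma fourier_inj : {ae mu, forall x, f x = 0}.
Proof.
have QI : setI_closed Q.
  move=> _ _ [s ->] [s' ->]; exists (s ++ s'); apply/seteqP.
  by split => x /=; rewrite /box /= all_cat => /andP.
have Qo : Q `<=` orth.
  move=> E QE; split; first exact: mQ; case: QE => s ->.
  by apply: tlim_orth => //; apply: measurable_indic; apply: mQ; exists s.
have sub := @lambda_system_subset _ _ QI setT _ orth_lambda Qo (fun X _ => @subsetT _ X).
have := @integral_ae_eq _ _ _ mu setT measurableT (cst 0%E) (EFin \o f) fi (measurable_cst _) _.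
case=> [E _ mE|N [mN N0 HN]].
  rewrite integral0; have [_ oE] := sub _ (gen_measurable mE).
  rewrite integral_mkcond -[LHS]fineK; last first.
    apply: integrable_fin_num => //; rewrite -integrable_mkcond//; exact: (integrableS measurableT mE (@subsetT _ E) fi).
  congr (_%:E); rewrite -oE /Rintegral; congr fine; apply: eq_integral => x _.
  by rewrite patchE indicE; case: (x \in E); rewrite ?mulr1 ?mulr0.
exists N; split => // x /= nx; apply: HN => /= H; apply: nx.
by have := H I => -[].
Qed.

End trig_poly.

Lemma synth_fourier {R : realType} {d} (f : 'rV[R]_d -> R) (A : R) :
  (torus_measure R d).-integrable setT (EFin \o f) ->
  ball1 (fun k => ComplexField.Normc.normc (fourier f k)) A ->
  {ae torus_measure R d, forall x, f x = synth (fourier f) x}.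
Proof.
move=> fi fA.
have bs := bm_synth fA; have si := bm_integrable (torus_measure R d) bs.
have h : herm (fourier f) by move=> k; exact: fourierN.
have := @fourier_inj R d (fun x => f x - synth (fourier f) x) (L1B fi si) _.
case=> [k|N [mN N0 HN]]; first by rewrite fourierB// (fourier_synth h fA) subrr.
by exists N; split => // x /= nx; apply: HN => /= /subr0_eq.
Qed.

(** * Weak formulation *)

Lemma frac_le {R : realType} (M e : R) : 0 <= M -> 0 < e -> M * (e / (1 + M)) <= e.
Proof. by move=> M0 e0; rewrite mulrCA ger_pMr// ler_pdivrMr ?mul1r ?lerDr// ltr_pwDl. Qed.

Section ae_integrable.
Context dsp (T : measurableType dsp) (R : realType) (mu : {finite_measure set T -> \bar R}).
Implicit Types (f g : T -> R) (N : T -> \bar R).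

(* time_measure is not complete, and the functions of time obtained from Bochner integrable
   functions are only almost everywhere equal to measurable ones. *)
Definition aemeas f := exists2 Z : T -> R, measurable_fun setT Z & {ae mu, forall t, f t = Z t}.
Definition aeint f := exists2 Z : T -> R, mu.-integrable setT (EFin \o Z) & {ae mu, forall t, f t = Z t}.

Lemma aeint_meas f : aeint f -> aemeas f.
Proof. by move=> [Z iZ fZ]; exists Z => //; apply/measurable_EFinP; exact: measurable_int iZ. Qed.

Lemma ae_eq_Rint f g : {ae mu, forall t, f t = g t} -> \int[mu]_t f t = \int[mu]_t g t.
Proof. by move=> fg; rewrite /Rintegral; congr fine; apply: ae_eq_integral_T; apply: filterS fg => t ->. Qed.

Lemma aeint_eq f g : {ae mu, forall t, f t = g t} -> aeint f -> aeint g.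
Proof. by move=> fg [Z iZ fZ]; exists Z => //; apply: filterS2 fg fZ => t <-. Qed.

Lemma aeint_integrable f : mu.-integrable setT (EFin \o f) -> aeint f.
Proof. by move=> fi; exists f => //; exact: nearW. Qed.

Lemma aeint_bmM f g : aeint f -> bm g -> aeint (fun t => f t * g t).
Proof.
move=> [Z iZ fZ] bg; exists (fun t => Z t * g t); first exact: integrable_bmM.
by apply: filterS fZ => t ->.
Qed.

Lemma aeintD f g : aeint f -> aeint g ->
  aeint (fun t => f t + g t) /\ \int[mu]_t (f t + g t) = \int[mu]_t f t + \int[mu]_t g t.
Proof.
move=> [Z iZ fZ] [W iW gW].
have E : {ae mu, forall t, f t + g t = Z t + W t} by apply: filterS2 fZ gW => t -> ->.
split; first by exists (fun t => Z t + W t) => //; exact: L1D.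
by rewrite (ae_eq_Rint E) (ae_eq_Rint fZ) (ae_eq_Rint gW) RintegralD.
Qed.

Lemma aeintZ r f : aeint f -> aeint (fun t => r * f t) /\ \int[mu]_t (r * f t) = r * \int[mu]_t f t.
Proof.
move=> [Z iZ fZ]; have E : {ae mu, forall t, r * f t = r * Z t} by apply: filterS fZ => t ->.
split; first by exists (fun t => r * Z t) => //; exact: L1Z.
by rewrite (ae_eq_Rint E) (ae_eq_Rint fZ) RintegralZl.
Qed.

Lemma aeintB f g : aeint f -> aeint g ->
  aeint (fun t => f t - g t) /\ \int[mu]_t (f t - g t) = \int[mu]_t f t - \int[mu]_t g t.
Proof.
move=> fi /(aeintZ (-1))[gi gE]; have [fgi fgE] := aeintD fi gi.
have E : (fun t => f t - g t) = fun t => f t + -1 * g t by apply/funext => t; rewrite mulN1r.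
by rewrite E fgE gE mulN1r.
Qed.

Lemma aeint_sum (I : Type) (s : seq I) (F : I -> T -> R) : (forall i, aeint (F i)) ->
  aeint (fun t => \sum_(i <- s) F i t) /\ \int[mu]_t (\sum_(i <- s) F i t) = \sum_(i <- s) \int[mu]_t F i t.
Proof.
move=> aF; elim: s => [|i s [IH IHE]].
  have -> : (fun t => \sum_(i <- [::]) F i t) = fun=> 0 by apply/funext => t; rewrite big_nil.
  split; first by apply: aeint_integrable; apply: bm_integrable; exact: bm_cst.
  by rewrite big_nil Rintegral_cst// mul0r.
have -> : (fun t => \sum_(j <- i :: s) F j t) = fun t => F i t + \sum_(j <- s) F j t.
  by apply/funext => t; rewrite big_cons.
have [sD ED] := aeintD (aF i) IH.
by rewrite big_cons -IHE.
Qed.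

Lemma aemeas_lim (F : nat -> T -> R) f : (forall n, measurable_fun setT (F n)) ->
  {ae mu, forall t, F n t @[n --> \oo] --> f t} -> aemeas f.
Proof.
move=> mF [N [mN N0 HN]].
have cF t : (\1_(~` N) t * F n t) @[n --> \oo] --> \1_(~` N) t * f t.
  rewrite indicE; have [tN|tN] := boolP (t \in ~` N).
    apply: cvgMr; apply: contrapT => nc; have : N t by exact: HN.
    by rewrite inE in tN.
  by rewrite mul0r; under eq_cvg do rewrite mul0r; exact: cvg_cst.
exists (fun t => \1_(~` N) t * f t).
  apply: (@measurable_fun_cvg _ _ _ setT (fun n t => \1_(~` N) t * F n t)) => [n|t _].
    by apply: measurable_funM => //; apply: measurable_indic; exact: measurableC.
  exact: cF.
exists N; split => // t /= nt; apply: contrapT => tN; apply: nt.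
by rewrite indicE mem_set ?mul1r.
Qed.

(** [N] is to be the norm of a Bochner integrable function, about whose measurability nothing is
    known; only the monotonicity of the integral of nonnegative functions is applied to it. *)
Lemma aeint_dom f N C : aemeas f -> (forall t, (0 <= N t)%E) -> (\int[mu]_t N t < +oo)%E -> 0 <= C ->
  {ae mu, forall t, (`|f t|%:E <= C%:E * N t)%E} ->
  aeint f /\ `|\int[mu]_t f t| <= C * fine (\int[mu]_t N t).
Proof.
move=> [Z mZ fZ] N0 Noo C0 fN.
have ZN : {ae mu, forall t, (`|Z t|%:E <= C%:E * N t)%E} by apply: filterS2 fZ fN => t ->.
have I0 : (0 <= \int[mu]_t N t)%E by exact: integral_ge0.
rewrite (ae_eq_Rint fZ).
have [C00|Cp] := leP C 0.
  have {C0 C00} C00 : C = 0 by apply/le_anti; rewrite C0 C00.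
  have Z0 : {ae mu, forall t, Z t = 0}.
    apply: filterS ZN => t; rewrite C00 mul0e lee_fin normr_le0 => /eqP.
    by [].
  have f0 : {ae mu, forall t, 0 = f t :> R} by apply: filterS2 Z0 fZ => t -> ->.
  split; first by apply: aeint_eq f0 _; apply: aeint_integrable; apply: bm_integrable; exact: bm_cst.
  by rewrite (ae_eq_Rint Z0) Rintegral_cst// mul0r normr0 C00 mul0r.
have IZ : (\int[mu]_t `|C^-1 * Z t|%:E <= \int[mu]_t N t)%E.
  apply: ae_ge0_le_integral => //; apply: filterS ZN => t.
  rewrite normrM gtr0_norm ?invr_gt0// => H.
  have : (C^-1%:E * `|Z t|%:E <= C^-1%:E * (C%:E * N t))%E by rewrite lee_pmul2l// lte_fin invr_gt0.
  by rewrite (muleA C^-1%:E C%:E) -[(C^-1%:E * C%:E)%E]EFinM mulVf ?gt_eqF// mul1e EFinM.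
have iZ' : mu.-integrable setT (EFin \o (fun t => C^-1 * Z t)).
  apply/integrableP; split; first by apply/measurable_EFinP; apply: measurable_funM => //; exact: measurable_cst.
  by apply: le_lt_trans Noo; apply: le_trans IZ.
have ZE : Z = fun t => C * (C^-1 * Z t) by apply/funext => t; rewrite mulrA mulfV ?gt_eqF ?mul1r.
have iZ : mu.-integrable setT (EFin \o Z) by rewrite ZE; exact: L1Z.
split; first by exists Z.
rewrite ZE RintegralZl// normrM gtr0_norm// ler_pM2l//.
apply: le_trans (le_normr_Rintegral measurableT iZ') _.
by rewrite /Rintegral fine_le// ge0_fin_numE// ?integral_ge0//; exact: le_lt_trans Noo.
Qed.

(** A substitute for dominated convergence: the approximation is uniform up to the factor [N] of
    finite integral, which also yields the measurability of the limit up to a null set. *)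
Lemma aeint_lim (Y : T -> R) (YK : nat -> T -> R) N : (forall K, aeint (YK K)) ->
  (forall t, (0 <= N t)%E) -> (\int[mu]_t N t < +oo)%E -> {ae mu, forall t, (N t < +oo)%E} ->
  (forall e : R, 0 < e -> exists K0, forall K, (K0 <= K)%N -> {ae mu, forall t, (`|Y t - YK K t|%:E <= e%:E * N t)%E}) ->
  aeint Y /\ \int[mu]_t YK K t @[K --> \oo] --> \int[mu]_t Y t.
Proof.
move=> iYK N0 Noo Nae HY.
have I0 : (0 <= \int[mu]_t N t)%E by exact: integral_ge0.
have /choice[Z HZ] : forall K, exists Z, mu.-integrable setT (EFin \o Z) /\ {ae mu, forall t, YK K t = Z t}.
  by move=> K; have [Z] := iYK K; exists Z.
have mY : aemeas Y.
  apply: (@aemeas_lim Z); first by move=> K; apply/measurable_EFinP; have [iZ _] := HZ K; exact: measurable_int iZ.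
  have /choice[K0 HK0] : forall m, exists K0, forall K, (K0 <= K)%N ->
      {ae mu, forall t, (`|Y t - YK K t|%:E <= m.+1%:R^-1%:E * N t)%E}.
    by move=> m; apply: HY; rewrite invr_gt0 ltr0n.
  have Hm : {ae mu, forall t, forall m K : nat, (K0 m <= K)%N -> (`|Y t - YK K t|%:E <= m.+1%:R^-1%:E * N t)%E}.
    apply/ae_foralln => m; apply/ae_foralln => K.
    have [KK|KK] := leqP (K0 m) K; last by apply: nearW.
    by apply: filterS (HK0 m K KK).
  have HE : {ae mu, forall t, forall K, YK K t = Z K t} by apply/ae_foralln => K; have [] := HZ K.
  near=> t.
  have Ht : forall m K : nat, (K0 m <= K)%N -> (`|Y t - YK K t|%:E <= m.+1%:R^-1%:E * N t)%E by near: t.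
  have Et : forall K, YK K t = Z K t by near: t.
  have Nt : (N t < +oo)%E by near: t.
  have NE : N t = (fine (N t))%:E by rewrite fineK// ge0_fin_numE.
  have n0 : 0 <= fine (N t) by exact: fine_ge0.
  apply/cvgrPdist_le => e e0.
  have e1 : 0 < e / (1 + fine (N t)) by rewrite divr_gt0// ltr_pwDl.
  have [m _ Hm'] := near_infty_natSinv_lt (PosNum e1).
  exists (K0 m) => // K /= KK; rewrite -Et; have := Ht m K KK; rewrite NE -EFinM lee_fin => /le_trans; apply.
  have /ltW/= := Hm' m (leqnn m) => /(ler_wpM2r n0)/le_trans; apply.
  by rewrite mulrC; exact: frac_le.
have D e : 0 < e -> exists K0, forall K, (K0 <= K)%N -> aeint (fun t => Y t - YK K t) /\
   `|\int[mu]_t (Y t - YK K t)| <= e * fine (\int[mu]_t N t).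
  move=> e0; have [K0 HK] := HY _ e0; exists K0 => K KK.
  apply: aeint_dom => //; [|exact: ltW|exact: HK].
  have [W mW YW] := mY; have [V mV YV] := aeint_meas (iYK K).
  exists (fun t => W t - V t); first exact: measurable_funB.
  by apply: filterS2 YW YV => t -> ->.
have iY : aeint Y.
  have [K0 HK0] := D 1 ltr01; have [iD _] := HK0 K0 (leqnn _).
  have [iS _] := aeintD iD (iYK K0).
  by apply: aeint_eq iS; apply: nearW => t; rewrite subrK.
split => //; apply/cvgrPdist_le => e e0.
set J := fine _ in D; have J0 : 0 <= J by exact: fine_ge0.
have e1 : 0 < e / (1 + J) by rewrite divr_gt0// ltr_pwDl.
have [K0 HK0] := D _ e1; exists K0 => // K /= KK.
have [_] := HK0 K KK; have [_ ->] := aeintB iY (iYK K) => /le_trans; apply.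
by rewrite mulrC; exact: frac_le.
Unshelve. all: by end_near. Qed.

End ae_integrable.

Section pairing.
Context {R : realType} {d : nat}.
Local Notation mu := (torus_measure R d).
Local Notation tm := (@time_measure R).
Local Notation L1 := (Lp_space (R := R) d 1%:E).
Implicit Types (u w : 'rV[R]_d -> R) (f : R -> 'rV[R]_d -> R).

Definition pair u w : R := \int[mu]_x (u x * w x).

Lemma L1_integrable u : fcarrier L1 u <-> mu.-integrable setT (EFin \o u).
Proof. exact: Lfun1_integrable. Qed.

Lemma pair_le u w M : fcarrier L1 u -> bm w -> (forall x, `|w x| <= M) ->
  (`|pair u w|%:E <= M%:E * fnorm L1 u)%E.
Proof.
move=> /L1_integrable iu bw wM; have iuw := integrable_bmM iu bw.
have M0 : 0 <= M by apply: le_trans (wM 0).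
rewrite /fnorm /= Lnorm1 -ge0_integralZl_EFin//=; last first.
  by apply/measurable_EFinP; apply: measurableT_comp => //; apply/measurable_EFinP; exact: measurable_int iu.
have iau : mu.-integrable setT (fun x => (`|u x * w x|)%:E).
  exact: (integrable_norm iuw).
apply: (@le_trans _ _ (\int[mu]_x (`|u x * w x|)%:E)%E).
  rewrite -[leRHS]fineK ?integrable_fin_num// lee_fin; exact: le_normr_Rintegral.
apply: ge0_le_integral_T => x //=.
by rewrite lee_fin normrM mulrC ler_wpM2r.
Qed.

Lemma pairBl u u' w : fcarrier L1 u -> fcarrier L1 u' -> bm w ->
  pair (fun x => u x - u' x) w = pair u w - pair u' w.
Proof.
move=> /L1_integrable iu /L1_integrable iu' bw; rewrite /pair.
under eq_Rintegral do rewrite mulrBl.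
by rewrite RintegralB//; exact: integrable_bmM.
Qed.

Lemma pairBr u w w' : fcarrier L1 u -> bm w -> bm w' ->
  pair u (fun x => w x - w' x) = pair u w - pair u w'.
Proof.
move=> /L1_integrable iu bw bw'; rewrite /pair.
under eq_Rintegral do rewrite mulrBr.
by rewrite RintegralB//; exact: integrable_bmM.
Qed.

Lemma pairZl r u w : fcarrier L1 u -> bm w -> pair (fun x => r * u x) w = r * pair u w.
Proof.
move=> /L1_integrable iu bw; rewrite /pair.
under eq_Rintegral do rewrite -mulrA.
by rewrite RintegralZl//; exact: integrable_bmM.
Qed.

Lemma pair_suml (I : Type) (s : seq I) (r : I -> R) (F : I -> 'rV[R]_d -> R) w :
  (forall i, fcarrier L1 (F i)) -> bm w ->
  fcarrier L1 (fun x => \sum_(i <- s) r i * F i x) /\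
  pair (fun x => \sum_(i <- s) r i * F i x) w = \sum_(i <- s) r i * pair (F i) w.
Proof.
move=> iF bw.
have iF' i : mu.-integrable setT (EFin \o F i) by apply/L1_integrable; exact: iF.
split; first by apply/L1_integrable; apply: integrable_seq_sum => i; exact: L1Z.
rewrite /pair; under eq_Rintegral do rewrite mulr_suml.
rewrite Rint_sum; last by move=> i; apply: integrable_bmM => //; exact: L1Z.
by apply: eq_bigr => i _; exact: pairZl.
Qed.

Lemma pair_sumr (I : Type) (s : seq I) u (W : I -> 'rV[R]_d -> R) :
  fcarrier L1 u -> (forall i, bm (W i)) ->
  pair u (fun x => \sum_(i <- s) W i x) = \sum_(i <- s) pair u (W i).
Proof.
move=> /L1_integrable iu bW; rewrite /pair; under eq_Rintegral do rewrite mulr_sumr.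
by rewrite Rint_sum// => i; exact: integrable_bmM.
Qed.

Lemma L1B_carrier u u' : fcarrier L1 u -> fcarrier L1 u' -> fcarrier L1 (fun x => u x - u' x).
Proof. by move=> /L1_integrable iu /L1_integrable iu'; apply/L1_integrable; exact: L1B. Qed.

Lemma fnorm_L1_fin u : fcarrier L1 u -> (fnorm L1 u < +oo)%E.
Proof. by move=> /L1_integrable/integrableP[_]; rewrite /fnorm /= Lnorm1. Qed.

Variable T : R.

Lemma step_pair (s : step R d) w : step_in L1 s -> bm w ->
  [/\ forall t, fcarrier L1 (step_fun s t),
      bm ((fun t => pair (step_fun s t) w) : measurableTypeR R -> R) &
      fcarrier L1 (step_int T s) /\ \int[tm T]_t pair (step_fun s t) w = pair (step_int T s) w].
Proof.
move=> sin bw; have vi i : fcarrier L1 (step_val (s := s) i) by have [] := sin i.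
have ms i : measurable (@step_set _ _ s i) by have [] := sin i.
have E t : pair (step_fun s t) w = \sum_i \1_(@step_set _ _ s i) t * pair (step_val i) w.
  by have [_] := pair_suml (index_enum _) (fun i => \1_(@step_set _ _ s i) t) vi bw.
have bi i : bm ((fun t => \1_(@step_set _ _ s i) t * pair (step_val i) w) : measurableTypeR R -> R).
  by apply: bmM; [exact: bm_indic|exact: bm_cst].
split.
- by move=> t; have [] := pair_suml (index_enum _) (fun i => \1_(@step_set _ _ s i) t) vi bw.
- rewrite (_ : (fun t => _) = fun t => \sum_i \1_(@step_set _ _ s i) t * pair (step_val i) w); last exact/funext.
  exact: bm_sum.
- have [si ->] := pair_suml (index_enum _) (fun i => fine (tm T (@step_set _ _ s i))) vi bw; split => //.
  under eq_Rintegral do rewrite E.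
  rewrite Rint_sum; last by move=> i; apply: bm_integrable; exact: bi.
  apply: eq_bigr => i _; rewrite RintegralZr//; last by apply: bm_integrable; exact: bm_indic.
  by congr (_ * _); rewrite /Rintegral integral_indic// setIT.
Qed.

Lemma strongly_measurable_pair f w : strongly_measurable T L1 f -> bm w ->
  aemeas (tm T) (fun t => pair (f t) w).
Proof.
move=> [fc [s [sin sf]]] bw; have [_ [M wM]] := bw.
have M0 : 0 <= M by apply: le_trans (wM 0).
apply: (@aemeas_lim _ (measurableTypeR R) R (tm T) (fun n t => pair (step_fun (s n) t) w) (fun t => pair (f t) w)).
  by move=> n; have [_ [mm _] _] := step_pair (sin n) bw.
apply: filterS2 fc sf => t ft st; apply/cvgrPdist_le => e e0.
have e1 : 0 < e / (1 + M) by rewrite divr_gt0// ltr_pwDl.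
have /fine_cvgP[_ /cvgrPdist_le/(_ _ e1)] := st; have /fine_cvgP[+ _] := st.
apply: filterS2 => n fn; rewrite sub0r normrN => Hn.
have [sc _ _] := step_pair (sin n) bw.
rewrite -pairBl//; rewrite -lee_fin.
apply: le_trans (pair_le (L1B_carrier ft (sc t)) bw wM) _.
rewrite -[X in (_ * X)%E]fineK// -EFinM lee_fin.
apply: (@le_trans _ _ (M * (e / (1 + M)))).
  by apply: ler_wpM2l => //; apply: le_trans Hn; exact: ler_norm.
exact: frac_le.
Qed.

Lemma bochner_L1_fin f : bochner_Lp T 1%:E L1 f -> (\int[tm T]_t fnorm L1 (f t) < +oo)%E.
Proof.
move=> [_]; rewrite Lnorm1; apply: le_lt_trans; apply: ge0_le_integral_T => t /=.
  exact: fnorm_Lp_ge0.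
by rewrite gee0_abs//; exact: fnorm_Lp_ge0.
Qed.

Lemma bochner_pair_aeint f w : bochner_Lp T 1%:E L1 f -> bm w -> aeint (tm T) (fun t => pair (f t) w).
Proof.
move=> bf bw; have [sm _] := bf; have [_ [M wM]] := bw; have [fc _] := sm.
have M0 : 0 <= M by apply: le_trans (wM 0).
have [] := @aeint_dom _ _ _ (tm T) _ (fun t => fnorm L1 (f t)) M (strongly_measurable_pair sm bw) => //.
- by move=> t; exact: fnorm_Lp_ge0.
- exact: bochner_L1_fin.
- by apply: filterS fc => t ft; exact: pair_le.
Qed.

(** Pairing with a bounded function is continuous on L^1, so it commutes with the Bochner integral.
    This reduces identities between L^1-valued functions to scalar ones. *)
Lemma bochner_int_pair f I w : is_bochner_int T L1 f I -> bm w ->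
  aeint (tm T) (fun t => pair (f t) w) -> pair I w = \int[tm T]_t pair (f t) w.
Proof.
move=> [sm cI [s [sin sf sI]]] bw ai; have [_ [M wM]] := bw; have [fc _] := sm.
have M0 : 0 <= M by apply: le_trans (wM 0).
apply: (@cvg_unique _ _ (pair (step_int T (s n)) w @[n --> \oo]) _ _) => //.
  apply/cvgrPdist_le => e e0.
  have e1 : 0 < e / (1 + M) by rewrite divr_gt0// ltr_pwDl.
  have /fine_cvgP[_ /cvgrPdist_le/(_ _ e1)] := sI; have /fine_cvgP[+ _] := sI.
  apply: filterS2 => n fn; rewrite sub0r normrN => Hn.
  have [_ _ [sc _]] := step_pair (sin n) bw.
  rewrite -pairBl//; rewrite -lee_fin.
  apply: le_trans (pair_le (L1B_carrier cI sc) bw wM) _.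
  rewrite -[X in (_ * X)%E]fineK// -EFinM lee_fin.
  apply: (@le_trans _ _ (M * (e / (1 + M)))).
    by apply: ler_wpM2l => //; apply: le_trans Hn; exact: ler_norm.
  exact: frac_le.
apply/cvgrPdist_le => e e0.
have e1 : 0 < e / (1 + M) by rewrite divr_gt0// ltr_pwDl.
have /fine_cvgP[_ /cvgrPdist_le/(_ _ e1)] := sf; have /fine_cvgP[+ _] := sf.
apply: filterS2 => n fn; rewrite sub0r normrN => Hn.
have [sc bsc [_ <-]] := step_pair (sin n) bw.
have as_ : aeint (tm T) (fun t => pair (step_fun (s n) t) w).
  by apply: aeint_integrable; exact: bm_integrable.
have [iD <-] := aeintB ai as_.
have [|||_ H] := @aeint_dom _ _ _ (tm T) (fun t => pair (f t) w - pair (step_fun (s n) t) w)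
   (fun t => fnorm L1 (f t \- step_fun (s n) t)) M (aeint_meas iD) _ _ M0.
- by move=> t; exact: fnorm_Lp_ge0.
- by rewrite ltey_eq fn.
- by apply: filterS fc => t ft; rewrite -pairBl//; apply: pair_le => //; apply: L1B_carrier.
apply: le_trans H _; apply: (@le_trans _ _ (M * (e / (1 + M)))).
  by apply: ler_wpM2l => //; apply: le_trans Hn; exact: ler_norm.
exact: frac_le.
Qed.

End pairing.

(** * Smooth cut-offs and weak derivatives in time *)

Section smooth_step.
Context {R : realType}.

(** Polynomials in 1/x times the flat function e^(-1/x): a family closed under differentiation, [p]
    being replaced by X^2 (p - p'). *)
Definition expp (p : {poly R}) (x : R) : R := if 0 < x then p.[x^-1] * expR (- x^-1) else 0.

Lemma expp_bound p : exists2 C, 0 <= C & forall x, `|expp p x| <= C.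
Proof.
exists (\sum_(i < size p) `|p`_i| * i`!%:R); first by apply: sumr_ge0 => i _; rewrite mulr_ge0.
move=> x; rewrite /expp; case: ifP => [x0|_]; last by rewrite normr0 sumr_ge0// => i _; rewrite mulr_ge0.
rewrite horner_coef mulr_suml; apply: le_trans (ler_norm_sum _ _ _) _; apply: ler_sum => i _.
have y0 : 0 <= x^-1 by rewrite invr_ge0 ltW.
rewrite -mulrA normrM ler_wpM2l// ger0_norm ?mulr_ge0 ?exprn_ge0 ?expR_ge0//.
rewrite expRN ler_pdivrMr ?expR_gt0// -ler_pdivrMl ?ltr0n ?fact_gt0// mulrC.
case: (nat_of_ord i) => [|j]; first by rewrite expr0 fact0 divr1 -expR0 ler_expR.
apply: le_trans (expR_ge1Dxn j y0); by rewrite lerDr.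
Qed.

Lemma affine_derive (a b x : R) : is_derive x 1 (fun u => a * u + b) a.
Proof.
have H := is_deriveD (is_deriveZ a (is_derive_id x (1 : R))) (is_derive_cst b x (1 : R)).
by apply: is_derive_eq H _; rewrite addr0 /GRing.scale/= mulr1.
Qed.

Lemma expp_derive p (x : R) : is_derive x 1 (expp p) (expp ('X^2 * (p - p^`())) x).
Proof.
have [x0|x0|->] := ltgtP x 0; last first.
(* At 0 the difference quotient of [expp p] with h > 0 is h times a value of the bounded function
   belonging to X^2 p, hence tends to 0. *)
- have [C C0 HC] := expp_bound ('X^2 * p).
  have z0 q : expp q 0 = 0 by rewrite /expp ltxx.
  have L : h^-1 *: ((expp p \o shift (0 : R)) (h *: (1 : R)) - expp p 0) @[h --> (0 : R)^'] --> (0 : R).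
    apply/cvgrPdist_le => e e0; have e1 : 0 < e / (1 + C) by rewrite divr_gt0// ltr_pwDl.
    near=> h; rewrite sub0r normrN z0 subr0 /= addr0 scaler1.
    have h0 : h != 0 by near: h; exact: nbhs_dnbhs_neq.
    have he : `|h| <= e / (1 + C).
      near: h; apply: dnbhs0_le.
      exact: e1.
    rewrite /GRing.scale/=; apply: le_trans (frac_le C0 e0).
    have [hp|hn] := ltP 0 h; last by rewrite /expp ltNge hn /= mulr0 normr0 mulr_ge0// ltW.
    rewrite [X in `|X|](_ : _ = expp ('X^2 * p) h * h); last first.
    by rewrite /expp hp hornerM hornerXn; move: (p.[_]) (expR _) => P E; field.
    by rewrite normrM ler_pM.
  rewrite z0; apply: DeriveDef; first by apply/cvg_ex; exists 0.
  exact: (cvg_lim (@norm_hausdorff _ _) L).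
- rewrite {2}/expp x0.
  have xn : x != 0 by rewrite gt_eqF.
  have i1 := @is_deriveV R id x 1 1 xn (is_derive_id _ _).
  have i2 := @is_derive1_comp R (horner p) _ x _ _ (is_derive_poly p x^-1) i1.
  have i3 := is_deriveN i1.
  have i4 := @is_derive1_comp R expR _ x _ _ (is_derive_expR (- x^-1)) i3.
  apply: (near_eq_is_derive _ (is_derive_eq (is_deriveM i2 i4) _)).
    near=> y; have y0 : 0 < y by near: y; exact: lt_nbhsr.
    by rewrite /expp y0.
  by rewrite /= !hornerE /GRing.scale/= exprVn; ring.
- rewrite {2}/expp ltNge (ltW x0)/=.
  apply: (@near_eq_is_derive _ _ _ (fun=> 0)) => //.
  near=> y; have y0 : y < 0 by near: y; exact: lt_nbhsl.
  by rewrite /expp ltNge (ltW y0).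
Unshelve. all: by end_near. Qed.

(* A class stable under differentiation, hence made of infinitely differentiable functions. *)
Inductive smooth : (R -> R) -> Prop :=
| smooth_expp p : smooth (expp p)
| smooth_cst c : smooth (fun=> c)
| smoothD f g : smooth f -> smooth g -> smooth (fun x => f x + g x)
| smoothM f g : smooth f -> smooth g -> smooth (fun x => f x * g x)
| smooth_affine f a b : smooth f -> smooth (fun x => f (a * x + b))
| smoothV f : smooth f -> (forall x, f x != 0) -> smooth (fun x => (f x)^-1).

Lemma smooth_derive f : smooth f -> exists2 f', smooth f' & forall x : R, is_derive x 1 f (f' x).
Proof.
elim=> {f} [p|c|f g _ [f' sf' ff'] _ [g' sg' gg']|f g sf [f' sf' ff'] sg [g' sg' gg']|f a b _ [f' sf' ff']|f sf [f' sf' ff'] f0].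
- by exists (expp ('X^2 * (p - p^`()))); [exact: smooth_expp|exact: expp_derive].
- by exists (fun=> 0); [exact: smooth_cst|move=> x; exact: is_derive_cst].
- exists (fun x => f' x + g' x); first exact: smoothD.
  by move=> x; exact: is_deriveD.
- exists (fun x => f x * g' x + g x * f' x); first by apply: smoothD; exact: smoothM.
  by move=> x; exact: is_deriveM.
- exists (fun x => f' (a * x + b) * a); first by apply: smoothM; [exact: smooth_affine|exact: smooth_cst].
  move=> x; have i1 := affine_derive a b x.
  exact: (@is_derive1_comp R f (fun x => a * x + b) x _ _ (ff' (a * x + b)) i1).
- exists (fun x => (- 1) * ((f x)^-1 * (f x)^-1) * f' x).
    by apply: smoothM => //; apply: smoothM; [exact: smooth_cst|apply: smoothM; exact: smoothV].
  move=> x; apply: (is_derive_eq (is_deriveV (f0 x) (ff' x))).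
  by rewrite /GRing.scale/= expr2 invfM mulN1r.
Qed.

Lemma smooth_derive1n f n : smooth f -> smooth (derive1n n f).
Proof.
move=> sf; elim: n => [//|n /smooth_derive[f' sf' ff']]; rewrite derive1nS.
by rewrite (_ : derive1 _ = f')//; apply/funext => x; rewrite derive1E derive_val.
Qed.

Lemma smooth_derivable f n (t : R) : smooth f -> derivable (derive1n n f) t 1.
Proof. by move=> /(@smooth_derive1n f n)/smooth_derive[f' _ /(_ t)[]]. Qed.

Lemma smooth_continuous f : smooth f -> continuous f.
Proof. by move=> sf y; apply/differentiable_continuous/derivable1_diffP; exact: (@smooth_derivable f 0). Qed.

Let e0 := expp 1.
Let e1 := expp 'X^2.
Let e0_ge0 x : 0 <= e0 x.
Proof. by rewrite /e0 /expp; case: ifP => // _; rewrite hornerE mul1r expR_ge0. Qed.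
Let e1_ge0 x : 0 <= e1 x.
Proof. by rewrite /e1 /expp; case: ifP => // _; rewrite !hornerE mulr_ge0 ?expR_ge0 ?sqr_ge0. Qed.
Let e0_neg x : x <= 0 -> e0 x = 0.
Proof. by rewrite /e0 /expp ltNge => ->. Qed.
Let e1_neg x : x <= 0 -> e1 x = 0.
Proof. by rewrite /e1 /expp ltNge => ->. Qed.
Let D x := e0 x + e0 (-1 * x + 1).
(** One of x and 1 - x is at least 1/2. *)
Let D_ge x : expR (- 2) <= D x.
Proof.
have half z : 2^-1 <= z -> expR (- 2) <= e0 z.
  move=> hz; have z0 : 0 < z by apply: lt_le_trans hz.
  rewrite /e0 /expp z0 hornerE mul1r ler_expR lerN2 -[leRHS]invrK lef_pV2// posrE//.
have [hx|hx] := leP 2^-1 x; first by apply: le_trans (half _ hx) _; rewrite lerDl.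
by apply: (@le_trans _ _ (e0 (-1 * x + 1))); [apply: half; lra|rewrite lerDr].
Qed.
Let D_gt0 x : 0 < D x. Proof. exact: lt_le_trans (expR_gt0 _) (D_ge x). Qed.

Definition smooth_step x := e0 x * (D x)^-1.
(** The derivative of [smooth_step] after cancellation, in a form that is visibly nonnegative and
    supported in [0, 1]. *)
Definition smooth_kernel x := (e1 x * e0 (-1 * x + 1) + e0 x * e1 (-1 * x + 1)) * ((D x)^-1 * (D x)^-1).

Let sD : smooth D.
Proof. by apply: smoothD; [exact: smooth_expp|apply: smooth_affine; exact: smooth_expp]. Qed.

Let Dn x : D x != 0. Proof. by rewrite gt_eqF. Qed.

Lemma smooth_smooth_step : smooth smooth_step.
Proof. by apply: smoothM; [exact: smooth_expp|apply: smoothV]. Qed.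

Lemma smooth_smooth_kernel : smooth smooth_kernel.
Proof.
apply: smoothM; last by apply: smoothM; exact: smoothV.
by apply: smoothD; apply: smoothM; try apply: smooth_affine; exact: smooth_expp.
Qed.

Lemma smooth_step_derive (x : R) : is_derive x 1 smooth_step (smooth_kernel x).
Proof.
have ee : 'X^2 * (1 - 1^`()) = 'X^2 :> {poly R} by rewrite derivC subr0 mulr1.
have d0 y : is_derive y (1 : R) e0 (e1 y) by have := expp_derive 1 y; rewrite ee.
have i1 := affine_derive (-1) 1 x.
have d1 := @is_derive1_comp R e0 (fun x => -1 * x + 1) x _ _ (d0 (-1 * x + 1)) i1.
have d2 : is_derive x (1 : R) D (e1 x + e1 (-1 * x + 1) * -1) by exact: (is_deriveD (d0 x) d1).
have d3 := is_deriveV (Dn x) d2.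
have d4 := is_deriveM (d0 x) d3.
apply: is_derive_eq d4 _.
rewrite /smooth_kernel /GRing.scale/=; have : D x = e0 x + e0 (-1 * x + 1) by []; move: (Dn x).
move: (D x) (e0 x) (e1 x) (e0 _) (e1 _) => Dx a b a' b' Dx0 E; rewrite E in Dx0 *; field.
exact: Dx0.
Qed.

Lemma smooth_step_le0 x : x <= 0 -> smooth_step x = 0.
Proof. by move=> x0; rewrite /smooth_step e0_neg ?mul0r. Qed.

Lemma smooth_step_ge1 x : 1 <= x -> smooth_step x = 1.
Proof.
move=> x1; have E : D x = e0 x by rewrite /D [X in _ + X]e0_neg ?addr0//; lra.
by rewrite /smooth_step E mulfV// -E.
Qed.

Lemma smooth_step_itv x : 0 <= smooth_step x <= 1.
Proof.
rewrite /smooth_step; move: (D_gt0 x) (e0_ge0 x) => D0 E0.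
by apply/andP; split; [exact: divr_ge0 E0 (ltW D0)|rewrite ler_pdivrMr// mul1r /D lerDl].
Qed.

Lemma smooth_kernel_ge0 x : 0 <= smooth_kernel x.
Proof.
have Di : 0 <= (D x)^-1 by rewrite invr_ge0 ltW.
by apply: mulr_ge0; [apply: addr_ge0|]; exact: mulr_ge0.
Qed.

Lemma smooth_kernel_supp x : smooth_kernel x != 0 -> 0 <= x <= 1.
Proof.
apply: contraNT; rewrite negb_and -!ltNge /smooth_kernel => /orP[x0|x1].
  by rewrite (e1_neg (ltW x0)) (e0_neg (ltW x0)) !mul0r addr0 mul0r.
have x1' : -1 * x + 1 <= 0 by lra.
by rewrite (e1_neg x1') (e0_neg x1') !mulr0 addr0 mul0r.
Qed.

Lemma bm_smooth_kernel a b : bm ((fun x => smooth_kernel (a * x + b)) : measurableTypeR R -> R).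
Proof.
split.
  apply: continuous_measurable_fun; apply: smooth_continuous; apply: smooth_affine.
  exact: smooth_smooth_kernel.
have [C0 C00 HC0] := expp_bound 1; have [C1 C10 HC1] := expp_bound 'X^2.
exists ((C1 * C0 + C0 * C1) * (expR 2 * expR 2)) => x; move: (a * x + b) => {}x.
have DE : `|(D x)^-1| <= expR 2.
  by rewrite gtr0_norm ?invr_gt0// -[leRHS]invrK -expRN lef_pV2 ?posrE ?expR_gt0.
rewrite /smooth_kernel normrM ler_pM//; last by rewrite normrM ler_pM.
by apply: le_trans (ler_normD _ _) _; rewrite !normrM lerD// ler_pM// ?HC0 ?HC1.
Qed.

Lemma bm_smooth_step a b : bm ((fun x => smooth_step (a * x + b)) : measurableTypeR R -> R).
Proof.
split; last by exists 1 => x; have /andP[h1 h2] := smooth_step_itv (a * x + b); rewrite ger0_norm.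
apply: continuous_measurable_fun; apply: smooth_continuous; apply: smooth_affine.
exact: smooth_smooth_step.
Qed.

Lemma smooth_step_affine_derive a b (x : R) :
  is_derive x 1 (fun u => smooth_step (a * u + b)) (a * smooth_kernel (a * x + b)).
Proof.
have i1 := affine_derive a b x.
rewrite mulrC; exact: (@is_derive1_comp R smooth_step (fun x => a * x + b) x _ _ (smooth_step_derive _) i1).
Qed.

Lemma smooth_kernel_integral T a b : 0 < T ->
  \int[time_measure T]_u (a * smooth_kernel (a * u + b)) = smooth_step (a * T + b) - smooth_step b.
Proof.
move=> T0; rewrite /Rintegral integral_mrestr.
pose F u := smooth_step (a * u + b).
have sF : smooth F by apply: smooth_affine; exact: smooth_smooth_step.
have cF := smooth_continuous sF.
have dF u := smooth_step_affine_derive a b u.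
have dLR : derivable_oo_LRcontinuous F 0 T.
  split; first by move=> x _; exact: (@smooth_derivable F 0).
  - by apply: cvg_at_right_filter; exact: cF.
  - by apply: cvg_at_left_filter; exact: cF.
have ck : continuous (fun u => a * smooth_kernel (a * u + b)).
  apply: smooth_continuous; apply: smoothM; first exact: smooth_cst.
  by apply: smooth_affine; exact: smooth_smooth_kernel.
have -> := @continuous_FTC2 R _ F 0 T T0 (continuous_subspaceT ck) dLR.
  by rewrite /F mulr0 add0r -EFinB.
by move=> x _; rewrite derive1E derive_val.
Qed.

End smooth_step.

Section weak_derivative.
Context {R : realType} (T : R) (T0 : 0 < T).
Local Notation tm := (time_measure T).

(** An approximate identity that concentrates at t0 from inside [0, T], so that continuity relative
    to [0, T] suffices and t0 may be an endpoint. *)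
Lemma kernel_cvg (y : R -> R) (t0 : R) (q : nat -> R -> R) (r : nat -> R) :
  aeint tm y -> y s @[s --> within `[0, T] (nbhs t0)] --> y t0 ->
  (forall n, bm (q n : measurableTypeR R -> R)) -> (forall n u, 0 <= q n u) ->
  (forall n, \int[tm]_u q n u = 1) ->
  (forall n u, q n u != 0 -> 0 <= u <= T /\ `|t0 - u| <= r n) -> r n @[n --> \oo] --> 0 ->
  \int[tm]_u (q n u * y u) @[n --> \oo] --> y t0.
Proof.
move=> iy cy bq q0 q1 qs rc; apply/cvgrPdist_le => e e0.
have /cvgrPdist_le/(_ _ e0) := cy; rewrite /within/= => /nbhs_ballP[del /= del0 Hdel].
have /cvgrPdist_lt/(_ _ del0) := rc; apply: filterS => n; rewrite sub0r normrN => /(le_lt_trans (ler_norm _)) rn.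
have iq := bm_integrable tm (bq n).
have ic : aeint tm (fun u => q n u * y t0).
  by apply: aeint_integrable; apply: bm_integrable; apply: bmM => //; exact: bm_cst.
have iqy : aeint tm (fun u => q n u * y u).
  by apply: aeint_eq (aeint_bmM iy (bq n)); apply: nearW => u; rewrite mulrC.
have -> : y t0 = \int[tm]_u (q n u * y t0) by rewrite RintegralZr// q1 mul1r.
have [iD <-] := aeintB ic iqy.
have [|||_] := @aeint_dom _ _ _ tm _ (fun u => (q n u)%:E) e (aeint_meas iD) _ _ (ltW e0).
- by move=> u; rewrite lee_fin.
- by have := integrable_fin_num measurableT iq; rewrite fin_numE ltey => /andP[].
- apply: nearW => u; rewrite -mulrBr normrM ger0_norm// -EFinM lee_fin mulrC.
  have [->|qn] := eqVneq (q n u) 0; first by rewrite !mulr0.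
  have [ut ur] := qs n u qn; rewrite ler_wpM2r//; apply: Hdel; last by rewrite /= in_itv.
  by rewrite /ball /=; exact: le_lt_trans ur rn.
by have := q1 n; rewrite /Rintegral => -> ; rewrite mulr1.
Qed.

(** The test function rises from 0 to 1 just after time 0 and falls back just before t. Its
    derivative is a difference of approximate identities at 0 and at t, while the function itself
    tends to the indicator of ]0, t[. *)
Lemma weak_derivative_ac (y y' : R -> R) :
  (forall t, 0 <= t <= T -> y s @[s --> within `[0, T] (nbhs t)] --> y t) ->
  aeint tm y -> tm.-integrable setT (EFin \o y') ->
  (forall eta, time_bump T eta -> \int[tm]_u (derive1 eta u * y u) = - \int[tm]_u (eta u * y' u)) ->
  forall t, 0 <= t <= T -> y t = y 0 + \int[tm]_u (\1_`[0, t] u * y' u).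
Proof.
move=> cy iy iy' Hw t /andP[t0 tT].
have [->|tn] := eqVneq t 0.
  rewrite (@eq_Rint_ae _ _ _ (fun=> 0)); first by rewrite Rintegral_cst// mul0r addr0.
  exists [set 0]; split => //; first exact: time_null1.
  move=> u /= nu; apply: contrapT => u0; apply: nu; rewrite indicE set_itv1 memNset ?mul0r//.
have {t0 tn} t0 : 0 < t by rewrite lt_neqAle eq_sym tn.
(* The denominator n + 4 ensures 4 h <= t, so that the rise on [h, 2 h] and the fall on
   [t - 2 h, t - h] do not overlap. *)
pose h n : R := t / n.+4%:R.
have h0 n : 0 < h n by rewrite divr_gt0.
have h4 n : 4 * h n <= t.
  rewrite /h mulrCA ger_pMr// ler_pdivrMr// mul1r ler_nat //.
have hc : h n @[n --> \oo] --> 0.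
  apply/cvgrPdist_lt => e e0; have e1 : 0 < e / t by rewrite divr_gt0.
  apply: filterS (near_infty_natSinv_lt (PosNum e1)) => n /= Hn.
  rewrite sub0r normrN gtr0_norm// /h mulrC -ltr_pdivlMr//; apply: le_lt_trans Hn.
  by rewrite lef_pV2 ?posrE ?ltr0n// ler_nat; lia.
pose q1 n u := (h n)^-1 * smooth_kernel ((h n)^-1 * u + - 1).
pose q2 n u := (h n)^-1 * smooth_kernel ((h n)^-1 * u + (2 - t / h n)).
pose eta n u := smooth_step ((h n)^-1 * u + - 1) - smooth_step ((h n)^-1 * u + (2 - t / h n)).
have hd n u c : (0 <= (h n)^-1 * u + c) = (- (c * h n) <= u).
  by rewrite -(ler_pM2r (h0 n)) mul0r mulrDl mulrAC mulVf ?gt_eqF// mul1r; apply/idP/idP => ?; lra.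
have hu n u c : ((h n)^-1 * u + c <= 1) = (u <= (1 - c) * h n).
  by rewrite -(ler_pM2r (h0 n)) mulrDl mulrAC mulVf ?gt_eqF// mul1r; apply/idP/idP => ?; lra.
have hu0 n u c : ((h n)^-1 * u + c <= 0) = (u <= - (c * h n)).
  by rewrite -(ler_pM2r (h0 n)) mul0r mulrDl mulrAC mulVf ?gt_eqF// mul1r; apply/idP/idP => ?; lra.
have hd1 n u c : (1 <= (h n)^-1 * u + c) = ((1 - c) * h n <= u).
  by rewrite -(ler_pM2r (h0 n)) mulrDl mulrAC mulVf ?gt_eqF// mul1r; apply/idP/idP => ?; lra.
have th n : t / h n * h n = t by rewrite mulfVK// gt_eqF.
have hh1 n : (1 - (2 - t / h n)) * h n = t - h n by have := th n; move: (t / h n) => a <-; ring.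
have hh2 n : (2 - t / h n) * h n = 2 * h n - t by rewrite mulrBl th.
have b1 n : bm (q1 n : measurableTypeR R -> R) by apply: bmM; [exact: bm_cst|exact: bm_smooth_kernel].
have b2 n : bm (q2 n : measurableTypeR R -> R) by apply: bmM; [exact: bm_cst|exact: bm_smooth_kernel].
have be n : bm (eta n : measurableTypeR R -> R) by apply: bmB; exact: bm_smooth_step.
have deta n u : is_derive u (1 : R) (eta n) (q1 n u - q2 n u).
  exact: is_deriveB (smooth_step_affine_derive _ _ _) (smooth_step_affine_derive _ _ _).
have eta_bump n : time_bump T (eta n).
  split.
    move=> m u; apply: smooth_derivable.
    rewrite (_ : eta n = fun u => smooth_step ((h n)^-1 * u + - 1) + (-1) * smooth_step ((h n)^-1 * u + (2 - t / h n))).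
      apply: smoothD; first by apply: smooth_affine; exact: smooth_smooth_step.
      by apply: smoothM; [exact: smooth_cst|apply: smooth_affine; exact: smooth_smooth_step].
    by apply/funext => v; rewrite mulN1r.
  exists (h n), (t - h n); split => //.
    by apply: lt_le_trans tT; rewrite gtrBl.
  move=> u; apply: contraNT; rewrite negb_and -!ltNge => /orP[uh|uh]; have := h4 n; have := h0 n => hp hq.
    rewrite /eta !smooth_step_le0 ?subrr// hu0; first by rewrite hh2; lra.
    by rewrite mulN1r opprK ltW.
  rewrite /eta !smooth_step_ge1 ?subrr// hd1; last by lra.
  by rewrite hh1; lra.
have L1 : \int[tm]_u (q1 n u * y u) @[n --> \oo] --> y 0.
  apply: (@kernel_cvg y 0 q1 (fun n => 2 * h n)) => //.
  - by apply: cy; rewrite lexx ltW.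
  - by move=> n u; rewrite mulr_ge0 ?smooth_kernel_ge0// invr_ge0 ltW.
  - move=> n; have := h4 n; have := h0 n => hp hq.
    rewrite smooth_kernel_integral// smooth_step_ge1; last by rewrite hd1; lra.
    by rewrite smooth_step_le0 ?subr0// lerN10.
  - move=> n u; rewrite mulf_eq0 negb_or => /andP[_ /smooth_kernel_supp].
    rewrite hd hu => /andP[u1 u2]; have := h4 n; have := h0 n => hp hq.
    have u0 : 0 < u by lra.
    by rewrite sub0r normrN gtr0_norm//; split; [apply/andP; split|]; lra.
  - by rewrite -[X in _ --> X](mulr0 2); apply: cvgMr.
have L2 : \int[tm]_u (q2 n u * y u) @[n --> \oo] --> y t.
  apply: (@kernel_cvg y t q2 (fun n => 2 * h n)) => //.
  - by apply: cy; rewrite ltW.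
  - by move=> n u; rewrite mulr_ge0 ?smooth_kernel_ge0// invr_ge0 ltW.
  - move=> n; have := h4 n; have := h0 n => hp hq.
    rewrite smooth_kernel_integral// smooth_step_ge1; last by rewrite hd1 hh1; lra.
    by rewrite smooth_step_le0 ?subr0// subr_le0 ler_pdivlMr//; lra.
  - move=> n u; rewrite mulf_eq0 negb_or => /andP[_ /smooth_kernel_supp].
    rewrite hd hu hh1 hh2 => /andP[u1 u2]; have := h4 n; have := h0 n => hp hq.
    have u0 : u <= t by lra.
    by rewrite ger0_norm ?subr_ge0//; split; [apply/andP; split|]; lra.
  - by rewrite -[X in _ --> X](mulr0 2); apply: cvgMr.
have LR : \int[tm]_u (eta n u * y' u) @[n --> \oo] --> \int[tm]_u (\1_`]0, t[ u * y' u).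
  have i1 n : tm.-integrable setT (EFin \o (fun u => eta n u * y' u)).
    rewrite (_ : (fun u => _) = fun u => y' u * eta n u); first exact: integrable_bmM.
    by apply/funext => u; rewrite mulrC.
  have i2 : tm.-integrable setT (EFin \o (fun u => \1_`]0, t[ u * y' u)).
    rewrite (_ : (fun u => _) = fun u => y' u * \1_`]0, t[ u); last by apply/funext => u; rewrite mulrC.
    by apply: integrable_bmM => //; exact: bm_indic.
  have [|||||_ _ L] := @dominated_convergence _ (measurableTypeR R) R tm setT measurableT
    (fun n u => (eta n u * y' u)%:E) (fun u => (\1_`]0, t[ u * y' u)%:E) (fun u => `|(y' u)%:E|%E).
  - by move=> n; exact: measurable_int (i1 n).
  - exact: measurable_int i2.
  - apply: aeW => u _; apply: cvg_EFin; first by apply: nearW.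
    apply: cvgMl; rewrite indicE.
    have [ut|nut] := pselect (0 < u < t); last first.
      rewrite memNset; last by rewrite /= in_itv.
      apply: cvg_near_cst; apply: nearW => n; have := h4 n; have := h0 n => hp hq.
      apply/eqP; apply: contrapT => /negP en; apply: nut.
      have [_ [a [b [a0 bT H]]]] := eta_bump n.
      have := en; apply: contraNP => /negP; rewrite negb_and -!leNgt => /orP[u0|u0].
        rewrite /eta !smooth_step_le0 ?subrr// hu0; first by rewrite hh2; lra.
        by rewrite mulN1r opprK; lra.
      rewrite /eta !smooth_step_ge1 ?subrr// hd1; last by lra.
      by rewrite hh1; lra.
    rewrite mem_set; last by rewrite /= in_itv.
    case/andP: ut => u0 ut.
    have e1 : 0 < Num.min (u / 2) ((t - u) / 2) by rewrite lt_min !divr_gt0 ?subr_gt0.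
    apply: cvg_near_cst; have /cvgrPdist_lt/(_ _ e1) := hc; apply: filterS => n.
    rewrite sub0r normrN gtr0_norm// lt_min => /andP[hu1 hu2].
    rewrite /eta smooth_step_ge1; last by rewrite hd1; lra.
    by rewrite smooth_step_le0 ?subr0// hu0 hh2; lra.
  - exact: integrable_abse iy'.
  - apply: aeW => u n _; rewrite lee_fin normrM ler_piMl//.
    have /andP[p1 p2] := smooth_step_itv ((h n)^-1 * u + - 1).
    have /andP[p3 p4] := smooth_step_itv ((h n)^-1 * u + (2 - t / h n)).
    by rewrite ler_norml /eta; apply/andP; split; lra.
  apply: fine_cvg; rewrite fineK; first exact: L.
  exact: integrable_fin_num i2.
have E : \int[tm]_u (\1_`]0, t[ u * y' u) = \int[tm]_u (\1_`[0, t] u * y' u).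
  apply: eq_Rint_ae; exists ([set 0] `|` [set t]); split.
  - exact: measurableU.
  - apply/eqP; rewrite eq_le measure_ge0 andbT; apply: le_trans (measureU2 _ _ _) _ => //.
    by rewrite [X in (X + _)%E]time_null1 [X in (_ + X)%E]time_null1 adde0.
  - move=> u /= nu; apply: contrapT => /not_orP[u0 ut]; apply: nu; congr (_ * _).
    rewrite !indicE; congr (nat_of_bool _)%:R; rewrite !mem_setE !in_itv/= !lt_neqAle.
    by move/eqP: u0 => u0; move/eqP: ut => ut; rewrite eq_sym u0 ut.
have LE : \int[tm]_u (q1 n u * y u) - \int[tm]_u (q2 n u * y u) @[n --> \oo] --> - \int[tm]_u (\1_`[0, t] u * y' u).
  rewrite -E; apply: cvg_trans (cvgN LR); apply: near_eq_cvg; apply: nearW => n.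
  transitivity (- \int[tm]_u (eta n u * y' u)) => //.
  rewrite -(Hw _ (eta_bump n)).
  have iq1 : aeint tm (fun u => q1 n u * y u).
    by apply: aeint_eq (aeint_bmM iy (b1 n)); apply: nearW => u; rewrite mulrC.
  have iq2 : aeint tm (fun u => q2 n u * y u).
    by apply: aeint_eq (aeint_bmM iy (b2 n)); apply: nearW => u; rewrite mulrC.
  have [_ <-] := aeintB iq1 iq2; congr Rintegral; apply/funext => u.
  by rewrite derive1E; have [_ ->] := deta n u; rewrite mulrBl.
have : y 0 - y t = - \int[tm]_u (\1_`[0, t] u * y' u).
  exact: (cvg_unique (@norm_hausdorff _ _) (cvgB L1 L2) LE).
lra.
Qed.

End weak_derivative.

Section bilaplacian.
Context {R : realType} {d : nat}.
Local Notation Zd := 'rV[int]_d.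
Local Notation mu := (torus_measure R d).
Local Notation nk := (@normk R d).
Local Notation L1 := (Lp_space (R := R) d 1%:E).

Lemma pair_mode (u : 'rV[R]_d -> R) k c : fcarrier L1 u ->
  pair u (mode k c) = complex.Re c * pair u (fun x => cos (dotk x k)) - complex.Im c * pair u (fun x => sin (dotk x k)).
Proof.
move=> /L1_integrable iu; have bc := @bm_cosk R d k; have bs := @bm_sink R d k; rewrite /pair.
rewrite (_ : (\int[mu]_x _) = \int[mu]_x (complex.Re c * (u x * cos (dotk x k)) - complex.Im c * (u x * sin (dotk x k)))); last first.
  by apply: eq_Rintegral => x _; rewrite /mode; ring.
have ic := integrable_bmM iu bc; have si := integrable_bmM iu bs.
by rewrite RintegralB ?RintegralZl//; exact: L1Z.
Qed.

Lemma fourier_pair0 (u : 'rV[R]_d -> R) : (forall k c, pair u (mode k c) = 0) -> forall k, fourier u k = 0.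
Proof.
move=> H k; rewrite /fourier.
have -> : \int[mu]_x (u x * cos (dotk x k)) = 0.
  by rewrite -[RHS](H k (Complex 1 0)); apply: eq_Rintegral => x _; rewrite /mode/=; ring.
have -> : \int[mu]_x (u x * sin (dotk x k)) = 0.
  by rewrite -[RHS](H k (Complex 0 (-1))); apply: eq_Rintegral => x _; rewrite /mode/=; ring.
by rewrite !mulr0 oppr0.
Qed.

Lemma mpartial_mode (a : 'I_d -> nat) (k : Zd) (c : R[i]) : mpartial a (mode k c) = mode k (ikpow a k * c).
Proof.
rewrite /mpartial /ikpow; elim: (enum 'I_d) => /= [|i s ->]; first by rewrite big_nil mul1r.
rewrite big_cons -mulrA; elim: (a i) => /= [|n ->]; first by rewrite expr0 mul1r.
by rewrite partial_mode exprS !mulrA.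
Qed.

Lemma laplacian_mode (k : Zd) (c : R[i]) : laplacian (mode k c) = mode k (Complex (- nk k ^+ 2) 0 * c).
Proof.
apply/funext => x; rewrite /laplacian mode_real normk_sqr -sumrN mulr_suml; apply: eq_bigr => i _.
rewrite !partial_mode mulrA -mode_real; congr (mode k (_ * c) x).
by rewrite /ik; apply: complex_eqP; rewrite /= ?expr2; ring.
Qed.

Lemma bilaplacian_mode (k : Zd) (c : R[i]) : laplacian (laplacian (mode k c)) = mode k (Complex (nk k ^+ 4) 0 * c).
Proof.
rewrite !laplacian_mode mulrA; congr (mode k (_ * c)).
by apply: complex_eqP; rewrite /=; ring.
Qed.

(** The multi-index of D_i^2 D_j^2; the bilaplacian is the sum of these derivatives over all i and
    j. *)
Let twice (i j l : 'I_d) : nat := (2 * (l == i) + 2 * (l == j))%N.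

Lemma sum_twice i j : (\sum_l twice i j l = 4)%N.
Proof.
have one m : (\sum_(l < d) 2 * (l == m) = 2)%N.
  by rewrite (bigD1 m)//= eqxx big1 // => l /negbTE ->.
by rewrite big_split/= !one.
Qed.

Lemma ikpow_twice i j (k : Zd) : ikpow (twice i j) k = ik k i ^+ 2 * ik k j ^+ 2 :> R[i].
Proof.
rewrite /ikpow big_enum/= /twice; under eq_bigr do rewrite exprD !exprM.
rewrite big_split/=; congr (_ * _).
  by rewrite (bigD1 i)//= eqxx expr1 big1 ?mulr1// => l /negbTE ->; rewrite expr0.
by rewrite (bigD1 j)//= eqxx expr1 big1 ?mulr1// => l /negbTE ->; rewrite expr0.
Qed.

Lemma sum_mode_twice (k : Zd) (c : R[i]) (x : 'rV[R]_d) :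
  \sum_i \sum_j mode k (ikpow (twice i j) k * c) x = mode k (Complex (nk k ^+ 4) 0 * c) x.
Proof.
have E i j : ikpow (twice i j) k = Complex ((k ord0 i)%:~R ^+ 2 * (k ord0 j)%:~R ^+ 2) 0 :> R[i].
  by rewrite ikpow_twice !expr2 /ik; apply: complex_eqP; rewrite /=; ring.
rewrite mode_real -[4%N]/(2 * 2)%N exprM normk_sqr expr2 !mulr_suml; apply: eq_bigr => i _.
by rewrite mulr_sumr mulr_suml; apply: eq_bigr => j _; rewrite E mode_real.
Qed.

(* b has the Fourier coefficients of the sum of the weak derivatives D_i^2 D_j^2 u, hence is
   almost everywhere equal to it; any choice of weak derivatives thus bounds b. *)
Lemma weak_bilaplacian_bound (u b : 'rV[R]_d -> R) : fcarrier L1 u -> fcarrier L1 b -> weak_bilaplacian u b ->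
  (fnorm L1 b <= (d * d).+1%:R%:E * sobolev_norm 4 1%:E u)%E.
Proof.
move=> uL bL wb; have D0 : (0 < (d * d).+1%:R :> R) by rewrite ltr0n.
rewrite -lee_pdivrMl//; apply: le_ereal_inf_tmp => _ [g [Hg ->]].
rewrite lee_pdivrMl//; set S := (\sum_(_ | _) _)%E.
pose al i j : {ffun 'I_d -> 'I_5} := [ffun l => inord (twice i j l)].
have alE i j : (fun l => al i j l : nat) = twice i j.
  by apply/funext => l; rewrite ffunE inordK// /twice; case: (l == i); case: (l == j).
have alS i j : (\sum_l al i j l = 4)%N.
  by rewrite (eq_bigr (twice i j)) ?sum_twice// => l _; have := congr1 (@^~ l) (alE i j).
have al4 i j : (\sum_l al i j l <= 4)%N by rewrite alS.
have gL i j : fcarrier L1 (g (al i j)) by have [] := Hg _ (al4 i j).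
have gI i j : mu.-integrable setT (EFin \o g (al i j)) by apply/L1_integrable; exact: gL.
have gS i j : (fnorm L1 (g (al i j)) <= S)%E.
  rewrite /S (bigD1 (al i j))//= leeDl//; apply: sume_ge0 => a _; exact: Lnorm_ge0.
have sI : mu.-integrable setT (EFin \o (fun x => \sum_i \sum_j g (al i j) x)).
  by apply: integrable_seq_sum => i; apply: integrable_seq_sum => j.
have bI : mu.-integrable setT (EFin \o b) by apply/L1_integrable.
have bE : {ae mu, forall x, b x - \sum_i \sum_j g (al i j) x = 0}.
  apply: fourier_inj; first exact: L1B.
  apply: fourier_pair0 => k c; have bm1 := @bm_mode R d k c.
  rewrite pairBl//; last by apply/L1_integrable.
  have -> : pair (fun x => \sum_i \sum_j g (al i j) x) (mode k c) = \sum_i \sum_j pair (g (al i j)) (mode k c).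
    rewrite /pair; under eq_Rintegral do rewrite mulr_suml.
    rewrite Rint_sum; last by move=> i; apply: integrable_bmM => //; apply: integrable_seq_sum.
    apply: eq_bigr => i _; under eq_Rintegral do rewrite mulr_suml.
    by rewrite Rint_sum// => j; exact: integrable_bmM.
  apply/eqP; rewrite subr_eq0; apply/eqP.
  have sp := smooth_periodic_mode k c.
  transitivity (pair u (mode k (Complex (nk k ^+ 4) 0 * c))).
    by rewrite /pair wb// bilaplacian_mode.
  transitivity (\sum_i \sum_j pair u (mode k (ikpow (twice i j) k * c))).
    have -> : mode k (Complex (nk k ^+ 4) 0 * c) = fun x => \sum_i \sum_j mode k (ikpow (twice i j) k * c) x.
      by apply/funext => x; rewrite sum_mode_twice.
    rewrite pair_sumr//; last by move=> i; apply: bm_sum => j; exact: bm_mode.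
    by apply: eq_bigr => i _; rewrite pair_sumr// => j; exact: bm_mode.
  apply: eq_bigr => i _; apply: eq_bigr => j _; have [_ /(_ _ sp)] := Hg _ (al4 i j).
  rewrite /pair => ->; rewrite alE alS mpartial_mode.
  by rewrite (_ : (-1) ^+ 4 = 1 :> R) ?mul1r//; ring.
rewrite /fnorm/= Lnorm1.
apply: (@le_trans _ _ (\int[mu]_x (\sum_i \sum_j `|g (al i j) x|)%:E)%E).
  apply: ae_ge0_le_integral => //=.
    by move=> x; rewrite lee_fin; apply: sumr_ge0 => i _; apply: sumr_ge0.
  apply: filterS bE => x /subr0_eq ->; rewrite lee_fin.
  by apply: le_trans (ler_norm_sum _ _ _) _; apply: ler_sum => i _; exact: ler_norm_sum.
have nI i j : mu.-integrable setT (EFin \o (fun x => `|g (al i j) x|)) by exact: integrable_norm (gI i j).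
have -> : (\int[mu]_x (\sum_i \sum_j `|g (al i j) x|)%:E = \sum_i \sum_j fnorm L1 (g (al i j)))%E.
  have -> : (\sum_i \sum_j fnorm L1 (g (al i j)) = (\sum_i \sum_j \int[mu]_x `|g (al i j) x|)%:E)%E.
    rewrite -sumEFin; apply: eq_bigr => i _; rewrite -sumEFin; apply: eq_bigr => j _.
    by rewrite /fnorm/= Lnorm1 /Rintegral fineK// integrable_fin_num//; exact: nI.
  rewrite -[LHS]fineK; last first.
    by apply: integrable_fin_num => //; apply: integrable_seq_sum => i; apply: integrable_seq_sum => j; exact: nI.
  congr (_%:E); rewrite -/(Rintegral _ _ _) Rint_sum; last by move=> i; apply: integrable_seq_sum => j; exact: nI.
  by apply: eq_bigr => i _; rewrite Rint_sum// => j; exact: nI.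
have S0 : (0 <= S)%E by apply: sume_ge0 => a _; exact: Lnorm_ge0.
apply: (@le_trans _ _ (\sum_(i < d) \sum_(j < d) S)%E).
  by apply: lee_sum => i _; apply: lee_sum => j _; exact: gS.
(* The sum has d * d terms; the extra 1 in the constant keeps it positive, as required when S is
   infinite and by the division at the start. *)
case: {gS} S S0 => [r||//] r0; last by rewrite gt0_muley ?lte_fin// leey.
under eq_bigr do rewrite sumEFin; rewrite sumEFin -EFinM lee_fin !sumr_const !card_ord -mulrnA -[leLHS]mulr_natl.
by rewrite ler_wpM2r// ler_nat.
Qed.

End bilaplacian.

Section bump_integrals.
Context {R : realType} (T : R).
Local Notation tm := (time_measure T).

Lemma time_bump_continuous eta : time_bump T eta -> continuous eta /\ continuous (derive1 eta).
Proof.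
move=> [sm _]; split=> y; apply/differentiable_continuous/derivable1_diffP; first exact: (sm 0%N).
by have := sm 1%N; rewrite derive1n1.
Qed.

Lemma aeint_continuousM (g f : R -> R) : 0 <= T -> continuous g -> aeint tm f -> aeint tm (fun t => g t * f t).
Proof.
move=> T0 cg af.
have [M HM] : exists M, forall t, 0 <= t <= T -> `|g t| <= M.
  have [c _ Hc] := @EVT_max R (fun t => `|g t|) 0 T T0 (continuous_subspaceT (fun t => continuous_comp (cg t) (@norm_continuous _ _ _))).
  by exists `|g c| => t tT; apply: Hc; rewrite in_itv.
have M0 : 0 <= M by apply: le_trans (HM 0 _); rewrite ?lexx.
have bg : bm ((fun t => \1_`[0, T] t * g t) : measurableTypeR R -> R).
  split; first by apply: measurable_funM; [exact: measurable_indic|exact: continuous_measurable_fun].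
  exists M => t; rewrite indicE; have [tT|tT] := boolP (t \in `[0, T]%classic).
    by rewrite mul1r HM//; move: tT; rewrite inE /= in_itv.
  by rewrite mul0r normr0.
apply: aeint_eq (aeint_bmM af bg); apply: time_ae => t tT.
by rewrite indicE mem_set ?mul1r 1?mulrC//= in_itv.
Qed.

End bump_integrals.

Section weak_flow.
Context {R : realType} {d : nat}.
Local Notation Zd := 'rV[int]_d.
Local Notation mu := (torus_measure R d).
Local Notation nk := (@normk R d).
Local Notation nc := (@ComplexField.Normc.normc R).
Local Notation L1 := (Lp_space (R := R) d 1%:E).
Hypothesis hd : d = 1%N \/ d = 2%N.
Variables (A H : R) (a : R -> Zd -> R[i]).
Hypothesis fa : flow A H a.
Hypothesis gA : growth A < 1.
Variable (T : R) (T0 : 0 < T).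
Local Notation tm := (time_measure T).
Local Notation v := (fun t => synth (a t)).
Local Notation expc := (expc a).

Section test_function.
Variables (phi dphi bphi : R -> 'rV[R]_d -> R).
Hypothesis tf : test_function T phi dphi bphi.

Let bphi1 : bochner_Lp T 1%:E L1 phi. Proof. by case: tf. Qed.
Let bdphi : bochner_Lp T 1%:E L1 dphi. Proof. by case: tf => _ []. Qed.
Let wphi : weak_time_derivative T L1 phi dphi. Proof. by case: tf => _ []. Qed.
Let cphi : continuous_into T L1 phi. Proof. by case: tf. Qed.
Let phiL t : 0 <= t <= T -> fcarrier L1 (phi t). Proof. by move=> /cphi[]. Qed.
Let phiTL : fcarrier L1 (phi T). Proof. by apply: phiL; rewrite lexx ltW. Qed.
Let phi0L : fcarrier L1 (phi 0). Proof. by apply: phiL; rewrite lexx ltW. Qed.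
Let phiLae : {ae tm, forall t, fcarrier L1 (phi t)}. Proof. exact: time_ae. Qed.
Let dphiLae : {ae tm, forall t, fcarrier L1 (dphi t)}. Proof. by case: bdphi => -[]. Qed.
Let bphiLae : {ae tm, forall t, fcarrier L1 (bphi t) /\ weak_bilaplacian (phi t) (bphi t)}.
Proof. by case: tf => _ _ _ []. Qed.
Let Wphi : bochner_Lp T 1%:E (Wspace d 4 1%:E) phi. Proof. by case: tf => _ _ _ []. Qed.

Lemma pair_phiT w : pair (phi T) w = 0.
Proof.
rewrite /pair (@ae_eq_Rint _ _ _ mu _ (fun=> 0)); first by rewrite Rintegral_cst// mul0r.
by case: tf => _ _ _ _; apply: filterS => x ->; rewrite mul0r.
Qed.

(** Paired with a fixed [w], the weak derivative in L^1 becomes a scalar one, and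
    [weak_derivative_ac] makes the pairing absolutely continuous. [Z] is an integrable
    representative of the pairing with [dphi]. *)
Lemma pair_phi_ac w : bm w -> exists Z, [/\ tm.-integrable setT (EFin \o Z),
  {ae tm, forall t, pair (dphi t) w = Z t} &
  forall t, 0 <= t <= T -> pair (phi t) w = pair (phi 0) w + \int[tm]_u (\1_`[0, t] u * Z u)].
Proof.
move=> bw; have [_ [M wM]] := bw; have M0 : 0 <= M by apply: le_trans (wM 0).
have ag := bochner_pair_aeint bdphi bw; have aphi := bochner_pair_aeint bphi1 bw.
have [Z iZ gZ] := ag; exists Z; split => //.
apply: (weak_derivative_ac T0) => //.
- move=> t tT; have [tL tc] := cphi tT; apply/cvgrPdist_le => e e0.
  have e1 : 0 < e / (1 + M) by rewrite divr_gt0// ltr_pwDl.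
  have /fine_cvgP[fc /cvgrPdist_le/(_ _ e1) fd] := tc.
  have inT : \forall s \near within `[0, T] (nbhs t), 0 <= s <= T.
    by apply: withinT; apply: filterE => s; rewrite /= in_itv.
  apply: filterS3 fc fd inT => s fs; rewrite sub0r normrN => Hs sT.
  have sL := phiL sT; rewrite distrC -pairBl// -lee_fin.
  apply: le_trans (pair_le (L1B_carrier sL tL) bw wM) _.
  rewrite -[X in (_ * X)%E]fineK// -EFinM lee_fin; apply: le_trans (frac_le M0 e0).
  by apply: ler_wpM2l => //; apply: le_trans Hs; exact: ler_norm.
- move=> eta be; have [ce cde] := time_bump_continuous be.
  have [I [I1 I2]] := wphi be.
  have E1 : {ae tm, forall t, derive1 eta t * pair (phi t) w = pair (fun x => derive1 eta t * phi t x) w}.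
    by apply: filterS phiLae => t tL; rewrite pairZl.
  have E2 : {ae tm, forall t, - eta t * pair (dphi t) w = pair (fun x => - (eta t * dphi t x)) w}.
    apply: filterS dphiLae => t tL; rewrite -pairZl//; congr pair; apply/funext => x.
    by rewrite mulNr.
  have a1 := aeint_eq E1 (aeint_continuousM (ltW T0) cde aphi).
  have cN : continuous (fun t => - eta t) by move=> t; apply: cvgN; exact: ce.
  have a2 := aeint_eq E2 (aeint_continuousM (ltW T0) cN ag).
  have := bochner_int_pair I2 bw a2; rewrite (bochner_int_pair I1 bw a1).
  rewrite -(ae_eq_Rint E1) -(ae_eq_Rint E2) => ->.
  have [_ <-] : aeint tm (fun t => -1 * (eta t * Z t)) /\ \int[tm]_t (-1 * (eta t * Z t)) = - \int[tm]_t (eta t * Z t).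
    have aZ := aeint_continuousM (ltW T0) ce (aeint_integrable iZ).
    by have [aa ->] := aeintZ (-1) aZ; rewrite mulN1r.
  by apply: ae_eq_Rint; apply: filterS gZ => t ->; rewrite mulN1r mulNr.
Qed.

Let ibp_real (x x' : R -> R) w : bm w -> bm (x : measurableTypeR R -> R) -> bm (x' : measurableTypeR R -> R) ->
  (forall t, 0 <= t <= T -> x t = x 0 + \int[tm]_u (\1_`[0, t] u * x' u)) ->
  - (x 0 * pair (phi 0) w) = \int[tm]_t (x' t * pair (phi t) w) + \int[tm]_t (x t * pair (dphi t) w).
Proof.
move=> bw bx bx' xE; have [Z [iZ gZ ZE]] := pair_phi_ac bw.
have := ibp_ac (ltW T0) (bm_integrable tm bx') iZ xE ZE; rewrite pair_phiT mulr0 sub0r => ->.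
have i1 : aeint tm (fun t => x' t * pair (phi t) w).
  by apply: aeint_eq (aeint_bmM (bochner_pair_aeint bphi1 bw) bx'); apply: nearW => t; rewrite mulrC.
have i2 : aeint tm (fun t => x t * pair (dphi t) w).
  by apply: aeint_eq (aeint_bmM (bochner_pair_aeint bdphi bw) bx); apply: nearW => t; rewrite mulrC.
have [_ <-] := aeintD i1 i2.
by apply: ae_eq_Rint; apply: filterS gZ => t ->.
Qed.

(** Integration by parts in time against the mode k. The factor |k|^4 in its equation is the
    eigenvalue of the bilaplacian and passes to [bphi]; the boundary term at T vanishes with
    [phi T]. *)
Let phi_mode k : [/\ aeint tm (fun t => pair (dphi t) (mode k (a t k))),
  aeint tm (fun t => pair (bphi t) (mode k (expc t k))) &
  \int[tm]_t pair (dphi t) (mode k (a t k)) + \int[tm]_t pair (bphi t) (mode k (expc t k)) =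
  - pair (phi 0) (mode k (a 0 k))].
Proof.
have bc := @bm_cosk R d k; have bs := @bm_sink R d k.
have fRe := bm_flow_Re fa gA k; have fIm := bm_flow_Im fa gA k.
have eRe := bmZ (nk k ^+ 4) (bm_expc_Re fa gA k).
have eIm := bmZ (nk k ^+ 4) (bm_expc_Im fa gA k).
have aM f g : bm (g : measurableTypeR R -> R) -> aeint tm f -> aeint tm (fun t => g t * f t).
  by move=> bg af; apply: aeint_eq (aeint_bmM af bg); apply: nearW => t; rewrite mulrC.
have pc := bochner_pair_aeint bphi1 bc; have ps := bochner_pair_aeint bphi1 bs.
have dc := bochner_pair_aeint bdphi bc; have ds := bochner_pair_aeint bdphi bs.
have Ed : {ae tm, forall t, complex.Re (a t k) * pair (dphi t) (fun x => cos (dotk x k))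
    - complex.Im (a t k) * pair (dphi t) (fun x => sin (dotk x k)) = pair (dphi t) (mode k (a t k))}.
  by apply: filterS dphiLae => t tL; rewrite pair_mode.
have Eb : {ae tm, forall t, nk k ^+ 4 * complex.Re (expc t k) * pair (phi t) (fun x => cos (dotk x k))
    - nk k ^+ 4 * complex.Im (expc t k) * pair (phi t) (fun x => sin (dotk x k)) = pair (bphi t) (mode k (expc t k))}.
  apply: filterS2 phiLae bphiLae => t tL [bL wb].
  transitivity (pair (phi t) (mode k (Complex (nk k ^+ 4) 0 * expc t k))).
    by rewrite pair_mode//; case: (expc t k) => p q; rewrite /= !mul0r subr0 addr0.
  by rewrite [RHS]/pair wb ?bilaplacian_mode//; exact: smooth_periodic_mode.
have [d1 d1E] := aeintB (aM _ _ fRe dc) (aM _ _ fIm ds).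
have [b1 b1E] := aeintB (aM _ _ eRe pc) (aM _ _ eIm ps).
split; [exact: aeint_eq Ed d1|exact: aeint_eq Eb b1|].
rewrite -(ae_eq_Rint Ed) -(ae_eq_Rint Eb) d1E b1E pair_mode//.
have rE t : 0 <= t <= T -> complex.Re (a t k) = complex.Re (a 0 k) +
    \int[tm]_u (\1_`[0, t] u * (nk k ^+ 4 * complex.Re (expc u k))).
  by move=> tT; apply: (flow_Re_int fa).
have iE t : 0 <= t <= T -> complex.Im (a t k) = complex.Im (a 0 k) +
    \int[tm]_u (\1_`[0, t] u * (nk k ^+ 4 * complex.Im (expc u k))).
  by move=> tT; apply: (flow_Im_int fa).
have alg (p q r s x y : R) : - x = p + r -> - y = q + s -> r - s + (p - q) = - (x - y) by lra.
exact: alg (ibp_real bc fRe eRe rE) (ibp_real bs fIm eIm iE).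
Qed.

Lemma galerkin_identity K : [/\ aeint tm (fun t => pair (dphi t) (psum K (a t))),
  aeint tm (fun t => pair (bphi t) (psum K (expc t))) &
  \int[tm]_t pair (dphi t) (psum K (a t)) + \int[tm]_t pair (bphi t) (psum K (expc t)) =
  - pair (phi 0) (psum K (a 0))].
Proof.
have a1 k : aeint tm (fun t => pair (dphi t) (mode k (a t k))) by case: (phi_mode k).
have a2 k : aeint tm (fun t => pair (bphi t) (mode k (expc t k))) by case: (phi_mode k).
have [s1 s1E] := aeint_sum (modes K) a1; have [s2 s2E] := aeint_sum (modes K) a2.
have E1 : {ae tm, forall t, \sum_(k <- modes K) pair (dphi t) (mode k (a t k)) = pair (dphi t) (psum K (a t))}.
  by apply: filterS dphiLae => t tL; rewrite -pair_sumr// => k; exact: bm_mode.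
have E2 : {ae tm, forall t, \sum_(k <- modes K) pair (bphi t) (mode k (expc t k)) = pair (bphi t) (psum K (expc t))}.
  by apply: filterS bphiLae => t [tL _]; rewrite -pair_sumr// => k; exact: bm_mode.
split; [exact: aeint_eq E1 s1|exact: aeint_eq E2 s2|].
rewrite -(ae_eq_Rint E1) -(ae_eq_Rint E2) s1E s2E -big_split/= /psum pair_sumr//; last by move=> k; exact: bm_mode.
by rewrite -sumrN; apply: eq_bigr => k _; case: (phi_mode k).
Qed.

Let aA t := flow_ball1 fa gA t.

Let expc_ball1 t : exists X, ball1 (fun k => nc (expc t k)) X.
Proof.
have [K0 /(_ K0 (leqnn _) t) HK] := expc_tail hd fa gA ltr01.
exists (\sum_(k <- modes K0) nc (expc t k) + 1) => s us.
apply: le_trans (ball1_split (modes K0) (fun k => nc_ge0 _) us) _; rewrite lerD2l.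
apply: le_trans (HK [seq k <- s | k \notin modes K0] (filter_uniq _ us)).
rewrite !big_filter; apply: ler_sum => k /negbTE ->; exact: lexx.
Qed.

(** The limit of [galerkin_identity] as K grows. The partial sums are close to v and to e^(-v)
    uniformly in time and space, so the errors are small multiples of the L^1 norm of [dphi] and of
    the W^(4,1) norm of [phi]. *)
Lemma weak_flow_identity : \int[tm]_t pair (dphi t) (v t) + \int[tm]_t pair (bphi t) (fun x => expR (- v t x)) =
    - pair (phi 0) (v 0) /\
  [/\ aeint tm (fun t => pair (dphi t) (v t)) & aeint tm (fun t => pair (bphi t) (fun x => expR (- v t x)))].
Proof.
have bv t := bm_synth (aA t).
have tailb (b : Zd -> R[i]) X K e : ball1 (fun k => nc (b k)) X -> ball1 (fun k => if k \in modes K then 0 else nc (b k)) e ->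
    forall x, `|synth b x - psum K b x| <= e by move=> bX be x; exact: synth_dist bX be.
have [|a1 l1] := @aeint_lim _ _ _ tm (fun t => pair (dphi t) (v t)) (fun K t => pair (dphi t) (psum K (a t)))
  (fun t => fnorm L1 (dphi t)) (fun K => let: And3 h _ _ := galerkin_identity K in h) (fun t => fnorm_Lp_ge0 _ _)
  (bochner_L1_fin bdphi) (filterS (fun t => @fnorm_L1_fin _ _ (dphi t)) dphiLae) _.
  move=> e e0; have [K0 HK] := flow_tail hd fa gA e0; exists K0 => K KK.
  apply: filterS dphiLae => t tL; rewrite -pairBr//; last exact: bm_psum.
  by apply: pair_le => //; [apply: bmB => //; exact: bm_psum|exact: tailb (aA t) (HK K KK t)].
have expE t : {ae mu, forall x, expR (- v t x) = synth (expc t) x}.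
  have [X HX] := expc_ball1 t; exact: synth_fourier (bm_integrable mu (bm_expN fa gA t)) HX.
have pE u t : pair u (fun x => expR (- v t x)) = pair u (synth (expc t)).
  by apply: ae_eq_Rint; apply: filterS (expE t) => x ->.
have D0 : (0 < (d * d).+1%:R :> R) by rewrite ltr0n.
have [[Wae _] Woo] := Wphi.
(* [bphi] is given at almost every time without control in time. Its L^1 norm is dominated by the
   W^(4,1) norm of [phi] through [weak_bilaplacian_bound], and [aeint_lim] supplies the
   measurability of the pairing. *)
have [|||a2 l2] := @aeint_lim _ _ _ tm (fun t => pair (bphi t) (fun x => expR (- v t x))) (fun K t => pair (bphi t) (psum K (expc t)))
  (fun t => sobolev_norm 4 1%:E (phi t)) (fun K => let: And3 _ h _ := galerkin_identity K in h) (fun t => fnorm_W_ge0 _ _ _) _ _ _.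
- move: Woo; rewrite Lnorm1; apply: le_lt_trans; apply: ge0_le_integral_T => t /=; first exact: (@fnorm_W_ge0 R d 4 1%:E).
  by rewrite gee0_abs//; exact: (@fnorm_W_ge0 R d 4 1%:E).
- by apply: filterS Wae => t [].
- move=> e e0; have e1 : 0 < e / (d * d).+1%:R by rewrite divr_gt0.
  have [K0 HK] := expc_tail hd fa gA e1; exists K0 => K KK.
  apply: filterS2 phiLae bphiLae => t tL [bL wb]; have [X HX] := expc_ball1 t.
  rewrite pE -pairBr//; [|exact: bm_synth HX|exact: bm_psum].
  apply: le_trans (pair_le bL (bmB (bm_synth HX) (bm_psum K _)) (tailb _ _ _ _ HX (HK K KK t))) _.
  have := weak_bilaplacian_bound tL bL wb => /(lee_wpmul2l (_ : (0 <= (e / (d * d).+1%:R)%:E)%E)) HB.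
  apply: le_trans (HB _) _; first by rewrite lee_fin ltW.
  by rewrite muleA -EFinM mulfVK// gt_eqF.
split; last by split.
have l3 : pair (phi 0) (psum K (a 0)) @[K --> \oo] --> pair (phi 0) (v 0).
  have := @Rint_unif_lim R d (v 0) (phi 0) (fun K => psum K (a 0)) (bv 0) (fun K => bm_psum K _) _ (fun e e0 => synth_unif (aA 0) e0).
  rewrite /pair; under eq_Rintegral do rewrite mulrC.
  rewrite (_ : (fun K => _) = fun K => \int[mu]_x (phi 0 x * psum K (a 0) x)).
    by apply; apply/L1_integrable.
  by apply/funext => K; apply: eq_Rintegral => x _; rewrite mulrC.
apply: (cvg_unique (@norm_hausdorff _ _) (cvgD l1 l2)).
apply: cvg_trans (cvgN l3); apply: near_eq_cvg; apply: nearW => K.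
by have [_ _ E] := galerkin_identity K; exact: esym E.
Qed.

End test_function.

Lemma flow_weak_solution v0 : {ae mu, forall x, v0 x = v 0 x} -> weak_solution T v0 v.
Proof.
move=> v0E; split; first exact: (bochner_v_Lp fa gA T).
move=> phi dphi bphi tf; have [E [a1 a2]] := weak_flow_identity tf.
have -> : \int[mu]_x (phi 0 x * v0 x) = pair (phi 0) (v 0).
  by apply: ae_eq_Rint; apply: filterS v0E => x ->.
have dL : {ae tm, forall t, fcarrier L1 (dphi t)} by case: tf => _ [[[]]].
have bL : {ae tm, forall t, fcarrier L1 (bphi t)} by case: tf => _ _ _ [_ h] _; apply: filterS h => t [].
have [_ aE] := aeintD a1 a2.
rewrite (@ae_eq_Rint _ _ _ tm _ (fun t => pair (dphi t) (v t) + pair (bphi t) (fun x => expR (- v t x)))).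
  by rewrite aE E subrr.
apply: filterS2 dL bL => t /L1_integrable ti /L1_integrable bi; rewrite /pair -RintegralD//.
  by apply: integrable_bmM => //; exact: bm_synth (flow_ball1 fa gA t).
by apply: integrable_bmM => //; exact: (bm_expN fa gA).
Qed.

End weak_flow.

Lemma flow_exists {R : realType} {d : nat} (hd : d = 1%N \/ d = 2%N) (v0 : 'rV[R]_d -> R) :
  wiener 0 v0 -> fcarrier (Hspace d (2 : R)) v0 -> \int[torus_measure R d]_x v0 x = 0 ->
  growth (fine (wiener_norm 0 v0)) < 1 ->
  exists H a, [/\ 0 <= H, flow (fine (wiener_norm 0 v0)) H a & {ae torus_measure R d, forall x, v0 x = synth (a 0) x}].
Proof.
set A := fine _; move=> [v0L wfin] [_ hfin] mean gA.
have v0I : (torus_measure R d).-integrable setT (EFin \o v0) by apply/Lfun1_integrable.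
pose nc := @ComplexField.Normc.normc R.
have a0A : ball1 (fun k => nc (fourier v0 k)) A.
  have pos (k : 'rV[int]_d) : 0 <= normk R k `^ 0 * nc (fourier v0 k) by rewrite mulr_ge0 ?powR_ge0 ?nc_ge0.
  have := ball1_esum pos wfin; apply: ball1_le => k.
  by rewrite powRr0 mul1r.
pose f (k : 'rV[int]_d) := normk R k `^ (2 * 2) * nc (fourier v0 k) ^+ 2.
have f0 k : 0 <= f k by rewrite mulr_ge0 ?powR_ge0 ?sqr_ge0.
have ffin : (\esum_(k in [set: 'rV[int]_d]) (f k)%:E < +oo)%E.
  rewrite ltNge leye_eq; apply/eqP => Hoo; move: hfin; rewrite /h_norm -/f Hoo poweRyr ?ltxx//.
have fB := ball1_esum f0 ffin; have B0 := ball1_ge0 fB.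
move: (fine _) fB B0 => B fB B0.
have a0H : ball2 (fun k => normk R k ^+ 2 * nc (fourier v0 k)) (Num.sqrt B).
  split; first exact: sqrtr_ge0.
  move=> s us; rewrite sqr_sqrtr//; apply: le_trans (fB s us); apply: ler_sum => k _.
  by rewrite /f exprMn -exprM (normk_powR k 2).
have h0 : herm (fourier v0) by move=> k; exact: fourierN.
(* The zero mean of the initial datum, in the form used throughout: no coefficient at k = 0. *)
have z0 : fourier v0 0 = 0.
  rewrite /fourier; under eq_Rintegral do rewrite dotk0 cos0 mulr1.
  rewrite mean mulr0; under eq_Rintegral do rewrite dotk0 sin0 mulr0.
  by rewrite Rintegral_cst// mul0r mulr0 oppr0.
have [a [[[p1 p2 p3 p4 p5] [p6 p7 p8 p9]] [p10 p11 p12]]] := galerkin_limit hd h0 z0 a0A a0H gA.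
exists (Num.sqrt B), a; split; first exact: sqrtr_ge0.
  by constructor => // t t0; rewrite (p5 t t0) (p5 0 (lexx _)).
by rewrite (p5 0 (lexx _)); exact: synth_fourier v0I a0A.
Qed.

Theorem theorem2p4 (R : realType) (d : nat) (hd : d = 1%N \/ d = 2%N)
    (v0 : 'rV[R]_d -> R)
    (v0A : wiener 0 v0) (v0H : fcarrier (Hspace d (2 : R)) v0)
    (v0mean : \int[torus_measure R d]_x v0 x = 0)
    (delta_gt0 : 0 < crystal_delta (fine (wiener_norm 0 v0))) :
  exists v : R -> 'rV[R]_d -> R,
    (forall T : R, 0 < T ->
      weak_solution T v0 v /\
      [/\ (fun p : measurableTypeR R * 'rV[R]_d => v p.1 p.2)
            \in Lfun (time_measure T \x torus_measure R d)%E +oo%E,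
          bochner_Lp T (4 / 3)%:E (Wspace d 3 +oo%E) v,
          measure_into T (Wspace d 4 +oo%E) v,
          bochner_Lp T 2%:E (Hspace d 2) v &
          continuous_into T (Lp_space d 2%:E) v] /\
      (forall t, 0 <= t <= T ->
        ('N[torus_measure R d]_+oo [EFin \o v t] <=
         (fine (wiener_norm 0 v0) *
          expR (- crystal_delta (fine (wiener_norm 0 v0)) * t))%:E)%E) /\
      continuous_into T (Hspace d 2) v /\
      bochner_Lp T 2%:E (Hspace d 4) v) /\
    exists c1 c2 c3 c4 : R,
      [/\ 0 < c1, 0 < c2, 0 < c3 & 0 < c4] /\
      forall T t : R, 0 < T -> 0 <= t <= T ->
        (h_norm 2 (v t) +
         c1%:E * \int[time_measure T]_s (h_norm 4 (v s) * h_norm 4 (v s))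
         <= c2%:E)%E /\
        (forall r : R, 0 <= r < 2 ->
           (h_norm r (v t) <= (c3 * expR (- c4 * t))%:E)%E).
Proof.
have gA : growth (fine (wiener_norm 0 v0)) < 1 by move: delta_gt0; rewrite growthE subr_gt0.
have [H [a [H0 fa v0E]]] := flow_exists hd v0A v0H v0mean gA.
exists (fun t => synth (a t)); split.
  move=> T T0; have T0' := ltW T0; split; first exact: (flow_weak_solution hd fa gA T0 v0E).
  split; last split; last split.
  - split.
    + exact: (joint_v fa gA T).
    + exact: (bochner_v_W3 fa gA T0').
    + exact: (flow_measure_into hd fa gA T0').
    + exact: (bochner_v_H2 hd fa gA T).
    + exact: (continuous_into_v_L2 hd fa gA).
  - by move=> t /andP[t0 _]; rewrite growthE; exact: (Lnorm_oo_v fa t0).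
  - exact: (continuous_into_v_H2 hd fa gA T0').
  - exact: (bochner_v_H4 hd fa gA T0').
move: delta_gt0; rewrite growthE; set A := fine _ in gA fa * => delta0.
(* The time integral of the squared H^4 norm is at most [H ^+ 2] / delta, so c1 = delta turns its
   contribution into [H ^+ 2]. The added 1 keeps c2 and c3 positive when H = 0, and c4 is the decay
   rate of the H^2 norm. *)
exists (1 - growth A), (H + H ^+ 2 + 1), (H + 1), ((1 - growth A) / 2); split.
  by split => //; rewrite ?divr_gt0// ltr_wpDl// addr_ge0// sqr_ge0.
move=> T t T0 /andP[t0 tT]; split.
  have h2 := h_norm2_v fa gA t; have h4 := h_norm4_v fa gA (ltW T0).
  apply: (@le_trans _ _ (H%:E + (1 - growth A)%:E * (H ^+ 2 / (1 - growth A))%:E)%E).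
    by apply: leeD => //; rewrite lee_pmul2l// lte_fin.
  by rewrite -EFinM -EFinD lee_fin mulrCA mulfV ?gt_eqF// mulr1 lerDl.
move=> r hr; apply: le_trans (h_norm_v_decay fa gA t0 hr) _.
by rewrite lee_fin ler_wpM2r ?expR_ge0// lerDl.
Qed.
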